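(* Suppose that for some fixed finite set $S$ of nonnegative real numbers the function $V\mapsto\pi(V,S)$ is eventually constant. If $\mathbb{Q}$ is the invariant trace field associated to $S$, then there is an integer $n\geq 0$ such that $$\lim_{V\to\infty}\pi(V,S)=2^{n}.$$
   Context: Let $F$ be a totally real number field, and let $B$ be a quaternion algebra over $F$ (a central simple $F$-algebra of dimension $4$) which is unramified at a unique real place $\nu$ of $F$, meaning $B\otimes_F F_\nu\cong \mathrm{M}_2(\mathbb{R})$ while $B\otimes_F F_\omega$ is a division algebra for every other real place $\omega$. Let $\mathcal{O}$ be a maximal order of $B$ and $\mathcal{O}^1$ the group of elements of $\mathcal{O}^*$ of reduced norm one. Let $\Gamma_{\mathcal{O}}$ denote the image of $\mathcal{O}^1$ in $\mathrm{PSL}_2(\mathbb{R})$ via the identification $B\otimes_F F_\nu\cong \mathrm{M}_2(\mathbb{R})$. An arithmetic Fuchsian group is a discrete subgroup of $\mathrm{PSL}_2(\mathbb{R})$ commensurable with a group of the form $\Gamma_{\mathcal{O}}$. It is derived from a quaternion algebra if it is contained in a group of the form $\Gamma_{\mathcal{O}}$. An arithmetic hyperbolic surface is a hyperbolic surface (or orbifold) of the form $\mathbf{H}^2/\Gamma$ with $\Gamma$ an arithmetic Fuchsian group and $\mathbf{H}^2$ the hyperbolic plane. It is derived from a quaternion algebra if $\Gamma$ is. The length spectrum of $\mathbf{H}^2/\Gamma$ is the set of all lengths of closed geodesics in it; a hyperbolic element $\gamma\in\Gamma$ gives a closed geodesic of length $\ell(\gamma)$ where $\cosh(\ell(\gamma)/2)=|\mathrm{tr}(\gamma)|/2$.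 Two such surfaces are commensurable if they share an isometric finite-sheeted covering. Volume means hyperbolic area. For a finite set $S$ of nonnegative real numbers, $\pi(V,S)$ is the maximum cardinality of a collection of pairwise non-commensurable arithmetic hyperbolic surfaces derived from quaternion algebras, each of which has volume less than $V$ and length spectrum containing $S$. The invariant trace field of an arithmetic Fuchsian group $\Gamma$ (or of $\mathbf{H}^2/\Gamma$) is the number field $\mathbb{Q}(\mathrm{tr}(\gamma^2):\gamma\in\Gamma)$. If $\pi(V,S)>0$ for sufficiently large $V$, then (for the sets $S$ considered here) all arithmetic hyperbolic surfaces with length spectrum containing $S$ have the same invariant trace field, called the invariant trace field associated to $S$. In particular, speaking of the invariant trace field associated to $S$ presupposes that $\pi(V,S)>0$ for sufficiently large $V$. *)

(* Defs.v *)
From HB Require Import structures.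
From mathcomp Require Import all_boot all_order all_algebra all_field.
From mathcomp Require Import complex.
From mathcomp Require Import all_classical all_reals all_analysis.

Set Implicit Arguments.
Unset Strict Implicit.
Unset Printing Implicit Defensive.

Import Order.TTheory GRing.Theory Num.Theory numFieldNormedType.Exports.

Local Open Scope classical_set_scope.
Local Open Scope ring_scope.

(* A number field is a [fieldExtType rat], i.e. a finite extension of Q. *)
Definition totally_real (R : realType) (F : fieldExtType rat) : Prop :=
  forall (s : {rmorphism F -> R[i]}) (x : F), complex.Im (s x) = 0.

Definition central_algebra (F : fieldType) (B : falgType F) : Prop :=
  forall x : B, (forall y : B, x * y = y * x) -> exists a : F, x = a%:A.

(* A two-sided ideal of a unital F-algebra is always an F-subspace. *)
Definition simple_algebra (F : fieldType) (B : falgType F) : Prop :=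
  forall I : {vspace B},
    (forall x y : B, x \in I -> y * x \in I /\ x * y \in I) ->
    I = 0%VS \/ I = {:B}%VS.

Definition quaternion_algebra (F : fieldType) (B : falgType F) : Prop :=
  [/\ central_algebra B, simple_algebra B & \dim {:B}%VS = 4%N].

(* [iota] exhibits the E-algebra A as the tensor product of B and E over F,
   with E an F-algebra through [s] : iota is a ring morphism, linear along s,
   and F-bases of B go to E-bases of A, so that iota x stands for x (x) 1. *)
Definition base_change (F E : fieldType) (s : {rmorphism F -> E})
    (B : falgType F) (A : falgType E)
    (iota : {lrmorphism B -> A | s \; *:%R}) : Prop :=
  forall X : seq B, basis_of {:B}%VS X -> basis_of {:A}%VS (map iota X).

(* The real places of F are its morphisms to R, and R is the completion of F
   at each of them. *)
Definition division_at (R : realType) (F : fieldExtType rat) (B : falgType F)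
    (omega : {rmorphism F -> R}) : Prop :=
  exists (A : falgType R) (iota : {lrmorphism B -> A | omega \; *:%R}),
    base_change iota /\ forall x : A, x != 0 -> x \is a GRing.unit.

(* The reduced norm of x is the n in F whose image in a splitting field E of B
   is the determinant of x (x) 1 seen in M_2(E). *)
Definition reduced_norm (F E : fieldType) (s : {rmorphism F -> E})
    (B : falgType F) (rho : {lrmorphism B -> 'M[E]_2 | s \; *:%R})
    (x : B) (n : F) : Prop :=
  \det (rho x) = s n.

Definition ring_of_integers (F : fieldExtType rat) : set F :=
  [set x | integralOver (intr : int -> F) x].

Definition is_order (F : fieldExtType rat) (B : falgType F) (O : set B) :
    Prop :=
  [/\ O 1,
      forall x y, O x -> O y -> O (x - y),
      forall x y, O x -> O y -> O (x * y)
    & exists2 s : seq B, span s = {:B}%VS &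
        O = [set \sum_(i < size s) c i *: s`_i | c in
              [set c : 'I_(size s) -> F | forall i, ring_of_integers (c i)]]].

Definition maximal_order (F : fieldExtType rat) (B : falgType F)
    (O : set B) : Prop :=
  is_order O /\ forall O' : set B, is_order O' -> O `<=` O' -> O' = O.

Definition norm_one_units (R : realType) (F : fieldExtType rat)
    (nu : {rmorphism F -> R}) (B : falgType F)
    (rho : {lrmorphism B -> 'M[R]_2 | nu \; *:%R}) (O : set B) : set B :=
  [set x | [/\ O x, exists2 y, O y & x * y = 1 /\ y * x = 1
             & reduced_norm rho x 1]].

(* A subgroup of PSL_2(R) is represented throughout by its full preimage in
   SL_2(R), that is, by a subgroup of SL_2(R) containing -1. *)
Definition PSL2_subgroup (R : realType) (G : set 'M[R]_2) : Prop :=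
  [/\ forall g, G g -> \det g = 1,
      G (-1),
      forall g h, G g -> G h -> G (g * h)
    & forall g, G g -> G g^-1].

Definition discrete_group (R : realType) (G : set 'M[R]_2) : Prop :=
  forall g, G g -> \forall h \near nbhs g, G h -> h = g.

Definition finite_index (R : realType) (H G : set 'M[R]_2) : Prop :=
  H `<=` G /\
  exists s : seq 'M[R]_2,
    forall g, G g -> exists2 t, t \in s & exists2 h, H h & g = t * h.

Definition commensurable_groups (R : realType) (G H : set 'M[R]_2) : Prop :=
  finite_index (G `&` H) G /\ finite_index (G `&` H) H.

(* G is of the form Gamma_O; rho is the identification of the completion of B
   at nu with M_2(R). The preimage in SL_2(R) of the image of O^1 in PSL_2(R)
   is rho(O^1), because -1 is in O^1. *)
Definition is_Gamma_O (R : realType) (G : set 'M[R]_2) : Prop :=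
  exists (F : fieldExtType rat) (B : falgType F) (nu : {rmorphism F -> R})
         (rho : {lrmorphism B -> 'M[R]_2 | nu \; *:%R}) (O : set B),
    [/\ totally_real R F,
        quaternion_algebra B,
        base_change rho,
        forall omega : {rmorphism F -> R},
          ~ (omega =1 nu) -> division_at B omega
      & maximal_order O /\ G = rho @` norm_one_units rho O].

Definition arithmetic_Fuchsian (R : realType) (G : set 'M[R]_2) : Prop :=
  [/\ PSL2_subgroup G, discrete_group G
    & exists2 H, is_Gamma_O H & commensurable_groups G H].

Definition derived_from_quaternion_algebra (R : realType)
    (G : set 'M[R]_2) : Prop :=
  arithmetic_Fuchsian G /\ exists2 H, is_Gamma_O H & G `<=` H.

(* From here on a surface H^2/G is represented by the group G. *)

Definition upper_half_plane (R : realType) : set R[i] :=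
  [set z | 0 < complex.Im z].

Definition mobius (R : realType) (g : 'M[R]_2) (z : R[i]) : R[i] :=
  ((g 0 0)%:C * z + (g 0 1)%:C)%C / ((g 1 0)%:C * z + (g 1 1)%:C)%C.

(* Points of H^2 are in R[i] for the action of the group and in R * R for
   measure theory; D stands for the set of x + iy with (x, y) in D. *)
Definition hyperbolic_area (R : realType) (D : set (R * R)) : \bar R :=
  (\int[(@lebesgue_measure R \x @lebesgue_measure R)%E]_(p in D)
     (p.2 ^- 2)%:E)%E.

(* D is a Borel subset of H^2 meeting each G-orbit exactly once, so that its
   area is that of H^2/G, whatever the choice of D. *)
Definition fundamental_set (R : realType) (G : set 'M[R]_2)
    (D : set (R * R)) : Prop :=
  [/\ measurable D,
      forall p, D p -> upper_half_plane (p.1 +i* p.2)%C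
    & forall z : R[i], upper_half_plane z ->
        exists! p, D p /\ exists2 g, G g & (p.1 +i* p.2)%C = mobius g z].

Definition has_volume (R : realType) (G : set 'M[R]_2) (v : \bar R) : Prop :=
  exists2 D, fundamental_set G D & hyperbolic_area D = v.

Definition cosh (R : realType) (x : R) : R := (expR x + expR (- x)) / 2.

Definition hyperbolic (R : realType) (g : 'M[R]_2) : Prop := 2 < `|\tr g|.

Definition length_spectrum (R : realType) (G : set 'M[R]_2) : set R :=
  [set l | 0 < l /\
     exists g, [/\ G g, hyperbolic g & cosh (l / 2) = `|\tr g| / 2]].

(* Locally isometric finite-sheeted coverings H^2/L -> H^2/G. They lift to
   isometries of H^2, and the isometry group PGL_2(R) acts on PSL_2(R) by
   conjugation (orientation-reversing when det g < 0). *)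
Definition finite_covering (R : realType) (L G : set 'M[R]_2) : Prop :=
  exists2 g : 'M[R]_2, g \in unitmx &
    finite_index [set g * h * g^-1 | h in L] G.

Definition commensurable_surfaces (R : realType) (G H : set 'M[R]_2) : Prop :=
  exists L, [/\ PSL2_subgroup L, discrete_group L,
                finite_covering L G & finite_covering L H].

Definition is_subfield (R : realType) (K : set R) : Prop :=
  [/\ K 1, forall x y, K x -> K y -> K (x - y)
    & forall x y, K x -> K y -> K (x / y)].

Definition invariant_trace_field (R : realType) (G : set 'M[R]_2) : set R :=
  \bigcap_(K in [set K : set R | is_subfield K /\
                  forall g, G g -> K (\tr (g ^+ 2))]) K.

Definition noncommensurable_family (R : realType) (V : R) (S : set R) (n : nat)
    (G : 'I_n -> set 'M[R]_2) : Prop :=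
  (forall i, [/\ derived_from_quaternion_algebra (G i),
                 exists2 v, has_volume (G i) v & (v < V%:E)%E
               & S `<=` length_spectrum (G i)]) /\
  (forall i j, i != j -> ~ commensurable_surfaces (G i) (G j)).

(* Extended real, so that it would be +oo (not a junk value) in the absence of
   a maximum. *)
Definition piVS (R : realType) (V : R) (S : set R) : \bar R :=
  ereal_sup [set (n%:R)%:E | n in
    [set n | exists G : 'I_n -> set 'M[R]_2, noncommensurable_family V S G]].

Definition eventually_constant (R : realType) (T : Type) (f : R -> T) : Prop :=
  exists V0 : R, forall V : R, V0 <= V -> f V = f V0.

Definition associated_invariant_trace_field (R : realType) (S K : set R) :
    Prop :=
  (exists V0 : R, forall V : R, V0 <= V -> (0 < piVS V S)%E) /\
  (forall G : set 'M[R]_2, arithmetic_Fuchsian G ->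
     S `<=` length_spectrum G -> invariant_trace_field G = K).

(* Main.v *)
(** A length l in S belongs to a hyperbolic element of trace t = 2 cosh (l / 2) up
    to sign. For groups derived from a quaternion algebra and with rational invariant
    trace field these t are integers > 2; fix one of them and put D = t^2 - 4. Such a
    group is conjugate into the unit group of an order in a quaternion algebra
    (D, b) over Q, and its commensurability class is the class of b modulo the norms
    from Q(sqrt D).

    The class of b occurs as soon as every Q(sqrt (u^2 - 4)), for u = 2 cosh (m / 2)
    with m in S, embeds in (D, b): a maximal order of (D, b) then contains a conjugate
    of every element of norm 1 and integral trace. This is where strong approximation
    enters; units approximating a given one are built from powers of conjugates of
    the element (t + sqrt D) / 2. The field Q(sqrt D') embeds in (D, b) if and only if
    b is a norm from Q(sqrt D) times a norm from Q(sqrt (D D')), so the classes that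
    occur form a group of exponent 2. As pi is eventually constant the group is
    finite, so it has 2^n elements.

    Only finitely many classes have volume less than V: by a Blichfeldt argument the
    group contains an element carrying a fixed large window back to meet itself, and
    its bounded integral trace bounds the class of b. The set S cannot be empty, since
    some arithmetic group over Q(sqrt 3) has irrational traces. *)

Require Import Defs.
From HB Require Import structures.
From mathcomp Require Import all_boot all_order all_algebra all_fingroup all_solvable all_field.
From mathcomp Require Import complex ring lra zify.
From mathcomp Require Import all_classical all_reals all_analysis measurable_realfun ftc.

Set Implicit Arguments.
Unset Strict Implicit.
Unset Printing Implicit Defensive.

Import Order.TTheory GRing.Theory Num.Theory numFieldNormedType.Exports.

Local Open Scope classical_set_scope.
Local Open Scope ring_scope.

(** * Values of quaternary norm forms over the rationals *)

Section NormValues.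
Implicit Types a b c : rat.

(** Realising a class means placing a conjugate of a given element x in a given maximal order O,
    that is, showing that the left lattice O + O x is principal. Its norm is corrected by a global
    element of prescribed reduced norm. That such an element exists is a Hasse principle, obtained
    from the symbol [norm_value a b c], symmetric and multiplicative in its nonzero arguments, by
    Tate's induction over the primes; it applies because D > 0. What remains differs from O at
    finitely many primes and is repaired one prime at a time, by an element of norm 1 that exchanges
    the two halves of an idempotent of a common overlattice modulo a power of the prime. Products of
    powers of conjugate units only reach elements very close to 1. Hurwitz's finiteness of lattice
    classes lifts this restriction: up to conjugation, a nilpotent element is q^k times an element
    of one fixed order, with k as large as wanted. Conversely, a hyperbolic element whose square has
    rational trace splits the algebra at every real place, so the base field is Q. The split class
    is realised by the modular group, because finite area of the other unit groups comes from
    cocompactness. *)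

Definition norm_value a b c : Prop :=
  exists x y z w : rat, c = x ^+ 2 - a * y ^+ 2 - b * z ^+ 2 + a * b * w ^+ 2.

Lemma norm_value_swap a b c : norm_value a b c -> norm_value b a c.
Proof. by move=> [x [y [z [w ->]]]]; exists x, z, y, w; ring. Qed.

Lemma norm_valueM a b c d :
  norm_value a b c -> norm_value a b d -> norm_value a b (c * d).
Proof.
move=> [x [y [z [w ->]]]] [x' [y' [z' [w' ->]]]].
exists (x * x' + a * y * y' + b * z * z' - a * b * w * w'),
  (x * y' + y * x' - b * z * w' + b * w * z'),
  (x * z' + z * x' + a * y * w' - a * w * y'),
  (x * w' + w * x' + y * z' - z * y').
by ring.
Qed.

(** If b is a norm from Q(sqrt a), the form contains the hyperbolic plane u^2 - v^2, which
    represents c at u = (c + 1) / 2, v = (c - 1) / 2. *)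
Lemma norm_value_split a b c u v : b != 0 -> b = u ^+ 2 - a * v ^+ 2 ->
  norm_value a b c.
Proof.
move=> b0 e; exists ((c + 1) / 2), 0, ((c - 1) / 2 * u / b), ((c - 1) / 2 * v / b).
have -> : ((c + 1) / 2) ^+ 2 - a * 0 ^+ 2 - b * ((c - 1) / 2 * u / b) ^+ 2 +
  a * b * ((c - 1) / 2 * v / b) ^+ 2 =
  ((c + 1) / 2) ^+ 2 - ((c - 1) / 2) ^+ 2 * ((u ^+ 2 - a * v ^+ 2) / b).
  by field.
by rewrite -e divff //; field.
Qed.

(** With N the norm of Q(sqrt a), c = N(x) - b N(y) gives b = N(x / y) - c N(1 / y) when N(y) is
    nonzero. With [norm_value_swap] this makes the relation symmetric in nonzero [a], [b], [c]: it
    is the vanishing of the symbol (a, b, c) of degree 3, and depends on its arguments modulo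
    squares. *)
Lemma norm_value_rot a b c : b != 0 -> c != 0 ->
  norm_value a b c -> norm_value a c b.
Proof.
move=> b0 c0 [x [y [z [w e]]]].
have [n0|n0] := eqVneq (z ^+ 2 - a * w ^+ 2) 0.
  apply: (@norm_value_split _ _ _ x y) => //.
  by rewrite e -[X in _ = X](subr0) -(mulr0 b) -n0; ring.
pose n := z ^+ 2 - a * w ^+ 2.
exists ((x * z - a * y * w) / n), ((y * z - x * w) / n), (z / n), (w / n).
have -> : c = x ^+ 2 - a * y ^+ 2 - b * n by rewrite e /n; ring.
by rewrite /n; field.
Qed.

(** The algebras (a, b) and (a, b') are isomorphic when b b' is a norm from Q(sqrt a): multiply the
    second component by (u + v sqrt a) / b'. *)
Lemma norm_value_congr a b b' c u v : b' != 0 ->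
  b * b' = u ^+ 2 - a * v ^+ 2 -> norm_value a b c -> norm_value a b' c.
Proof.
move=> b0 e [x [y [z [w ->]]]].
exists x, y, ((z * u + a * w * v) / b'), ((z * v + w * u) / b').
have -> : b = (u ^+ 2 - a * v ^+ 2) / b' by rewrite -e mulfK.
by field.
Qed.

Lemma norm_value_sqrl a b c : a != 0 -> norm_value (a ^+ 2) b c.
Proof.
move=> a0; have [->|b0] := eqVneq b 0.
  exists ((c + 1) / 2), ((c - 1) / (2 * a)), 0, 0; field; exact: a0.
apply: (@norm_value_split _ _ _ ((b + 1) / 2) ((b - 1) / (2 * a))) => //.
by field.
Qed.

(** Multiplicativity of the reduced norm in the last argument, carried to the first one by
    symmetry. *)
Lemma norm_valueMl a a' b c : a != 0 -> a' != 0 -> c != 0 ->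
  norm_value a b c -> norm_value a' b c -> norm_value (a * a') b c.
Proof.
move=> a0 a'0 c0 /norm_value_swap /(norm_value_rot a0 c0) h.
move=> /norm_value_swap /(norm_value_rot a'0 c0) h'.
apply: norm_value_swap; apply: norm_value_rot => //; first by rewrite mulf_neq0.
exact: norm_valueM.
Qed.

(* Division is multiplication by the inverse, which differs by a square. *)
Lemma norm_value_divl a a' b c : a != 0 -> a' != 0 -> c != 0 ->
  norm_value (a * a') b c -> norm_value a' b c -> norm_value a b c.
Proof.
move=> a0 a'0 c0 h h'.
have /norm_value_swap : norm_value (a * a' * a') b c.
  by apply: norm_valueMl => //; rewrite mulf_neq0.
move=> /(norm_value_rot (mulf_neq0 (mulf_neq0 a0 a'0) a'0) c0) [x [y [z [w e]]]].
apply: norm_value_swap; apply: norm_value_rot => //.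
exists (x / a'), (y / a'), (z / a'), (w / a').
have -> : a = (a * a' * a') / a' ^+ 2 by field.
by rewrite e; field.
Qed.

End NormValues.

(** A nonsquare is an odd power of a generator of the cyclic group of units, and the sum of two odd
    exponents is even. *)
Lemma Fp_nonsquareM p (x y : 'F_p) : prime p ->
  (forall z, x <> z ^+ 2) -> (forall z, y <> z ^+ 2) -> exists z, x * y = z ^+ 2.
Proof.
move=> pp nx ny.
have /cyclicP [g gE] := field_unit_group_cyclic [set: {unit 'F_p}]%G.
have mem (t : 'F_p) : (forall z, t <> z ^+ 2) -> exists i, t = (FinRing.uval g) ^+ i /\ odd i.
  move=> nt; have t0 : t \is a GRing.unit.
    by rewrite unitfE; apply/eqP => t0; apply: (nt 0); rewrite t0 expr0n.
  have : FinRing.unit 'F_p t0 \in [set: {unit 'F_p}]%G by rewrite inE.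
  rewrite gE => /cycleP [i e]; exists i.
  have tE : t = (FinRing.uval g) ^+ i by rewrite -FinRing.val_unitX -e.
  split=> //; case: (boolP (odd i)) => // ev.
  by case: (nt ((FinRing.uval g) ^+ i./2)); rewrite -exprM muln2 even_halfK.
have [i [-> oi]] := mem _ nx; have [j [-> oj]] := mem _ ny.
exists ((FinRing.uval g) ^+ (i + j)./2).
by rewrite -exprD -exprM muln2 even_halfK // oddD oi oj.
Qed.

(* The least nonresidue n is s^2 + 1, and then u = s^2/n works. *)
Lemma Fp_nonsquare_pair p (x : 'F_p) : prime p -> (forall z, x <> z ^+ 2) ->
  exists u : 'F_p, (forall z, u <> z ^+ 2) /\ (forall z, 1 - u <> z ^+ 2).
Proof.
move=> pp nx.
have ex : exists n, `[< forall z : 'F_p, n%:R <> z ^+ 2 >].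
  by exists (val x); apply/asboolP; rewrite natr_Zp.
case: (ex_minnP ex) => -[|n] /asboolP nn mn.
  by case: (nn 0); rewrite expr0n.
have [s e] : exists s : 'F_p, n%:R = s ^+ 2.
  apply: contrapT => h; have : `[< forall z : 'F_p, n%:R <> z ^+ 2 >].
    by apply/asboolP => z ez; apply: h; exists z.
  by move/mn; rewrite ltnn.
have n0 : (n.+1%:R : 'F_p) != 0.
  by apply/eqP => h; apply: (nn 0); rewrite h expr0n.
have s0 : s != 0.
  apply/eqP => s0; apply: (nn 1); rewrite expr1n -natr1 e s0 expr0n add0r //.
exists (s ^+ 2 / n.+1%:R); split=> z ez.
  have z0 : z != 0.
    apply/eqP => z0; move/eqP: ez; rewrite z0 expr0n mulf_eq0 invr_eq0.
    by rewrite (negPf n0) expf_eq0 (negPf s0).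
  apply: (nn (s / z)); rewrite expr_div_n -ez invf_div mulrC mulfVK //.
  by rewrite expf_neq0.
have h : 1 - s ^+ 2 / n.+1%:R = n.+1%:R^-1.
  have -> : s ^+ 2 = n.+1%:R - 1 by rewrite -e -natr1 addrK.
  by rewrite mulrBl mulfV // mul1r subKr.
apply: (nn z^-1); rewrite exprVn -ez h invrK //.
Qed.

(** * Symbols over the rationals by induction over the primes *)

Section TateInduction.

Definition int_norm_value (a b c : int) := norm_value a%:~R b%:~R c%:~R.
Local Notation nv := int_norm_value.

(** The filtration of the nonzero integers by their largest prime factor, as in Tate's computation
    of K_2 of Q; its bottom step consists of 1 and -1. *)
Definition smooth (m : nat) (a : int) :=
  a <> 0 /\ forall q, prime q -> (q %| `|a|)%N -> (q < m)%N.

Lemma smoothM m a b : smooth m a -> smooth m b -> smooth m (a * b).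
Proof.
move=> [a0 ha] [b0 hb]; split; first by apply/eqP; rewrite mulf_neq0 //; exact/eqP.
by move=> q pq; rewrite abszM Euclid_dvdM // => /orP[/ha|/hb]; exact.
Qed.

Lemma smooth_nat m (a : nat) : (0 < a < m)%N -> smooth m a.
Proof.
move=> /andP[a0 am]; split; first by apply/eqP; rewrite -lt0n.
by move=> q pq /= /dvdn_leq -/(_ a0) qa; exact: leq_ltn_trans am.
Qed.

Lemma smoothN m a : smooth m a -> smooth m (- a).
Proof. by move=> [a0 ha]; split; [move=> /eqP; rewrite oppr_eq0 => /eqP|rewrite abszN]. Qed.

Let intr0 (a : int) : a <> 0 -> (a%:~R : rat) != 0.
Proof. by move=> /eqP; rewrite intr_eq0. Qed.

Variable p : nat.
Hypothesis pp : prime p.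
Hypothesis IH : forall a b c, smooth p a -> smooth p b -> smooth p c ->
  0 <= a -> nv a b c.

Let p0 : (p%:~R : rat) != 0.
Proof. by rewrite intr_eq0 eqz_nat -lt0n prime_gt0. Qed.

Let swap a b c : nv a b c -> nv b a c. Proof. exact: norm_value_swap. Qed.

(** p k is a norm from Q(sqrt e), so p and k have the same symbol with e, and k is smooth, where the
    induction hypothesis applies. *)
Let step e k b v : smooth p e -> smooth p k -> smooth p b -> 0 <= e -> 
  p%:Z * k = v ^+ 2 - e -> nv e b p.
Proof.
move=> se sk sb e0 h; rewrite /nv; apply: norm_value_rot => //.
  by apply: intr0; case: sb.
apply: (@norm_value_congr _ k%:~R _ _ v%:~R 1) => //; last exact: IH.
by move/(congr1 (fun z : int => z%:~R : rat)): h; rewrite !rmorphM !rmorphB /= rmorphXn /= mulrC => ->; ring.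
Qed.

(** Write a a' = k p + c. Then p (k a a') = (a a')^2 - c a a' is a norm from Q(sqrt(c a a')), and k
    < p keeps the cofactor smooth. So the symbol with p is compatible with reduction of products
    modulo p. *)
Let residue (a a' c : nat) b : smooth p b -> (0 < a < p)%N -> (0 < a' < p)%N ->
  c = (a * a' %% p)%N -> nv (c%:Z * (a * a')%:Z) b p.
Proof.
move=> sb ha ha' ec.
have c0 : (0 < c)%N.
  rewrite ec lt0n -/(dvdn _ _) Euclid_dvdM // negb_or.
  by case/andP: ha => a0 ap; case/andP: ha' => a'0 a'p; rewrite !gtnNdvd.
have cp : (c < p)%N by rewrite ec ltn_mod prime_gt0.
have [sa sa' sc] : [/\ smooth p a, smooth p a' & smooth p c].
  by split; apply: smooth_nat; rewrite ?c0.
have e := divn_eq (a * a') p.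
case: (posnP (a * a' %/ p)) => k0.
  have -> : c = (a * a')%N by rewrite ec {2}e k0.
  rewrite /nv rmorphM /= -expr2; apply: norm_value_sqrl.
  by rewrite intr_eq0; apply/eqP; rewrite PoszM; exact: (smoothM sa sa').1.
have kp : (a * a' %/ p < p)%N.
  rewrite ltn_divLR ?prime_gt0 //; case/andP: ha => a0 ap; case/andP: ha' => a'0 a'p.
  by apply: ltn_mul.
have sk : smooth p (a * a' %/ p)%N by apply: smooth_nat; rewrite k0.
apply: (@step _ ((a * a' %/ p)%N%:Z * (a * a')%:Z) _ (a * a')%:Z) => //.
- by apply: smoothM => //; rewrite PoszM; exact: smoothM.
- by apply: smoothM => //; rewrite PoszM; exact: smoothM.
- have eA : (a * a')%N%:Z = (a * a' %/ p)%N%:Z * p%:Z + c%:Z.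
    by rewrite -PoszM -PoszD ec -e.
  have -> : c%:Z = (a * a')%N%:Z - (a * a' %/ p)%N%:Z * p%:Z by rewrite eA; ring.
  by ring.
Qed.

Let is_sq (a : nat) := exists z : 'F_p, a%:R = z ^+ 2.

Let nat_of_Fp (z : 'F_p) : z != 0 -> exists n : nat, (0 < n < p)%N /\ z = n%:R.
Proof.
move=> z0; exists (val z); rewrite natr_Zp; split=> //.
rewrite lt0n -[X in (_ < X)%N](Fp_cast pp) ltn_ord andbT; exact: z0.
Qed.

Let FpE (m n : nat) : (m%:R == n%:R :> 'F_p) = (m == n %[mod p]).
Proof.
by rewrite -[LHS]val_eqE /= !val_Fp_nat.
Qed.

Let sq_case a b : smooth p b -> (0 < a < p)%N -> is_sq a -> nv a b p.
Proof.
move=> sb ha [z e].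
have a0 : (a%:R : 'F_p) != 0.
  rewrite (FpE _ 0) mod0n -/(dvdn _ _); case/andP: ha => a0 ap; by rewrite gtnNdvd.
have z0 : z != 0 by apply: contra a0 => /eqP z0; rewrite e z0 expr0n.
have [x [hx ex]] := nat_of_Fp z0.
have := @residue x x a b sb hx hx.
have -> : a = (x * x %% p)%N.
  move: e; rewrite ex -natrX => /eqP; rewrite FpE mulnn => /eqP <-.
  by rewrite modn_small //; case/andP: ha.
move=> /(_ erefl) h.
have {}h : nv (a%:Z * (x * x)%:Z) b p.
  move: h; have -> // : (x * x %% p)%N = a.
  move: e; rewrite ex -natrX => /eqP; rewrite FpE mulnn => /eqP <-.
  by rewrite modn_small //; case/andP: ha.
have x0 : (x%:~R : rat) != 0 by rewrite intr_eq0 eqz_nat; case/andP: hx; case: (x).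
have a00 : (a%:~R : rat) != 0 by rewrite intr_eq0 eqz_nat; case/andP: ha; case: (a).
have -> : (x * x %% p)%N = a.
  move: e; rewrite ex -natrX => /eqP; rewrite FpE mulnn => /eqP <-.
  by rewrite modn_small //; case/andP: ha.
apply: (@norm_value_divl _ (x * x)%N%:~R) => //.
- by rewrite PoszM rmorphM /= mulf_neq0.
- by move: h; rewrite /nv rmorphM.
- by rewrite PoszM rmorphM /= -expr2; apply: norm_value_sqrl.
Qed.

(** The residue of a u is a square, so its symbol is trivial and those of a and u agree. *)
Let prod_case (a u : nat) b : smooth p b -> (0 < a < p)%N -> (0 < u < p)%N ->
  ~ is_sq a -> ~ is_sq u -> nv u b p -> nv a b p.
Proof.
move=> sb ha hu na nu h.
have := @residue a u _ b sb ha hu erefl; set c := (a * u %% p)%N => hr.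
have au0 : ~~ (p %| a * u)%N.
  rewrite Euclid_dvdM // negb_or.
  by case/andP: ha => a0 ap; case/andP: hu => u0 up; rewrite !gtnNdvd.
have hc : (0 < c < p)%N.
  by apply/andP; split; [rewrite lt0n; exact: au0|rewrite /c ltn_mod prime_gt0].
have hs : is_sq c.
  have [z ez] := @Fp_nonsquareM p a%:R u%:R pp
    (fun z e => na (ex_intro _ z e)) (fun z e => nu (ex_intro _ z e)).
  exists z; rewrite -ez -natrM; apply/eqP; rewrite FpE modn_mod //.
have hcv := sq_case sb hc hs.
have nz (n : nat) : (0 < n < p)%N -> (n%:~R : rat) != 0.
  by case: n => //= n _; rewrite intr_eq0.
have h1 : norm_value (a * u)%N%:~R b%:~R p%:~R.
  apply: (@norm_value_divl _ c%:~R) => //.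
  - by rewrite PoszM rmorphM mulf_neq0 ?nz.
  - exact: nz.
  - by move: hr; rewrite /nv mulrC rmorphM.
apply: (@norm_value_divl _ u%:~R) => //; rewrite ?nz //.
by move: h1; rewrite PoszM rmorphM.
Qed.

(** When neither argument is a square modulo p, [prod_case] allows replacing each by any other
    nonsquare. One pair of nonsquares is therefore enough, and u + v = p + 1 is arranged so that the
    Steinberg relation between u and 1 - u applies. *)
Let nv_small (a b : nat) : (0 < a < p)%N -> (0 < b < p)%N -> nv a b p.
Proof.
move=> ha hb; have sa := smooth_nat ha; have sb := smooth_nat hb.
have [qa|na] := pselect (is_sq a); first exact: sq_case.
have [qb|nb] := pselect (is_sq b); first by apply: swap; exact: sq_case.
have [z [nz n1z]] := Fp_nonsquare_pair pp (fun z e => na (ex_intro _ z e)).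
have z0 : z != 0 by apply/eqP => h; apply: (nz 0); rewrite h expr0n.
have z1 : 1 - z != 0 by apply/eqP => h; apply: (n1z 0); rewrite h expr0n.
have [u [hu eu]] := nat_of_Fp z0; have [v [hv ev]] := nat_of_Fp z1.
have nu : ~ is_sq u by move=> [t]; rewrite -eu => /nz.
have nw : ~ is_sq v by move=> [t]; rewrite -ev => /n1z.
have euv : (u + v)%N = p.+1.
  have : (u + v)%:R == 1%:R :> 'F_p by rewrite natrD -eu -ev addrC subrK.
  rewrite FpE; have p1 := prime_gt1 pp; rewrite [(1 %% _)%N]modn_small //.
  have u1 : u <> 1%N by move=> e1; apply: nu; exists 1; rewrite e1 expr1n.
  have v1 : v <> 1%N by move=> e1; apply: nw; exists 1; rewrite e1 expr1n.
  case/andP: hu => u0 up; case/andP: hv => v0 vp.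
  have [lt|ge] := ltnP (u + v) p.
    by rewrite modn_small // => /eqP e1; lia.
  have -> : (u + v)%N = (p + (u + v - p))%N by lia.
  by rewrite modnDl modn_small => [/eqP|]; lia.
have su := smooth_nat hu; have sv := smooth_nat hv.
have u0 : (u%:~R : rat) != 0 by apply: intr0; case: su.
have v0 : (v%:~R : rat) != 0 by apply: intr0; case: sv.
have huv : nv u v p.
  (* [1 - u] and [v] differ by [p]; the symbol of [u] and [1 - u] is trivial *)
  have u1 : (1 < u)%N.
    case: u {su u0 eu} hu nu euv => [|[|u]] //= _ nu _.
    by case: nu; exists 1; rewrite expr1n.
  have e1 : (1 - u%:Z) = - (u.-1)%:Z by lia.
  have su1 : smooth p (1 - u%:Z).
    rewrite e1; apply: smoothN; apply: smooth_nat; case/andP: hu => _ up.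
    by apply/andP; split; [lia|exact: leq_ltn_trans (leq_pred _) up].
  have h1 : norm_value (1 - u%:Z)%:~R u%:~R p%:~R.
    apply: norm_value_swap.
    apply: (@norm_value_split _ _ _ 1 1); first by apply: intr0; case: su1.
    by rewrite rmorphB /=; ring.
  have h2 : norm_value ((1 - u%:Z)%:~R * v%:~R) u%:~R p%:~R.
    apply: norm_value_rot => //.
    apply: (@norm_value_congr _ v%:~R _ _ v%:~R 1) => //.
      by rewrite -!rmorphM -rmorphXn expr1n mulr1 -rmorphB /=; congr (_%:~R); lia.
    by rewrite -rmorphM; apply/swap/IH => //; exact: smoothM.
  apply: norm_value_swap; apply: (@norm_value_divl _ (1 - u%:Z)%:~R) => //.
    by apply: intr0; case: su1.
  by rewrite mulrC.
apply: (prod_case sb ha hu na nu); apply: swap.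
by apply: (prod_case su hb hv nb nw); apply: swap.
Qed.

Let nv_pos (a : int) b : smooth p a -> 0 < a -> smooth p b ->
  (forall q : nat, (0 < q < p)%N -> nv q b p) -> nv a b p.
Proof.
case: a => // a [a0 ha] agt0 sb h.
elim/ltn_ind: a a0 ha agt0 => a IHa a0 ha agt0.
have [a1|a1] := leqP a 1.
  have -> : a = 1%N by lia.
  by apply: h; rewrite prime_gt1.
have pq := pdiv_prime a1; set q := pdiv a in pq.
have qa : (q %| a)%N by exact: pdiv_dvd.
have hq : (0 < q < p)%N by rewrite prime_gt0 //=; exact: ha.
case/dvdnP: qa => d ed; have d0 : (0 < d)%N by lia.
have d00 : (d%:~R : rat) != 0 by rewrite intr_eq0 eqz_nat -lt0n.
have q00 : (q%:~R : rat) != 0 by rewrite intr_eq0 eqz_nat -lt0n prime_gt0.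
rewrite ed PoszM /nv rmorphM; apply: norm_valueMl => //; last exact: h.
apply: IHa; rewrite ?ltz_nat //.
- by rewrite ed -[X in (X < _)%N]muln1 ltn_pmul2l // prime_gt1.
- by move=> e; move: d0; rewrite (_ : d = 0%N) //; case: e.
- by move=> r pr rd; apply: ha => //; rewrite ed dvdn_mulr.
Qed.

Let smoothp1 : smooth p p.-1.
Proof. by apply: smooth_nat; have := prime_gt1 pp; lia. Qed.

(** 1 - p is a norm from Q(sqrt p), so - (p - 1) has trivial symbol with p, and -1 behaves like p -
    1. *)
Let nv_N1 b : smooth p b -> nv p.-1 b p -> nv (- 1) b p.
Proof.
move=> sb h; have p1 : (p.-1%:~R : rat) != 0 by apply: intr0; case: smoothp1.
have eN : (- 1)%:~R * p.-1%:~R = 1 - p%:~R :> rat.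
  by rewrite mulN1r -[in RHS](prednK (prime_gt0 pp)) -addn1 PoszD rmorphD /=; ring.
apply: (@norm_value_divl _ p.-1%:~R) => //.
rewrite eN; apply: norm_value_rot => //; first by apply: intr0; case: sb.
by apply: (@norm_value_split _ _ _ 1 1) => //; ring.
Qed.

Let nv_pospos (a b : int) : smooth p a -> smooth p b -> 0 < a -> 0 < b -> nv a b p.
Proof.
move=> sa sb a0 b0; apply: nv_pos => // q hq; apply: swap; apply: nv_pos => //.
  exact: smooth_nat.
by move=> r hr; exact: nv_small.
Qed.

Let nv_sign b : smooth p b -> nv (- 1) b p ->
  (forall a : int, smooth p a -> 0 < a -> nv a b p) ->
  forall a : int, smooth p a -> nv a b p.
Proof.
move=> sb h1 h a sa; case: (ltrgtP a 0) => a0.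
- have sNa := smoothN sa.
  have -> : a = - 1 * - a by rewrite mulN1r opprK.
  rewrite /nv rmorphM; apply: norm_valueMl => //.
  + by apply: intr0; case: sNa.
  + by apply: h => //; rewrite oppr_gt0.
- exact: h.
- by case: sa; rewrite a0.
Qed.

(** All signs of [a] and [b] are allowed because the third entry p is positive. *)
Lemma norm_value_prime (a b : int) : smooth p a -> smooth p b -> nv a b p.
Proof.
have pp0 : 0 < p.-1%:Z by rewrite ltz_nat -subn1 subn_gt0 prime_gt1.
have hp (b' : int) : smooth p b' -> 0 < b' -> forall a', smooth p a' -> nv a' b' p.
  move=> sb' b0; apply: nv_sign => // [|a' sa' a0]; last exact: nv_pospos.
  by apply: nv_N1 => //; apply: nv_pospos => //; exact: smoothp1.
move=> sa sb; apply: nv_sign => // [|a' sa' a0].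
  by apply: nv_N1 => //; apply: swap; apply: hp => //; exact: smoothp1.
by apply: swap; apply: hp.
Qed.

End TateInduction.

Lemma smooth_prime_split p a : prime p -> smooth p.+1 a ->
  exists (i : nat) (a' : int), smooth p a' /\ a = p%:Z ^+ i * a'.
Proof.
move=> pp [a0 h]; have a00 : (0 < `|a|)%N by rewrite absz_gt0; exact/eqP.
exists (logn p `|a|), (sgz a * (`|a| %/ p ^ logn p `|a|)%N); split; last first.
  have -> : p%:Z ^+ logn p `|a| = (p ^ logn p `|a|)%N%:Z by rewrite -!natz natrX.
  by rewrite mulrCA -PoszM mulnC divnK ?pfactor_dvdnn // -intEsg.
have [m cm em] := pfactor_coprime pp a00.
have -> : (`|a| %/ p ^ logn p `|a|)%N = m.
  by rewrite {1}em mulnK // expn_gt0 prime_gt0.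
have m0 : (0 < m)%N by move: a00; rewrite em muln_gt0 => /andP[].
split; first by apply/eqP; rewrite mulf_neq0 // ?sgz_eq0 ?eqz_nat -?lt0n //; exact/eqP.
move=> q pq; rewrite abszM absz_sg; have -> : (a != 0) by exact/eqP.
rewrite mul1n => qm; have : (q < p.+1)%N by apply: h => //; rewrite em dvdn_mulr.
rewrite ltnS leq_eqVlt => /orP[/eqP eqp|//].
by move: cm; rewrite prime_coprime // -eqp qm.
Qed.

Lemma norm_value_pow_reduce (p : rat) i a b c : p != 0 ->
  norm_value (p ^+ (odd i) * a) b c -> norm_value (p ^+ i * a) b c.
Proof.
move=> p0 [x [y [z [w ->]]]]; set k := p ^+ i./2.
have k0 : k != 0 by rewrite expf_neq0.
exists x, (y / k), z, (w / k).
rewrite -[in X in _ = X](odd_double_half i) exprD -mul2n mulnC exprM -/k.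
by field.
Qed.

(** Each entry is a power of the prime p = [m] times a number smooth below p, and only the parity of
    the exponents matters. Several factors p are merged by the relation (p, p) = (p, -1) until at
    most one is left, the case of [norm_value_prime]. Three negative entries are excluded because
    the form is then positive definite and c < 0. *)
Lemma norm_value_smooth m (a b c : int) : smooth m a -> smooth m b -> smooth m c ->
  ~ (a < 0 /\ b < 0 /\ c < 0) -> int_norm_value a b c.
Proof.
have intr0 (x : int) : x <> 0 -> (x%:~R : rat) != 0.
  by move=> /eqP; rewrite intr_eq0.
elim: m a b c => [|m IH] a b c sa sb sc nneg.
  have u (x : int) : smooth 0 x -> x = 1 \/ x = -1.
    move=> [x0 hx]; have : `|x|%N = 1%N.
      apply/eqP; rewrite eqn_leq absz_gt0 andbC; apply/andP; split; first exact/eqP.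
      by rewrite leqNgt; apply/negP => x1; have := hx _ (pdiv_prime x1) (pdiv_dvd _).
    by case: x {x0 hx} => n /= e; [left|right]; lia.
  rewrite /int_norm_value.
  case: (u a sa) => ea; case: (u b sb) => eb; case: (u c sc) => ec; subst;
  try (by exists 1, 0, 0, 0; ring); try (by exists 0, 1, 0, 0; ring);
  try (by exists 0, 0, 1, 0; ring).
  by case: nneg.
have [pm|npm] := boolP (prime m); last first.
  have red x : smooth m.+1 x -> smooth m x.
    move=> [x0 hx]; split=> // q pq qx; have := hx q pq qx.
    rewrite ltnS leq_eqVlt => /orP[/eqP e|//].
    by move: npm; rewrite -e pq.
  by apply: IH => //; exact: red.
have IHp a' b' c' : smooth m a' -> smooth m b' -> smooth m c' -> 0 <= a' ->
    int_norm_value a' b' c'.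
  move=> sa' sb' sc' a0; apply: IH => // -[a1 _].
  by move: a1; rewrite ltNge a0.
have m0 : (m%:~R : rat) != 0 by rewrite intr_eq0 eqz_nat -lt0n prime_gt0.
have mgt0 : (0 < m%:Z) by rewrite ltz_nat prime_gt0.
have main a' b' c' : smooth m a' -> smooth m b' -> smooth m c' ->
   ~ (a' < 0 /\ b' < 0 /\ c' < 0) -> int_norm_value a' b' (m%:Z * c').
  move=> sa' sb' sc' nn; rewrite /int_norm_value rmorphM.
  by apply: norm_valueM; [exact: norm_value_prime|exact: IH].
have rot x y z : x <> 0 -> y <> 0 -> z <> 0 -> int_norm_value x y z -> int_norm_value x z y.
  by move=> x0 y0 z0; apply: norm_value_rot; exact: intr0.
have swp x y z : int_norm_value x y z -> int_norm_value y x z by exact: norm_value_swap.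
have nM x : smooth m x -> m%:Z * x <> 0.
  by move=> [x0 _]; apply/eqP; apply: mulf_neq0; [rewrite gt_eqF|exact/eqP].
have main1 a' b' c' : smooth m a' -> smooth m b' -> smooth m c' ->
   ~ (a' < 0 /\ b' < 0 /\ c' < 0) -> int_norm_value (m%:Z * a') b' c'.
  move=> sa' sb' sc' nn; apply/swp; apply/rot; try (by case: sa'); try (by case: sb');
    try (by case: sc'); try exact: nM.
  by apply: main => //; tauto.
(* two factors p: (p a', p b') = (p a', - a' b') *)
have main2 a' b' c' : smooth m a' -> smooth m b' -> smooth m c' ->
   ~ (a' < 0 /\ b' < 0 /\ c' < 0) -> int_norm_value (m%:Z * a') (m%:Z * b') c'.
  move=> sa' sb' sc' nn.
  apply: (@norm_value_congr _ (- (a' * b'))%:~R _ _ 0 b'%:~R).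
  + by apply: intr0; exact: nM.
  + by rewrite !(rmorphM, rmorphN) /=; ring.
  + apply: main1 => //; first by apply/smoothN/smoothM.
    by rewrite oppr_lt0 => -[a0 [/= ab c0]]; case: nn; split=> //; split=> //; nia.
have main3 a' b' c' : smooth m a' -> smooth m b' -> smooth m c' ->
   ~ (a' < 0 /\ b' < 0 /\ c' < 0) -> int_norm_value (m%:Z * a') (m%:Z * b') (m%:Z * c').
  move=> sa' sb' sc' nn; apply/rot; try exact: nM.
  apply: (@norm_value_congr _ (- (a' * c'))%:~R _ _ 0 c'%:~R).
  + by apply: intr0; exact: nM.
  + by rewrite !(rmorphM, rmorphN) /=; ring.
  + rewrite -/(int_norm_value (m%:Z * a') (- (a' * c')) (m%:Z * b')).
    apply/rot; try exact: nM.
      by case: (smoothN (smoothM sa' sc')).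
    apply: main2 => //; first by apply/smoothN/smoothM.
    by rewrite oppr_lt0 => -[a0 [b0 ac]]; case: nn; split=> //; split=> //; nia.
have [i [a' [sa' ea]]] := smooth_prime_split pm sa.
have [j [b' [sb' eb]]] := smooth_prime_split pm sb.
have [k [c' [sc' ec]]] := smooth_prime_split pm sc.
have nn : ~ (a' < 0 /\ b' < 0 /\ c' < 0).
  by move: nneg; rewrite ea eb ec !pmulr_rlt0 ?exprn_gt0.
have red i' x y z : x <> 0 -> int_norm_value (m%:Z ^+ (odd i') * x) y z ->
    int_norm_value (m%:Z ^+ i' * x) y z.
  move=> x0; rewrite /int_norm_value !rmorphM !rmorphXn; exact: norm_value_pow_reduce.
have nzX e x : smooth m x -> m%:Z ^+ e * x <> 0.
  by move=> [x0 _]; apply/eqP; apply: mulf_neq0; [rewrite expf_neq0 // gt_eqF|exact/eqP].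
rewrite ea eb ec; apply/red; first by case: sa'.
apply/swp; apply/red; first by case: sb'.
apply/rot; try exact: nzX; apply/swp; apply/red; first by case: sc'.
apply/swp; apply/rot; try exact: nzX; apply/swp.
case: (odd i) (odd j) (odd k) => [] [] []; rewrite ?expr1 ?expr0 ?mul1r.
- by apply: main3.
- by apply: main2.
- apply/rot; try exact: nM; first by case: sb'.
  by apply: main2 => //; tauto.
- by apply: main1.
- apply/swp/rot; try exact: nM; first by case: sa'.
  by apply: main2 => //; tauto.
- by apply/swp; apply: main1 => //; tauto.
- by apply: main.
- by apply: IH.
Qed.

(** The Hasse principle for reduced norms over Q: the real place carries the only obstruction.
    Multiplication by squares of denominators reduces to integers. *)
Theorem norm_value_universal (a b c : rat) : a != 0 -> b != 0 -> c != 0 ->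
  ~ (a < 0 /\ b < 0 /\ c < 0) -> norm_value a b c.
Proof.
have toint (x : rat) : x != 0 -> exists (n : int) (d : rat), [/\ n <> 0, 0 < d & n%:~R = x * d ^+ 2].
  move=> x0; exists (numq x * denq x), (denq x)%:~R; split.
  - by apply/eqP; rewrite mulf_neq0 ?numq_eq0 ?denq_eq0.
  - by rewrite ltr0z denq_gt0.
  - rewrite rmorphM /= expr2 mulrA; congr (_ * _).
    by rewrite -[RHS]mulr1 -{2}[x]divq_num_den divfK ?mulr1 // intr_eq0 denq_eq0.
move=> a0 b0 c0 nn.
have [n [d [n0 d0 en]]] := toint a a0; have [n' [d' [n'0 d'0 en']]] := toint b b0.
have [n'' [d'' [n''0 d''0 en'']]] := toint c c0.
have sgn (x e : rat) (k : int) : 0 < e -> k%:~R = x * e ^+ 2 -> (k < 0) = (x < 0).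
  by move=> e0 h; rewrite -(ltrz0 rat) h pmulr_llt0 // exprn_gt0.
have big (k : int) M : k <> 0 -> (`|k| < M)%N -> smooth M k.
  move=> k0 kM; split=> // q pq qk; apply: leq_ltn_trans kM; apply: dvdn_leq => //.
  by rewrite absz_gt0; exact/eqP.
have [x [y [z [w h]]]] : int_norm_value n n' n''.
  apply: (@norm_value_smooth (`|n| + `|n'| + `|n''|).+1).
  - by apply: big => //; rewrite ltnS -addnA leq_addr.
  - by apply: big => //; rewrite ltnS addnAC leq_addl.
  - by apply: big => //; rewrite ltnS leq_addl.
  by rewrite (sgn _ _ _ d0 en) (sgn _ _ _ d'0 en') (sgn _ _ _ d''0 en'').
exists (x / d''), (y * d / d''), (z * d' / d''), (w * d * d' / d'').
have -> : c = n''%:~R / d'' ^+ 2 by rewrite en'' mulfK // expf_neq0 // gt_eqF.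
by rewrite h en en'; field; rewrite gt_eqF.
Qed.

(** * Transversals in quotients of exponent 2 *)

Section ElementaryTransversal.
Variables N E : set rat.
Hypotheses (N0 : forall x, N x -> x != 0) (Nsq : forall x, x != 0 -> N (x ^+ 2))
  (NM : forall x y, N x -> N y -> N (x * y))
  (NsqV : forall x y, x != 0 -> N (x ^+ 2 * y) -> N y)
  (E1 : E 1) (E0 : forall x, E x -> x != 0) (EM : forall x y, E x -> E y -> E (x * y)).

Definition inequivalent (s : seq rat) := forall i j, (i < size s)%N -> (j < size s)%N ->
  i != j -> ~ N (s`_i * s`_j).

(* E / N has exponent 2, so a finite subgroup missing a class doubles. *)
Lemma transversal_or_subgroup k :
  (exists n (s : seq rat), [/\ size s = (2 ^ n)%N, {in s, forall x, E x}, inequivalent s &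
    forall x, E x -> exists2 y, y \in s & N (x * y)]) \/
  (exists s : seq rat, [/\ size s = (2 ^ k)%N, {in s, forall x, E x}, inequivalent s &
    {in s &, forall x y, exists2 z, z \in s & N (x * y * z)}]).
Proof.
elim: k => [|k [IH|[s [ss sE si sM]]]]; [right|by left|].
  exists [:: 1]; split=> //; first by move=> x; rewrite inE => /eqP ->.
    by move=> [|i] [|j].
  move=> x y; rewrite !inE => /eqP -> /eqP ->; exists 1; rewrite ?inE //.
  by rewrite !mulr1 -[1](expr1n rat 2); apply: Nsq; exact: oner_neq0.
have [full|/existsNP [b /not_implyP [Eb hb]]] :=
  pselect (forall x, E x -> exists2 y, y \in s & N (x * y)).
  by left; exists k, s.
right; exists (s ++ [seq b * x | x <- s]).
have b0 := E0 Eb.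
have nb x y : x \in s -> y \in s -> ~ N (x * (b * y)).
  move=> xs ys h; apply: hb; have [z zs hz] := sM _ _ xs ys; exists z => //.
  have x0 := E0 (sE _ xs); have y0 := E0 (sE _ ys).
  apply: (NsqV (x := x * y)); first exact: mulf_neq0.
  have -> : (x * y) ^+ 2 * (b * z) = (x * (b * y)) * (x * y * z) by ring.
  exact: NM.
split.
- by rewrite size_cat size_map ss addnn -mul2n expnS.
- move=> x; rewrite mem_cat => /orP [/sE //|/mapP [y ys ->]].
  by apply: EM => //; exact: sE.
- move=> i j; rewrite size_cat size_map => li lj ij; rewrite !nth_cat.
  case: ltnP => hi; case: ltnP => hj.
  + exact: si.
  + rewrite (nth_map 0); last by rewrite ltn_subLR.
    by apply: nb; apply: mem_nth => //; rewrite ltn_subLR.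
  + rewrite (nth_map 0); last by rewrite ltn_subLR.
    by rewrite mulrC; apply: nb; apply: mem_nth => //; rewrite ltn_subLR.
  + rewrite !(nth_map 0) ?ltn_subLR // => h.
    have := si (i - size s)%N (j - size s)%N.
    rewrite !ltn_subLR // => /(_ li lj); apply.
      by apply: contra ij => /eqP e; rewrite -(subnK hi) e subnK.
    apply: (NsqV b0); congr N: h; ring.
- move=> x y; rewrite !mem_cat => /orP [xs|/mapP [x' xs ->]] /orP [ys|/mapP [y' ys ->]].
  + by have [z zs hz] := sM _ _ xs ys; exists z; rewrite // mem_cat zs.
  + have [z zs hz] := sM _ _ xs ys; exists (b * z); first by rewrite mem_cat map_f ?orbT.
    have -> : x * (b * y') * (b * z) = b ^+ 2 * (x * y' * z) by ring.
    by apply: NM => //; exact: Nsq.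
  + have [z zs hz] := sM _ _ xs ys; exists (b * z); first by rewrite mem_cat map_f ?orbT.
    have -> : b * x' * y * (b * z) = b ^+ 2 * (x' * y * z) by ring.
    by apply: NM => //; exact: Nsq.
  + have [z zs hz] := sM _ _ xs ys; exists z; first by rewrite mem_cat zs.
    have -> : b * x' * (b * y') * z = b ^+ 2 * (x' * y' * z) by ring.
    by apply: NM => //; exact: Nsq.
Qed.

Lemma transversal_pow2 (M : nat) :
  (forall s : seq rat, {in s, forall x, E x} -> inequivalent s -> (size s <= M)%N) ->
  exists n (s : seq rat), [/\ size s = (2 ^ n)%N, {in s, forall x, E x}, inequivalent s &
    forall x, E x -> exists2 y, y \in s & N (x * y)].
Proof.
move=> h; have [//|[s [ss sE si _]]] := transversal_or_subgroup M.
by have := h s sE si; rewrite ss leqNgt ltn_expl.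
Qed.

End ElementaryTransversal.

(** * Norm classes and embeddings of quadratic fields *)

Section TraceClasses.
Variable D : rat.
Hypothesis D0 : D != 0.
Hypothesis Dnsq : forall x y : rat, x ^+ 2 - D * y ^+ 2 = 0 -> x = 0 /\ y = 0.

Definition qnorm : set rat := [set n | n != 0 /\ exists u v, n = u ^+ 2 - D * v ^+ 2].

Definition trace_class (d : rat) : set rat := [set b | b != 0 /\ exists u v X Y,
  b = (u ^+ 2 - D * v ^+ 2) * (X ^+ 2 - D * d * Y ^+ 2)].

Lemma qnorm_sq x : x != 0 -> qnorm (x ^+ 2).
Proof. by move=> x0; split; [rewrite expf_neq0|exists x, 0; ring]. Qed.

Lemma qnormM x y : qnorm x -> qnorm y -> qnorm (x * y).
Proof.
move=> [x0 [u [v e]]] [y0 [u' [v' e']]]; split; first exact: mulf_neq0.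
by rewrite e e'; exists (u * u' + D * v * v'), (u * v' + v * u'); ring.
Qed.

Lemma qnorm_sqV x y : x != 0 -> qnorm (x ^+ 2 * y) -> qnorm y.
Proof.
move=> x0 h; have -> : y = (x^-1) ^+ 2 * (x ^+ 2 * y) by field.
by apply: qnormM => //; apply: qnorm_sq; rewrite invr_eq0.
Qed.

Lemma trace_classM d x y : trace_class d x -> trace_class d y -> trace_class d (x * y).
Proof.
move=> [x0 [u [v [X [Y e]]]]] [y0 [u' [v' [X' [Y' e']]]]]; split; first exact: mulf_neq0.
rewrite e e'; exists (u * u' + D * v * v'), (u * v' + v * u').
by exists (X * X' + D * d * Y * Y'), (X * Y' + Y * X'); ring.
Qed.

Lemma qnorm_trace_class d : qnorm `<=` trace_class d.
Proof.
by move=> x [x0 [u [v e]]]; split=> //; exists u, v, 1, 0; rewrite e; ring.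
Qed.

(** D y^2 + b (z^2 - D w^2) is the square of the pure quaternion y i + z j + w i j, so the
    right-hand side says that (D, b) contains a square root of d. The substitution X = D y, Y = 1
    passes between the two descriptions. *)
Lemma trace_class_realized d b : d != 0 -> b != 0 ->
  trace_class d b <-> exists y z w, d = D * y ^+ 2 + b * (z ^+ 2 - D * w ^+ 2).
Proof.
move=> d0 b0; split.
  move=> [_ [u [v [X [Y e]]]]].
  have n0 : u ^+ 2 - D * v ^+ 2 != 0.
    by apply: contraNneq b0 => h; rewrite e h mul0r.
  have [Y0|Y0] := eqVneq Y 0.
    have X0 : X != 0.
      by apply: contraNneq b0 => h; rewrite e h Y0; apply/eqP; ring.
    have eb : b = (u * X) ^+ 2 - D * (v * X) ^+ 2 by rewrite e Y0; ring.
    (* Here b is a norm from Q(sqrt D), so the form contains D (y^2 - w^2); the choice gives y - w =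
       1 and y + w = d / D. *)
    pose y := (1 + d / D) / 2; pose w := (d / D - 1) / 2.
    exists y, (D * (v * X / b) * w), (u * X / b * w).
    have -> : b * ((D * (v * X / b) * w) ^+ 2 - D * (u * X / b * w) ^+ 2) =
      - D * w ^+ 2 * ((u * X) ^+ 2 - D * (v * X) ^+ 2) / b by field.
    by rewrite -eb mulfK // /y /w; field.
  pose m := - D * (u ^+ 2 - D * v ^+ 2).
  have m0 : m != 0 by rewrite mulf_neq0 // oppr_eq0.
  exists (X / (D * Y)), (D * v / (m * Y)), (u / (m * Y)).
  by rewrite e /m; field; rewrite n0 D0 Y0.
move=> [y [z [w e]]]; split=> //.
(* In the degenerate case d = D y^2, so D d is a square and X^2 - D d Y^2 takes every value. *)
have [n0|n0] := eqVneq (z ^+ 2 - D * w ^+ 2) 0.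
  have y0 : y != 0.
    by apply: contraNneq d0 => h; rewrite e h n0; apply/eqP; ring.
  exists 1, 0, ((b + 1) / 2), ((b - 1) / (2 * D * y)); rewrite e n0.
  by field; rewrite D0 y0.
pose m := - D * (z ^+ 2 - D * w ^+ 2).
exists (D * w / m), (z / m), (D * y), 1.
have -> : D * w / m = - w / (z ^+ 2 - D * w ^+ 2) by rewrite /m; field; rewrite n0 D0.
have -> : z / m = - z / (D * (z ^+ 2 - D * w ^+ 2)) by rewrite /m; field; rewrite n0 D0.
by rewrite e; field; rewrite n0 D0.
Qed.

End TraceClasses.

(** * Quaternion algebras and their orders *)

(** A copy of the row vectors that carries [a] and [b] in its type; the coordinates refer to 1, i,
    j, i j with i^2 = a and j^2 = b. *)
Definition quaternion (F : fieldType) (a b : F) : Type := 'rV[F]_4.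

Section QuaternionType.
Variables (F : fieldType) (a b : F).
Local Notation quat := (quaternion a b).

HB.instance Definition _ := GRing.Lmodule.on quat.
HB.instance Definition _ := Vector.copy quat 'rV[F]_4.

Definition mkq (x y z w : F) : quat := \row_(i < 4) [:: x; y; z; w]`_i.
Definition q0 (x : quat) : F := x 0 (@Ordinal 4 0 isT).
Definition q1 (x : quat) : F := x 0 (@Ordinal 4 1 isT).
Definition q2 (x : quat) : F := x 0 (@Ordinal 4 2 isT).
Definition q3 (x : quat) : F := x 0 (@Ordinal 4 3 isT).

Lemma q0_mk x y z w : q0 (mkq x y z w) = x. Proof. by rewrite /q0 mxE. Qed.
Lemma q1_mk x y z w : q1 (mkq x y z w) = y. Proof. by rewrite /q1 mxE. Qed.
Lemma q2_mk x y z w : q2 (mkq x y z w) = z. Proof. by rewrite /q2 mxE. Qed.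
Lemma q3_mk x y z w : q3 (mkq x y z w) = w. Proof. by rewrite /q3 mxE. Qed.

Lemma quatP (x y : quat) :
  q0 x = q0 y -> q1 x = q1 y -> q2 x = q2 y -> q3 x = q3 y -> x = y.
Proof.
move=> e0 e1 e2 e3; apply/rowP => -[[|[|[|[|i]]]] lti] //.
- by rewrite (_ : Ordinal lti = Ordinal (isT : (0 < 4)%N)) //; exact: val_inj.
- by rewrite (_ : Ordinal lti = Ordinal (isT : (1 < 4)%N)) //; exact: val_inj.
- by rewrite (_ : Ordinal lti = Ordinal (isT : (2 < 4)%N)) //; exact: val_inj.
- by rewrite (_ : Ordinal lti = Ordinal (isT : (3 < 4)%N)) //; exact: val_inj.
Qed.

Definition qmul (x y : quat) : quat :=
  mkq (q0 x * q0 y + a * q1 x * q1 y + b * q2 x * q2 y - a * b * q3 x * q3 y)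
      (q0 x * q1 y + q1 x * q0 y - b * q2 x * q3 y + b * q3 x * q2 y)
      (q0 x * q2 y + q2 x * q0 y + a * q1 x * q3 y - a * q3 x * q1 y)
      (q0 x * q3 y + q3 x * q0 y + q1 x * q2 y - q2 x * q1 y).

Definition qone : quat := mkq 1 0 0 0.

Lemma q0D (x y : quat) : q0 (x + y) = q0 x + q0 y. Proof. exact: mxE. Qed.
Lemma q1D (x y : quat) : q1 (x + y) = q1 x + q1 y. Proof. exact: mxE. Qed.
Lemma q2D (x y : quat) : q2 (x + y) = q2 x + q2 y. Proof. exact: mxE. Qed.
Lemma q3D (x y : quat) : q3 (x + y) = q3 x + q3 y. Proof. exact: mxE. Qed.
Lemma q0N (x : quat) : q0 (- x) = - q0 x. Proof. exact: mxE. Qed.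
Lemma q1N (x : quat) : q1 (- x) = - q1 x. Proof. exact: mxE. Qed.
Lemma q2N (x : quat) : q2 (- x) = - q2 x. Proof. exact: mxE. Qed.
Lemma q3N (x : quat) : q3 (- x) = - q3 x. Proof. exact: mxE. Qed.
Lemma q0Z c (x : quat) : q0 (c *: x) = c * q0 x. Proof. exact: mxE. Qed.
Lemma q1Z c (x : quat) : q1 (c *: x) = c * q1 x. Proof. exact: mxE. Qed.
Lemma q2Z c (x : quat) : q2 (c *: x) = c * q2 x. Proof. exact: mxE. Qed.
Lemma q3Z c (x : quat) : q3 (c *: x) = c * q3 x. Proof. exact: mxE. Qed.
Lemma q0_0 : q0 0 = 0. Proof. exact: mxE. Qed.
Lemma q1_0 : q1 0 = 0. Proof. exact: mxE. Qed.
Lemma q2_0 : q2 0 = 0. Proof. exact: mxE. Qed.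
Lemma q3_0 : q3 0 = 0. Proof. exact: mxE. Qed.

Definition qlinE := (q0D, q1D, q2D, q3D, q0N, q1N, q2N, q3N, q0Z, q1Z, q2Z, q3Z,
  q0_0, q1_0, q2_0, q3_0, q0_mk, q1_mk, q2_mk, q3_mk).

Lemma qmulA : associative qmul.
Proof. by move=> x y z; apply: quatP; rewrite !qlinE; ring. Qed.
Lemma qmul1 : left_id qone qmul.
Proof. by move=> x; apply: quatP; rewrite !qlinE; ring. Qed.
Lemma qmulr1 : right_id qone qmul.
Proof. by move=> x; apply: quatP; rewrite !qlinE; ring. Qed.
Lemma qmulDl : left_distributive qmul +%R.
Proof. by move=> x y z; apply: quatP; rewrite !qlinE; ring. Qed.
Lemma qmulDr : right_distributive qmul +%R.
Proof. by move=> x y z; apply: quatP; rewrite !qlinE; ring. Qed.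
Lemma qone_neq0 : qone != 0.
Proof. by apply/eqP => /(congr1 q0); rewrite !qlinE => /eqP; rewrite oner_eq0. Qed.

HB.instance Definition _ := GRing.Zmodule_isNzRing.Build quat
  qmulA qmul1 qmulr1 qmulDl qmulDr qone_neq0.

Lemma qscaleAl (c : F) (x y : quat) : c *: (x * y) = (c *: x) * y.
Proof. by apply: quatP; rewrite /GRing.mul /= /qmul !qlinE; ring. Qed.
Lemma qscaleAr (c : F) (x y : quat) : c *: (x * y) = x * (c *: y).
Proof. by apply: quatP; rewrite /GRing.mul /= /qmul !qlinE; ring. Qed.

HB.instance Definition _ := GRing.Lmodule_isLalgebra.Build F quat qscaleAl.
HB.instance Definition _ := GRing.Lalgebra_isAlgebra.Build F quat qscaleAr.
HB.instance Definition _ := Algebra_isFalgebra.Build F quat.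

End QuaternionType.

Section QuaternionNorm.
Variables (F : fieldType) (a b : F).
Local Notation B := (quaternion a b).
Implicit Types x y z : B.

Definition qconj x : B := mkq a b (q0 x) (- q1 x) (- q2 x) (- q3 x).
Definition qtr x : F := q0 x + q0 x.
Definition qnrd x : F :=
  q0 x ^+ 2 - a * q1 x ^+ 2 - b * q2 x ^+ 2 + a * b * q3 x ^+ 2.

Lemma qmul_E x y : x * y = qmul x y. Proof. by []. Qed.
Lemma q0_1 : q0 (1 : B) = 1. Proof. exact: q0_mk. Qed.
Lemma q1_1 : q1 (1 : B) = 0. Proof. exact: q1_mk. Qed.
Lemma q2_1 : q2 (1 : B) = 0. Proof. exact: q2_mk. Qed.
Lemma q3_1 : q3 (1 : B) = 0. Proof. exact: q3_mk. Qed.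

Definition qE := (qmul_E, q0D, q1D, q2D, q3D, q0N, q1N, q2N, q3N, q0Z, q1Z, q2Z,
  q3Z, q0_0, q1_0, q2_0, q3_0, q0_1, q1_1, q2_1, q3_1, q0_mk, q1_mk, q2_mk, q3_mk).

Ltac qring := apply: quatP; rewrite ?qmul_E /qmul /qconj /qtr /qnrd ?qE; ring.

Lemma qconjD x y : qconj (x + y) = qconj x + qconj y. Proof. by qring. Qed.
Lemma qconjN x : qconj (- x) = - qconj x. Proof. by qring. Qed.
Lemma qconjZ c x : qconj (c *: x) = c *: qconj x. Proof. by qring. Qed.
Lemma qconjK : involutive qconj. Proof. by move=> x; qring. Qed.
Lemma qconj1 : qconj 1 = 1. Proof. by qring. Qed.
Lemma qconjM x y : qconj (x * y) = qconj y * qconj x. Proof. by qring. Qed.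
Lemma mul_qconj x : x * qconj x = qnrd x *: 1. Proof. by qring. Qed.
Lemma qconj_mul x : qconj x * x = qnrd x *: 1. Proof. by qring. Qed.
Lemma qconjE x : qconj x = qtr x *: 1 - x. Proof. by qring. Qed.
Lemma qsqrE x : x * x = qtr x *: x - qnrd x *: 1. Proof. by qring. Qed.
(** y z + conj(y z) is scalar, so y z y = (tr(y z) - conj(z) conj(y)) y. This is what keeps products
    inside O + O y O when y has suitable traces and norm. *)
Lemma qmul_sandwich y z : y * z * y = qtr (y * z) *: y - qnrd y *: qconj z.
Proof. by qring. Qed.

Lemma qnrdM x y : qnrd (x * y) = qnrd x * qnrd y.
Proof. by rewrite /qnrd ?qmul_E /qmul ?qE; ring. Qed.
Lemma qnrdZ c x : qnrd (c *: x) = c ^+ 2 * qnrd x.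
Proof. by rewrite /qnrd !qE; ring. Qed.
Lemma qnrd1 : qnrd 1 = 1. Proof. by rewrite /qnrd !qE; ring. Qed.
Lemma qnrd0 : qnrd 0 = 0. Proof. by rewrite /qnrd !qE; ring. Qed.
Lemma qnrdN x : qnrd (- x) = qnrd x. Proof. by rewrite /qnrd !qE; ring. Qed.
Lemma qnrd_conj x : qnrd (qconj x) = qnrd x.
Proof. by rewrite /qnrd /qconj !qE; ring. Qed.
Lemma qtrN x : qtr (- x) = - qtr x. Proof. by rewrite /qtr !qE; ring. Qed.
Lemma qtrB x y : qtr (x - y) = qtr x - qtr y. Proof. by rewrite /qtr !qE; ring. Qed.
Lemma qtrZ c x : qtr (c *: x) = c * qtr x. Proof. by rewrite /qtr !qE; ring. Qed.
Lemma qtr1 : qtr 1 = 1 + 1. Proof. by rewrite /qtr !qE. Qed.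
Lemma qtr_conj x : qtr (qconj x) = qtr x. Proof. by rewrite /qtr /qconj !qE. Qed.
Lemma qtrMC x y : qtr (x * y) = qtr (y * x).
Proof. by rewrite /qtr ?qmul_E /qmul ?qE; ring. Qed.
Lemma qnrdD x y : qnrd (x + y) = qnrd x + qnrd y + qtr (x * qconj y).
Proof. by rewrite /qnrd /qtr /qconj ?qmul_E /qmul ?qE; ring. Qed.
Lemma qnrdX x n : qnrd (x ^+ n) = qnrd x ^+ n.
Proof. by elim: n => [|n IH]; rewrite ?expr0 ?qnrd1 // !exprS qnrdM IH. Qed.

Lemma qunitP x : qnrd x != 0 -> x \is a GRing.unit.
Proof.
move=> n0; apply/unitrP; exists ((qnrd x)^-1 *: qconj x); split.
  by rewrite -scalerAl qconj_mul scalerA mulVf // scale1r.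
by rewrite -scalerAr mul_qconj scalerA mulVf // scale1r.
Qed.

Lemma qinvE x : qnrd x != 0 -> x^-1 = (qnrd x)^-1 *: qconj x.
Proof.
move=> n0; apply: (mulrI (qunitP n0)).
by rewrite divrr ?qunitP // -scalerAr mul_qconj scalerA mulVf // scale1r.
Qed.

Lemma qnrdV x : qnrd x != 0 -> qnrd x^-1 = (qnrd x)^-1.
Proof. by move=> n0; rewrite qinvE // qnrdZ qnrd_conj; field. Qed.

Lemma qtr_conjg x y : qnrd y != 0 -> qtr (y * x * y^-1) = qtr x.
Proof. by move=> n0; rewrite qtrMC mulrA mulVr ?mul1r // qunitP. Qed.

Lemma qnrd_conjg x y : qnrd y != 0 -> qnrd (y * x * y^-1) = qnrd x.
Proof. by move=> n0; rewrite !qnrdM qnrdV // mulrAC divff // mul1r. Qed.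

End QuaternionNorm.

Ltac zint := repeat first [assumption | exact: intr_int | exact: natr_int |
  exact: rpred0 | exact: rpred1 | apply: rpredB | apply: rpredD | apply: rpredN |
  apply: rpredM | apply: rpredX].

(** The denominator of r^n is the n-th power of that of r, so bounded denominators force it to be 1.
    Integrality of norms in an order is deduced from this. *)
Lemma rat_pow_bounded (r c : rat) : c != 0 ->
  (forall n, r ^+ n * c \is a Num.int) -> r \is a Num.int.
Proof.
move=> c0 h; set u := numq r; set v := denq r; set m := numq c.
have v0 : (v%:~R : rat) != 0 by rewrite intr_eq0 denq_eq0.
have dv n : (v ^+ n %| m)%Z.
  have := h n; rewrite -[r]divq_num_den -/u -/v -[c]divq_num_den -/m => /intrP [k ek].
  have d0 : ((denq c)%:~R : rat) != 0 by rewrite intr_eq0 denq_eq0.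
  have : (u ^+ n * m = k * denq c * v ^+ n)%R.
    apply: (@intr_inj rat); rewrite !rmorphM !rmorphXn /= -ek.
    by rewrite expr_div_n; field; rewrite d0 expf_neq0.
  move=> e; have : (v ^+ n %| u ^+ n * m)%Z by rewrite e dvdz_mull.
  rewrite Gauss_dvdzr // coprimezE !abszX coprimeXl // coprimeXr //.
  by rewrite coprime_sym coprime_num_den.
have vgt0 : 0 < v by exact: denq_gt0.
have m0 : m != 0 by rewrite numq_eq0.
have [v1|v1] := leqP `|v|%N 1.
  have -> : r = u%:~R.
    by rewrite -[LHS]divq_num_den -/u -/v (_ : v = 1) ?divr1 //; lia.
  exact: intr_int.
have := dv `|m|%N; rewrite dvdzE abszX => /dvdn_leq.
rewrite absz_gt0 m0 => /(_ isT); rewrite leqNgt => /negP [].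
exact: ltn_expl.
Qed.

Lemma rat_infinitely_divisible (q : nat) (r : rat) : (1 < q)%N ->
  (forall n, q%:R ^- n * r \is a Num.int) -> r = 0.
Proof.
move=> q1 h; apply/eqP; apply: contraT => r0.
have q0 : (q%:R : rat) != 0 by rewrite pnatr_eq0 -lt0n ltnW.
have /intrP [m em] := h 0%N; rewrite expr0 invr1 mul1r in em.
have m0 : m != 0 by apply: contraNneq r0 => m0; rewrite em m0.
have /intrP [k ek] := h `|m|%N.
have : m = k * q%:Z ^+ `|m|.
  apply: (@intr_inj rat); rewrite rmorphM rmorphXn /= -ek -em mulrAC mulVf ?mul1r //.
  by rewrite expf_neq0.
move/(congr1 absz); rewrite abszM abszX => e.
have : (q ^ `|m| <= `|m|)%N.
  by rewrite {2}e -[X in (X <= _)%N]mul1n leq_mul2r; apply/orP; right; rewrite absz_gt0; apply: contraNneq m0 => k0; rewrite -absz_eq0 e k0 mul0n.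
by rewrite leqNgt ltn_expl.
Qed.

(** * Orders of rational quaternion algebras and their localizations *)

Section Orders.
Variables (a b : rat).
Local Notation B := (quaternion a b).
Implicit Types (x y z : B) (X R O : set B).

Definition qlat0 x := [/\ q0 x \is a Num.int, q1 x \is a Num.int,
  q2 x \is a Num.int & q3 x \is a Num.int].

Definition zsub X := X 0 /\ forall x y, X x -> X y -> X (x - y).

(** Finite generation and full rank are expressed by squeezing [R] between N times and 1/N times the
    lattice on 1, i, j, i j. No basis has to be chosen, and intersections are immediate. *)
Definition qorder R := [/\ R 1, forall x y, R x -> R y -> R (x - y),
  forall x y, R x -> R y -> R (x * y) &
  exists N : nat, [/\ (0 < N)%N, forall x, R x -> qlat0 (N%:R *: x) &
    forall x, qlat0 x -> R (N%:R *: x)]].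

Lemma zsubN X x : zsub X -> X x -> X (- x).
Proof. by move=> [X0 h] Xx; rewrite -sub0r; exact: h. Qed.

Lemma zsubD X x y : zsub X -> X x -> X y -> X (x + y).
Proof. by move=> zX Xx Xy; rewrite -[y]opprK; apply: zX.2 => //; exact: zsubN. Qed.

Lemma zsubMn X x n : zsub X -> X x -> X (x *+ n).
Proof.
move=> zX Xx; elim: n => [|n IH]; first by rewrite mulr0n; case: zX.
by rewrite mulrS; exact: zsubD.
Qed.

Lemma zsubZ X x (c : rat) : zsub X -> c \is a Num.int -> X x -> X (c *: x).
Proof.
move=> zX /intrP [[n|n] ->] Xx.
  by rewrite -[_%:~R]/(n%:R) scaler_nat; exact: zsubMn.
have -> : (Negz n)%:~R = - n.+1%:R :> rat by rewrite NegzE rmorphN.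
by rewrite scaleNr; apply: zsubN => //; rewrite scaler_nat; exact: zsubMn.
Qed.

Lemma zsub_coprime X x (m n : nat) : zsub X -> coprime m n ->
  X (m%:R *: x) -> X (n%:R *: x) -> X x.
Proof.
move=> zX cmn hm hn; case: (posnP m) => [m0|m0].
  by move: cmn hn; rewrite m0 /coprime gcd0n => /eqP ->; rewrite scale1r.
case: (egcdnP n m0) => u v e _.
have -> : x = u%:R *: (m%:R *: x) - v%:R *: (n%:R *: x).
  by rewrite !scalerA -!natrM e (eqP cmn) natrD scalerDl scale1r addrAC subrr add0r.
by apply: zX.2; apply: zsubZ => //; exact: natr_int.
Qed.

Lemma qorder_zsub R : qorder R -> zsub R.
Proof. by move=> [R1 RB _ _]; split=> //; rewrite -(subrr 1); exact: RB. Qed.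

Lemma qlat0_zsub : zsub qlat0.
Proof.
split; first by split; rewrite !qE; exact: rpred0.
by move=> x y [? ? ? ?] [? ? ? ?]; split; rewrite !qE; exact: rpredB.
Qed.

Lemma qorderX R x n : qorder R -> R x -> R (x ^+ n).
Proof. by move=> [R1 _ RM _] Rx; elim: n => [|n IH] //; rewrite exprS; exact: RM. Qed.

Lemma qlat0_nrd x : qlat0 x ->
  ((denq a)%:~R * (denq b)%:~R) * qnrd x \is a Num.int.
Proof.
move=> [h0 h1 h2 h3]; rewrite /qnrd.
have dn (c : rat) : c * (denq c)%:~R \is a Num.int.
  by rewrite -{1}[c]divq_num_den divfK ?intr_int // intr_eq0 denq_eq0.
have -> : (denq a)%:~R * (denq b)%:~R *
   (q0 x ^+ 2 - a * q1 x ^+ 2 - b * q2 x ^+ 2 + a * b * q3 x ^+ 2) =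
   (denq a)%:~R * (denq b)%:~R * q0 x ^+ 2 -
   (a * (denq a)%:~R) * (denq b)%:~R * q1 x ^+ 2 -
   (b * (denq b)%:~R) * (denq a)%:~R * q2 x ^+ 2 +
   (a * (denq a)%:~R) * (b * (denq b)%:~R) * q3 x ^+ 2 by ring.
have := dn a; have := dn b; move: (a * _) (b * _) => ? ? ? ?; zint.
Qed.

(** All powers of x lie in R, so the powers of its norm have a common denominator. *)
Lemma qorder_nrd_int R x : qorder R -> R x -> qnrd x \is a Num.int.
Proof.
move=> oR Rx; have [_ _ _ [N [N0 hN _]]] := oR.
apply: (@rat_pow_bounded _ ((denq a)%:~R * (denq b)%:~R * N%:R ^+ 2)).
  by rewrite !mulf_neq0 ?expf_neq0 ?intr_eq0 ?denq_eq0 ?pnatr_eq0 -?lt0n.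
move=> n; have := qlat0_nrd (hN _ (qorderX n oR Rx)).
by rewrite qnrdZ qnrdX; congr (_ \is a _); ring.
Qed.

Lemma qorder_tr_int R x : qorder R -> R x -> qtr x \is a Num.int.
Proof.
move=> oR Rx; have [R1 RB RM _] := oR.
have h1 := qorder_nrd_int oR Rx; have h2 := qorder_nrd_int oR (RB _ _ Rx R1).
have -> : qtr x = qnrd x + 1 - qnrd (x - 1).
  by rewrite qnrdD qnrdN qnrd1 qconjN qconj1 mulrN1 qtrN; ring.
by rewrite rpredB // rpredD // rpred1.
Qed.

Lemma qorder_conj R x : qorder R -> R x -> R (qconj x).
Proof.
move=> oR Rx; rewrite qconjE; have [R1 RB RM _] := oR.
by apply: RB => //; apply: zsubZ => //; [exact: qorder_zsub|exact: qorder_tr_int Rx].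
Qed.

Lemma rat_multiple (r : rat) : exists n : nat, (0 < n)%N /\ n%:R * r \is a Num.int.
Proof.
exists `|denq r|%N; split; first by rewrite absz_gt0 denq_eq0.
rewrite natr_absz ger0_norm ?denq_ge0 // mulrC.
by rewrite -{1}[r]divq_num_den divfK ?intr_int // intr_eq0 denq_eq0.
Qed.

Lemma qlat0_multiple x : exists n : nat, (0 < n)%N /\ qlat0 (n%:R *: x).
Proof.
have [n0 [p0 h0]] := rat_multiple (q0 x); have [n1 [p1 h1]] := rat_multiple (q1 x).
have [n2 [p2 h2]] := rat_multiple (q2 x); have [n3 [p3 h3]] := rat_multiple (q3 x).
exists (n0 * n1 * n2 * n3)%N; split; first by rewrite !muln_gt0 p0 p1 p2 p3.
split; rewrite !qE !natrM.
- have -> : n0%:R * n1%:R * n2%:R * n3%:R * q0 x = n1%:R * n2%:R * n3%:R * (n0%:R * q0 x) by ring.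
  by move: (_ * q0 x) h0 => ? ?; zint.
- have -> : n0%:R * n1%:R * n2%:R * n3%:R * q1 x = n0%:R * n2%:R * n3%:R * (n1%:R * q1 x) by ring.
  by move: (_ * q1 x) h1 => ? ?; zint.
- have -> : n0%:R * n1%:R * n2%:R * n3%:R * q2 x = n0%:R * n1%:R * n3%:R * (n2%:R * q2 x) by ring.
  by move: (_ * q2 x) h2 => ? ?; zint.
- by rewrite -mulrA; move: (_ * q3 x) h3 => ? ?; zint.
Qed.

Lemma qorder_multiple R x : qorder R -> exists n : nat, (0 < n)%N /\ R (n%:R *: x).
Proof.
move=> [_ _ _ [N [N0 _ hN]]]; have [n [n0 hn]] := qlat0_multiple x.
exists (N * n)%N; split; first by rewrite muln_gt0 N0.
by rewrite natrM -scalerA; exact: hN.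
Qed.

(* [at_prime q X] is the localization of the Z-module [X] at [q]. *)
Definition at_prime (q : nat) X : set B :=
  [set x | exists n : nat, ~~ (q %| n)%N /\ X (n%:R *: x)].

Lemma at_prime_sub q X : prime q -> X `<=` at_prime q X.
Proof. by move=> pq x Xx; exists 1%N; rewrite scale1r dvdn1 gtn_eqF ?prime_gt1. Qed.

Lemma at_primeS q X Y : X `<=` Y -> at_prime q X `<=` at_prime q Y.
Proof. by move=> XY x [n [qn Xn]]; exists n; split=> //; exact: XY. Qed.

Lemma at_prime_zsub q X : prime q -> zsub X -> zsub (at_prime q X).
Proof.
move=> pq zX; split; first by apply: at_prime_sub => //; case: zX.
move=> x y [m [qm hm]] [n [qn hn]]; exists (m * n)%N; split.
  by rewrite Euclid_dvdM // negb_or qm.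
rewrite scalerBr; apply: zX.2.
  by rewrite mulnC natrM -scalerA; apply: zsubZ => //; exact: natr_int.
by rewrite natrM -scalerA; apply: zsubZ => //; exact: natr_int.
Qed.

Lemma at_primeM q X Y Z : prime q -> (forall x y, X x -> Y y -> Z (x * y)) ->
  forall x y, at_prime q X x -> at_prime q Y y -> at_prime q Z (x * y).
Proof.
move=> pq h x y [m [qm hm]] [n [qn hn]]; exists (m * n)%N; split.
  by rewrite Euclid_dvdM // negb_or qm.
have -> : (m * n)%:R *: (x * y) = (m%:R *: x) * (n%:R *: y).
  by rewrite -scalerAl -scalerAr scalerA natrM.
exact: h.
Qed.

Lemma at_prime_idem q X x : prime q -> at_prime q (at_prime q X) x -> at_prime q X x.
Proof.
move=> pq [m [qm [n [qn h]]]]; exists (n * m)%N; split.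
  by rewrite Euclid_dvdM // negb_or qm qn.
by rewrite natrM -scalerA.
Qed.

Lemma at_primeZ q X x n : prime q -> ~~ (q %| n)%N -> at_prime q X (n%:R *: x) ->
  at_prime q X x.
Proof. by move=> pq qn h; apply: at_prime_idem => //; exists n. Qed.

Lemma at_prime_pow q X x e : prime q -> zsub X -> at_prime q X x ->
  X (q%:R ^+ e *: x) -> X x.
Proof.
move=> pq zX [n [qn hn]] hq; apply: (zsub_coprime zX _ hn (n := (q ^ e)%N)).
  by rewrite coprime_sym coprimeXl // prime_coprime.
by rewrite natrX.
Qed.

Lemma at_prime_multiple q R x : prime q -> qorder R ->
  exists e, at_prime q R (q%:R ^+ e *: x).
Proof.
move=> pq oR; have [n [n0 hn]] := qorder_multiple x oR.
have [m cm em] := pfactor_coprime pq n0.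
exists (logn q n), m; split; first by rewrite -prime_coprime.
by rewrite scalerA -natrX -natrM -em.
Qed.

(** The local-global principle for lattices: membership at the least prime factor q of the
    multiplier n removes the q-part of n, and n decreases. *)
Lemma at_prime_all X x : zsub X -> (exists n : nat, (0 < n)%N /\ X (n%:R *: x)) ->
  (forall q, prime q -> at_prime q X x) -> X x.
Proof.
move=> zX; case=> n []; elim/ltn_ind: n => n IH n0 hn h.
have [n1|n1] := leqP n 1.
  have e1 : n = 1%N by apply/eqP; rewrite eqn_leq n1 n0.
  by move: hn; rewrite e1 scale1r.
have pq := pdiv_prime n1; have [m [qm hm]] := h _ pq.
set q := pdiv n in pq qm.
have [k ck ek] := pfactor_coprime pq n0.
have kn : (k < n)%N.
  have k0 : (0 < k)%N by move: n0; rewrite ek muln_gt0 => /andP[].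
  rewrite [X in (_ < X)%N]ek -[X in (X < _)%N]muln1 ltn_pmul2l //.
  by rewrite -{1}(expn0 q) ltn_exp2l ?prime_gt1 // logn_gt0 mem_primes pq n0 pdiv_dvd.
have k0 : (0 < k)%N by move: n0; rewrite ek muln_gt0 => /andP[].
apply: (IH k) => //.
apply: (zsub_coprime zX (m := m) (n := (q ^ logn q n)%N)).
- by rewrite coprime_sym coprimeXl // prime_coprime.
- by rewrite scalerA mulrC -scalerA; apply: zsubZ => //; exact: natr_int.
- by rewrite scalerA -natrM mulnC -ek.
Qed.

(** Orders are separated for the q-adic topology. *)
Lemma qorder_infinitely_divisible R q x : qorder R -> prime q ->
  (forall n, R (q%:R ^- n *: x)) -> x = 0.
Proof.
move=> [_ _ _ [N [N0 hN _]]] pq h.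
have N00 : (N%:R : rat) != 0 by rewrite pnatr_eq0 -lt0n.
have key (f : B -> rat) : (forall c y, f (c *: y) = c * f y) ->
    (forall y, qlat0 y -> f y \is a Num.int) -> f x = 0.
  move=> fZ fi; apply/eqP; rewrite -(mulrI_eq0 _ (mulfI N00)); apply/eqP.
  apply: (rat_infinitely_divisible (prime_gt1 pq)) => n.
  by rewrite mulrCA -!fZ; apply/fi/hN.
apply: quatP; rewrite ?qE; apply: key => //; try (by move=> c y; rewrite !qE);
  by move=> y [].
Qed.

End Orders.

(** The bound on j is recorded because it becomes the constant of [hurwitz_approx]. *)
Lemma pigeonhole_nat (T : finType) (f : nat -> T) :
  exists i j, [/\ (i < j)%N, (j <= #|T|)%N & f i = f j].
Proof.
have : ~~ injectiveb (fun i : 'I_#|T|.+1 => f i).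
  apply/negP => /injectiveP inj; have := leq_card _ inj.
  by rewrite card_ord ltnn.
move=> /injectivePn [i [j ij e]]; wlog lij : i j ij e / (i < j)%N.
  move=> H; case: (ltngtP i j) => h; first exact: (H i j).
    by apply: (H j i) => //; rewrite eq_sym.
  by move: ij; rewrite (val_inj h) eqxx.
by exists i, j; split=> //; rewrite -ltnS ltn_ord.
Qed.

Lemma pigeonhole_infinite (T : finType) (f : nat -> T) :
  exists t, forall n, exists k, (n <= k)%N /\ f k = t.
Proof.
apply: contrapT => /forallNP h.
have /choice [g hg] : forall t, exists n, forall k, (n <= k)%N -> f k <> t.
  move=> t; have /existsNP [n hn] := h t; exists n => k nk e.
  by apply: hn; exists k.
have := hg (f (\max_t g t)%N) (\max_t g t)%N.
by move=> /(_ (leq_bigmax _)) /(_ erefl).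
Qed.

Definition local_int (q : nat) (r : rat) : Prop :=
  exists n : nat, ~~ (q %| n)%N /\ n%:R * r \is a Num.int.

Section LocalInt.
Variable q : nat.
Hypothesis pq : prime q.

Lemma local_int_int r : r \is a Num.int -> local_int q r.
Proof. by move=> h; exists 1%N; rewrite mul1r dvdn1 gtn_eqF ?prime_gt1. Qed.

Lemma local_intB r s : local_int q r -> local_int q s -> local_int q (r - s).
Proof.
move=> [m [qm hm]] [n [qn hn]]; exists (m * n)%N; split.
  by rewrite Euclid_dvdM // negb_or qm.
rewrite mulrBr natrM {1}[m%:R * _]mulrC -!mulrA.
by move: (m%:R * r) (n%:R * s) hm hn => ? ? ? ?; zint.
Qed.

Lemma local_intM r s : local_int q r -> local_int q s -> local_int q (r * s).
Proof.
move=> [m [qm hm]] [n [qn hn]]; exists (m * n)%N; split.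
  by rewrite Euclid_dvdM // negb_or qm.
by rewrite natrM mulrACA; zint.
Qed.

Lemma local_intD r s : local_int q r -> local_int q s -> local_int q (r + s).
Proof.
move=> hr hs; rewrite -[s]opprK; apply: local_intB => //; rewrite -sub0r.
by apply: local_intB => //; apply: local_int_int; exact: rpred0.
Qed.

Lemma local_int_pow r e : local_int q r -> q%:R ^+ e * r \is a Num.int ->
  r \is a Num.int.
Proof.
move=> [n [qn hn]] hq; have n0 : (0 < n)%N by case: n qn {hn} => //; rewrite dvdn0.
case: (egcdnP (q ^ e) n0) => u v ee _.
have cqn : gcdn n (q ^ e) = 1%N.
  by apply/eqP; rewrite -/(coprime _ _) coprime_sym coprimeXl // prime_coprime.
have -> : r = u%:R * (n%:R * r) - v%:R * (q%:R ^+ e * r).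
  rewrite !mulrA -natrX -!natrM ee cqn natrD mulrDl mul1r; ring.
by move: (n%:R * r) (_ * r) hn hq => ? ? ? ?; zint.
Qed.

End LocalInt.

(** * Maximal orders and local generators *)

Section MaximalOrders.
Variables (a b : rat).
Local Notation B := (quaternion a b).
Implicit Types (x y z : B) (X R O I J : set B).

Definition qmaximal O := qorder O /\ forall O', qorder O' -> O `<=` O' -> O' `<=` O.

(** The additive group generated by O and O y O; it is a ring only for special y. *)
Inductive order_ext O y : B -> Prop :=
| order_ext_in z : O z -> order_ext O y z
| order_ext_mul u v : O u -> O v -> order_ext O y (u * y * v)
| order_ext_sub u v : order_ext O y u -> order_ext O y v -> order_ext O y (u - v).

(* If y were not in qO, then O + O(y/q)O would be a strictly larger order. *)
Lemma qmaximal_saturated O q y : qmaximal O -> (0 < q)%N -> O y ->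
  q%:R ^- 2 * qnrd y \is a Num.int ->
  (forall d, O d -> q%:R^-1 * qtr (y * d) \is a Num.int) -> O (q%:R^-1 *: y).
Proof.
move=> [oO mO] q0 Oy hn ht; have [Oone OB OM [N [N0 hN hN']]] := oO.
have q00 : (q%:R : rat) != 0 by rewrite pnatr_eq0 -lt0n.
have [y' y'E] : exists y', y' = q%:R^-1 *: y by exists (q%:R^-1 *: y).
rewrite -y'E.
have zE : zsub (order_ext O y').
  by split; [rewrite -(subrr 1); apply: order_ext_sub; exact: order_ext_in|exact: order_ext_sub].
have EM : forall u, order_ext O y' u -> forall v, order_ext O y' v -> order_ext O y' (u * v).
  move=> u; elim=> {u} [z Oz|u1 u2 Ou1 Ou2|u1 u2 _ IH1 _ IH2] v; last first.
    by move=> Ev; rewrite mulrBl; apply: order_ext_sub; auto.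
  - elim=> {v} [w Ow|v1 v2 Ov1 Ov2|v1 v2 _ IH1 _ IH2]; last first.
    + by rewrite mulrBr; apply: order_ext_sub; auto.
    + have -> : u1 * y' * u2 * (v1 * y' * v2) = u1 * (y' * (u2 * v1) * y') * v2.
        by rewrite !mulrA.
      (* The middle factor y' z y' is an integral multiple of y' minus an element of O: this is
         where the trace and norm hypotheses enter. *)
      rewrite qmul_sandwich mulrBr mulrBl -!scalerAr -!scalerAl.
      apply: order_ext_sub; apply: zsubZ => //.
      * by rewrite y'E -scalerAl qtrZ; apply: ht; exact: OM.
      * exact: order_ext_mul.
      * by rewrite y'E qnrdZ exprVn.
      * have Oc : O (qconj (u2 * v1)) by apply: qorder_conj => //; exact: OM.
        by apply: order_ext_in; exact: (OM _ _ (OM _ _ Ou1 Oc) Ov2).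
    + by rewrite -mulrA; apply: order_ext_mul => //; exact: OM.
  - elim=> {v} [w Ow|v1 v2 Ov1 Ov2|v1 v2 _ IH1 _ IH2]; last first.
    + by rewrite mulrBr; apply: order_ext_sub; auto.
    + by rewrite !mulrA; apply: order_ext_mul => //; exact: OM.
    + by apply: order_ext_in; exact: OM.
have oE : qorder (order_ext O y').
  split=> //; first exact: order_ext_in; first exact: order_ext_sub.
    by move=> u v hu hv; exact: EM.
  exists (N * q)%N; split; first by rewrite muln_gt0 N0.
    move=> x Ex; rewrite natrM -scalerA; apply: hN.
    elim: Ex => {x} [z Oz|u v Ou Ov|u v _ h1 _ h2].
    - by apply: zsubZ; [exact: qorder_zsub|exact: natr_int|].
    - by rewrite scalerAl scalerAr y'E scalerA divff // scale1r; exact: (OM _ _ (OM _ _ Ou Oy) Ov).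
    - by rewrite scalerBr; exact: OB.
  move=> x Lx; apply: order_ext_in; rewrite mulnC natrM -scalerA.
  by apply: zsubZ; [exact: qorder_zsub|exact: natr_int|exact: hN'].
apply: (mO _ oE); first by move=> z; exact: order_ext_in.
have h : order_ext O y' (1 * y' * 1) by exact: order_ext_mul.
by move: h; rewrite mul1r mulr1.
Qed.

(* A left O-lattice is generated at q by any element of minimal norm. *)
Lemma left_lattice_generator O P q p : qmaximal O -> prime q -> zsub P ->
  (forall u w, O u -> P w -> P (u * w)) -> P p -> qnrd p != 0 ->
  (forall w, P w -> local_int q (qnrd w / qnrd p)) ->
  forall w, P w -> at_prime q O (w * p^-1).
Proof.
move=> mO pq zP OP Pp p0 hP w Pw; apply: contrapT => nz.
have oO := mO.1; have [Oone OB OM _] := oO; have q0 := prime_gt0 pq.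
have pu := qunitP p0.
(* The least e with q^e w p^-1 in O at q; if it is k + 1, saturation of O shows that k works
   already. *)
have ex : exists e, `[< at_prime q O (q%:R ^+ e *: (w * p^-1)) >].
  by have [e he] := at_prime_multiple (w * p^-1) pq oO; exists e; exact/asboolP.
case: (ex_minnP ex) => -[|k] /asboolP hk mk; first by case: nz; rewrite scale1r in hk.
have nk : ~ at_prime q O (q%:R ^+ k *: (w * p^-1)).
  by move=> h; have := mk k; rewrite ltnn => h'; have : false by apply: h'; exact/asboolP.
case: hk => n [qn hn].
set z := (n%:R * q%:R ^+ k) *: (w * p^-1).
have zE : n%:R *: (q%:R ^+ k.+1 *: (w * p^-1)) = q%:R *: z.
  by rewrite /z !scalerA exprS; congr (_ *: _); ring.
rewrite zE in hn.
have q00 : (q%:R : rat) != 0 by rewrite pnatr_eq0 -lt0n.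
have Jn v : P v -> local_int q (qnrd (v * p^-1)).
  by move=> Pv; rewrite qnrdM qnrdV //; exact: hP.
pose v := (n%:R * q%:R ^+ k) *: w.
have Pv : P v by apply: zsubZ => //; rewrite -natrX; zint.
have zv : z = v * p^-1 by rewrite /v -scalerAl.
apply: nk; apply: (@at_primeZ _ _ _ _ _ n) => //.
rewrite scalerA -/z; apply: at_prime_sub => //.
have -> : z = q%:R^-1 *: (q%:R *: z) by rewrite scalerA mulVf // scale1r.
apply: (qmaximal_saturated mO) => //.
  rewrite qnrdZ mulrA mulVf ?expf_neq0 // mul1r.
  apply: (local_int_pow pq (e := 2)); first by rewrite zv; exact: Jn.
  by rewrite -qnrdZ; exact: qorder_nrd_int hn.
move=> d Od; rewrite -scalerAl qtrZ mulrA mulVf // mul1r.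
apply: (local_int_pow pq (e := 1)).
  (* The trace is a polarised norm, and 1 + d z = (p + d v) p^-1 is again an element of P divided by
     p. *)
  have -> : qtr (z * d) = qnrd (1 + d * z) - 1 - qnrd (d * z).
    by rewrite qtrMC [1 + _]addrC qnrdD qconj1 mulr1 qnrd1; ring.
  apply: local_intB => //; last first.
    by rewrite zv mulrA; apply: Jn; exact: OP.
  apply: local_intB => //; last by apply: local_int_int => //; exact: rpred1.
  have -> : 1 + d * z = (p + d * v) * p^-1 by rewrite mulrDl divrr // zv mulrA.
  by apply: Jn; apply: zsubD => //; exact: OP.
by rewrite expr1 -qtrZ scalerAl; apply: (qorder_tr_int oO); exact: OM.
Qed.

End MaximalOrders.

(** * Finiteness of classes of left lattices *)

Section LatticeClasses.
Variables (a b : rat).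
Local Notation B := (quaternion a b).
Implicit Types (x y z : B) (X R O I J : set B).

Definition lat_rep (U : nat) (K : nat) (c : 'I_K * 'I_K * 'I_K * 'I_K) : B :=
  U%:R^-1 *: mkq a b c.1.1.1%:R c.1.1.2%:R c.1.2%:R c.2%:R.

Lemma lat_repP U L x : (0 < U)%N -> (0 < L)%N -> qlat0 (U%:R *: x) ->
  exists (c : 'I_(U * L) * 'I_(U * L) * 'I_(U * L) * 'I_(U * L)) y,
    qlat0 y /\ x = lat_rep U c + L%:R *: y.
Proof.
move=> U0 L0 [] /[!qE] h0 h1 h2 h3.
have U00 : (U%:R : rat) != 0 by rewrite pnatr_eq0 -lt0n.
have UL0 : (0 < U * L)%N by rewrite muln_gt0 U0.
have key (r : rat) : U%:R * r \is a Num.int -> exists (c : 'I_(U * L)) (k : rat),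
   k \is a Num.int /\ r = U%:R^-1 * c%:R + L%:R * k.
  move=> /intrP [m em].
  have c0 : (0 <= m %% (U * L)%N)%Z by rewrite modz_ge0 // eqz_nat -lt0n.
  have cl : (`|(m %% (U * L)%N)%Z| < U * L)%N.
    by rewrite -ltz_nat gez0_abs // ltz_pmod.
  exists (Ordinal cl), (m %/ (U * L)%N)%Z%:~R; split; first exact: intr_int.
  have e : (m%:~R : rat) = (m %/ (U * L)%N)%Z%:~R * (U%:R * L%:R) + `|(m %% (U * L)%N)%Z|%N%:R.
    rewrite {1}(divz_eq m (U * L)%N) rmorphD rmorphM /= natr_absz ger0_norm //.
    by rewrite -natrM.
  rewrite -[LHS]mul1r -(mulVf U00) -mulrA em e /=; field.
  exact: U00.
have [c0 [k0 [ik0 e0]]] := key _ h0; have [c1 [k1 [ik1 e1]]] := key _ h1.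
have [c2 [k2 [ik2 e2]]] := key _ h2; have [c3 [k3 [ik3 e3]]] := key _ h3.
exists (c0, c1, c2, c3), (mkq a b k0 k1 k2 k3); split; first by split; rewrite !qE.
by rewrite /lat_rep; apply: quatP; rewrite !qE.
Qed.

(** A lattice squeezed between L times and 1/U times the standard one is determined by the finitely
    many coset representatives it contains. Hence there are finitely many such lattices. *)
Lemma lat_codeP U L X Y : (0 < U)%N -> (0 < L)%N -> zsub X -> zsub Y ->
  (forall x, X x -> qlat0 (U%:R *: x)) ->
  (forall x, qlat0 x -> X (L%:R *: x)) -> (forall x, qlat0 x -> Y (L%:R *: x)) ->
  (forall c : 'I_(U * L) * 'I_(U * L) * 'I_(U * L) * 'I_(U * L), X (lat_rep U c) -> Y (lat_rep U c)) ->
  X `<=` Y.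
Proof.
move=> U0 L0 zX zY XU LX LY h x Xx.
have [c [y [ly e]]] := lat_repP U0 L0 (XU _ Xx).
rewrite e; apply: zsubD => //; last exact: LY.
apply: h; have -> : lat_rep U c = x - L%:R *: y by rewrite e addrK.
by apply: zX.2 => //; exact: LX.
Qed.

Definition box (m : nat) (r : rat) : 'I_m.+1 :=
  inord `|Num.floor (m.+1%:R * (r - (Num.floor r)%:~R))|.

Lemma boxP m r s : box m r = box m s ->
  exists k : int, `|r - s - k%:~R| < m.+1%:R^-1.
Proof.
have m0 : (0 : rat) < m.+1%:R by rewrite ltr0n.
have fr (t : rat) : 0 <= t - (Num.floor t)%:~R < 1.
  by rewrite subr_ge0 ge_floor ltrBlDl -intrD1 floorD1_gt.
have fl (t : rat) : 0 <= Num.floor (m.+1%:R * (t - (Num.floor t)%:~R)) < m.+1%:Z.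
  have /andP[f0 f1] := fr t; rewrite floor_ge0 mulr_ge0 ?(ltW m0) ?f0 //=.
  by rewrite floor_lt_int /= gtr_pMr.
move=> /(congr1 val); rewrite /= !inordK; first last.
- by have /andP[? ?] := fl r; rewrite -ltz_nat gez0_abs.
- by have /andP[? ?] := fl s; rewrite -ltz_nat gez0_abs.
move=> /(congr1 Posz); rewrite !gez0_abs; try by have /andP[] := fl r; have /andP[] := fl s.
set u := _ * (r - _); set v := _ * (s - _) => e.
exists (Num.floor r - Num.floor s).
have := ge_floor u; have := ge_floor v; have := floorD1_gt u; have := floorD1_gt v.
rewrite e !intrD1 => h1 h2 h3 h4.
have huv : `|u - v| < 1 by rewrite ltr_norml; lra.
have -> : r - s - (Num.floor r - Num.floor s)%:~R = (u - v) / m.+1%:R.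
  by rewrite /u /v -mulrBr mulrAC divff ?pnatr_eq0 // mul1r rmorphB /=; ring.
by rewrite normrM normfV (gtr0_norm m0) ltr_pdivrMr // mulVf // lt0r_neq0.
Qed.

Lemma qnrd_bound x (c : rat) : 0 <= c -> `|q0 x| <= c -> `|q1 x| <= c ->
  `|q2 x| <= c -> `|q3 x| <= c ->
  `|qnrd x| <= (1 + `|a| + `|b| + `|a * b|) * c ^+ 2.
Proof.
move=> c0 h0 h1 h2 h3; rewrite /qnrd.
have sq (r : rat) : `|r| <= c -> `|r ^+ 2| <= c ^+ 2.
  by move=> h; rewrite normrX lerXn2r ?nnegrE.
apply: le_trans (ler_normD _ _) _; apply: le_trans (lerD (ler_normB _ _) (lexx _)) _.
apply: le_trans (lerD (lerD (ler_normB _ _) (lexx _)) (lexx _)) _.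
rewrite !normrM !mulrDl mul1r; repeat apply: lerD.
- by rewrite -normrM -expr2; exact: sq.
- by rewrite -?mulrA ler_wpM2l // -normrM -expr2; exact: sq.
- by rewrite -?mulrA ler_wpM2l // -normrM -expr2; exact: sq.
- by rewrite -?[_ * `|q3 x| * _]mulrA ler_wpM2l ?mulr_ge0 // -normrM -expr2; exact: sq.
Qed.

(** Pigeonhole on the multiples of y modulo N times the standard lattice: two multiples in one cell
    differ by an element of R up to coordinates of size N / (m + 1), and m is so large that such
    coordinates give norm below 1. *)
Lemma hurwitz_approx R : qorder R -> exists C : nat, forall y : B, exists n : nat,
  (0 < n <= C)%N /\ exists r, R r /\ `|qnrd (n%:R *: y - r)| < 1.
Proof.
move=> [_ _ _ [N [N0 _ hN]]].
have N00 : (0 : rat) < N%:R by rewrite ltr0n.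
pose K := (1 + `|a| + `|b| + `|a * b|) * N%:R ^+ 2.
have K0 : 0 < K.
  by rewrite mulr_gt0 ?exprn_gt0 // -!addrA ltr_wpDr // !addr_ge0.
have [m hm] : exists m : nat, K < m.+1%:R.
  by exists (Num.bound K); have := archi_boundP (ltW K0); rewrite -natr1; lra.
pose T : finType := ('I_m.+1 * 'I_m.+1 * 'I_m.+1 * 'I_m.+1)%type.
exists #|T| => y.
pose f (i : nat) : T := (box m (i%:R * q0 y / N%:R), box m (i%:R * q1 y / N%:R),
  box m (i%:R * q2 y / N%:R), box m (i%:R * q3 y / N%:R)).
have [i [j [ij jT]]] := pigeonhole_nat f.
move=> [] /boxP[k0 h0] /boxP[k1 h1] /boxP[k2 h2] /boxP[k3 h3].
exists (j - i)%N; split.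
  by rewrite subn_gt0 ij /= (leq_trans (leq_subr _ _)).
exists (N%:R *: mkq a b (- k0%:~R) (- k1%:~R) (- k2%:~R) (- k3%:~R)); split.
  by apply: hN; split; rewrite !qE rpredN intr_int.
have m0 : (0 : rat) < m.+1%:R by rewrite ltr0n.
have c0 : 0 <= N%:R / m.+1%:R :> rat by rewrite divr_ge0.
have key (r k : rat) : `|i%:R * r / N%:R - j%:R * r / N%:R - k| < m.+1%:R^-1 ->
   `|(j - i)%:R * r - N%:R * - k| <= N%:R / m.+1%:R.
  move=> h; have -> : (j - i)%:R * r - N%:R * - k =
     - (N%:R * (i%:R * r / N%:R - j%:R * r / N%:R - k)).
    rewrite natrB ?(ltnW ij) //; field; exact: lt0r_neq0.
  by rewrite normrN normrM (gtr0_norm N00) ler_wpM2l // ltW.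
apply: le_lt_trans (qnrd_bound c0 _ _ _ _) _; try by rewrite !qE; exact: key.
rewrite expr_div_n mulrA -/K ltr_pdivrMr ?exprn_gt0 // mul1r expr2.
by apply: lt_le_trans hm _; rewrite ler_peMl ?ler1n // ltW.
Qed.

Definition left_lattice R I := [/\ zsub I, forall r x, R r -> I x -> I (r * x),
  exists2 x, I x & x != 0 & exists N : nat, (0 < N)%N /\ forall x, I x -> qlat0 (N%:R *: x)].

Hypothesis division : forall x, x != 0 -> qnrd x != 0.

Lemma left_lattice_min R I : left_lattice R I -> exists z, [/\ I z, z != 0 &
  forall w, I w -> w != 0 -> `|qnrd z| <= `|qnrd w|].
Proof.
move=> [zI _ [x0 Ix0 nx0] [N [N0 hN]]].
pose c : rat := (denq a)%:~R * (denq b)%:~R * N%:R ^+ 2.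
have c0 : 0 < c by rewrite !mulr_gt0 ?ltr0z ?denq_gt0 ?exprn_gt0 ?ltr0n.
have hc x : I x -> c * qnrd x \is a Num.int.
  by move=> Ix; have := qlat0_nrd (hN _ Ix); rewrite qnrdZ mulrA.
have ex : exists n : nat, `[< exists x, [/\ I x, x != 0 & c * `|qnrd x| = n%:R] >].
  have /intrP [m em] := hc _ Ix0; exists `|m|%N; apply/asboolP; exists x0; split=> //.
  by rewrite -{1}(gtr0_norm c0) -normrM em natr_absz intr_norm.
case: (ex_minnP ex) => n /asboolP [z [Iz z0 ez]] mn; exists z; split=> // w Iw w0.
have /intrP [m em] := hc _ Iw.
have em' : c * `|qnrd w| = `|m|%N%:R by rewrite -{1}(gtr0_norm c0) -normrM em natr_absz intr_norm.
rewrite -(ler_pM2l c0) ez em' ler_nat; apply: mn; apply/asboolP; exists w; split=> //.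
Qed.

(** Hurwitz's argument: if z has least norm in I, then n w - r z lies in I with smaller norm, so it
    vanishes and w z^-1 = r / n with n <= C. The factorial of C clears all these denominators at
    once. *)
Lemma left_lattice_class R : qorder R -> exists M : nat, (0 < M)%N /\
  forall I, left_lattice R I -> exists z, [/\ I z, qnrd z != 0 &
    forall w, I w -> R (M%:R *: (w * z^-1))].
Proof.
move=> oR; have [C hC] := hurwitz_approx oR; exists C`!; split; first exact: fact_gt0.
move=> I lI; have [z [Iz z0 mz]] := left_lattice_min lI.
have nz := division z0; have zu := qunitP nz; have [zI RI _ _] := lI.
exists z; split=> // w Iw; have [n [/andP[n0 nC] [r [Rr hr]]]] := hC (w * z^-1).
have e : n%:R *: w - r * z = (n%:R *: (w * z^-1) - r) * z.
  by rewrite mulrBl -!scalerAl -mulrA mulVr // mulr1.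
have e0 : n%:R *: w - r * z = 0.
  apply/eqP; apply: contraT => ne.
  have := mz _ _ ne; rewrite e qnrdM normrM => h.
  have : `|qnrd z| <= `|qnrd (n%:R *: (w * z^-1) - r)| * `|qnrd z|.
    by apply: h; rewrite -e; apply: zI.2; [apply: zsubZ => //; exact: natr_int|exact: RI].
  by rewrite leNgt gtr_pMl ?normr_gt0 // hr.
have -> : C`!%:R *: (w * z^-1) = (C`! %/ n)%:R *: r.
  have -> : r = n%:R *: (w * z^-1).
    by apply: (mulIr zu); move/eqP: e0; rewrite subr_eq0 => /eqP <-; rewrite -scalerAl -mulrA mulVr // mulr1.
  by rewrite scalerA -natrM divnK // dvdn_fact // n0.
by apply: zsubZ; [exact: qorder_zsub|exact: natr_int|].
Qed.

End LatticeClasses.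

Lemma dvdzD (d m n : int) : (d %| m)%Z -> (d %| n)%Z -> (d %| m + n)%Z.
Proof. by move=> /dvdzP[u ->] /dvdzP[v ->]; rewrite -mulrDl dvdz_mull. Qed.

Lemma dvdzB (d m n : int) : (d %| m)%Z -> (d %| n)%Z -> (d %| m - n)%Z.
Proof. by move=> /dvdzP[u ->] /dvdzP[v ->]; rewrite -mulrBl dvdz_mull. Qed.

(** * Powers of an element of norm one *)

Section Chebyshev.
Variable t : int.

(** Chebyshev polynomials of the second kind, shifted by one: an element of norm 1 and trace t
    satisfies x^n = U_n x - U_(n-1). *)
Fixpoint cheb (n : nat) : int * int :=
  if n is n'.+1 then ((cheb n').2, t * (cheb n').2 - (cheb n').1) else (0, 1).
Definition chebU n := (cheb n).1.

Lemma chebU0 : chebU 0 = 0. Proof. by []. Qed.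
Lemma chebU1 : chebU 1 = 1. Proof. by []. Qed.
Lemma chebUSS n : chebU n.+2 = t * chebU n.+1 - chebU n. Proof. by []. Qed.

(** For t = 2 the recurrence is solved by U_n = n. *)
Lemma chebU_mod n : (t - 2 %| chebU n - n%:Z)%Z.
Proof.
suff: (t - 2 %| chebU n - n%:Z)%Z /\ (t - 2 %| chebU n.+1 - n.+1%:Z)%Z by case.
elim: n => [|n [h1 h2]]; first by rewrite chebU0 chebU1 !subrr !dvdz0.
split=> //; have -> : chebU n.+2 - n.+2%:Z =
   t * (chebU n.+1 - n.+1%:Z) - (chebU n - n%:Z) + (t - 2) * n.+1%:Z.
  by rewrite chebUSS -!natz -!natr1; ring.
by apply: dvdzD; [apply: dvdzB => //; exact: dvdz_mull|exact: dvdz_mulr].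
Qed.

Lemma chebU_gt0 n : 2 < t -> 0 < chebU n.+1.
Proof.
move=> t2; suff: 0 <= chebU n < chebU n.+1 by case/andP => h; apply: le_lt_trans.
by elim: n => [|n /andP[h1 h2]] //; rewrite chebUSS; nia.
Qed.

(** The recurrence is reversible, so a repeated pair of consecutive values modulo N can be moved
    back to the start. A power of x is then congruent to 1. *)
Lemma chebU_period (N : nat) : (0 < N)%N ->
  exists n, (N %| chebU n.+1)%Z /\ (N %| chebU n.+2 - 1)%Z.
Proof.
case: N => // N _; pose f n : 'I_N.+1 * 'I_N.+1 :=
  (inord `|(chebU n %% N.+1)%Z|, inord `|(chebU n.+1 %% N.+1)%Z|).
have [i [j [ij _ e]]] := pigeonhole_nat f.
have md (u v : int) : inord `|(u %% N.+1)%Z| = inord `|(v %% N.+1)%Z| :> 'I_N.+1 ->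
    (N.+1 %| u - v)%Z.
  have lt (w : int) : (`|(w %% N.+1)%Z| < N.+1)%N.
    by rewrite -ltz_nat gez0_abs ?modz_ge0 // ltz_pmod.
  move=> /(congr1 val); rewrite /= !inordK // => /(congr1 Posz).
  by rewrite !gez0_abs ?modz_ge0 // => h; rewrite -eqz_mod_dvd h.
case: e => /md h1 /md h2.
elim: i j ij h1 h2 {f} => [|i IH] [|j] // ij.
  rewrite chebU0 chebU1 sub0r !dvdzE abszN => h1 h2.
  by exists j; rewrite !dvdzE; split=> //; rewrite -[X in (_ %| X)%N]abszN opprB.
move=> h1 h2; apply: (IH j) => //.
have -> : chebU i - chebU j = t * (chebU i.+1 - chebU j.+1) - (chebU i.+2 - chebU j.+2).
  by rewrite !chebUSS; ring.
by apply: dvdzB => //; exact: dvdz_mull.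
Qed.

End Chebyshev.

Section LocalIntMore.
Variable q : nat.
Hypothesis pq : prime q.
Let q00 : (q%:R : rat) != 0. Proof. by rewrite pnatr_eq0 -lt0n prime_gt0. Qed.

Lemma local_int_logn n : (0 < n)%N -> local_int q (q%:R ^+ logn q n / n%:R).
Proof.
move=> n0; have [m cm em] := pfactor_coprime pq n0.
have m0 : (m%:R : rat) != 0.
  by rewrite pnatr_eq0; apply: contraTneq n0 => m0; rewrite em m0.
exists m; split; first by rewrite -prime_coprime.
have nE : n%:R = m%:R * q%:R ^+ logn q n :> rat by rewrite [in LHS]em natrM natrX.
by rewrite mulrA -nE divff ?rpred1 // pnatr_eq0 -lt0n.
Qed.

Lemma local_int_half : local_int q (q%:R / 2).
Proof.
have [e|ne] := eqVneq q 2%N; first by apply: local_int_int => //; rewrite e divff ?rpred1.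
exists 2%N; split; last by rewrite mulrC divfK ?natr_int.
by rewrite dvdn_prime2.
Qed.

Lemma local_int_dvd (s : int) e (f : nat) : (f <= e)%N -> (q%:Z ^+ e %| s)%Z ->
  (q%:R ^- f * s%:~R : rat) \is a Num.int.
Proof.
move=> fe /dvdzP [k ->]; rewrite rmorphM rmorphXn /= -(subnK fe) exprD.
have -> : q%:R ^- f * (k%:~R * (q%:~R ^+ (e - f) * q%:~R ^+ f)) =
   k%:~R * q%:R ^+ (e - f) * (q%:R ^+ f / q%:R ^+ f) :> rat by ring.
by rewrite divff ?expf_neq0 // mulr1; zint.
Qed.

Lemma at_primeZl a b (R : set (quaternion a b)) c w : qorder R -> local_int q c ->
  R w -> at_prime q R (c *: w).
Proof.
move=> oR [n [qn hn]] Rw; exists n; split=> //; rewrite scalerA.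
by apply: zsubZ => //; exact: qorder_zsub.
Qed.

End LocalIntMore.

(** * Approximation by products of conjugate units *)

Section UnitApproximation.
Variables (t : int) (b : rat).
Hypothesis t2 : 2 < t.
Let a : rat := t%:~R ^+ 2 - 4.
Local Notation B := (quaternion a b).
Hypothesis division : forall x : B, x != 0 -> qnrd x != 0.
Implicit Types (x y z : B) (R : set B).

Let a0 : a != 0.
Proof.
have h : (2 : rat) < t%:~R by rewrite (ltr_int rat 2 t).
by rewrite /a gt_eqF //; nra.
Qed.

(* The elements (tau + sigma i)/2 of norm 1. *)
Definition pell (tau sigma : int) : B := mkq a b (tau%:~R / 2) (sigma%:~R / 2) 0 0.
Definition is_pell tau sigma := (tau%:~R ^+ 2 - a * sigma%:~R ^+ 2 = 4).

Lemma pell_nrd tau sigma : is_pell tau sigma -> qnrd (pell tau sigma) = 1.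
Proof.
move=> h; rewrite /qnrd /pell !qE.
transitivity ((tau%:~R ^+ 2 - a * sigma%:~R ^+ 2) / 4); first by field.
by rewrite h divff.
Qed.

(** The trace 2 U_(n+1) - tau U_n of the n-th power of an element of norm 1 and trace tau. *)
Definition pellT (tau : int) n := tau * chebU tau n - 2 * (tau * chebU tau n - chebU tau n.+1).

Lemma pellX tau sigma n : is_pell tau sigma ->
  pell tau sigma ^+ n = pell (pellT tau n) (sigma * chebU tau n).
Proof.
move=> h; elim: n => [|n IH].
  rewrite expr0 /pellT chebU0 chebU1; apply: quatP; rewrite /pell !qE //=; by field.
rewrite exprS IH /pellT chebUSS qmul_E; apply: quatP; rewrite /pell /qmul ?qE.
- rewrite !(rmorphB, rmorphM, rmorphD) /=.
  have -> : a * (sigma%:~R / 2) * (sigma%:~R * (chebU tau n)%:~R / 2) =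
     (tau%:~R ^+ 2 - 4) * (chebU tau n)%:~R / 4 :> rat.
    have hs : a * sigma%:~R ^+ 2 = tau%:~R ^+ 2 - 4 by rewrite -h; ring.
    by rewrite -hs; field.
  by field.
- by rewrite !(rmorphB, rmorphM, rmorphD) /=; field.
- by ring.
- by ring.
Qed.

Lemma is_pellX tau sigma n : is_pell tau sigma -> is_pell (pellT tau n) (sigma * chebU tau n).
Proof.
move=> h; have := qnrdX (pell tau sigma) n; rewrite pell_nrd // expr1n pellX //.
rewrite /qnrd /pell !qE /is_pell => e.
by move/(congr1 (fun u => 4 * u)): e; rewrite mulr1 => <-; field.
Qed.

Lemma pellT_mod tau n : (tau - 2 %| pellT tau n - 2)%Z.
Proof.
have -> : pellT tau n - 2 = 2 * (chebU tau n.+1 - n.+1%:Z) - 2 * (chebU tau n - n%:Z)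
   - (tau - 2) * chebU tau n.
  by rewrite /pellT -!natz -!natr1; ring.
by apply: dvdzB; [apply: dvdzB; apply: dvdz_mull; exact: chebU_mod|exact: dvdz_mulr].
Qed.

(* A unit of infinite order, with the valuation of sigma growing by one under q-th powers. *)
Lemma pell_valuation (q N : nat) : prime q -> (0 < N)%N -> exists v0 : nat,
  forall A, (v0 <= A)%N -> exists tau sigma s : int,
   [/\ is_pell tau sigma, (N %| tau - 2)%Z, (N %| sigma)%Z,
     sigma = q%:Z ^+ A * s /\ ~~ (q %| s)%Z & (q%:Z ^+ (2 * A - 2) %| tau - 2)%Z].
Proof.
move=> pq N0; have q0 := prime_gt0 pq.
(* The extra factor q^3 makes a q-th power multiply sigma by exactly one factor q. It also keeps q^3
   from dividing tau + 2, because (tau + 2) - (tau - 2) = 4 < 8. *)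
have NN0 : (0 < N * q ^ 3)%N by rewrite muln_gt0 N0 expn_gt0 q0.
have [n [h1 h2]] := chebU_period t NN0.
have base : is_pell t 1 by rewrite /is_pell /a; ring.
have s0 : chebU t n.+1 != 0 by rewrite gt_eqF // chebU_gt0.
have as0 : (0 < `|chebU t n.+1|)%N by rewrite absz_gt0.
pose v0 := logn q `|chebU t n.+1|.
have [m cm em] := pfactor_coprime pq as0.
have main A : (v0 <= A)%N -> exists tau sigma s : int, [/\ is_pell tau sigma,
     ((N * q ^ 3)%N %| tau - 2)%Z, ((N * q ^ 3)%N %| sigma)%Z &
     sigma = q%:Z ^+ A * s /\ ~~ (q %| s)%Z].
  elim: A => [|A IH].
    rewrite leqn0 => /eqP v00; exists (pellT t n.+1), (1 * chebU t n.+1), (chebU t n.+1).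
    split; first exact: is_pellX.
    - have -> : pellT t n.+1 - 2 = 2 * (chebU t n.+2 - 1) - t * chebU t n.+1.
        by rewrite /pellT; ring.
      by rewrite rpredB ?dvdz_mull.
    - by rewrite mul1r.
    - split; first by ring.
      by rewrite dvdzE /= -prime_coprime // em -/v0 v00 expn0 muln1.
  rewrite leq_eqVlt => /orP[/eqP ev|].
    exists (pellT t n.+1), (1 * chebU t n.+1), (sgz (chebU t n.+1) * m).
    split; first exact: is_pellX.
    - have -> : pellT t n.+1 - 2 = 2 * (chebU t n.+2 - 1) - t * chebU t n.+1.
        by rewrite /pellT; ring.
      by rewrite rpredB ?dvdz_mull.
    - by rewrite mul1r.
    - split; last by rewrite dvdzE abszM absz_sg s0 mul1n -prime_coprime.
      rewrite -ev mul1r {1}[chebU _ _]intEsg em PoszM.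
      have -> : (q ^ v0)%N%:Z = q%:Z ^+ v0 by rewrite -!natz natrX.
      by rewrite /v0; ring.
  rewrite ltnS => /IH [tau [sigma [s [hp ht hs [es qs]]]]].
  have [k ek] := dvdzP (chebU_mod tau q).
  have [l el] := dvdzP ht.
  exists (pellT tau q), (sigma * chebU tau q), (s * (1 + k * l * N%:Z * q%:Z ^+ 2)); split.
  - exact: is_pellX.
  - by apply: dvdz_trans ht _; exact: pellT_mod.
  - exact: dvdz_mulr.
  - split.
      have -> : chebU tau q = q%:Z + k * (tau - 2) by rewrite -ek; ring.
      rewrite el es PoszM; have -> : (q ^ 3)%N%:Z = q%:Z ^+ 3 by rewrite -!natz natrX.
      by rewrite [q%:Z ^+ A.+1]exprS; ring.
    have qs' : ~~ (q %| `|s|)%N := qs.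
    rewrite dvdzE abszM Euclid_dvdM // negb_or qs' /=; apply/negP => hd.
    have hX : (q %| k * l * N%:Z * q%:Z ^+ 2)%Z by rewrite expr2 dvdz_mull // dvdz_mulr.
    have hd' : (q %| 1 + k * l * N%:Z * q%:Z ^+ 2)%Z := hd.
    have := dvdzB hd' hX; rewrite addrK dvdzE /= dvdn1 => /eqP q1.
    by have := prime_gt1 pq; rewrite q1.
exists v0 => A /main [tau [sigma [s [hp ht hs [es qs]]]]]; exists tau, sigma, s; split=> //.
- by apply: dvdz_trans ht; rewrite PoszM dvdz_mulr.
- by apply: dvdz_trans hs; rewrite PoszM dvdz_mulr.
(* Since tau + 2 contains q at most twice, tau - 2 receives all but two of the 2 A factors q of
   sigma^2. *)
have e : ((tau - 2) * (tau + 2) = (t ^+ 2 - 4) * sigma ^+ 2)%R.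
  apply: (@intr_inj rat); rewrite !(rmorphM, rmorphB, rmorphD, rmorphXn) /=.
  have := hp; rewrite /is_pell /a; lra.
have q2 : ~~ ((q ^ 3)%N %| tau + 2)%Z.
  apply/negP => h; have : ((q ^ 3)%N %| (tau + 2) - (tau - 2))%Z.
    by apply: dvdzB => //; apply: dvdz_trans ht; rewrite PoszM dvdz_mull.
  have -> : tau + 2 - (tau - 2) = 4%N :> int by ring.
  rewrite dvdzE /= => /dvdn_leq -/(_ isT); rewrite leqNgt => /negP [].
  by apply: (@leq_trans (2 ^ 3)) => //; rewrite leq_exp2r // prime_gt1.
have d : (q%:Z ^+ (2 * A) %| (tau - 2) * (tau + 2))%Z.
  by rewrite e es exprMn -exprM mulnC dvdz_mull // dvdz_mulr.
have [z0|z0] := eqVneq (tau - 2) 0; first by rewrite z0 dvdz0.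
have tp : tau + 2 != 0.
  by apply: contraNneq q2 => ->; rewrite dvdz0.
move: d q2; rewrite !dvdzE !abszX abszM /= => d q2.
rewrite pfactor_dvdn ?absz_gt0 //.
move: d; rewrite pfactor_dvdn // ?muln_gt0 ?absz_gt0 ?z0 // lognM ?absz_gt0 //.
move: q2; rewrite pfactor_dvdn // ?absz_gt0 // -ltnNge ltnS => q2 d.
by rewrite leq_subLR (leq_trans d) // addnC leq_add2r.
Qed.

End UnitApproximation.

Section UnitApproximationMain.
Variables (t : int) (b : rat).
Hypothesis t2 : 2 < t.
Let a : rat := t%:~R ^+ 2 - 4.
Local Notation B := (quaternion a b).
Hypothesis division : forall x : B, x != 0 -> qnrd x != 0.
Implicit Types (x y z : B) (R : set B).

Let a0 : a != 0.
Proof.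
have h : (2 : rat) < t%:~R by rewrite (ltr_int rat 2 t).
by rewrite /a gt_eqF //; nra.
Qed.

(* The conjugates of i by 1, 1 + j and 1 + ij. *)
Let e_ (m : 'I_3) : B :=
  if m == 0 then mkq a b 0 1 0 0
  else if m == 1 then mkq a b 0 ((1 + b) / (1 - b)) 0 (- 2 / (1 - b))
  else mkq a b 0 ((1 - a * b) / (1 + a * b)) (- 2 * a / (1 + a * b)) 0.

Let b1 : 1 - b != 0.
Proof.
have := @division (mkq a b 1 0 1 0); rewrite /qnrd !qE.
have -> : 1 ^+ 2 - a * 0 ^+ 2 - b * 1 ^+ 2 + a * b * 0 ^+ 2 = 1 - b by ring.
by apply; apply/eqP => /(congr1 (@q0 _ _ _)); rewrite !qE => /eqP; rewrite oner_eq0.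
Qed.

Let ab1 : 1 + a * b != 0.
Proof.
have := @division (mkq a b 1 0 0 1); rewrite /qnrd !qE.
have -> : 1 ^+ 2 - a * 0 ^+ 2 - b * 0 ^+ 2 + a * b * 1 ^+ 2 = 1 + a * b by ring.
by apply; apply/eqP => /(congr1 (@q0 _ _ _)); rewrite !qE => /eqP; rewrite oner_eq0.
Qed.

Let e_sqr m : q0 (e_ m) = 0 /\ qnrd (e_ m) = - a.
Proof.
rewrite /e_; case: ifP => _; last case: ifP => _; rewrite /qnrd !qE; split=> //.
- by ring.
- by field; rewrite b1.
- by field; rewrite ab1.
Qed.

Let co (m : 'I_3) (x : B) : rat :=
  if m == 0 then q1 x + (1 + b) / 2 * q3 x + (1 - a * b) / (2 * a) * q2 x
  else if m == 1 then - (1 - b) / 2 * q3 x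
  else - (1 + a * b) / (2 * a) * q2 x.

Let co_decomp x : x = (qtr x / 2) *: 1 + (co 0 x *: e_ 0 + (co 1 x *: e_ 1 + co 2 x *: e_ 2)).
Proof. by apply: quatP; rewrite /qtr /co /e_ /= !qE; field; rewrite ?a0 ?b1 ?ab1. Qed.

Let co_int R m : qorder R -> exists N : nat, (0 < N)%N /\
  forall x, R x -> N%:R * co m x \is a Num.int.
Proof.
move=> [_ _ _ [N [N0 hN _]]].
have [n1 [p1 h1]] := rat_multiple ((1 + b) / 2).
have [n2 [p2 h2]] := rat_multiple ((1 - a * b) / (2 * a)).
have [n3 [p3 h3]] := rat_multiple (- (1 - b) / 2).
have [n4 [p4 h4]] := rat_multiple (- (1 + a * b) / (2 * a)).
exists (N * (n1 * n2 * n3 * n4))%N; split; first by rewrite !muln_gt0 N0 p1 p2 p3 p4.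
move=> x /hN [] /[!qE] _ i1 i2 i3; rewrite !natrM /co.
move: (_ / _) (_ / _) (_ / _) (_ / _) h1 h2 h3 h4 => c4 c3 c2 c1 h1 h2 h3 h4.
case: ifP => _; last case: ifP => _.
- have -> : N%:R * (n1%:R * n2%:R * n3%:R * n4%:R) * (q1 x + c1 * q3 x + c2 * q2 x) =
   n1%:R * n2%:R * n3%:R * n4%:R * (N%:R * q1 x) +
   n2%:R * n3%:R * n4%:R * (n1%:R * c1) * (N%:R * q3 x) +
   n1%:R * n3%:R * n4%:R * (n2%:R * c2) * (N%:R * q2 x) by ring.
  apply: rpredD; [apply: rpredD|].
  + by apply: rpredM => //; rewrite !rpredM ?natr_int.
  + by apply: rpredM => //; apply: rpredM => //; rewrite !rpredM ?natr_int.
  + by apply: rpredM => //; apply: rpredM => //; rewrite !rpredM ?natr_int.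
- have -> : N%:R * (n1%:R * n2%:R * n3%:R * n4%:R) * (c3 * q3 x) =
   n1%:R * n2%:R * n4%:R * (n3%:R * c3) * (N%:R * q3 x) by ring.
  by apply: rpredM => //; apply: rpredM => //; rewrite !rpredM ?natr_int.
- have -> : N%:R * (n1%:R * n2%:R * n3%:R * n4%:R) * (c4 * q2 x) =
   n1%:R * n2%:R * n3%:R * (n4%:R * c4) * (N%:R * q2 x) by ring.
  by apply: rpredM => //; apply: rpredM => //; rewrite !rpredM ?natr_int.
Qed.

Let common (P : 'I_3 -> nat -> Prop) : (forall m n n', P m n -> P m (n * n')%N) ->
  (forall m, exists n, (0 < n)%N /\ P m n) -> exists n, (0 < n)%N /\ forall m, P m n.
Proof.
move=> PM /choice [f hf]; exists (\prod_m f m)%N; split.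
  by apply: prodn_gt0 => m; case: (hf m).
by move=> m; rewrite (bigD1 m) //=; apply: PM; case: (hf m).
Qed.

Let solve_mod (q L : nat) (m r : int) : prime q -> ~~ (q %| m)%Z ->
  exists c : nat, (q%:Z ^+ L %| c%:Z * m - r)%Z.
Proof.
move=> pq qm.
have cop : coprimez (q%:Z ^+ L) m.
  by rewrite coprimezE abszX coprimeXl // prime_coprime // -dvdzE.
have [u [v huv]] : exists u v, u * q%:Z ^+ L + v * m = 1.
  by have [u [v e]] := Bezoutz (q%:Z ^+ L) m; exists u, v; rewrite e; exact/eqP.
have qL : q%:Z ^+ L != 0 by rewrite expf_neq0 // eqz_nat -lt0n prime_gt0.
exists `|((r * v) %% (q%:Z ^+ L))%Z|%N; rewrite gez0_abs ?modz_ge0 //.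
have -> : ((r * v) %% (q%:Z ^+ L))%Z = r * v - ((r * v) %/ (q%:Z ^+ L))%Z * q%:Z ^+ L.
  by rewrite {2}(divz_eq (r * v) (q%:Z ^+ L)); ring.
have -> : (r * v - ((r * v) %/ q%:Z ^+ L)%Z * q%:Z ^+ L) * m - r =
    q%:Z ^+ L * (- ((r * v) %/ q%:Z ^+ L)%Z * m - r * u).
  rewrite mulrBl.
  have -> : r * v * m = r * (1 - u * q%:Z ^+ L) by rewrite -huv; ring.
  by ring.
exact: dvdz_mulr.
Qed.

Let arith (v0 n1 n2 e k : nat) : (v0 + n1 + e + n1 + n1 + n2 + n2 + 5 <= k)%N ->
  [/\ v0 <= k - n1, n2 <= k - n1, k + e <= (k - n1 - n2) + (k - n1 - n2),
     (k - n1 - n2).+1 <= 2 * (k - n1) - 2 & (k + e).+1 <= 2 * (k - n1) - 2]%N /\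
  [/\ k = k - n1 + n1, k + (e + n1 + n2) = k + e + n1 + n2 & k = (k - e - 1).+1 + e]%N.
Proof. by move=> h; split; split; lia. Qed.

Let expand3 (x y z u v w s : B) : (1 + x) * (1 + y) * (1 + z) - 1 - (s + (u + (v + w))) =
  (x - u) + (y - v) + (z - w) - s + (x * y + x * z + y * z + x * y * z).
Proof.
rewrite !mulrDl !mulrDr !mul1r !mulr1 !mulrDl.
move: (x * y) (x * z) (y * z) (x * y * z) => p1 p2 p3 p4.
by apply: quatP; rewrite !qE; ring.
Qed.

(** A product of three units 1 + d_m, powers of three conjugates of one unit, where d_m is close to
    q^k times the e_m-component of n'. To first order the product is 1 + q^k n': the products of the
    d_m are smaller because k is large, and the scalar part of q^k n' is negligible because its
    trace is divisible by q^(2k). *)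
Lemma unit_approximation R q e : qorder R -> prime q -> exists K : nat,
  forall k n', (K <= k)%N -> R n' -> q%:R ^- k * qtr n' \is a Num.int ->
  exists g, [/\ R g, qnrd g = 1 & R (q%:R ^- (k + e) *: (g - 1 - q%:R ^+ k *: n'))].
Proof.
move=> oR pq; have q0 := prime_gt0 pq; have zR := qorder_zsub oR.
have q00 : (q%:R : rat) != 0 by rewrite pnatr_eq0 -lt0n.
have [R1 RB RM _] := oR.
have [N1 [N10 hN1]] : exists n, (0 < n)%N /\ forall m, R (n%:R *: e_ m) /\
    forall x, R x -> n%:R * co m x \is a Num.int.
  apply: common => [m n n' [h1 h2]|m].
    split; first by rewrite mulnC natrM -scalerA; apply: zsubZ => //; exact: natr_int.
    by move=> x /h2 h; rewrite mulnC natrM -mulrA rpredM ?natr_int.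
  have [n [n0 hn]] := qorder_multiple (e_ m) oR; have [n' [n'0 hn']] := co_int m oR.
  exists (n * n')%N; split; first by rewrite muln_gt0 n0.
  split; first by rewrite mulnC natrM -scalerA; apply: zsubZ => //; exact: natr_int.
  by move=> x /hn' h; rewrite natrM -mulrA rpredM ?natr_int.
have N100 : (N1%:R : rat) != 0 by rewrite pnatr_eq0 -lt0n.
have N20 : (0 < 2 * N1)%N by rewrite muln_gt0.
set n1 := logn q N1; set n2 := logn q (2 * N1).
have [N1' cN1' eN1'] := pfactor_coprime pq N10.
have [v0 hv0] := pell_valuation b t2 pq N20.
(* The bound makes the inequalities of [arith] hold: E = k + e is the precision to reach, and A = k
   - n1 the valuation prescribed for sigma. *)
exists (v0 + n1 + e + n1 + n1 + n2 + n2 + 5)%N => k n' hk Rn' trn'.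
have := arith hk; pose A := (k - n1)%N; pose E := (k + e)%N; pose L := (e + n1 + n2)%N.
rewrite -/A -/E -/L => -[[hA1 hA2 hE1 hA3 hE2] [ekA eL eke]].
have [tau [sigma [s [hp ht hs [es qs] htau]]]] : exists tau sigma s : int,
   [/\ is_pell t tau sigma, ((2 * N1)%N %| tau - 2)%Z, ((2 * N1)%N %| sigma)%Z,
     sigma = q%:Z ^+ A * s /\ ~~ (q %| s)%Z & (q%:Z ^+ (2 * A - 2) %| tau - 2)%Z].
  by exact: hv0.
have /choice [rho hrho] : forall m, exists r : int, N1%:R * co m n' = r%:~R.
  by move=> m; apply/intrP; apply: (hN1 m).2.
(* The c-th power has i-part sigma U_c, and U_c is congruent to c modulo tau - 2. So c only has to
   solve a linear congruence whose coefficient s N1' is prime to q. *)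
have /choice [c hc] : forall m : 'I_3, exists c : nat,
    (q%:Z ^+ L %| c%:Z * (s * N1'%:Z) - 2 * rho m)%Z.
  move=> m; apply: solve_mod => //; apply/negP; rewrite dvdzE abszM Euclid_dvdM //.
  move=> /orP[h|h]; first by move: qs; rewrite dvdzE h.
  by move: cN1'; rewrite prime_coprime // h.
have /choice [w hw] : forall m : 'I_3, exists w : int,
    (c m)%:Z * (s * N1'%:Z) - 2 * rho m = q%:Z ^+ L * w.
  by move=> m; have /dvdzP [w ew] := hc m; exists w; rewrite ew mulrC.
pose T (m : 'I_3) : int := pellT tau (c m); pose U (m : 'I_3) : int := chebU tau (c m).
have intB2 (x : int) : x%:~R - 2 = (x - 2)%:~R :> rat by rewrite intrB.
have TB m : (T m)%:~R - 2 = (T m - 2)%:~R :> rat by exact: intB2.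
pose d m : B := (((T m)%:~R - 2) / 2) *: 1 + ((sigma * U m)%:~R / 2) *: e_ m.
have nd m : qnrd (1 + d m) = 1.
  have [e0 en] := e_sqr m; have := @is_pellX t b _ _ (c m) hp; rewrite -/(T m) -/(U m) /is_pell.
  have -> : 1 + d m = ((T m)%:~R / 2) *: 1 + ((sigma * U m)%:~R / 2) *: e_ m.
    by rewrite addrA -{1}[1 : B]scale1r -scalerDl; congr (_ *: _ + _); field.
  rewrite qnrdD !qnrdZ qnrd1 en -scalerAl mul1r qtrZ qtr_conj qtrZ /qtr e0 -/a.
  by lra.
have Tdvd m : (tau - 2 %| T m - 2)%Z by exact: pellT_mod.
have Udvd m : (tau - 2 %| U m - (c m)%:Z)%Z by exact: chebU_mod.
have dR m : R (d m).
  apply: zsubD => //.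
    apply: zsubZ => //; have /dvdzP [l el] := dvdz_trans ht (Tdvd m).
    rewrite TB el rmorphM PoszM rmorphM /=.
    have -> : l%:~R * (2%:~R * N1%:~R) / 2 = l%:~R * N1%:~R :> rat by field.
    by zint.
  have /dvdzP [l el] := hs.
  have -> : ((sigma * U m)%:~R / 2) *: e_ m = (l * U m)%:~R *: (N1%:R *: e_ m).
    by rewrite scalerA; congr (_ *: _); rewrite el !rmorphM PoszM rmorphM /=; field.
  by apply: zsubZ; [done|exact: intr_int|exact: (hN1 m).1].
have loc2 : local_int q (q%:R / 2) by exact: local_int_half.
have loc1 : local_int q (q%:R ^+ n1 / N1%:R) by exact: local_int_logn.
have loc3 : local_int q (q%:R ^+ n2 / (2 * N1)%:R) by exact: local_int_logn.
have atR (r : rat) x : local_int q r -> R x -> at_prime q R (r *: x) by exact: at_primeZl.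
have zat := at_prime_zsub pq zR.
have n12 : (n1 <= n2)%N by rewrite /n1 /n2 lognM // leq_addl.
have smallT m f : (f.+1 <= 2 * A - 2)%N -> local_int q (q%:R ^- f * (((T m)%:~R - 2) / 2)).
  move=> hf; have -> : q%:R ^- f * (((T m)%:~R - 2) / 2) =
     (q%:R ^- f.+1 * (T m - 2)%:~R) * (q%:R / 2) :> rat.
    by rewrite -TB exprS invfM; field; rewrite ?q00 ?expf_neq0.
  apply: local_intM => //; apply: local_int_int => //.
  by apply: (local_int_dvd pq hf); apply: dvdz_trans htau _.
have sigE : (sigma%:~R : rat) = q%:R ^+ A * s%:~R by rewrite es rmorphM rmorphXn.
have E2 : (2 * N1)%:R = 2 * N1%:R :> rat by rewrite natrM.
have dat m : at_prime q R (q%:R ^- (A - n2) *: d m).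
  rewrite scalerDr !scalerA; apply: zsubD => //.
    by apply: atR => //; exact: smallT.
  have -> : (q%:R ^- (A - n2) * ((sigma * U m)%:~R / 2)) *: e_ m =
     ((s * U m)%:~R * (q%:R ^+ n2 / (2 * N1)%:R)) *: (N1%:R *: e_ m).
    rewrite scalerA; congr (_ *: _).
    have -> : (A = (A - n2) + n2)%N by rewrite subnK.
    rewrite addnK !rmorphM /= sigE E2.
    have -> : (A = (A - n2) + n2)%N by rewrite subnK.
    rewrite exprD addnK; field.
    by rewrite N100 expf_neq0.
  apply: atR; last exact: (hN1 m).1.
  by apply: local_intM => //; apply: local_int_int => //; exact: intr_int.
have weaken f x : (E <= f)%N -> at_prime q R (q%:R ^- f *: x) -> at_prime q R (q%:R ^- E *: x).
  move=> Ef h; have -> : q%:R ^- E *: x = q%:R ^+ (f - E) *: (q%:R ^- f *: x).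
    rewrite scalerA; congr (_ *: _); rewrite -{2}(subnK Ef) exprD; field.
    by rewrite !expf_neq0.
  by apply: zsubZ => //; zint.
have prod2 x y : at_prime q R (q%:R ^- (A - n2) *: x) -> at_prime q R (q%:R ^- (A - n2) *: y) ->
   at_prime q R (q%:R ^- E *: (x * y)).
  move=> hx hy; apply: (weaken ((A - n2) + (A - n2))%N); first by [].
  have := at_primeM pq RM hx hy; rewrite -scalerAl -scalerAr scalerA.
  by rewrite -invfM -exprD.
have prod3 x y z : R z -> at_prime q R (q%:R ^- E *: (x * y)) -> at_prime q R (q%:R ^- E *: (x * y * z)).
  by move=> Rz h; rewrite scalerAl; apply: (at_primeM pq RM) => //; exact: at_prime_sub.
have main m : at_prime q R (q%:R ^- E *: (d m - q%:R ^+ k *: (co m n' *: e_ m))).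
  have -> : d m - q%:R ^+ k *: (co m n' *: e_ m) = (((T m)%:~R - 2) / 2) *: 1 +
     ((sigma * (U m - (c m)%:Z))%:~R / 2) *: e_ m +
     (q%:R ^+ (k + L) * (w m)%:~R / (2 * N1)%:R) *: e_ m.
    rewrite /d -!addrA; congr (_ + _); rewrite scalerA -!scalerDl -scalerBl; congr (_ *: _).
    have -> : co m n' = (rho m)%:~R / N1%:R by rewrite -hrho; field.
    have hwr : (c m)%:R * (s%:~R * N1'%:R) - 2 * (rho m)%:~R = q%:R ^+ L * (w m)%:~R :> rat.
      by rewrite -[q%:R]/(q%:~R) -rmorphXn -rmorphM -hw rmorphB !rmorphM.
    rewrite exprD -[_ * _ * (w m)%:~R]mulrA -hwr E2.
    have eN : (N1%:R : rat) = N1'%:R * q%:R ^+ n1 by rewrite -natrX -natrM -eN1'.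
    have ek : q%:R ^+ k = q%:R ^+ A * q%:R ^+ n1 :> rat.
      by rewrite -exprD -ekA.
    have N1'0 : (N1'%:R : rat) != 0 by apply: contraNneq N100 => h; rewrite eN h mul0r.
    rewrite !rmorphM rmorphB /= sigE ek eN; field.
    by rewrite N1'0 expf_neq0.
  rewrite !scalerDr; apply: zsubD; [done|apply: zsubD; [done| |]|].
  - by rewrite scalerA; apply: atR => //; exact: smallT.
  - have [l el] := dvdzP (Udvd m).
    have -> : q%:R ^- E *: (((sigma * (U m - (c m)%:Z))%:~R / 2) *: e_ m) =
       ((q%:R ^- E * (tau - 2)%:~R) * l%:~R * (sigma%:~R / (2 * N1)%:R)) *: (N1%:R *: e_ m).
      rewrite !scalerA; congr (_ *: _); rewrite el !rmorphM /= E2; field.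
      by rewrite N100 expf_neq0.
    apply: atR; last exact: (hN1 m).1.
    apply: local_int_int => //; apply: rpredM; last first.
      have /dvdzP [l' ->] := hs; rewrite rmorphM /= -[(2 * N1)%N%:~R]/((2 * N1)%:R).
      by rewrite mulfK ?intr_int // pnatr_eq0 -lt0n.
    apply: rpredM; last exact: intr_int.
    by apply: (local_int_dvd pq _ htau); exact: ltnW.
  - have -> : q%:R ^- E *: ((q%:R ^+ (k + L) * (w m)%:~R / (2 * N1)%:R) *: e_ m) =
      ((w m)%:~R * (q%:R ^+ n2 / (2 * N1)%:R) * (q%:R ^+ n1 / N1%:R)) *: (N1%:R *: e_ m).
      rewrite !scalerA; congr (_ *: _).
      have -> : q%:R ^+ (k + L) = q%:R ^+ E * q%:R ^+ n1 * q%:R ^+ n2 :> rat.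
        by rewrite -!exprD eL.
      rewrite E2; field.
      by rewrite N100 expf_neq0.
    apply: atR; last exact: (hN1 m).1.
    by do 2 (apply: local_intM => //); apply: local_int_int => //; exact: intr_int.
have trat : at_prime q R (q%:R ^- E *: (q%:R ^+ k *: ((qtr n' / 2) *: 1))).
  have /intrP [l el] := trn'.
  have -> : q%:R ^- E *: (q%:R ^+ k *: ((qtr n' / 2) *: 1)) =
      (q%:R ^+ (k - e - 1) * l%:~R * (q%:R / 2)) *: 1 :> B.
    have -> : qtr n' = q%:R ^+ k * l%:~R by rewrite -el mulrA divff ?mul1r // expf_neq0.
    rewrite !scalerA; congr (_ *: _); rewrite mulrA.
    have ek : q%:R ^+ k = q%:R ^+ (k - e - 1) * q%:R * q%:R ^+ e :> rat.
      by rewrite -exprSr -exprD -eke.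
    rewrite /E exprD ek; field.
    by rewrite q00 !expf_neq0.
  apply: atR => //; apply: local_intM => //; apply: local_int_int => //; zint.
exists ((1 + d 0) * (1 + d 1) * (1 + d 2)); split.
- by apply: (RM); [apply: (RM)|]; apply: zsubD.
- by rewrite !qnrdM !nd !mulr1.
apply: (at_prime_pow pq zR (e := E)); last first.
  rewrite scalerA divff ?expf_neq0 // scale1r; apply: (RB); last first.
    by apply: zsubZ => //; zint.
  by apply: (RB) => //; apply: (RM); [apply: (RM)|]; apply: zsubD.
have -> : (1 + d 0) * (1 + d 1) * (1 + d 2) - 1 - q%:R ^+ k *: n' =
   (d 0 - q%:R ^+ k *: (co 0 n' *: e_ 0)) + (d 1 - q%:R ^+ k *: (co 1 n' *: e_ 1)) +
   (d 2 - q%:R ^+ k *: (co 2 n' *: e_ 2)) - q%:R ^+ k *: ((qtr n' / 2) *: 1) +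
   (d 0 * d 1 + d 0 * d 2 + d 1 * d 2 + d 0 * d 1 * d 2).
  by rewrite [in LHS](co_decomp n') !scalerDr; exact: expand3.
have zA x y : at_prime q R (q%:R ^- E *: x) -> at_prime q R (q%:R ^- E *: y) ->
    at_prime q R (q%:R ^- E *: (x + y)).
  by move=> hx hy; rewrite scalerDr; exact: zsubD.
have zB x y : at_prime q R (q%:R ^- E *: x) -> at_prime q R (q%:R ^- E *: y) ->
    at_prime q R (q%:R ^- E *: (x - y)).
  by move=> hx hy; rewrite scalerBr; exact: (zat.2).
exact: (zA _ _ (zB _ _ (zA _ _ (zA _ _ (main 0) (main 1)) (main 2)) trat)
  (zA _ _ (zA _ _ (zA _ _ (prod2 _ _ (dat 0) (dat 1)) (prod2 _ _ (dat 0) (dat 2)))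
    (prod2 _ _ (dat 1) (dat 2))) (prod3 _ _ _ (dR 2) (prod2 _ _ (dat 0) (dat 1))))).
Qed.

End UnitApproximationMain.

(** * Units congruent to 1 plus a nilpotent element *)

Section NilpotentApproximation.
Variables (t : int) (b : rat).
Hypothesis t2 : 2 < t.
Let a : rat := t%:~R ^+ 2 - 4.
Local Notation B := (quaternion a b).
Hypothesis division : forall x : B, x != 0 -> qnrd x != 0.
Implicit Types (x y z : B) (R I J : set B).

Definition right_order J : set B := [set r | forall x, J x -> J (x * r)].

Lemma right_order_qorder J (U L : nat) : zsub J -> J 1 -> (0 < U)%N -> (0 < L)%N ->
  (forall x, J x -> qlat0 (U%:R *: x)) ->
  (forall x, qlat0 x -> right_order J (L%:R *: x)) -> qorder (right_order J).
Proof.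
move=> zJ J1 U0 L0 hU hL.
have zR : zsub (right_order J).
  split; first by move=> x Jx; rewrite mulr0; case: zJ.
  by move=> r s hr hs x Jx; rewrite mulrBr; apply: zJ.2; [exact: hr|exact: hs].
split; first by move=> x; rewrite mulr1.
- exact: zR.2.
- by move=> r s hr hs x Jx; rewrite mulrA; apply/hs/hr.
- exists (U * L)%N; split; first by rewrite muln_gt0 U0.
    move=> r hr; rewrite mulnC natrM -scalerA; apply: zsubZ; first exact: qlat0_zsub.
      exact: natr_int.
    by apply: hU; have := hr 1 J1; rewrite mul1r.
  by move=> x hx; rewrite natrM -scalerA; apply: (@zsubZ _ _ (right_order J)); [exact: zR|exact: natr_int|exact: hL].
Qed.

(* The lattices R + R (nu/q^k) fall into finitely many classes, so for some
   arbitrarily large k the element nu = q^k (nu/q^k) is approximated by units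
   of a conjugate of one fixed order. *)
Lemma nilpotent_approximation R q e (nu : B) : qorder R -> prime q -> R nu ->
  (forall k : nat, exists nuk, [/\ R nuk, R (q%:R ^- e *: (nuk - nu)),
     q%:R ^- (2 * k) * qtr nuk \is a Num.int &
     q%:R ^- (2 * k) * qnrd nuk \is a Num.int]) ->
  exists g, [/\ R g, qnrd g = 1 & R (q%:R ^- e *: (g - 1 - nu))].
Proof.
move=> oR pq Rnu /choice [f hf]; have zR := qorder_zsub oR.
have [R1 RB RM [N [N0 hN hN']]] := oR; have q0 := prime_gt0 pq.
have q00 : (q%:R : rat) != 0 by rewrite pnatr_eq0 -lt0n.
have qk0 (k : nat) : (q%:R ^+ k : rat) != 0 by rewrite expf_neq0.
(* Trace and norm of f k are divisible by q^(2k), so those of n_k are still integral, and R + R n_k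
   is stable under right multiplication by n_k. *)
pose n k := q%:R ^- k *: f k.
pose I k : set B := [set x | exists u v, [/\ R u, R v & x = u + v * n k]].
have zI k : zsub (I k).
  split; first by exists 0, 0; split; [exact: zR.1|exact: zR.1|rewrite mul0r addr0].
  move=> _ _ [u [v [Ru Rv ->]]] [u' [v' [Ru' Rv' ->]]].
  by exists (u - u'), (v - v'); split; [exact: RB|exact: RB|rewrite mulrBl opprD addrACA].
have RI k r x : R r -> I k x -> I k (r * x).
  move=> Rr [u [v [Ru Rv ->]]]; exists (r * u), (r * v).
  by split; [exact: RM|exact: RM|rewrite mulrDr mulrA].
have I1 k : I k 1 by exists 1, 0; split; [|exact: zR.1|rewrite mul0r addr0].
have IR k x : I k x -> R (q%:R ^+ k *: x).
  move=> [u [v [Ru Rv ->]]]; rewrite scalerDr; apply: zsubD => //.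
    by apply: zsubZ => //; zint.
  rewrite scalerAr /n scalerA divff // scale1r; apply: RM => //.
  by case: (hf k).
have lI k : left_lattice R (I k).
  split=> //; first exact: RI; first by exists 1; rewrite ?oner_neq0.
  exists (N * q ^ k)%N; split; first by rewrite muln_gt0 N0 expn_gt0 q0.
  by move=> x /IR h; rewrite natrM -scalerA natrX; exact: hN.
have [M [M0 hM]] := left_lattice_class division oR.
have /choice [z hz] : forall k, exists z, [/\ I k z, qnrd z != 0 &
   forall w, I k w -> R (M%:R *: (w * z^-1))] by move=> k; exact: hM.
have zu k : z k \is a GRing.unit by apply: qunitP; case: (hz k).
pose J k : set B := [set x | I k (x * z k)].
have zJ k : zsub (J k).
  split; first by rewrite /J /= mul0r; case: (zI k).
  by move=> x y hx hy; rewrite /J /= mulrBl; apply: (zI k).2.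
have RJ k x : R x -> J k x by move=> Rx; apply: RI => //; case: (hz k).
have JR k x : J k x -> R (M%:R *: x).
  by move=> Jx; have [_ _ /(_ _ Jx)] := hz k; rewrite mulrK.
have UM0 : (0 < N * M)%N by rewrite muln_gt0 N0.
have JU k x : J k x -> qlat0 ((N * M)%:R *: x).
  by move=> /JR h; rewrite natrM -scalerA; exact: hN.
have LJ k x : qlat0 x -> J k (N%:R *: x) by move=> hx; apply/RJ/hN'.
pose code k := [ffun c : 'I_(N * M * N) * 'I_(N * M * N) * 'I_(N * M * N) * 'I_(N * M * N)
   => `[< J k (lat_rep a b (N * M) c) >]].
have codeP k l : code k = code l -> J k `<=` J l.
  move=> /ffunP h; apply: (lat_codeP UM0 N0) => //; [exact: JU|exact: LJ|exact: LJ|].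
  by move=> c hc; have := h c; rewrite !ffunE (asboolT hc) => /esym /asboolW.
(* After normalisation by z_k all the lattices lie between two fixed ones, so one of them recurs for
   arbitrarily large k. Its right order is the fixed order to which [unit_approximation] is
   applied. *)
have [tc htc] := pigeonhole_infinite code.
have [k0 [_ hk0]] := htc 0%N.
have oS : qorder (right_order (J k0)).
  apply: (right_order_qorder (zJ k0) (RJ _ _ R1) UM0 (_ : (0 < M * N)%N)).
  - by rewrite muln_gt0 M0.
  - exact: JU.
  - move=> x hx y Jy; have -> : y * ((M * N)%:R *: x) = (M%:R *: y) * (N%:R *: x).
      by rewrite natrM -!scalerAr -scalerAl scalerA [N%:R * _]mulrC.
    by apply: RJ; apply: RM; [exact: JR Jy|exact: hN'].
have [K hK] := unit_approximation t2 division e oS pq.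
have [k [kK hk]] := htc K.
have [Rf Rfnu trf nf] := hf k; have [Iz nz hzk] := hz k.
have jk : J k `<=` J k0 by apply: codeP; rewrite hk hk0.
have kj : J k0 `<=` J k by apply: codeP; rewrite hk hk0.
have trn : q%:R ^- k * qtr (n k) \is a Num.int.
  by rewrite /n qtrZ mulrA -invfM -exprD addnn -mul2n.
have trn' : qtr (n k) \is a Num.int.
  have -> : qtr (n k) = q%:R ^+ k * (q%:R ^- k * qtr (n k)) by rewrite mulrA divff ?mul1r.
  by apply: rpredM => //; zint.
have nrn : qnrd (n k) \is a Num.int.
  by rewrite /n qnrdZ exprVn -exprM mulnC.
have In x : I k x -> I k (x * n k).
  move=> [u [v [Ru Rv ->]]]; exists (- (qnrd (n k) *: v)), (u + qtr (n k) *: v).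
  split; first by apply: zsubN => //; exact: zsubZ.
    by apply: zsubD => //; exact: zsubZ.
  move: (qsqrE (n k)); move: (qtr (n k)) (qnrd (n k)) (n k) => tau d m em.
  rewrite !mulrDl -mulrA em mulrBr -!scalerAr mulr1 -scalerAl.
  by rewrite addrA [RHS]addrC.
set n' := z k * n k * (z k)^-1.
have Sn' : right_order (J k0) n'.
  move=> x /kj Jx; apply: jk; rewrite /J /= /n' mulrA mulrVK //.
  by rewrite mulrA; exact: In.
have [|g [Sg ng hg]] := hK k n' kK Sn'; first by rewrite /n' qtr_conjg.
have Jz : J k (z k)^-1 by rewrite /J /= mulVr.
have key r : right_order (J k0) r -> R (q%:R ^+ k *: ((z k)^-1 * r * z k)).
  by move=> hr; exact: (IR k _ (kj _ (hr _ (jk _ Jz)))).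
set g' := (z k)^-1 * g * z k.
(* Conjugating back from the right order into R costs a factor q^k, which the precision q^(k + e) of
   g covers. *)
have h1 : R (q%:R ^- e *: (g' - 1 - f k)).
  have -> : q%:R ^- e *: (g' - 1 - f k) =
     q%:R ^+ k *: ((z k)^-1 * (q%:R ^- (k + e) *: (g - 1 - q%:R ^+ k *: n')) * z k).
    rewrite -scalerAr -scalerAl scalerA !mulrBr !mulrBl mulr1 mulVr //.
    rewrite -scalerAr -scalerAl /n' !mulrA mulVr // mul1r mulrVK // /n scalerA divff // scale1r.
    by congr (_ *: _); rewrite exprD; field; rewrite !qk0.
  exact: key.
have h2 : R (q%:R ^- e *: (g' - 1 - nu)).
  have -> : g' - 1 - nu = (g' - 1 - f k) + (f k - nu) by rewrite addrA subrK.
  by rewrite scalerDr; exact: zsubD.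
exists g'; split=> //; last by rewrite /g' !qnrdM qnrdV // ng mulr1 mulVf.
have -> : g' = q%:R ^+ e *: (q%:R ^- e *: (g' - 1 - nu)) + 1 + nu.
  by rewrite scalerA divff // scale1r addrAC !subrK.
by apply: zsubD => //; apply: zsubD => //; apply: zsubZ => //; zint.
Qed.

End NilpotentApproximation.

Section LocalIntVal.
Variable q : nat.
Hypothesis pq : prime q.
Let q00 : (q%:R : rat) != 0. Proof. by rewrite pnatr_eq0 -lt0n prime_gt0. Qed.

Lemma local_int_inv n : ~~ (q %| n)%N -> local_int q n%:R^-1.
Proof.
move=> qn; exists n; split=> //; rewrite mulfV ?rpred1 // pnatr_eq0.
by apply: contraNneq qn => ->; rewrite dvdn0.
Qed.

Lemma local_int_logz (m : int) : m != 0 -> local_int q (q%:R ^+ logn q `|m| / m%:~R).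
Proof.
move=> m0; have a0 : (0 < `|m|)%N by rewrite absz_gt0.
have := local_int_logn pq a0; case: m m0 a0 => n m0 a0; first by [].
have -> : (Negz n)%:~R = - (`|Negz n|%N)%:R :> rat by rewrite NegzE rmorphN.
move=> h; rewrite invrN mulrN -mulN1r.
by apply: local_intM => //; apply: local_int_int => //; rewrite rpredN rpred1.
Qed.

Lemma int_logz (m : int) : m != 0 -> m%:~R / q%:R ^+ logn q `|m| \is a @Num.int rat.
Proof.
move=> m0; have /dvdnP [k ek] := pfactor_dvdnn q `|m|.
rewrite {1}[m]intEsg rmorphM /= -[(`|m|%N)%:~R]/((`|m|%N)%:R) {1}ek natrM natrX -mulrA mulfK ?expf_neq0 //.
by apply: rpredM; [exact: intr_int|exact: natr_int].
Qed.

Lemma local_int_val r : local_int q r -> r != 0 -> exists f,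
  local_int q (r / q%:R ^+ f) /\ local_int q (q%:R ^+ f / r).
Proof.
move=> [n [qn /intrP [m em]]] r0.
have n0 : (n%:R : rat) != 0.
  by rewrite pnatr_eq0; apply: contraNneq qn => ->; rewrite dvdn0.
have m0 : m != 0 by rewrite -(intr_eq0 rat) -em mulf_neq0.
exists (logn q `|m|); split.
  have -> : r / q%:R ^+ logn q `|m| = n%:R^-1 * (m%:~R / q%:R ^+ logn q `|m|).
    by rewrite -em; field; rewrite n0 expf_neq0.
  by apply: local_intM; [done|exact: local_int_inv|apply: local_int_int => //; exact: int_logz].
have -> : q%:R ^+ logn q `|m| / r = n%:R * (q%:R ^+ logn q `|m| / m%:~R).
  by rewrite -em; field; rewrite n0 r0.
by apply: local_intM; [done|apply: local_int_int => //; exact: natr_int|exact: local_int_logz].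
Qed.

Lemma local_int_div (m k : int) : m != 0 -> k != 0 -> (logn q `|m| <= logn q `|k|)%N ->
  local_int q (k%:~R / m%:~R).
Proof.
move=> m0 k0 le.
have -> : (k%:~R / m%:~R : rat) = (k%:~R / q%:R ^+ logn q `|k|) *
    q%:R ^+ (logn q `|k| - logn q `|m|) * (q%:R ^+ logn q `|m| / m%:~R).
  have -> : q%:R ^+ logn q `|k| = q%:R ^+ (logn q `|k| - logn q `|m|) * q%:R ^+ logn q `|m| :> rat.
    by rewrite -exprD subnK.
  by field; rewrite intr_eq0 m0 !expf_neq0.
apply: local_intM; [done| |exact: local_int_logz].
apply: local_int_int => //; apply: rpredM; first exact: int_logz.
by rewrite -natrX natr_int.
Qed.

(* A p-adic unit may be inverted modulo any power. *)
Lemma local_unit_inverse (m : nat) f : ~~ (q %| m)%N ->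
  exists y : nat, q%:R ^- f * (m%:R * y%:R - 1) \is a @Num.int rat.
Proof.
move=> qm; have m0 : (0 < m)%N by rewrite lt0n; apply: contraNneq qm => ->; rewrite dvdn0.
case: (egcdnP (q ^ f) m0) => u v e _; exists u.
have c1 : gcdn m (q ^ f) = 1%N.
  by apply/eqP; rewrite -/(coprime _ _) coprime_sym coprimeXl // prime_coprime.
have -> : m%:R * u%:R - 1 = v%:R * q%:R ^+ f :> rat.
  by rewrite -natrX -!natrM mulnC e c1 natrD addrK.
by rewrite mulrCA mulVf ?expf_neq0 // mulr1 natr_int.
Qed.

End LocalIntVal.

(** * Lifting approximate idempotents *)

Section Idempotents.
Variables (a b : rat).
Local Notation B := (quaternion a b).
Implicit Types (x y z e : B) (R : set B).

(** Newton's iteration e -> 3 e^2 - 2 e^3: the norms of e and of 1 - e are replaced by multiples of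
    their squares, so the precision doubles. *)
Lemma idempotent_lift R q f e : qorder R -> prime q -> (0 < f)%N -> R e ->
  q%:R ^- f * (qtr e - 1) \is a Num.int -> q%:R ^- f * qnrd e \is a Num.int ->
  forall N, exists e', [/\ R e', R (q%:R ^- f *: (e' - e)),
    q%:R ^- N * (qtr e' - 1) \is a Num.int & q%:R ^- N * qnrd e' \is a Num.int].
Proof.
move=> oR pq f0 Re te ne N.
have [R1 RB RM _] := oR; have zR := qorder_zsub oR.
have q00 : (q%:R : rat) != 0 by rewrite pnatr_eq0 -lt0n prime_gt0.
have weak (i j : nat) (r : rat) : (i <= j)%N -> q%:R ^- j * r \is a Num.int ->
    q%:R ^- i * r \is a Num.int.
  move=> ij h; have -> : q%:R ^- i * r = q%:R ^+ (j - i) * (q%:R ^- j * r).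
    rewrite -{2}(subnK ij) exprD; field.
    by rewrite !expf_neq0.
  by apply: rpredM => //; zint.
have [M hNM] : exists M, (N <= f * 2 ^ M)%N.
  by exists N; apply: leq_trans (ltnW (ltn_expl N (ltnSn 1))) _; rewrite leq_pmull.
suff [e' [? ? ? ?]] : exists e', [/\ R e', R (q%:R ^- f *: (e' - e)),
    q%:R ^- (f * 2 ^ M) * (qtr e' - 1) \is a Num.int &
    q%:R ^- (f * 2 ^ M) * qnrd e' \is a Num.int].
  by exists e'; split=> //; exact: weak hNM _.
elim: M {hNM} => [|M [e' [Re' de' te' ne']]].
  by exists e; rewrite expn0 muln1 subrr scaler0; split=> //; exact: zR.1.
set g := (f * 2 ^ M)%N in te' ne'.
have fg : (f <= g)%N by rewrite /g leq_pmulr // expn_gt0.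
have n1 : qnrd (1 - e') = qnrd e' - (qtr e' - 1).
  by rewrite qnrdD qnrdN qnrd1 qconjN mulrN mul1r qtrN qtr_conj; ring.
have n1' : q%:R ^- g * qnrd (1 - e') \is a Num.int.
  by rewrite n1 mulrBr rpredB.
pose e2 := e' * e' * (3%:R *: 1 - 2%:R *: e').
have R3 : R (3%:R *: 1 - 2%:R *: e').
  by apply: RB; apply: zsubZ => //; exact: natr_int.
have R4 : R (1 + 2%:R *: e') by apply: zsubD => //; apply: zsubZ => //; exact: natr_int.
have nX : qnrd e2 = qnrd e' ^+ 2 * qnrd (3%:R *: 1 - 2%:R *: e').
  by rewrite !qnrdM expr2.
have e2' : 1 - e2 = (1 - e') * (1 - e') * (1 + 2%:R *: e').
  rewrite /e2; rewrite !(mulrBr, mulrBl, mulrDr, mulrDl, mulr1, mul1r) -!scalerAr !mulr1.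
  move: (e' * e') (e' * e' * e') => u v.
  by apply: quatP; rewrite !qE; ring.
have nX' : qnrd (1 - e2) = qnrd (1 - e') ^+ 2 * qnrd (1 + 2%:R *: e').
  by rewrite e2' !qnrdM expr2.
have sq (r s : rat) : q%:R ^- g * r \is a Num.int -> s \is a Num.int ->
    q%:R ^- (f * 2 ^ M.+1) * (r ^+ 2 * s) \is a Num.int.
  move=> hr hs; have -> : (f * 2 ^ M.+1 = g + g)%N by rewrite /g expnS; lia.
  have -> : q%:R ^- (g + g) * (r ^+ 2 * s) = (q%:R ^- g * r) ^+ 2 * s.
    rewrite exprD; field; exact: expf_neq0.
  by rewrite rpredM ?rpredX.
have i1 := sq _ _ ne' (qorder_nrd_int oR R3).
have i2 := sq _ _ n1' (qorder_nrd_int oR R4).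
rewrite -nX in i1; rewrite -nX' in i2.
exists e2; split=> //.
- by apply: (RM) => //; exact: (RM).
- have -> : e2 - e = (e' - e) + (e' * e' - e') * (1 - 2%:R *: e').
    rewrite /e2; rewrite !(mulrBr, mulrBl, mulr1) -!scalerAr.
    move: (e' * e') (e' * e' * e') => u v.
    by apply: quatP; rewrite !qE; ring.
  rewrite scalerDr; apply: zsubD => //; rewrite scalerAl; apply: (RM); last first.
    by apply: (RB) => //; apply: zsubZ => //; exact: natr_int.
  have -> : e' * e' - e' = (qtr e' - 1) *: e' - qnrd e' *: 1.
    by rewrite qsqrE scalerBl scale1r addrAC.
  rewrite scalerBr !scalerA; apply: (RB).
    by apply: zsubZ => //; exact: weak fg _.
  by apply: zsubZ => //; exact: weak fg _.
- have -> : qtr e2 - 1 = qnrd e2 - qnrd (1 - e2).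
    by rewrite [qnrd (1 - e2)]qnrdD qnrdN qnrd1 qconjN mulrN mul1r qtrN qtr_conj; ring.
  by rewrite mulrBr rpredB.
Qed.

End Idempotents.

Lemma quat_ij_ji (a b m n : rat) : m != 0 -> n != 0 ->
  (m *: mkq a b 0 1 0 0) * (n *: mkq a b 0 0 1 0) -
  (n *: mkq a b 0 0 1 0) * (m *: mkq a b 0 1 0 0) <> 0.
Proof.
move=> m0 n0 /(congr1 (@q3 _ _ _)); rewrite /q3 !mxE /= !qE => /eqP.
have -> : m * 0 * (n * 0) + m * 0 * (n * 0) + m * 1 * (n * 1) - m * 0 * (n * 0) -
  (n * 0 * (m * 0) + n * 0 * (m * 0) + n * 0 * (m * 0) - n * 1 * (m * 1)) = 2 * m * n by ring.
by rewrite !mulf_eq0 (negPf m0) (negPf n0).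
Qed.

(** Two transvections carry the e'-part into the e-part: the right-hand side collects only multiples
    of 1 - c tau, of n, and of the defects e e - e and e' e' - e'. *)
Lemma glue_id (a b c tau n : rat) (e e' w w' z : quaternion a b) : e' * e = - (e * e - e) ->
  e' * (e' * (w' * e * w) * e') = tau *: (e' * e') - n *: (e' * z) ->
  e' * ((1 + e' * w' * e) * (1 + e * (- c *: w) * e')) - e' * e' * w' * e =
  (1 - c * tau) *: e' - c *: (tau *: (e' * e' - e') - n *: (e' * z))
     - c *: (e' * e' * w' * (e * e - e) * w * e') + c *: ((e * e - e) * w * e').
Proof.
move=> h2 h1; rewrite !(mulrDr, mulr1, mulrDl, mul1r) -!scalerAr -!scalerAl -!scalerAr.
rewrite ?(mulrDr, mulrDl, mulNr, mulrN) !scaleNr !mulrA h2 ?(mulrDr, mulrDl, mulNr, mulrN) ?mulrA.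
have -> : e' * e' * w' * e * w * e' = tau *: (e' * e') - n *: (e' * z) by rewrite -h1 !mulrA.
move: (e' * e' * w' * e * e * w * e') (e' * e' * w' * e) (e * e * w * e') => u1 u2 u3.
move: (e * w * e') (e' * z) (e' * e') => u4 u5 u6.
by apply: quatP; rewrite !qE; ring.
Qed.

(** * Correcting a lattice at one prime *)

Section Gluing.
Variables (t : int) (b : rat).
Hypothesis t2 : 2 < t.
Let a : rat := t%:~R ^+ 2 - 4.
Local Notation B := (quaternion a b).
Hypothesis division : forall x : B, x != 0 -> qnrd x != 0.
Variable O : set B.
Hypothesis maxO : qmaximal O.
Implicit Types (x y z : B) (M P R I J : set B).

Let oO : qorder O := maxO.1.
Let zO : zsub O := qorder_zsub oO.
Let Oone : O 1. Proof. by case: oO. Qed.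
Let OM x y : O x -> O y -> O (x * y). Proof. by case: oO => _ _ h _; exact: h. Qed.

(** At every prime such a lattice is O times an element of unit norm, by [loc_gen], so it is locally
    indistinguishable from O; no global generator is assumed. *)
Definition norm_one_lattice M := [/\ zsub M, forall u w, O u -> M w -> M (u * w),
  forall w, M w -> qnrd w \is a Num.int &
  forall q, prime q -> exists w, [/\ M w, qnrd w != 0 & local_int q (qnrd w)^-1]].

Let loc_gen M q m : norm_one_lattice M -> prime q -> M m -> qnrd m != 0 ->
  local_int q (qnrd m)^-1 -> forall w, M w -> at_prime q O (w * m^-1).
Proof.
move=> [zM OM' nM _] pq Mm m0 lm w Mw.
apply: (left_lattice_generator maxO pq zM OM' Mm m0) => // v Mv.
by apply: local_intM => //; apply: local_int_int => //; exact: nM.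
Qed.

Let loc_conj q x : prime q -> at_prime q O x -> at_prime q O (qconj x).
Proof. by move=> pq [n [qn h]]; exists n; rewrite -qconjZ; split=> //; exact: qorder_conj. Qed.

Let locOM q x y : prime q -> at_prime q O x -> at_prime q O y -> at_prime q O (x * y).
Proof. by move=> pq; apply: at_primeM => // u v; exact: OM. Qed.

Let locZ q c x : prime q -> local_int q c -> at_prime q O x -> at_prime q O (c *: x).
Proof.
move=> pq lc lx; have -> : c *: x = (c *: 1) * x by rewrite -scalerAl mul1r.
by apply: locOM => //; exact: at_primeZl.
Qed.

Lemma lattice_min_norm P (n : nat) q : prime q -> (0 < n)%N -> zsub P -> P 1 ->
  (forall w, P w -> O (n%:R *: w)) ->
  exists p, [/\ P p, qnrd p != 0 & forall w, P w -> local_int q (qnrd w / qnrd p)].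
Proof.
move=> pq n0 zP P1 nP; have n00 : (n%:R : rat) != 0 by rewrite pnatr_eq0 -lt0n.
have ni w : P w -> exists m : int, n%:R ^+ 2 * qnrd w = m%:~R.
  by move=> /nP /(qorder_nrd_int oO); rewrite qnrdZ => /intrP.
have ex : exists v : nat, `[< exists w (m : int), [/\ P w, w != 0,
     n%:R ^+ 2 * qnrd w = m%:~R & logn q `|m| = v] >].
  have [m em] := ni _ P1; exists (logn q `|m|); apply/asboolP; exists 1, m; split=> //.
  exact: oner_neq0.
case: (ex_minnP ex) => v /asboolP [p [m [Pp p0 em vm]]] minv.
have np := division p0; exists p; split=> // w Pw.
have [->|w0] := eqVneq w 0; first by rewrite qnrd0 mul0r; apply: local_int_int => //; exact: rpred0.
have [k ek] := ni _ Pw; have nw := division w0.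
have m0 : m != 0 by rewrite -(intr_eq0 rat) -em mulf_neq0 ?expf_neq0.
have k0 : k != 0 by rewrite -(intr_eq0 rat) -ek mulf_neq0 ?expf_neq0.
have -> : qnrd w / qnrd p = k%:~R / m%:~R.
  by rewrite -ek -em; field; rewrite np n00.
apply: local_int_div => //; rewrite vm; apply: minv; apply/asboolP.
by exists w, k.
Qed.

Section Step.
Variables (M : set B) (n q : nat).
Hypothesis (nM : norm_one_lattice M) (n0 : (0 < n)%N) (pq : prime q).
Hypothesis (bM : forall w, M w -> O (n%:R *: w)).

Let P : set B := [set x | exists m s, [/\ M m, O s & x = m + s]].
Let zM : zsub M. Proof. by case: nM. Qed.
Let zP : zsub P.
Proof.
split; first by exists 0, 0; split; [exact: zM.1|exact: zO.1|rewrite addr0].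
move=> _ _ [m [s [Mm Os ->]]] [m' [s' [Mm' Os' ->]]].
by exists (m - m'), (s - s'); split; [exact: zM.2|exact: zO.2|rewrite opprD addrACA].
Qed.
Let OP u w : O u -> P w -> P (u * w).
Proof.
move=> Ou [m [s [Mm Os ->]]]; exists (u * m), (u * s).
by split; [case: nM => _ h _ _; exact: h|exact: OM|rewrite mulrDr].
Qed.
Let MP w : M w -> P w.
Proof. by move=> Mw; exists w, 0; split; [|exact: zO.1|rewrite addr0]. Qed.
Let OsP w : O w -> P w.
Proof. by move=> Ow; exists 0, w; split; [exact: zM.1| |rewrite add0r]. Qed.
Let P1 : P 1. Proof. exact: OsP. Qed.
Let bP w : P w -> O (n%:R *: w).
Proof.
move=> [m [s [Mm Os ->]]]; rewrite scalerDr; apply: zsubD => //; first exact: bM.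
by apply: zsubZ => //; exact: natr_int.
Qed.

Let R := right_order P.
Let oR : qorder R.
Proof.
have [_ _ _ [N [N0 hN hN']]] := oO.
apply: (@right_order_qorder t b P (N * n) (n * N)) => //; rewrite ?muln_gt0 ?N0 ?n0 //.
  by move=> x Px; rewrite natrM -scalerA; apply/hN/bP.
move=> x lx y Py; have -> : y * ((n * N)%:R *: x) = (n%:R *: y) * (N%:R *: x).
  by rewrite natrM -!scalerAr -scalerAl scalerA mulrC.
by apply: OsP; apply: OM; [exact: bP|exact: hN'].
Qed.
Let zR : zsub R := qorder_zsub oR.
Let RM x y : R x -> R y -> R (x * y). Proof. by case: oR => _ _ h _; exact: h. Qed.
Let RB x y : R x -> R y -> R (x - y). Proof. by case: oR => _ h _ _; exact: h. Qed.
Let R1 : R 1. Proof. by case: oR. Qed.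
Let RZ c x : c \is a Num.int -> R x -> R (c *: x).
Proof. exact: (@zsubZ _ _ R x c zR). Qed.
Let RD x y : R x -> R y -> R (x + y).
Proof. exact: (@zsubD _ _ R x y zR). Qed.
Let q00 : (q%:R : rat) != 0. Proof. by rewrite pnatr_eq0 -lt0n prime_gt0. Qed.

Let locR x : (forall w, P w -> at_prime q P (w * x)) -> at_prime q R x.
Proof.
move=> h; have [k [m [qm hm]]] := at_prime_multiple x pq oR.
exists m; split=> // w Pw; apply: (at_prime_pow pq zP (e := k)).
  rewrite -scalerAr; apply: zsubZ; [exact: at_prime_zsub|exact: natr_int|exact: h].
by have := hm w Pw; rewrite scalerA mulrC -scalerA -[in X in X -> _]scalerAr.
Qed.

Let zatO := at_prime_zsub pq zO.
Let zatP := at_prime_zsub pq zP.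
Let OsatP x : at_prime q O x -> at_prime q P x. Proof. exact: at_primeS. Qed.
Section Unipotent.
Variable f : nat.
Hypothesis f0 : (0 < f)%N.
Let Q x := R (q%:R ^- f *: x).
Let QD x y : Q x -> Q y -> Q (x + y).
Proof. by rewrite /Q scalerDr; exact: RD. Qed.
Let QB x y : Q x -> Q y -> Q (x - y).
Proof. by rewrite /Q scalerBr; exact: RB. Qed.
Let QMl r x : R r -> Q x -> Q (r * x).
Proof. by rewrite /Q scalerAr; exact: RM. Qed.
Let QMr r x : R r -> Q x -> Q (x * r).
Proof. by move=> Rr Qx; rewrite /Q scalerAl; exact: RM. Qed.

(** (1 - e) w e is nilpotent when e is idempotent. Lifts of e that are idempotent to higher and
    higher precision give the nearly nilpotent elements required by [nilpotent_approximation]. *)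
Lemma unipotent e w : R e -> R w -> q%:R ^- f * (qtr e - 1) \is a Num.int ->
  q%:R ^- f * qnrd e \is a Num.int ->
  exists g, [/\ R g, qnrd g = 1 & R (q%:R ^- f *: (g - 1 - (1 - e) * w * e))].
Proof.
move=> Re Rw te ne; apply: (nilpotent_approximation t2 division oR pq).
  by apply: (RM) => //; apply: (RM) => //; exact: RB.
move=> k; have [e' [Re' ee' te' ne']] := idempotent_lift oR pq f0 Re te ne (2 * k).
exists ((1 - e') * w * e'); split.
- by apply: (RM) => //; apply: (RM) => //; exact: RB.
- have -> : (1 - e') * w * e' - (1 - e) * w * e =
     (1 - e') * w * (e' - e) - (e' - e) * (w * e).
    rewrite mulrBr mulrA !mulrBl !mul1r.
    move: (w * e') (w * e) (e' * w * e') (e' * w * e) (e * w * e) => u1 u2 u3 u4 u5.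
    by apply: quatP; rewrite !qE; ring.
  by apply: (QB); [apply: (QMl) => //; apply: (RM) => //; exact: RB|apply: (QMr) => //; exact: RM].
- have -> : qtr ((1 - e') * w * e') = qnrd e' * qtr w - (qtr e' - 1) * qtr (w * e').
    rewrite (qtrMC ((1 - e') * w) e') [e' * _]mulrA.
    have -> : e' * (1 - e') = qnrd e' *: 1 - (qtr e' - 1) *: e'.
      by rewrite mulrBr mulr1 qsqrE; apply: quatP; rewrite !qE; ring.
    by rewrite mulrBl -!scalerAl mul1r qtrB !qtrZ [qtr (e' * w)]qtrMC.
  rewrite mulrBr !mulrA; apply: rpredB; apply: rpredM => //; apply: (qorder_tr_int oR) => //.
  exact: RM.
- rewrite !qnrdM mulrA mulrC mulrA; apply: rpredM.
    by rewrite mulrC.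
  by apply: rpredM; apply: (qorder_nrd_int oR) => //; exact: RB.
Qed.

End Unipotent.

Let subD (x y z : B) : x - (y + z) = x - y - z. Proof. by rewrite opprD addrA. Qed.

Let split_id (x g1 g2 a1 a2 v : B) : x * (g1 * g2) - v =
  x * ((g1 - a1) * g2 + a1 * (g2 - a2)) + (x * (a1 * a2) - v).
Proof. by rewrite addrA -mulrDr mulrBl mulrBr addrA subrK subrK. Qed.

Let final_id (v e g w : B) : v * g = v * e * g + (v * ((1 - e) * g - w) + v * w).
Proof. by rewrite mulrBr subrK mulrBl mul1r mulrBr mulrA addrC subrK. Qed.

Let peirce (e z : B) :
  z = e * z * e + (1 - e) * z * (1 - e) + ((1 - e) * z * e + e * z * (1 - e)).
Proof.
rewrite !(mulrBl, mulrBr, mul1r, mulr1).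
move: (e * z * e) (e * z) (z * e) => u1 u2 u3.
by apply: quatP; rewrite !qE; ring.
Qed.

Let decomp_id (c1 c2 c3 c4 : rat) (e1 u1 u2 u3 : B) :
  c1 *: e1 - c3 *: u3 + (c2 *: (1 - e1) - c4 *: u3) + (u1 + u2) =
  c2 *: 1 + (c1 - c2) *: e1 + (u1 + u2 - c3 *: u3 - c4 *: u3).
Proof. by apply: quatP; rewrite !qE; ring. Qed.

Let comm_id (al be al' be' c : rat) (e r r' : B) :
  (al *: 1 + be *: e + c *: r) * (al' *: 1 + be' *: e + c *: r') -
  (al' *: 1 + be' *: e + c *: r') * (al *: 1 + be *: e + c *: r) =
  c *: (be *: (e * r' - r' * e) + be' *: (r * e - e * r) + c *: (r * r' - r' * r)).
Proof. by apply: quatP; rewrite ?qE /qmul ?qE; ring. Qed.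

(** At q the lattice P = M + O equals O p. Writing p = m0 + s0 gives e = p^-1 s0 with P e inside O
    and P (1 - e) inside M; it is an idempotent of the right order R of P modulo q^f, where nrd p is
    q^-f up to a unit. An element g of R of norm 1 with (1 - e) g in R e modulo q^f then moves M
    into O at q, while M g stays inside P at the other primes. *)
Lemma lattice_step : exists g, [/\ qnrd g = 1, forall w, M w -> P (w * g) &
  forall w, M w -> at_prime q O (w * g)].
Proof.
have [p [Pp np minp]] := lattice_min_norm pq n0 zP P1 bP.
have pu := qunitP np.
have locP := left_lattice_generator maxO pq zP OP Pp np minp.
set c := qnrd p in np minp.
have lc1 : local_int q c^-1 by have := minp _ P1; rewrite qnrd1 mul1r.
have c10 : c^-1 != 0 by rewrite invr_eq0.
have [f [hf1 hf2]] := local_int_val pq lc1 c10; rewrite invrK in hf2.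
have qf0 : (q%:R ^+ f : rat) != 0 by rewrite expf_neq0.
have pV : at_prime q O p^-1 by have := locP _ P1; rewrite mul1r.
have qfP w : P w -> at_prime q O (q%:R ^+ f *: w).
  move=> Pw; have -> : q%:R ^+ f *: w = (w * p^-1) * ((q%:R ^+ f * c) *: qconj p^-1).
    rewrite qinvE // qconjZ qconjK scalerA -/c mulfK // -scalerAr -mulrA.
    by rewrite -scalerAl qconj_mul scalerA mulVf // scale1r mulr1.
  by apply: locOM => //; [exact: locP|apply: locZ => //; exact: loc_conj].
(* For f = 0 the lattice P is already inside O at q. *)
case: (posnP f) => f0.
  exists 1; split; first exact: qnrd1; first by move=> w Mw; rewrite mulr1; exact: MP.
  by move=> w Mw; rewrite mulr1; have := qfP _ (MP Mw); rewrite f0 scale1r.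
have [m0 [s0 [Mm0 Os0 pE]]] := Pp.
have [_ OMM nMi uM] := nM.
pose e := p^-1 * s0.
have e'E : 1 - e = p^-1 * m0.
  by apply: (mulrI pu); rewrite mulrBr mulr1 /e !mulrA divrr // !mul1r {1}pE addrK.
have Pe w : P w -> at_prime q O (w * e).
  by move=> Pw; rewrite mulrA; apply: locOM => //; [exact: locP|exact: at_prime_sub].
have [m' [qm' Rm']] : at_prime q R e by apply: locR => w /Pe; exact: OsatP.
(* e lies in R only locally at q. A multiple k of m' congruent to 1 modulo q^f makes k e a genuine
   element of R with the same properties modulo q^f. *)
have [yk hy] := local_unit_inverse pq f qm'.
set k : rat := m'%:R * yk%:R in hy.
have ik : k \is a Num.int by rewrite rpredM ?natr_int.
have [e1 e1E] : exists e1, e1 = k *: e by exists (k *: e).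
have Re1 : R e1 by rewrite e1E /k mulrC -scalerA; apply: RZ => //; exact: natr_int.
have ne : local_int q (q%:R ^- f * qnrd e).
  rewrite /e qnrdM qnrdV // mulrA [_ * c^-1]mulrC; apply: local_intM => //.
  by apply: local_int_int => //; exact: (qorder_nrd_int oO).
have ne' : local_int q (q%:R ^- f * qnrd (1 - e)).
  rewrite e'E qnrdM qnrdV // mulrA [_ * c^-1]mulrC; apply: local_intM => //.
  by apply: local_int_int => //; exact: nMi.
have te : local_int q (q%:R ^- f * (qtr e - 1)).
  have -> : qtr e - 1 = qnrd e - qnrd (1 - e).
    by rewrite [qnrd (1 - e)]qnrdD qnrdN qnrd1 qconjN mulrN mul1r qtrN qtr_conj; ring.
  by rewrite mulrBr; exact: local_intB.
have ne1 : q%:R ^- f * qnrd e1 \is a Num.int.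
  apply: (local_int_pow pq (e := f)).
    rewrite e1E qnrdZ mulrCA; apply: local_intM => //; apply: local_int_int => //.
    exact: rpredX.
  by rewrite mulrA divff // mul1r; exact: (qorder_nrd_int oR).
have te1 : q%:R ^- f * (qtr e1 - 1) \is a Num.int.
  apply: (local_int_pow pq (e := f)).
    have -> : q%:R ^- f * (qtr e1 - 1) = k * (q%:R ^- f * (qtr e - 1)) + q%:R ^- f * (k - 1).
      by rewrite e1E qtrZ; ring.
    apply: local_intD => //; last exact: local_int_int.
    by apply: local_intM => //; exact: local_int_int.
  rewrite mulrA divff // mul1r; apply: rpredB; last exact: rpred1.
  exact: (qorder_tr_int oR).
have conjR d : at_prime q O d -> at_prime q R (p^-1 * d * p).
  move=> [l [ql Ol]]; apply: (at_primeZ pq ql); apply: locR => w Pw.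
  have -> : w * (l%:R *: (p^-1 * d * p)) = (w * p^-1 * (l%:R *: d)) * p.
    by rewrite -!scalerAr -scalerAl !mulrA.
  have : at_prime q O (w * p^-1 * (l%:R *: d)).
    by apply: locOM => //; [exact: locP|exact: at_prime_sub].
  move=> [l' [ql' Ol']]; exists l'; split=> //.
  by rewrite scalerAl; exact: OP.
(* R is conjugate to the maximal order O at q, so it is saturated there too. *)
have satR y1 : R y1 -> q%:R ^- 2 * qnrd y1 \is a Num.int ->
    (forall d, R d -> q%:R^-1 * qtr (y1 * d) \is a Num.int) -> R (q%:R^-1 *: y1).
  move=> Ry ny ty; have [l [ql Ol]] : at_prime q O (p * y1 * p^-1) by apply/locP/Ry.
  set y2 := l%:R *: (p * y1 * p^-1) in Ol.
  have Oy2 : O (q%:R^-1 *: y2).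
    apply: (qmaximal_saturated maxO) => //; first exact: prime_gt0.
      by rewrite qnrdZ qnrd_conjg // mulrCA rpredM // rpredX // natr_int.
    move=> d Od; have [l' [ql' Rd]] := conjR d (at_prime_sub pq Od).
    have := ty _ Rd.
    have -> : qtr (y1 * (l'%:R *: (p^-1 * d * p))) = l'%:R * qtr (p * y1 * p^-1 * d).
      rewrite -scalerAr qtrZ; congr (_ * _).
      by rewrite [y1 * _]mulrA [LHS]qtrMC !mulrA.
    move=> h; apply: (local_int_pow pq (e := 1)).
      rewrite /y2 -scalerAl qtrZ mulrCA; apply: local_intM => //.
        by apply: local_int_int => //; exact: natr_int.
      by exists l'; split=> //; rewrite mulrCA.
    by rewrite expr1 mulrA divff // mul1r; apply: (qorder_tr_int oO); exact: OM.
  apply: (at_prime_pow pq zR (e := 1)); last by rewrite expr1 scalerA divff // scale1r.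
  apply: (at_primeZ pq ql).
  have -> : l%:R *: (q%:R^-1 *: y1) = p^-1 * (q%:R^-1 *: y2) * p.
    rewrite /y2 -!scalerAr -!scalerAl -!mulrA mulVr // mulr1 mulKr //.
    by rewrite !scalerA mulrC.
  by apply: conjR; exact: at_prime_sub.
pose e2 := 1 - e1.
have Re2 : R e2 by exact: RB.
have n2E : qnrd e2 = qnrd e1 - (qtr e1 - 1).
  by rewrite qnrdD qnrdN qnrd1 qconjN mulrN mul1r qtrN qtr_conj; ring.
have ne2 : q%:R ^- f * qnrd e2 \is a Num.int by rewrite n2E mulrBr; exact: rpredB.
have te2 : q%:R ^- f * (qtr e2 - 1) \is a Num.int.
  have -> : qtr e2 - 1 = - (qtr e1 - 1) by rewrite qtrB qtr1; ring.
  by rewrite mulrN rpredN.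
have q1f (r : rat) : q%:R ^- f * r \is a Num.int -> q%:R^-1 * r \is a Num.int.
  move=> h; have -> : q%:R^-1 * r = q%:R ^+ f.-1 * (q%:R ^- f * r).
    have -> : (q%:R : rat) ^+ f = q%:R * q%:R ^+ f.-1 by rewrite -exprS prednK.
    by field; rewrite q00 expf_neq0.
  by apply: rpredM => //; rewrite -natrX natr_int.
(* If every such trace were divisible by q, saturation would make the off-diagonal Peirce components
   divisible by q. Then R = Z + Z e1 + q R, and by iteration all commutators of R would be
   infinitely divisible by q, against noncommutativity. *)
have [w [w' [Rw Rw' ntau]]] : exists w w', [/\ R w, R w' &
    ~ q%:R^-1 * qtr (e2 * w' * e1 * w) \is a Num.int].
  apply: contrapT => none.
  have all1 w w' : R w -> R w' -> q%:R^-1 * qtr (e2 * w' * e1 * w) \is a Num.int.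
    by move=> Rw Rw'; apply: contrapT => h; apply: none; exists w, w'.
  have i2 (r s u : rat) : q%:R^-1 * r \is a Num.int -> q%:R^-1 * s \is a Num.int ->
     u \is a Num.int -> q%:R ^- 2 * (r * u * s) \is a Num.int.
    move=> hr hs hu; have -> : q%:R ^- 2 * (r * u * s) = (q%:R^-1 * r) * u * (q%:R^-1 * s).
      by rewrite expr2; field.
    exact: rpredM (rpredM hr hu) hs.
  have off1 z : R z -> R (q%:R^-1 *: (e2 * z * e1)).
    move=> Rz; apply: satR => //; first by apply: (RM) => //; exact: RM.
      by rewrite !qnrdM; apply: i2; [exact: q1f|exact: q1f|exact: (qorder_nrd_int oR)].
    by move=> d Rd; exact: all1.
  have off2 z : R z -> R (q%:R^-1 *: (e1 * z * e2)).
    move=> Rz; apply: satR => //; first by apply: (RM) => //; exact: RM.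
      by rewrite !qnrdM; apply: i2; [exact: q1f|exact: q1f|exact: (qorder_nrd_int oR)].
    move=> d Rd; have -> : qtr (e1 * z * e2 * d) = qtr (e2 * d * e1 * z).
      by rewrite -mulrA qtrMC !mulrA.
    exact: all1.
  have decomp z : R z -> exists al be r, [/\ al \is a Num.int, be \is a Num.int, R r &
      z = al *: 1 + be *: e1 + q%:R *: r].
    move=> Rz; pose al := qtr (e2 * z); pose be := qtr (e1 * z) - al.
    pose r := q%:R^-1 *: (e2 * z * e1) + q%:R^-1 *: (e1 * z * e2)
        - (q%:R^-1 * qnrd e1) *: qconj z - (q%:R^-1 * qnrd e2) *: qconj z.
    have ial : al \is a Num.int by apply: (qorder_tr_int oR); exact: RM.
    have ie1 : qtr (e1 * z) \is a Num.int by apply: (qorder_tr_int oR); exact: RM.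
    exists al, be, r; split=> //; first by rewrite rpredB.
      have Rcz := qorder_conj oR Rz.
      apply: RB; last by apply: RZ => //; exact: q1f.
      apply: RB; last by apply: RZ => //; exact: q1f.
      by apply: RD; [exact: off1|exact: off2].
    rewrite /r !(scalerBr, scalerDr) !scalerA !mulrA !divff // !mul1r !scale1r /be.
    have h3 := peirce e1 z; rewrite -/e2 in h3.
    rewrite {1}h3 (qmul_sandwich e1 z) (qmul_sandwich e2 z) -/al.
    move: (e2 * z * e1) (e1 * z * e2) (qconj z) (qtr (e1 * z)) => u1 u2 u3 c1.
    move: (qnrd e1) (qnrd e2) => c3 c4; rewrite /e2.
    exact: decomp_id.
  have comm N : forall z z', R z -> R z' -> R (q%:R ^- N *: (z * z' - z' * z)).
    elim: N => [|N IH] z z' Rz Rz'.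
      by rewrite expr0 invr1 scale1r; apply: RB; exact: RM.
    have [al [be [r [ial ibe Rr ->]]]] := decomp _ Rz.
    have [al' [be' [r' [ial' ibe' Rr' ->]]]] := decomp _ Rz'.
    have -> : q%:R ^- N.+1 *: ((al *: 1 + be *: e1 + q%:R *: r) * (al' *: 1 + be' *: e1 + q%:R *: r')
        - (al' *: 1 + be' *: e1 + q%:R *: r') * (al *: 1 + be *: e1 + q%:R *: r)) =
      be *: (q%:R ^- N *: (e1 * r' - r' * e1)) + be' *: (q%:R ^- N *: (r * e1 - e1 * r))
       + q%:R *: (q%:R ^- N *: (r * r' - r' * r)).
      have sc : q%:R ^- N.+1 * q%:R = q%:R ^- N :> rat.
        by rewrite exprS invfM mulrC mulrA divff ?mul1r.
      rewrite comm_id [LHS]scalerA sc !scalerDr !scalerA.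
      by rewrite ![q%:R ^- N * _]mulrC.
    apply: RD; last by apply: RZ; [exact: natr_int|exact: IH].
    by apply: RD; apply: RZ => //; exact: IH.
  have [N [N0 hN]] := qorder_multiple (mkq a b 0 1 0 0) oR.
  have [N' [N'0 hN']] := qorder_multiple (mkq a b 0 0 1 0) oR.
  have := qorder_infinitely_divisible oR pq (fun k => comm k _ _ hN hN').
  by apply: quat_ij_ji; rewrite pnatr_eq0 -lt0n.
pose tau := qtr (e2 * w' * e1 * w); rewrite -/tau in ntau.
have Rww : R (w' * e1 * w) by apply: (RM) => //; exact: RM.
have itau : tau \is a Num.int.
  by rewrite /tau -!mulrA mulrA in Rww *; apply: (qorder_tr_int oR); apply: RM.
have [c1 [ic1 hc1]] : exists c1 : rat, c1 \is a Num.int /\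
    q%:R ^- f * (1 - c1 * tau) \is a Num.int.
  case/intrP: itau ntau => ti eti; rewrite eti => nti.
  have qti : ~~ (q %| `|ti|)%N.
    apply/negP => /dvdnP [j ej]; apply: nti; rewrite [ti]intEsg ej rmorphM /= PoszM rmorphM /=.
    rewrite mulrC -!mulrA mulfV ?mulr1 ?pnatr_eq0 -?lt0n ?prime_gt0 //.
    by rewrite rpredM ?intr_int // natr_int.
  have [yy hyy] := local_unit_inverse pq f qti.
  exists ((sgz ti)%:~R * yy%:R); split; first by rewrite rpredM ?intr_int ?natr_int.
  have -> : (sgz ti)%:~R * yy%:R * ti%:~R = `|ti|%N%:R * yy%:R :> rat.
    by rewrite mulrAC -rmorphM /= -abszEsg.
  by rewrite -rpredN -mulrN opprB.
have [g1 [Rg1 ng1 Qg1]] := unipotent f0 Re1 Rw' te1 ne1.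
have Rcw : R (- c1 *: w) by apply: RZ => //; rewrite rpredN.
have [g2 [Rg2 ng2 Qg2]] := unipotent f0 Re2 Rcw te2 ne2.
pose Q := [set x | R (q%:R ^- f *: x)].
have QD x y : Q x -> Q y -> Q (x + y) by rewrite /Q /= scalerDr; exact: RD.
have QB x y : Q x -> Q y -> Q (x - y) by rewrite /Q /= scalerBr; exact: RB.
have QMl r x : R r -> Q x -> Q (r * x) by rewrite /Q /= scalerAr; exact: RM.
have QMr r x : R r -> Q x -> Q (x * r) by move=> Rr Qx; rewrite /Q /= scalerAl; exact: RM.
have QZ r x : q%:R ^- f * r \is a Num.int -> R x -> Q (r *: x).
  by move=> hr Rx; rewrite /Q /= scalerA; exact: RZ.
have d1 : Q (e1 * e1 - e1).
  have -> : e1 * e1 - e1 = (qtr e1 - 1) *: e1 - qnrd e1 *: 1.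
    by rewrite qsqrE scalerBl scale1r addrAC.
  by apply: (QB); exact: QZ.
have d2 : Q (e2 * e2 - e2).
  have -> : e2 * e2 - e2 = (qtr e2 - 1) *: e2 - qnrd e2 *: 1.
    by rewrite qsqrE scalerBl scale1r addrAC.
  by apply: (QB); exact: QZ.
pose u := e2 * e2 * w'.
have Ru : R u by apply: (RM) => //; exact: RM.
(* With e2 = 1 - e1 and c1 inverse to tau modulo q^f, the product g1 g2 carries the e2-part into R
   e1 modulo q^f. *)
have Qmain : Q (e2 * (g1 * g2) - u * e1).
  pose a1 := 1 + e2 * w' * e1; pose a2 := 1 + e1 * (- c1 *: w) * e2.
  have Ra1 : R a1 by apply: RD => //; apply: (RM) => //; exact: RM.
  have Qa1 : Q (g1 - a1).
    rewrite /Q /= (_ : g1 - a1 = g1 - 1 - (1 - e1) * w' * e1); first exact: Qg1.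
    exact: subD.
  have Qa2 : Q (g2 - a2).
    rewrite /Q /= (_ : g2 - a2 = g2 - 1 - (1 - e2) * (- c1 *: w) * e2); first exact: Qg2.
    have e21 : 1 - e2 = e1 by rewrite /e2 opprB addrC subrK.
    by rewrite /a2 e21; exact: subD.
  rewrite (split_id e2 g1 g2 a1 a2).
  apply: (QD).
    by apply: (QMl) => //; apply: (QD); [exact: QMr|exact: QMl].
  rewrite (@glue_id a b c1 tau (qnrd e2) e1 e2 w w' (qconj (w' * e1 * w))); first last.
  - by rewrite (qmul_sandwich e2 (w' * e1 * w)) mulrBr -!scalerAr /tau !mulrA.
  - by rewrite /e2 mulrBl mul1r opprB.
  have Qc x : Q x -> Q (c1 *: x).
    by move=> h; rewrite /Q /= scalerA mulrC -scalerA; apply: RZ.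
  apply: (QD); last by apply: (Qc); apply: (QMr) => //; exact: QMr.
  apply: (QB); last by apply: (Qc); apply: (QMr) => //; apply: (QMr) => //; exact: QMl.
  apply: (QB); first exact: QZ.
  apply: (Qc); apply: (QB).
    by rewrite /Q /= scalerA mulrC -scalerA; apply: RZ.
  by apply: QZ => //; apply: (RM) => //; exact: (qorder_conj oR).
exists (g1 * g2); have Rg : R (g1 * g2) by exact: RM.
have qfPat x : at_prime q P x -> at_prime q O (q%:R ^+ f *: x).
  move=> [n1 [qn1 hn1]]; apply: (at_primeZ pq qn1).
  by rewrite scalerA mulrC -scalerA; exact: qfP.
have PR x r : at_prime q P x -> R r -> at_prime q P (x * r).
  by move=> [n1 [qn1 hn1]] Rr; exists n1; split=> //; rewrite scalerAl; exact: Rr.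
split; first by rewrite qnrdM ng1 ng2 mulr1.
  by move=> v Mv; apply: (Rg); exact: MP.
move=> v Mv; have Pv := MP Mv.
have [l1 [lM ql1]] : exists l1 : nat, M (l1%:R *: (v * e)) /\ ~~ (q %| l1)%N.
  have [l1 [ql1 Ol1]] := locP _ Pv; exists l1; split=> //.
  have -> : l1%:R *: (v * e) = l1%:R *: v - (l1%:R *: (v * p^-1)) * m0.
    have -> : (l1%:R *: (v * p^-1)) * m0 = l1%:R *: (v * (1 - e)).
      by rewrite e'E -scalerAl !mulrA.
    by rewrite mulrBr mulr1 scalerBr opprB addrC subrK.
  by apply: zM.2; [apply: zsubZ => //; exact: natr_int|exact: OMM].
(* v e lies in both M and O at q, and conj p = conj m0 + conj s0; each summand is paired inside its
   own lattice. The outcome is that v e lies in q^f P. *)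
have zp : at_prime q O ((v * e) * qconj p).
  rewrite pE qconjD mulrDr; apply: zsubD => //; last first.
    by apply: locOM; [|exact: Pe|apply: at_prime_sub => //; exact: qorder_conj].
  apply: (at_primeZ pq ql1).
  have [m [Mm nm lm]] := uM _ pq.
  have mu := qunitP nm.
  have h1 := loc_gen nM pq Mm nm lm lM.
  have h2 := loc_conj pq (loc_gen nM pq Mm nm lm Mm0).
  have -> : l1%:R *: (v * e * qconj m0) =
     ((l1%:R *: (v * e)) * m^-1) * (qnrd m *: qconj (m0 * m^-1)).
    rewrite qconjM -scalerAr [qconj m^-1](_ : _ = (qnrd m)^-1 *: m); last first.
      by rewrite qinvE // qconjZ qconjK.
    rewrite -[_ *: m * _]scalerAl -[X in qnrd m *: X]scalerAr scalerA mulfV // scale1r.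
    rewrite -!scalerAl; congr (_ *: _).
    by rewrite !mulrA divrK.
  by apply: locOM => //; apply: locZ => //; apply: local_int_int => //; exact: nMi.
pose y0 := (c^-1 / q%:R ^+ f) *: ((v * e * qconj p) * p).
have Py0 : at_prime q P y0.
  have [n1 [qn1 hn1]] := locZ pq hf1 zp; exists n1; split=> //.
  have -> : n1%:R *: y0 = (n1%:R *: ((c^-1 / q%:R ^+ f) *: (v * e * qconj p))) * p.
    by rewrite /y0 -!scalerAl.
  exact: OP.
have vE : v * e = q%:R ^+ f *: y0.
  rewrite /y0 scalerA mulrCA mulfV // mulr1 -mulrA qconj_mul -scalerAr mulr1.
  by rewrite scalerA mulVf // scale1r.
have -> : v * (g1 * g2) = q%:R ^+ f *: (k *: (y0 * (g1 * g2)))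
    + (q%:R ^+ f *: (v * (q%:R ^- f *: (e2 * (g1 * g2) - u * e1))) + k *: ((v * u) * e)).
  have e3 : q%:R ^+ f *: (k *: (y0 * (g1 * g2))) = v * e1 * (g1 * g2).
    by rewrite scalerA mulrC -scalerA [q%:R ^+ f *: _]scalerAl -vE e1E -scalerAr -scalerAl.
  have e4 (x : B) : q%:R ^+ f *: (v * (q%:R ^- f *: x)) = v * x.
    by rewrite -scalerAr scalerA mulfV // scale1r.
  have e5 : k *: (v * u * e) = v * (u * e1) by rewrite [v * (u * _)]mulrA e1E -[in RHS]scalerAr.
  rewrite e3 e4 e5; exact: final_id.
apply: zsubD => //.
  by apply: qfPat; apply: zsubZ => //; exact: PR.
apply: zsubD => //; first by apply: qfP; apply: Qmain.
by apply: zsubZ => //; apply: Pe; apply: Ru.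
Qed.

End Step.
End Gluing.

(** * Conjugating an integral element into a maximal order *)

Section ConjugateIntoOrder.
Variables (t : int) (b : rat).
Hypothesis t2 : 2 < t.
Let a : rat := t%:~R ^+ 2 - 4.
Local Notation B := (quaternion a b).
Hypothesis division : forall x : B, x != 0 -> qnrd x != 0.
Variable O : set B.
Hypothesis maxO : qmaximal O.
Implicit Types (x y z : B) (M P R I J : set B).

Let oO : qorder O := maxO.1.
Let zO : zsub O := qorder_zsub oO.
Let Oone : O 1. Proof. by case: oO. Qed.
Let OM x y : O x -> O y -> O (x * y). Proof. by case: oO => _ _ h _; exact: h. Qed.

(** Induction on n: [lattice_step] at the least prime factor removes that prime from n. *)
Lemma norm_one_lattice_sub (n : nat) M : norm_one_lattice O M -> (0 < n)%N ->
  (forall w, M w -> O (n%:R *: w)) ->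
  exists g, qnrd g = 1 /\ forall w, M w -> O (w * g).
Proof.
elim/ltn_ind: n M => n IH M nM n0 bM.
have [n1|n1] := leqP n 1.
  exists 1; split=> [|w Mw]; first exact: qnrd1.
  have e1 : n = 1%N by apply/eqP; rewrite eqn_leq n1 n0.
  by have := bM _ Mw; rewrite e1 scale1r mulr1.
have pq := pdiv_prime n1; set q := pdiv n in pq.
have [g [ng Pg Og]] := lattice_step t2 division maxO nM n0 pq bM.
have [m cm em] := pfactor_coprime pq n0.
have gu := qunitP (x := g); rewrite ng oner_neq0 in gu; have {}gu := gu isT.
have m0 : (0 < m)%N by case: m cm em => // _ em; move: n0; rewrite em.
have l0 : (0 < logn q n)%N by rewrite logn_gt0 mem_primes pq n0 pdiv_dvd.
have mn : (m < n)%N by rewrite [X in (_ < X)%N]em -[X in (X < _)%N]muln1 ltn_pmul2l // -(expn0 q) ltn_exp2l ?prime_gt1.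
have [zM OMM nMi uM] := nM.
pose M' : set B := [set w | M (w * g^-1)].
have nM' : norm_one_lattice O M'.
  split.
  - split; first by rewrite /M' /= mul0r; exact: zM.1.
    by move=> x y; rewrite /M' /= mulrBl; exact: zM.2.
  - by move=> u w Ou; rewrite /M' /= -mulrA; exact: OMM.
  - by move=> w /nMi; rewrite qnrdM qnrdV ?ng ?oner_neq0 // invr1 mulr1.
  - move=> p pp; have [w [Mw nw lw]] := uM _ pp; exists (w * g).
    by rewrite /M' /= mulrK // qnrdM ng mulr1.
have bM' w : M' w -> O (m%:R *: w).
  move=> Mw; have := Og _ Mw; rewrite divrK // => ow.
  have [m' [s [Mm Os e]]] := Pg _ Mw; rewrite divrK // in e.
  apply: (at_prime_pow pq zO (e := logn q n)).
    by apply: zsubZ => //; exact: at_prime_zsub.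
  rewrite scalerA -natrX -natrM mulnC -em e scalerDr; apply: zsubD => //; first exact: bM.
  by apply: zsubZ => //; exact: natr_int.
have [g' [ng' Og']] := IH m mn M' nM' m0 bM'.
exists (g * g'); split=> [|w Mw]; first by rewrite qnrdM ng ng' mulr1.
by rewrite mulrA; apply: Og'; rewrite /M' /= mulrK.
Qed.

(** Inclusion already gives equality: with w0 in M of unit norm at q, g^-1 = nrd(w0)^-1 conj(w0 g)
    w0 lies in M at q because w0 g lies in O. *)
Lemma norm_one_lattice_principal (n : nat) M : norm_one_lattice O M -> (0 < n)%N ->
  (forall w, M w -> O (n%:R *: w)) ->
  exists g, qnrd g = 1 /\ forall w, M w <-> O (w * g).
Proof.
move=> nM n0 bM; have [g [ng hg]] := norm_one_lattice_sub nM n0 bM.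
exists g; split=> // w; split; first exact: hg.
have gu := qunitP (x := g); rewrite ng oner_neq0 in gu; have {}gu := gu isT.
have [zM OMM nMi uM] := nM.
suff M1 : M g^-1 by move=> Ow; have := OMM _ _ Ow M1; rewrite mulrK.
have [k [k0 Ok]] := qorder_multiple (g^-1 * 1) oO; rewrite mulr1 in Ok.
apply: (at_prime_all zM).
  have [w0 [Mw0 nw0 _]] := uM 2%N isT.
  have [l [l0 Ol]] := qorder_multiple (g^-1 * w0^-1) oO.
  exists l; split=> //; have := OMM _ _ Ol Mw0.
  by rewrite -scalerAl divrK // qunitP.
move=> q pq; have [w0 [Mw0 nw0 lw0]] := uM q pq.
have w0u := qunitP nw0.
have Ow0 := hg _ Mw0.
have [l [ql hl]] := lw0; exists l; split=> //.
have -> : l%:R *: g^-1 = ((l%:R / qnrd w0) *: qconj (w0 * g)) * w0.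
  rewrite -scalerAl -scalerA; congr (_ *: _).
  rewrite qconjM -mulrA qconj_mul -scalerAr mulr1 scalerA mulVf // scale1r.
  by rewrite qinvE ng ?oner_neq0 // invr1 scale1r.
apply: OMM => //; apply: zsubZ => //; exact: qorder_conj.
Qed.

(** I = O + O x is stable under right multiplication by x. Dividing it by an element whose norm
    generates the norms of I produces a norm one lattice, so I = O d, and stability says that d x
    lies in O d. *)
Lemma conj_into_maximal x : qnrd x = 1 -> qtr x \is a Num.int ->
  exists d, qnrd d != 0 /\ O (d * x * d^-1).
Proof.
move=> nx tx; pose I : set B := [set w | exists u v, [/\ O u, O v & w = u + v * x]].
have [N [N0 ON]] := qorder_multiple (qconj x) oO.
have N00 : (N%:R : rat) != 0 by rewrite pnatr_eq0 -lt0n.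
have nI w : I w -> N%:R * qnrd w \is a Num.int.
  move=> [u [v [Ou Ov ->]]]; rewrite qnrdD qnrdM nx mulr1 mulrDr; apply: rpredD.
    by apply: rpredM; [exact: natr_int|apply: rpredD; exact: (qorder_nrd_int oO)].
  have -> : N%:R * qtr (u * qconj (v * x)) = qtr (u * (N%:R *: qconj x) * qconj v).
    by rewrite qconjM -scalerAr -scalerAl qtrZ mulrA.
  apply: (qorder_tr_int oO); apply: (OM); last exact: qorder_conj.
  exact: OM.
have I1 : I 1 by exists 1, 0; split=> //; [exact: zO.1|rewrite mul0r addr0].
have Ix : I x by exists 0, 1; split=> //; [exact: zO.1|rewrite mul1r add0r].
have IM u w : O u -> I w -> I (u * w).
  move=> Ou [u1 [v1 [Ou1 Ov1 ->]]]; exists (u * u1), (u * v1).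
  by split; [exact: OM|exact: OM|rewrite mulrDr mulrA].
have zI : zsub I.
  split; first by exists 0, 0; split; [exact: zO.1|exact: zO.1|rewrite mul0r addr0].
  move=> _ _ [u [v [Ou Ov ->]]] [u' [v' [Ou' Ov' ->]]].
  exists (u - u'), (v - v'); split; [exact: zO.2|exact: zO.2|].
  by rewrite mulrBl opprD addrACA.
have IMx w : I w -> I (w * x).
  move=> [u [v [Ou Ov ->]]]; exists (- v), (u + qtr x *: v); split.
  - exact: zsubN.
  - by apply: zsubD => //; exact: zsubZ.
  - rewrite mulrDl -mulrA qsqrE nx scale1r mulrBr mulr1 mulrDl -scalerAl -scalerAr.
    by rewrite addrC addrAC addrC; congr (_ + _); rewrite addrC.
pose dv (g : nat) := `[< (0 < g)%N /\ forall w, I w -> N%:R * qnrd w / g%:R \is a Num.int >].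
have dv1 : exists g, dv g.
  by exists 1%N; apply/asboolP; split=> // w /nI; rewrite divr1.
have dvb g : dv g -> (g <= N)%N.
  move/asboolP => [g0 /(_ _ I1)]; rewrite qnrd1 mulr1 => /intrP [m em].
  have g00 : (g%:R : rat) != 0 by rewrite pnatr_eq0 -lt0n.
  have : (N%:R : rat) = m%:~R * g%:R by rewrite -em divfK.
  case: m {em} => m em; last first.
    have : (0 : rat) < N%:R by rewrite ltr0n.
    by rewrite em pmulr_lgt0 ?ltr0n // ltr0z.
  move: em; rewrite -[_%:~R]/(m%:R) -natrM => /eqP; rewrite eqr_nat => /eqP eN.
  by rewrite eN leq_pmull //; move: N0; rewrite eN muln_gt0 => /andP [].
case: (ex_maxnP dv1 dvb) => g /asboolP [g0 hg] maxg.
have g00 : (g%:R : rat) != 0 by rewrite pnatr_eq0 -lt0n.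
(* r is the greatest common divisor of the norms of elements of I. As a > 0, [norm_value_universal]
   provides an element of norm r. *)
pose r : rat := g%:R / N%:R.
have r0 : 0 < r by rewrite divr_gt0 ?ltr0n.
have rn0 : r != 0 by rewrite gt_eqF.
have a0 : 0 < a by rewrite /a subr_gt0 -rmorphXn /= -[4]/((4%:Z)%:~R) ltr_int; nia.
have b0 : b != 0.
  have : mkq a b 0 0 1 0 != 0.
    by apply/eqP => /(congr1 (@q2 _ _ _)); rewrite /q2 !mxE /= => /eqP; rewrite oner_eq0.
  move/division; apply: contra_neq => b0; rewrite /qnrd !qE b0; ring.
have : norm_value a b r.
  by apply: norm_value_universal => //; [rewrite gt_eqF|case=> a1 _; move: a0; rewrite ltNge ltW].
move=> [y0 [y1 [y2 [y3 er]]]].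
pose be := mkq a b y0 y1 y2 y3.
have nbe : qnrd be = r by rewrite er /be /qnrd !qE.
have beu : be \is a GRing.unit by apply: qunitP; rewrite nbe.
pose M : set B := [set w | I (w * be)].
have nM : norm_one_lattice O M.
  split.
  - split; first by rewrite /M /= mul0r; exact: zI.1.
    by move=> u v; rewrite /M /= mulrBl; exact: zI.2.
  - by move=> u w Ou; rewrite /M /= -mulrA; exact: IM.
  - move=> w /hg; rewrite qnrdM nbe /r.
    by have -> : N%:R * (qnrd w * (g%:R / N%:R)) / g%:R = qnrd w by field; rewrite N00 g00.
  - move=> q pq; apply: contrapT => none.
    have : (g * q <= g)%N.
      apply: maxg; apply/asboolP; split; first by rewrite muln_gt0 g0 prime_gt0.
      move=> w Iw; apply: contrapT => hw; apply: none.
      have /intrP [k ek] := hg _ Iw.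
      have qk : ~~ (q %| `|k|)%N.
        apply/negP => /dvdnP [j ej]; apply: hw.
        rewrite natrM invfM mulrA ek [k]intEsg ej PoszM !rmorphM /= -mulrA.
        by rewrite mulrK ?rpredM ?intr_int // unitfE pnatr_eq0 -lt0n prime_gt0.
      have k0 : k%:~R != 0 :> rat.
        by rewrite intr_eq0; apply: contraNneq qk => ->; rewrite dvdn0.
      have nwE : qnrd (w * be^-1) = k%:~R.
        by rewrite qnrdM qnrdV ?nbe // -ek /r; field; rewrite N00 g00.
      exists (w * be^-1); split; first by rewrite /M /= divrK.
        by rewrite nwE.
      rewrite nwE; exists `|k|%N; split=> //.
      rewrite -[_%:R]/((`|k|%N : int)%:~R) abszEsg rmorphM /= mulfK //.
    by rewrite -[leqRHS]muln1 leq_pmul2l // leqNgt prime_gt1.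
have [n1 [n10 On1]] := qorder_multiple be^-1 oO.
have [n2 [n20 On2]] := qorder_multiple (x * be^-1) oO.
have bM w : M w -> O ((n1 * n2)%:R *: w).
  move=> [u [v [Ou Ov e]]]; have -> : w = u * be^-1 + v * (x * be^-1).
    by rewrite mulrA -mulrDl -e mulrK.
  rewrite scalerDr natrM; apply: zsubD => //.
    rewrite mulrC -scalerA scalerAr; apply: zsubZ => //.
    exact: OM.
  rewrite -scalerA [n2%:R *: _]scalerAr; apply: zsubZ => //.
  exact: OM.
have [ga [nga hga]] := norm_one_lattice_principal nM (n := (n1 * n2)%N) (ltac:(by rewrite muln_gt0 n10)) bM.
have nga0 : qnrd ga != 0 by rewrite nga oner_neq0.
have gau := qunitP nga0.
have ngV0 : qnrd ga^-1 != 0 by rewrite qnrdV // invr_neq0.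
have MI w : M w <-> I (w * be) by [].
exists (ga^-1 * be); have nd : qnrd (ga^-1 * be) != 0 by rewrite qnrdM mulf_neq0 // nbe.
split=> //.
have I2 : I (ga^-1 * be) by apply/MI/hga; rewrite mulVr.
have := IMx _ I2 => I3.
have : M (ga^-1 * be * x * be^-1) by apply/MI; rewrite divrK.
move/hga; congr (O _); rewrite invrM ?unitrV // invrK.
by rewrite !mulrA.
Qed.

End ConjugateIntoOrder.

(** Division with remainder by the monic equation of x bounds the degree uniformly in n. *)
Lemma integral_pow (K : comNzRingType) (x : K) : integralOver (intr : int -> K) x ->
  exists m, forall n, exists p : {poly int}, (size p <= m)%N /\ x ^+ n = (map_poly intr p).[x].
Proof.
move=> [d md rd]; exists (size d) => n; exists (Pdiv.Ring.rmodp 'X^n d); split.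
  by apply/ltnW; rewrite Pdiv.Ring.ltn_rmodp monic_neq0.
have := Pdiv.RingMonic.rdivp_eq md 'X^n.
move/(congr1 (map_poly (intr : int -> K))); rewrite rmorphD rmorphM /= map_polyXn.
move/(congr1 (fun p : {poly K} => p.[x])); rewrite hornerXn hornerD hornerM => ->.
by move: rd; rewrite rootE => /eqP ->; rewrite mulr0 add0r.
Qed.

Lemma integral_intr (K : comNzRingType) (z : int) : integralOver (intr : int -> K) z%:~R.
Proof.
exists ('X - z%:P); first exact: monicXsubC.
by rewrite rmorphB /= map_polyX map_polyC /= rootE hornerXsubC subrr.
Qed.

Lemma rat_integral_int (r : rat) : integralOver (intr : int -> rat) r -> r \is a Num.int.
Proof.
move=> /integral_pow [m hm]; pose d : rat := (denq r)%:~R.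
have d0 : d != 0 by rewrite intr_eq0 denq_eq0.
have rd : r * d \is a Num.int by rewrite /d -{1}[r]divq_num_den divfK ?intr_int // intr_eq0 denq_eq0.
apply: (@rat_pow_bounded _ (d ^+ m)); first by rewrite expf_neq0.
move=> n; have [p [sp ->]] := hm n.
rewrite horner_coef mulr_suml; apply: rpred_sum => i _.
rewrite coef_map /= -mulrA rpredM ?intr_int //.
have im : (i <= m)%N.
  apply: ltnW; apply: leq_trans (ltn_ord i) (leq_trans _ sp); exact: size_poly.
by rewrite -(subnK im) exprD mulrCA -exprMn rpredM ?rpredX // intr_int.
Qed.

(** * Existence of maximal orders *)

Section MaximalOrderExists.
Variables (a b : rat).
Hypotheses (a0 : a != 0) (b0 : b != 0).
Local Notation B := (quaternion a b).
Implicit Types (x y z : B) (X R O : set B).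

Lemma qorder_exists : exists O : set B, qorder O.
Proof.
pose n : rat := (denq a)%:~R; pose m : rat := (denq b)%:~R.
have n0 : n != 0 by rewrite intr_eq0 denq_eq0.
have m0 : m != 0 by rewrite intr_eq0 denq_eq0.
have dn (c : rat) : c * (denq c)%:~R \is a Num.int.
  by rewrite -{1}[c]divq_num_den divfK ?intr_int // intr_eq0 denq_eq0.
have ia : a * n \is a Num.int by exact: dn.
have ib : b * m \is a Num.int by exact: dn.
have iN : n \is a Num.int by exact: intr_int.
have iM : m \is a Num.int by exact: intr_int.
pose O : set B := [set x | [/\ q0 x \is a Num.int, q1 x / n \is a Num.int,
  q2 x / m \is a Num.int & q3 x / (n * m) \is a Num.int]].
exists O; split.
- by rewrite /O /= !qE !mul0r; split; rewrite ?rpred1 ?rpred0.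
- move=> x y [h0 h1 h2 h3] [g0 g1 g2 g3]; rewrite /O /= !qE !mulrBl.
  by split; exact: rpredB.
- move=> x y [h0 h1 h2 h3] [g0 g1 g2 g3]; rewrite /O /= qmul_E /qmul !qE.
  have [ia2 ib2] : a * n * n \is a Num.int /\ b * m * m \is a Num.int.
    by split; exact: rpredM.
  move: h1 h2 h3 g1 g2 g3; set x1 := q1 x / n; set x2 := q2 x / m; set x3 := q3 x / (n * m).
  set y1 := q1 y / n; set y2 := q2 y / m; set y3 := q3 y / (n * m) => h1 h2 h3 g1 g2 g3.
  have nm0 : n * m != 0 by rewrite mulf_neq0.
  have -> : q1 x = x1 * n by rewrite divfK.
  have -> : q2 x = x2 * m by rewrite divfK.
  have -> : q3 x = x3 * (n * m) by rewrite divfK.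
  have -> : q1 y = y1 * n by rewrite divfK.
  have -> : q2 y = y2 * m by rewrite divfK.
  have -> : q3 y = y3 * (n * m) by rewrite divfK.
  move: (q0 x) (q0 y) h0 g0 => x0 y0 h0 g0.
  split.
  + have -> : x0 * y0 + a * (x1 * n) * (y1 * n) + b * (x2 * m) * (y2 * m)
      - a * b * (x3 * (n * m)) * (y3 * (n * m)) =
      x0 * y0 + (a * n * n) * (x1 * y1) + (b * m * m) * (x2 * y2) -
      (a * n * n) * (b * m * m) * (x3 * y3) by ring.
    by zint.
  + have -> : (x0 * (y1 * n) + x1 * n * y0 - b * (x2 * m) * (y3 * (n * m)) +
      b * (x3 * (n * m)) * (y2 * m)) / n =
      x0 * y1 + x1 * y0 - (b * m * m) * (x2 * y3) + (b * m * m) * (x3 * y2) by field.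
    by zint.
  + have -> : (x0 * (y2 * m) + x2 * m * y0 + a * (x1 * n) * (y3 * (n * m)) -
      a * (x3 * (n * m)) * (y1 * n)) / m =
      x0 * y2 + x2 * y0 + (a * n * n) * (x1 * y3) - (a * n * n) * (x3 * y1) by field.
    by zint.
  + have -> : (x0 * (y3 * (n * m)) + x3 * (n * m) * y0 + x1 * n * (y2 * m) -
      x2 * m * (y1 * n)) / (n * m) = x0 * y3 + x3 * y0 + x1 * y2 - x2 * y1.
      by field; rewrite n0 m0.
    by zint.
exists (`|denq a| * `|denq b|)%N; split.
- by rewrite muln_gt0 !absz_gt0 !denq_eq0.
- have -> : (`|denq a| * `|denq b|)%:R = n * m :> rat.
    by rewrite natrM /n /m -[in RHS](gtz0_abs (denq_gt0 a)) -[in RHS](gtz0_abs (denq_gt0 b)).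
  move=> x [h0 h1 h2 h3]; rewrite /qlat0 !qE; split.
  + by zint.
  + have -> : n * m * q1 x = n * n * m * (q1 x / n) by field.
    by zint.
  + have -> : n * m * q2 x = n * m * m * (q2 x / m) by field.
    by zint.
  + have -> : n * m * q3 x = n * m * (n * m) * (q3 x / (n * m)) by field; rewrite n0 m0.
    by zint.
- have -> : (`|denq a| * `|denq b|)%:R = n * m :> rat.
    by rewrite natrM /n /m -[in RHS](gtz0_abs (denq_gt0 a)) -[in RHS](gtz0_abs (denq_gt0 b)).
  move=> x [h0 h1 h2 h3]; rewrite /O /= !qE; split.
  + by zint.
  + have -> : n * m * q1 x / n = m * q1 x by field.
    by rewrite rpredM.
  + have -> : n * m * q2 x / m = n * q2 x by field.
    by rewrite rpredM.
  + by have -> : n * m * q3 x / (n * m) = q3 x by field; rewrite n0 m0.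
Qed.

(** A larger order has integral traces against O, so all larger orders lie in the dual lattice of O
    under the trace form. *)
Lemma qorder_dual O : qorder O -> exists U : nat, (0 < U)%N /\
  forall O', qorder O' -> O `<=` O' -> forall x, O' x -> qlat0 (U%:R *: x).
Proof.
move=> oO.
have [n1 [p1 h1]] := qorder_multiple (mkq a b 0 1 0 0) oO.
have [n2 [p2 h2]] := qorder_multiple (mkq a b 0 0 1 0) oO.
have [n3 [p3 h3]] := qorder_multiple (mkq a b 0 0 0 1) oO.
have z1 : (n1%:R : rat) != 0 by rewrite pnatr_eq0 -lt0n.
have z2 : (n2%:R : rat) != 0 by rewrite pnatr_eq0 -lt0n.
have z3 : (n3%:R : rat) != 0 by rewrite pnatr_eq0 -lt0n.
have [m1 [s1 g1]] := rat_multiple (2 * a * n1%:R)^-1.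
have [m2 [s2 g2]] := rat_multiple (2 * b * n2%:R)^-1.
have [m3 [s3 g3]] := rat_multiple (- (2 * a * b * n3%:R))^-1.
exists (2 * m1 * m2 * m3)%N; split; first by rewrite !muln_gt0 s1 s2 s3.
move=> O' oO' OO' x O'x; have [_ _ OM _] := oO'.
have t0 := qorder_tr_int oO' O'x.
have t1 := qorder_tr_int oO' (OM _ _ O'x (OO' _ h1)).
have t2 := qorder_tr_int oO' (OM _ _ O'x (OO' _ h2)).
have t3 := qorder_tr_int oO' (OM _ _ O'x (OO' _ h3)).
rewrite !natrM /qlat0 !qE; split.
- have -> : 2 * m1%:R * m2%:R * m3%:R * q0 x = m1%:R * m2%:R * m3%:R * qtr x.
    by rewrite /qtr; ring.
  by zint.
- have -> : 2 * m1%:R * m2%:R * m3%:R * q1 x = 2 * m2%:R * m3%:R *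
      (m1%:R * (2 * a * n1%:R)^-1) * qtr (x * (n1%:R *: mkq a b 0 1 0 0)).
    by rewrite /qtr qmul_E /qmul !qE; field; rewrite a0 z1.
  by zint.
- have -> : 2 * m1%:R * m2%:R * m3%:R * q2 x = 2 * m1%:R * m3%:R *
      (m2%:R * (2 * b * n2%:R)^-1) * qtr (x * (n2%:R *: mkq a b 0 0 1 0)).
    by rewrite /qtr qmul_E /qmul !qE; field; rewrite b0 z2.
  by zint.
- have -> : 2 * m1%:R * m2%:R * m3%:R * q3 x = 2 * m1%:R * m2%:R *
      (m3%:R * (- (2 * a * b * n3%:R))^-1) * qtr (x * (n3%:R *: mkq a b 0 0 0 1)).
    by rewrite /qtr qmul_E /qmul !qE; field; rewrite a0 b0 z3.
  by zint.
Qed.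

(** The orders above a given one lie between two fixed lattices; one that contains the most coset
    representatives is maximal. *)
Lemma qmaximal_exists : exists O : set B, qmaximal O.
Proof.
have [Omin oOmin] := qorder_exists; have [U [U0 hU]] := qorder_dual oOmin.
have [_ _ _ [L [L0 _ hL]]] := oOmin.
pose code O : {set ('I_(U * L) * 'I_(U * L) * 'I_(U * L) * 'I_(U * L))} :=
  [set c | `[< O (lat_rep a b U c) >]]%SET.
pose P (n : nat) := `[< exists O, [/\ qorder O, Omin `<=` O & #|code O| = n] >].
have exP : exists n, P n by exists #|code Omin|; apply/asboolP; exists Omin; split.
have bP n : P n -> (n <= #|{: 'I_(U * L) * 'I_(U * L) * 'I_(U * L) * 'I_(U * L)}|)%N.
  by move/asboolP => [ O [_ _ <-]]; exact: max_card.
case: (ex_maxnP exP bP) => n /asboolP [ O [oO OO cO]] maxn.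
exists O; split=> // O' oO' OO'.
have sOmin : Omin `<=` O' by apply: subset_trans OO'.
have sub : code O \subset code O'.
  by apply/fintype.subsetP => c; rewrite finset.in_set => /asboolP/OO' h; rewrite finset.in_set; exact/asboolP.
have eqc : code O' = code O.
  apply/esym/eqP; rewrite eqEcard sub cO /=; apply: maxn; apply/asboolP.
  by exists O'.
apply: (@lat_codeP a b U L) => //; try exact: qorder_zsub.
- exact: hU.
- by move=> x lx; apply/sOmin/hL.
- by move=> x lx; apply/OO/hL.
- move=> c O'c; have : c \in code O' by rewrite finset.in_set; apply/asboolP.
  by rewrite eqc finset.in_set => /asboolP.
Qed.

End MaximalOrderExists.

(** * Comparison with orders over the ring of integers of Q *)

Section RationalOrders.
Variables (a b : rat).
Local Notation B := (quaternion a b).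
Local Notation BF := (@quaternion rat^o a b).
Implicit Types (x y z : B) (X R O : set B).

Definition zcomb (s : seq B) : set B := [set x | exists c : 'I_(size s) -> rat,
  (forall i, c i \is a Num.int) /\ x = \sum_(i < size s) c i *: s`_i].

Lemma zcombB s x y : zcomb s x -> zcomb s y -> zcomb s (x - y).
Proof.
move=> [c [ic ->]] [d [id ->]]; exists (fun i => c i - d i); split=> [i|]; first exact: rpredB.
by rewrite -sumrB; apply: eq_bigr => i _; rewrite scalerBl.
Qed.

Lemma zcomb_zsub s : zsub (zcomb s).
Proof.
split; last exact: zcombB.
by exists (fun=> 0); split=> [i|]; [exact: rpred0|rewrite big1 // => i _; rewrite scale0r].
Qed.

Lemma zcomb_mem s x : x \in s -> zcomb s x.
Proof.
move=> xs; have li : (index x s < size s)%N by rewrite index_mem.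
exists (fun i => (i == Ordinal li)%:R); split=> [i|]; first exact: natr_int.
rewrite (bigD1 (Ordinal li)) //= eqxx scale1r nth_index // big1 ?addr0 // => i /negPf ->.
by rewrite scale0r.
Qed.

Lemma zcomb_sub s X : zsub X -> {in s, forall x, X x} -> zcomb s `<=` X.
Proof.
move=> zX sX x [c [ic ->]]; apply: (big_ind X).
- by case: zX.
- by move=> u v; exact: zsubD.
- by move=> i _; apply: zsubZ => //; apply: sX; exact: mem_nth.
Qed.

Lemma qlat0E (n : rat) x : n *: x = q0 x *: (n *: 1) + q1 x *: (n *: mkq a b 0 1 0 0) +
  q2 x *: (n *: mkq a b 0 0 1 0) + q3 x *: (n *: mkq a b 0 0 0 1).
Proof. by apply: quatP; rewrite !qE; ring. Qed.

(** The generators are the coset representatives contained in O together with N times the standard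
    basis, which avoids computing a basis of O. *)
Lemma qorder_is_order O : qorder O -> @is_order rat^o BF O.
Proof.
move=> oO; have [Oone OB OM [N [N0 hN hN']]] := oO; split=> //.
have zO := qorder_zsub oO.
have N00 : (N%:R : rat) != 0 by rewrite pnatr_eq0 -lt0n.
pose s := [seq lat_rep a b N c | c <- enum {: 'I_(N * N) * 'I_(N * N) * 'I_(N * N) * 'I_(N * N)} &
   `[< O (lat_rep a b N c) >]] ++
  [:: N%:R *: 1; N%:R *: mkq a b 0 1 0 0; N%:R *: mkq a b 0 0 1 0; N%:R *: mkq a b 0 0 0 1].
have se x : x \in [:: N%:R *: 1; N%:R *: mkq a b 0 1 0 0; N%:R *: mkq a b 0 0 1 0; N%:R *: mkq a b 0 0 0 1] -> x \in s.
  by move=> xs; rewrite mem_cat xs orbT.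
have le x : x \in [:: 1; mkq a b 0 1 0 0; mkq a b 0 0 1 0; mkq a b 0 0 0 1] -> qlat0 x.
  rewrite !inE => /or4P [] /eqP ->; rewrite /qlat0 !qE; split; rewrite ?rpred0 ?rpred1 //.
have OE : O = zcomb s.
  apply/seteqP; split=> [x Ox|].
    have [c [y [ly xE]]] := lat_repP N0 N0 (hN _ Ox).
    have Oc : O (lat_rep a b N c).
      have -> : lat_rep a b N c = x - N%:R *: y by rewrite xE addrK.
      by apply: OB => //; exact: hN'.
    rewrite xE; apply: zsubD; first exact: zcomb_zsub.
      apply: zcomb_mem; rewrite mem_cat; apply/orP; left; apply: map_f.
      by rewrite mem_filter mem_enum andbT; apply/asboolP.
    rewrite qlat0E; have [l0 l1 l2 l3] := ly.
    have zs := zcomb_zsub s.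
    have zD u v : zcomb s u -> zcomb s v -> zcomb s (u + v) by exact: zsubD.
    have zZ k u : k \is a Num.int -> zcomb s u -> zcomb s (k *: u) by exact: zsubZ.
    by apply: (zD); [apply: (zD); [apply: (zD)|]|]; apply: zZ => //; apply: zcomb_mem; apply: se; rewrite !inE eqxx ?orbT.
  apply: zcomb_sub => // x; rewrite mem_cat => /orP [/mapP [c]|].
    by rewrite mem_filter => /andP [/asboolP Oc _] ->.
  rewrite !inE => /or4P [] /eqP ->; apply/hN'/le; by rewrite !inE eqxx ?orbT.
exists s.
  apply/eqP; rewrite eqEsubv subvf /=; apply/subvP => x _.
  have -> : x = N%:R *: (N%:R^-1 *: x : BF) by rewrite scalerA mulfV // scale1r.
  rewrite (qlat0E N%:R (N%:R^-1 *: x)); apply: rpredD; [apply: rpredD; [apply: rpredD|]|];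
    apply: rpredZ; apply: memv_span; apply: se; by rewrite !inE eqxx ?orbT.
rewrite OE; apply/seteqP; split=> x.
  move=> [c [ic ->]]; exists c => // i; have /intrP [z ->] := ic i.
  exact: (@integral_intr rat z).
by move=> [c ic <-]; exists c; split=> // i; apply: rat_integral_int; exact: ic.
Qed.

Lemma qlat0_multiple_seq (s : seq B) : exists n : nat, (0 < n)%N /\
  {in s, forall x, qlat0 (n%:R *: x)}.
Proof.
elim: s => [|x s [n [n0 hn]]]; first by exists 1%N.
have [m [m0 hm]] := qlat0_multiple x; exists (m * n)%N; split; first by rewrite muln_gt0 m0.
have zl := qlat0_zsub a b.
move=> y; rewrite inE => /orP [/eqP ->|ys]; rewrite natrM.
  by rewrite mulrC -scalerA; apply: zsubZ => //; exact: natr_int.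
by rewrite -scalerA; apply: zsubZ => //; exact: hn.
Qed.

Lemma is_order_qorder O : @is_order rat^o BF O -> qorder O.
Proof.
move=> [Oone OB OM [s ss Os]].
have OE : O = zcomb s.
  rewrite Os; apply/seteqP; split=> x.
    by move=> [c ic <-]; exists c; split=> // i; apply: rat_integral_int; exact: ic.
  move=> [c [ic ->]]; exists c => // i; have /intrP [z ->] := ic i.
  exact: (@integral_intr rat z).
have zO : zsub O by split=> //; rewrite -(subrr 1); exact: OB.
have mult x : exists n : nat, (0 < n)%N /\ O (n%:R *: x).
  have : (x : BF) \in span s by rewrite ss memvf.
  move/(@coord_span _ _ _ (in_tuple s)); pose c i : rat := coord (in_tuple s) i (x : BF) => xE.
  have [n [n0 hn]] : exists n : nat, (0 < n)%N /\ forall i, n%:R * c i \is a Num.int.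
    have /choice [f hf] : forall i, exists n : nat, (0 < n)%N /\ n%:R * c i \is a Num.int.
      by move=> i; exact: rat_multiple.
    exists (\prod_i f i)%N; split; first by rewrite prodn_gt0 // => i; case: (hf i).
    move=> i; rewrite (bigD1 i) //= natrM mulrAC rpredM ?natr_int //.
    by case: (hf i).
  exists n; split=> //; rewrite OE; exists (fun i => n%:R * c i); split=> //.
  by rewrite {1}xE scaler_sumr; apply: eq_bigr => i _; rewrite scalerA.
split=> //.
have [N1 [N10 h1]] := qlat0_multiple_seq s.
have [m0 [p0 g0]] := mult 1.
have [m1 [p1 g1]] := mult (mkq a b 0 1 0 0).
have [m2 [p2 g2]] := mult (mkq a b 0 0 1 0).
have [m3 [p3 g3]] := mult (mkq a b 0 0 0 1).
pose m := (m0 * m1 * m2 * m3)%N.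
exists (N1 * m)%N; split; first by rewrite !muln_gt0 N10 p0 p1 p2 p3.
  move=> x; rewrite OE => xs.
  have zl := qlat0_zsub a b.
  rewrite natrM mulrC -scalerA; apply: zsubZ => //.
  case: xs => c [ic ->]; rewrite scaler_sumr; apply: (big_ind (@qlat0 a b)).
  - by case: zl.
  - by move=> u v; exact: zsubD.
  - move=> i _; rewrite scalerA mulrC -scalerA; apply: zsubZ => //.
    by apply: h1; exact: mem_nth.
move=> x [l0 l1 l2 l3]; rewrite natrM -scalerA; apply: zsubZ => //.
rewrite qlat0E.
have e0 : m%:R = (m1 * m2 * m3)%:R * m0%:R :> rat by rewrite -natrM /m; congr (_%:R); ring.
have e1 : m%:R = (m0 * m2 * m3)%:R * m1%:R :> rat by rewrite -natrM /m; congr (_%:R); ring.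
have e2 : m%:R = (m0 * m1 * m3)%:R * m2%:R :> rat by rewrite -natrM /m; congr (_%:R); ring.
have e3 : m%:R = (m0 * m1 * m2)%:R * m3%:R :> rat by rewrite -natrM /m; congr (_%:R); ring.
apply: zsubD => //; [apply: zsubD => //; [apply: zsubD => //|]|].
- by rewrite e0 -scalerA; do 2 (apply: zsubZ => //).
- by rewrite e1 -scalerA; do 2 (apply: zsubZ => //).
- by rewrite e2 -scalerA; do 2 (apply: zsubZ => //).
- by rewrite e3 -scalerA; do 2 (apply: zsubZ => //).
Qed.

Lemma qmaximal_maximal_order O : qmaximal O -> @maximal_order rat^o BF O.
Proof.
move=> [oO mO]; split; first exact: qorder_is_order.
move=> O' /is_order_qorder oO' OO'; apply/seteqP; split=> //; exact: mO.
Qed.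

End RationalOrders.

(** * Hyperbolic area and fundamental sets *)

Section LebesgueAffine.
Variable R : realType.
Local Notation lambda := (@lebesgue_measure R).

Let affine (k c : R) (x : measurableTypeR R) : measurableTypeR R := k * x + c.

Let measurable_affine k c : measurable_fun [set: measurableTypeR R] (affine k c).
Proof. by apply: measurable_funD => //; exact: measurable_funM. Qed.

Lemma lebesgue_measure_affine (k c : R) (A : set R) : k != 0 -> measurable A ->
  lambda [set x | A (k * x + c)] = ((`|k|^-1)%:E * lambda A)%E.
Proof.
move=> k0 mA; have nk : 0 < `|k| by rewrite normr_gt0.
pose m := mscale (NngNum (ltW nk)) (pushforward lambda (affine k c)).
have -> : lambda A = m (@measurable_affine k c) A.
  apply: lebesgue_measure_unique => // _ [[a b] _ <-] /=.
  rewrite /m /mscale /= /pushforward lebesgue_measure_itv /=.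
  have [k_gt0|k_lt0|/eqP] := ltgtP 0 k; last by rewrite eq_sym (negPf k0).
    rewrite (_ : _ @^-1` _ = `](a - c) / k, (b - c) / k]%classic).
      rewrite lebesgue_measure_itv /= !lte_fin ltr_pM2r ?invr_gt0 // ltrD2r.
      case: ifP => _; last by rewrite mule0.
      by rewrite gtr0_norm // -!EFinB -EFinM; congr EFin; field.
    apply/seteqP; split=> x; rewrite /= !in_itv /= /affine ltr_pdivrMr // ler_pdivlMr //;
      by rewrite ltrBlDr lerBrDr [x * k]mulrC.
  rewrite (_ : _ @^-1` _ = `[(b - c) / k, (a - c) / k[%classic).
    rewrite lebesgue_measure_itv /= !lte_fin ltr_nM2r ?invr_lt0 // ltrD2r.
    case: ifP => _; last by rewrite mule0.
    by rewrite ltr0_norm // -!EFinB -EFinM; congr EFin; field.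
  apply/seteqP; split=> x; rewrite /= !in_itv /= /affine ltr_ndivlMr // ler_ndivrMr //;
    by rewrite andbC ltrBlDr lerBrDr [x * k]mulrC.
by rewrite /m /mscale /= muleA -EFinM mulVf ?mul1e // normr_eq0.
Qed.

End LebesgueAffine.

Section DensityMeasure.
Context d (T : measurableType d) (R : realType).
Variables (mu : {measure set T -> \bar R}) (D : set T) (g : T -> \bar R).
Hypotheses (mD : measurable D) (mg : measurable_fun [set: T] g) (g0 : forall x, (0 <= g x)%E).

(** The proofs are arguments so that the measure structure can be attached to the term. *)
Definition density_measure (_ : measurable D) (_ : measurable_fun [set: T] g)
  (_ : forall x, (0 <= g x)%E) (A : set T) : \bar R := (\int[mu]_(x in A `&` D) g x)%E.

Local Notation density := (density_measure mD mg g0).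

Let density0 : density set0 = 0%E.
Proof. by rewrite /density_measure set0I integral_set0. Qed.

Let density_ge0 A : (0 <= density A)%E.
Proof. exact: integral_ge0. Qed.

Let density_additive : semi_sigma_additive density.
Proof.
move=> F mF tF mUF; rewrite /density_measure setI_bigcupl.
rewrite ge0_integral_bigcup //; first last.
- apply/trivIsetP => i j _ _ ij; move/trivIsetP: tF => /(_ i j I I ij) e.
  by rewrite setIACA e set0I.
- exact: measurable_funTS.
- by move=> k; exact: measurableI.
by apply: is_cvg_nneseries => n _ _; exact: integral_ge0.
Qed.

HB.instance Definition _ := isMeasure.Build _ _ _ density
  density0 density_ge0 density_additive.

End DensityMeasure.

Section LogMeasure.
Variable R : realType.
Local Notation lambda := (@lebesgue_measure R).
Let pos : set (measurableTypeR R) := [set y : R | 0 < y].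

Let mpos : measurable pos.
Proof. by rewrite /pos (_ : [set y | _] = `]0, +oo[%classic) //; apply/seteqP; split=> x; rewrite /= in_itv /= andbT. Qed.

Let invy (y : measurableTypeR R) : \bar R := (expR (- ln y))%:E.

Let minvy : measurable_fun [set: measurableTypeR R] invy.
Proof.
apply/measurable_EFinP; apply: measurableT_comp => //.
by apply: measurableT_comp => //; exact: measurable_ln.
Qed.

Let invy0 y : (0 <= invy y)%E. Proof. by rewrite lee_fin expR_ge0. Qed.

Let mln : measurable_fun [set: measurableTypeR R] (@ln R : measurableTypeR R -> measurableTypeR R).
Proof. exact: measurable_ln. Qed.

(** The logarithm carries dy / y to Lebesgue measure; on half-open intervals this is the fundamental
    theorem of calculus. The density 1 / y is written [expR (- ln y)]. *)
Lemma lebesgue_measure_ln (A : set R) : measurable A ->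
  (\int[lambda]_(y in [set y : R | A (ln y)] `&` [set y : R | (0 < y)%R]) (expR (- ln y))%:E)%E
  = lambda A.
Proof.
move=> mA.
pose m := mscale (NngNum (@ler01 R)) (pushforward (density_measure lambda mpos minvy invy0) (@ln R : measurableTypeR R -> measurableTypeR R)).
suff -> : lambda A = m mln A by rewrite /m /mscale /= mul1e.
apply: lebesgue_measure_unique => // _ [[a b] _ <-] /=.
rewrite /m /mscale /= mul1e /pushforward /density_measure lebesgue_measure_itv /= lte_fin.
have -> : @ln R @^-1` `]a, b] `&` pos = `]expR a, expR b]%classic.
  apply/seteqP; split=> y; rewrite /= !in_itv /=.
    by move=> [/andP [h1 h2] y0]; rewrite -(lnK (y0 : y \in Num.pos)) ltr_expR ler_expR h1.
  move=> /andP [h1 h2]; have y0 : 0 < y by apply: lt_trans h1; exact: expR_gt0.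
  by rewrite -ltr_expR -ler_expR lnK // h1 h2.
case: ifP => ab; last first.
  rewrite set_itv_ge ?integral_set0 // -leNgt /= bnd_simp ler_expR leNgt ab //.
rewrite integral_itv_obnd_cbnd; last first.
  exact: (measurable_funTS (D := `]expR a, expR b[%classic) minvy) || exact: measurable_funTS.
rewrite (continuous_FTC2 (F := @ln R)).
- by rewrite !expRK.
- by rewrite ltr_expR.
- apply/continuous_within_itvP; first by rewrite ltr_expR.
  have ce y : 0 < y -> {for y, continuous (fun y : R => expR (- ln y))}.
    move=> y0; apply: continuous_comp; last exact: continuous_expR.
    by apply: continuousN; exact: continuous_ln.
  split.
  + move=> y; rewrite in_itv /= => /andP [h _]; apply: ce; exact: lt_trans (expR_gt0 _) h.
  + by apply: cvg_at_right_filter; apply: ce; exact: expR_gt0.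
  + by apply: cvg_at_left_filter; apply: ce; exact: expR_gt0.
- split.
  + move=> y; rewrite in_itv /= => /andP [h _].
    have y0 : 0 < y by exact: lt_trans (expR_gt0 _) h.
    by have [] := is_derive1_ln y0.
  + by apply: cvg_at_right_filter; apply: continuous_ln; exact: expR_gt0.
  + by apply: cvg_at_left_filter; apply: continuous_ln; exact: expR_gt0.
- move=> y; rewrite in_itv /= => /andP [h _].
  have y0 : 0 < y by exact: lt_trans (expR_gt0 _) h.
  rewrite derive1E; have [_ ->] := is_derive1_ln y0.
  by rewrite expRN lnK.
Qed.

End LogMeasure.

Section HyperbolicArea.
Variable R : realType.
Local Notation lambda := (@lebesgue_measure R).
Local Notation T := (measurableTypeR R).
Local Notation TT := (measurableTypeR R * measurableTypeR R)%type.
Local Notation lambda2 := ((lambda \x lambda)%E).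

Definition half_plane : set (R * R) := [set p | 0 < p.2].

Let mH : measurable (half_plane : set TT).
Proof.
rewrite (_ : half_plane = snd @^-1` `]0, +oo[%classic); last first.
  by apply/seteqP; split=> p; rewrite /half_plane /= in_itv /= andbT.
by rewrite -[X in measurable X]setTI; exact: measurable_snd.
Qed.

Let k (y : T) : R := expR (- ln y).

Let mk : measurable_fun [set: T] (k : T -> T).
Proof. by apply: measurableT_comp => //; apply: measurableT_comp => //; exact: measurable_ln. Qed.

Let g (p : TT) : \bar R := (k p.2 ^+ 2)%:E.

Let mg : measurable_fun [set: TT] g.
Proof.
apply/measurable_EFinP; apply: measurable_funX.
by apply: (measurableT_comp mk); exact: measurable_snd.
Qed.

Let g0 p : (0 <= g p)%E. Proof. by rewrite lee_fin exprn_ge0 // expR_ge0. Qed.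

Let phi (p : TT) : TT := (p.1 * k p.2, ln p.2).
(** The inverse of the coordinates c = x / y and s = ln y, in which dx dy / y^2 becomes dc ds. *)
Definition polar (q : R * R) : R * R := (q.1 * expR q.2, expR q.2).

Let mphi : measurable_fun [set: TT] phi.
Proof.
apply: measurable_fun_pair.
  by apply: measurable_funM => //; apply: (measurableT_comp mk); exact: measurable_snd.
by apply: (measurableT_comp (@measurable_ln R)); exact: measurable_snd.
Qed.

Lemma measurable_polar : measurable_fun [set: TT] (polar : TT -> TT).
Proof.
apply: measurable_fun_pair.
  by apply: measurable_funM => //; apply: (measurableT_comp (@measurable_expR R)); exact: measurable_snd.
by apply: (measurableT_comp (@measurable_expR R)); exact: measurable_snd.
Qed.

Let mpolar := measurable_polar.

Let phiK p : half_plane p -> polar (phi p) = p.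
Proof.
by case: p => x y /= y0; rewrite /polar /phi /k /= expRN lnK // divfK // gt_eqF.
Qed.

Let polarH q : half_plane (polar q). Proof. exact: expR_gt0. Qed.

Let mpre (S : TT -> TT) (X : set TT) : measurable_fun [set: TT] S -> measurable X ->
  measurable (S @^-1` X).
Proof. by move=> mS mX; rewrite -[X in measurable X]setTI; exact: mS. Qed.

Let density2 (A : set TT) : \bar R := pushforward (density_measure lambda2 mH mg g0) phi A.

Let area_rectangle (A B : set T) : measurable A -> measurable B ->
  density2 (A `*` B) = (lambda A * lambda B)%E.
Proof.
move=> mA mB; rewrite /density2 /pushforward /density_measure.
rewrite integral_mkcond fubini_tonelli2; first last.
- by move=> p; rewrite patchE; case: ifP.
- apply/(measurable_restrictT _ _).1; last exact: measurable_funTS.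
  by apply: measurableI => //; apply: mpre => //; exact: measurableX.
rewrite -(lebesgue_measure_ln mB) muleC -ge0_integralZr //; first last.
- by apply: measurable_funTS; apply/measurable_EFinP; exact: mk.
- apply: measurableI.
    by rewrite -[X in measurable X]setTI; exact: measurable_ln.
  by rewrite (_ : [set y | _] = `]0, +oo[%classic) //; apply/seteqP; split=> x; rewrite /= in_itv /= andbT.
rewrite [RHS]integral_mkcond; apply: eq_integral => y _.
rewrite /fubini_G patchE; case: ifP => hy.
  move: hy; rewrite inE => -[/= By y0].
  have kp : 0 < k y by exact: expR_gt0.
  transitivity (\int[lambda]_x (((fun=> (k y ^+ 2)%:E) \_ [set x | A (k y * x + 0)%R]) x))%E.
    apply: eq_integral => x _; rewrite !patchE.
    suff -> : ((x, y) \in phi @^-1` (A `*` B) `&` half_plane) = (x \in [set x | A (k y * x + 0)]) by [].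
    apply/idP/idP; rewrite !inE /= addr0 mulrC; first by case=> -[].
    by [].
  rewrite -integral_mkcond integral_cst /=; last first.
    rewrite -[X in measurable X]setTI.
    by apply: (_ : measurable_fun [set: T] (fun x : T => k y * x + 0 : T)) => //; apply: measurable_funD => //; exact: measurable_funM.
  rewrite lebesgue_measure_affine ?gt_eqF // muleA -EFinM gtr0_norm //; congr (_ * _)%E.
  by congr EFin; rewrite -/(k y); field; rewrite gt_eqF.
rewrite -[RHS](integral0 lambda setT); apply: eq_integral => x _.
rewrite patchE; case: ifP => // hxy; move: hy hxy; rewrite !inE => hy [[/= _ By] y0].
by have : false by rewrite -hy inE.
Qed.

Lemma hyperbolic_area_polar (D : set (R * R)) : measurable (D : set TT) -> D `<=` half_plane ->
  hyperbolic_area D = lambda2 (polar @^-1` D).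
Proof.
move=> mD DH.
pose m := mscale (NngNum (@ler01 R)) (pushforward (density_measure lambda2 mH mg g0) phi).
have mE A : m mphi A = density2 A by rewrite /m /mscale /= mul1e.
have -> : lambda2 (polar @^-1` D) = density2 (polar @^-1` D).
  rewrite -mE.
  apply: product_measure_unique; last exact: mpre.
  move=> A B mA mB; transitivity (density2 (A `*` B)); [exact: mE|exact: area_rectangle].
rewrite /density2 /pushforward /density_measure /hyperbolic_area.
have -> : phi @^-1` (polar @^-1` D) `&` half_plane = D.
  by apply/seteqP; split=> p /= => [[h /phiK e]|h]; [rewrite -e|split; [rewrite phiK //; exact: DH|exact: DH]].
apply: eq_integral => p; rewrite inE => /DH p0; rewrite /g /k expRN lnK // exprVn //.
Qed.

Lemma lebesgue2_shear (f : R -> R) (X : set TT) : measurable_fun [set: T] (f : T -> T) ->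
  measurable X -> lambda2 [set q : TT | X (q.1 + f q.2, q.2)] = lambda2 X.
Proof.
move=> mf mX; pose S (q : TT) : TT := (q.1 + f q.2, q.2).
have mS : measurable_fun [set: TT] S.
  apply: measurable_fun_pair => //; apply: measurable_funD => //.
  by apply: (measurableT_comp mf); exact: measurable_snd.
pose m := mscale (NngNum (@ler01 R)) (pushforward lambda2 S).
suff -> : lambda2 X = m mS X by rewrite /m /mscale /= mul1e.
apply: product_measure_unique => // A B mA mB.
transitivity (lambda2 (S @^-1` (A `*` B))); first by rewrite /= /mscale /= mul1e.
have mAB := measurableX mA mB.
rewrite (product_measure_unique _ _ (m' := (lambda \x^ lambda)%E)); first last.
- exact: mpre.
- by move=> A' B' mA' mB'; exact: product_measure2E.
rewrite -(product_measure2E lambda lambda mA mB) /product_measure2.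
apply: eq_integral => y _ /=.
have -> : ysection (S @^-1` (A `*` B)) y = [set x | ysection (A `*` B) y (1 * x + f y)].
  by apply/seteqP; split=> x; rewrite /ysection /= !inE /= mul1r.
rewrite lebesgue_measure_affine ?oner_neq0 //; last exact: measurable_ysection.
by rewrite normr1 invr1 mul1e.
Qed.

Lemma lebesgue2_flip (e : R) (f : R -> R) (X : set TT) : `|e| = 1 ->
  measurable_fun [set: T] (f : T -> T) ->
  measurable X -> lambda2 [set q : TT | X (e * q.1, e * q.2 + f q.1)] = lambda2 X.
Proof.
move=> e1 mf mX; have e0 : e != 0 by rewrite -normr_eq0 e1 oner_neq0.
pose S (q : TT) : TT := (e * q.1, e * q.2 + f q.1).
have mS : measurable_fun [set: TT] S.
  apply: measurable_fun_pair; first by apply: measurable_funM.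
  apply: measurable_funD; first by apply: measurable_funM.
  by apply: (measurableT_comp mf); exact: measurable_fst.
pose m := mscale (NngNum (@ler01 R)) (pushforward lambda2 S).
suff -> : lambda2 X = m mS X by rewrite /m /mscale /= mul1e.
apply: product_measure_unique => // A B mA mB.
transitivity (lambda2 (S @^-1` (A `*` B))); first by rewrite /= /mscale /= mul1e.
have mA' : measurable ([set x | A (e * x + 0)] : set T).
  rewrite -[X in measurable X]setTI.
  by apply: (_ : measurable_fun [set: T] (fun x : T => e * x + 0 : T)) => //; apply: measurable_funD => //; exact: measurable_funM.
transitivity (lambda [set x | A (e * x + 0)%R] * lambda B)%E; last first.
  by rewrite lebesgue_measure_affine // e1 invr1 mul1e.
rewrite -(product_measure1E lambda lambda mA' mB) /product_measure1.
apply: eq_integral => x _ /=.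
have -> : xsection (S @^-1` (A `*` B)) x =
    [set y | xsection ([set x | A (e * x + 0)] `*` B) x (e * y + f x)].
  by apply/seteqP; split=> y; rewrite /xsection /= !inE /= addr0.
rewrite lebesgue_measure_affine //; last by apply: measurable_xsection; exact: measurableX.
by rewrite e1 invr1 mul1e.
Qed.

Definition area_preserving (f : R * R -> R * R) : Prop :=
  (forall p, half_plane p -> half_plane (f p)) /\
  forall D : set (R * R), measurable (D : set TT) -> D `<=` half_plane ->
    measurable (f @^-1` D `&` half_plane : set TT) /\
    hyperbolic_area (f @^-1` D `&` half_plane) = hyperbolic_area D.

Lemma area_preserving_ext f h : (forall p, half_plane p -> f p = h p) ->
  area_preserving f -> area_preserving h.
Proof.
move=> e [fH fD]; split=> [p hp|D mD DH]; first by rewrite -e //; exact: fH.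
have -> : h @^-1` D `&` half_plane = f @^-1` D `&` half_plane; last exact: fD.
by apply/seteqP; split=> p [/= h1 h2]; split=> //; [rewrite e|rewrite -e].
Qed.

Lemma area_preserving_comp f h : area_preserving f -> area_preserving h ->
  area_preserving (f \o h).
Proof.
move=> [fH fD] [hH hD]; split=> [p hp|D mD DH]; first exact/fH/hH.
have -> : (f \o h) @^-1` D `&` half_plane = h @^-1` (f @^-1` D `&` half_plane) `&` half_plane.
  by apply/seteqP; split=> p [/= h1 h2]; split=> //; [split=> //; exact: hH|case: h1].
have [m1 a1] := fD D mD DH.
have [|m2 a2] := hD _ m1; first by move=> p [].
by split=> //; rewrite a2.
Qed.

(** In the coordinates of [polar] the generators of the isometry group become shears and
    reflections, whose effect on Lebesgue measure is elementary. *)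
Lemma area_preserving_polar f (S : TT -> TT) : measurable_fun [set: TT] S ->
  (forall X, measurable X -> lambda2 (S @^-1` X) = lambda2 X) ->
  (forall q, f (polar q) = polar (S q)) -> area_preserving f.
Proof.
move=> mS pS fS; split=> [p /phiK <-|D mD DH]; first by rewrite fS.
have mfD : measurable (f @^-1` D `&` half_plane : set TT).
  have -> : f @^-1` D `&` half_plane = phi @^-1` (S @^-1` (polar @^-1` D)) `&` half_plane.
    by apply/seteqP; split=> p [/= h1 h2]; split=> //; move: h1; rewrite /= -fS phiK.
  apply: measurableI => //; do 3 (apply: mpre => //).
split=> //; rewrite !hyperbolic_area_polar //.
rewrite -[RHS]pS; last exact: mpre.
congr lambda2; apply/seteqP; split=> q /=; first by rewrite fS; case.
by rewrite fS => h; split=> //; rewrite -fS; have := polarH (S q); rewrite -fS; exact.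
Qed.

Lemma area_preserving_translation (t : R) : area_preserving (fun p => (p.1 + t, p.2)).
Proof.
pose S (q : TT) : TT := (q.1 + t * expR (- q.2), q.2).
have mf : measurable_fun [set: T] (fun s : T => t * expR (- s) : T).
  by apply: measurable_funM => //; apply: measurableT_comp.
apply: (@area_preserving_polar _ S).
- apply: measurable_fun_pair => //; apply: measurable_funD => //.
  by apply: (measurableT_comp mf); exact: measurable_snd.
- by move=> X mX; exact: (lebesgue2_shear mf mX).
- move=> [c s]; rewrite /polar /S /=; congr pair.
  by rewrite mulrDl -mulrA -expRD addNr expR0 mulr1.
Qed.

Lemma area_preserving_dilation (r : R) : 0 < r -> area_preserving (fun p => (r * p.1, r * p.2)).
Proof.
move=> r0; pose S (q : TT) : TT := (1 * q.1, 1 * q.2 + ln r).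
apply: (@area_preserving_polar _ S).
- apply: measurable_fun_pair; first by apply: measurable_funM.
  by apply: measurable_funD => //; apply: measurable_funM.
- move=> X mX; apply: (@lebesgue2_flip 1 (fun=> ln r)) => //; exact: normr1.
- by move=> [c s]; rewrite /polar /S /= !mul1r expRD lnK //; congr pair; ring.
Qed.

Lemma area_preserving_inversion : area_preserving
  (fun p => (- p.1 / (p.1 ^+ 2 + p.2 ^+ 2), p.2 / (p.1 ^+ 2 + p.2 ^+ 2))).
Proof.
(* |z|^2 = y^2 (1 + c^2), whence this correction of the second coordinate under z -> -1/z. *)
pose h (c : R) := - ln (1 + c ^+ 2); pose S (q : TT) : TT := (-1 * q.1, -1 * q.2 + h q.1).
have mh : measurable_fun [set: T] (h : T -> T).
  apply: measurableT_comp => //; apply: (measurableT_comp (@measurable_ln R)).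
  by apply: measurable_funD => //; exact: measurable_funX.
apply: (@area_preserving_polar _ S).
- apply: measurable_fun_pair; first by apply: measurable_funM.
  apply: measurable_funD; first by apply: measurable_funM.
  by apply: (measurableT_comp mh); exact: measurable_fst.
- by move=> X mX; apply: (@lebesgue2_flip (-1) h) => //; rewrite normrN1.
- move=> [c s]; rewrite /polar /S /h /= !mulN1r expRD !expRN lnK; last first.
    by rewrite posrE; apply: ltr_pwDl => //; exact: sqr_ge0.
  have c0 : 1 + c ^+ 2 != 0 by rewrite gt_eqF //; apply: ltr_pwDl => //; exact: sqr_ge0.
  have s0 : expR s != 0 by rewrite gt_eqF // expR_gt0.
  have d0 : (c * expR s) ^+ 2 + expR s ^+ 2 != 0.
    by rewrite exprMn -[X in _ + X]mul1r -mulrDl mulf_neq0 ?expf_neq0 // addrC.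
  by congr pair; field; rewrite ?c0 ?s0 ?d0.
Qed.

End HyperbolicArea.

(** * Moebius transformations *)

Section Mobius.
Variable R : realType.

(** The action on pairs of reals, with determinant 1 already used in the second coordinate. *)
Definition mob (g : 'M[R]_2) (p : R * R) : R * R :=
  let n := (g 1 0 * p.1 + g 1 1) ^+ 2 + (g 1 0 * p.2) ^+ 2 in
  (((g 0 0 * p.1 + g 0 1) * (g 1 0 * p.1 + g 1 1) + g 0 0 * g 1 0 * p.2 ^+ 2) / n, p.2 / n).

Lemma det2 (g : 'M[R]_2) : \det g = g 0 0 * g 1 1 - g 0 1 * g 1 0.
Proof. rewrite (expand_det_row _ 0) big_ord_recl big_ord1 /cofactor !det_mx11 !mxE /=.
rewrite expr0 mul1r expr1 mulN1r mulrN.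
by congr (_ * g _ _ - g _ _ * g _ _); apply: val_inj. Qed.

Lemma mob_den (g : 'M[R]_2) p : \det g = 1 -> half_plane p ->
  0 < (g 1 0 * p.1 + g 1 1) ^+ 2 + (g 1 0 * p.2) ^+ 2.
Proof.
rewrite det2 => d1 p0; have [c0|c0] := eqVneq (g 1 0) 0.
  rewrite c0 mul0r add0r mul0r expr0n /= addr0 exprn_even_gt0 //=.
  by apply: contra_eq_neq d1 => ->; rewrite c0 !mulr0 subr0 eq_sym oner_neq0.
by apply: ltr_wpDl; rewrite ?sqr_ge0 // exprn_even_gt0 //= mulf_neq0 // gt_eqF.
Qed.

(** Bruhat decomposition: a triangular matrix is a dilation followed by a translation, and any other
    one is built from translations, a dilation and z -> -1/z. *)
Lemma area_preserving_mob (g : 'M[R]_2) : \det g = 1 -> area_preserving (mob g).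
Proof.
move=> d1; have := d1; rewrite det2 => d2; have [c0|c0] := eqVneq (g 1 0) 0.
  have a0 : g 0 0 != 0.
    by apply: contra_eq_neq d2 => ->; rewrite c0 mulr0 mul0r subr0 eq_sym oner_neq0.
  have dE : g 1 1 = (g 0 0)^-1.
    by apply: (mulfI a0); rewrite divff // -d2 c0 mulr0 subr0.
  have a2 : 0 < g 0 0 ^+ 2 by rewrite exprn_even_gt0.
  have := area_preserving_comp (area_preserving_translation (g 0 0 * g 0 1)) (area_preserving_dilation a2).
  apply: area_preserving_ext => -[x y] _; rewrite /mob /= c0 dE !mul0r add0r expr0n /= addr0.
  by congr pair; field.
have c2 : 0 < (g 1 0 ^+ 2)^-1 by rewrite invr_gt0 exprn_even_gt0.
have := area_preserving_comp (area_preserving_translation (g 0 0 / g 1 0))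
  (area_preserving_comp (area_preserving_dilation c2)
  (area_preserving_comp (area_preserving_inversion R) (area_preserving_translation (g 1 1 / g 1 0)))).
apply: area_preserving_ext => -[x y] p0; have := mob_den d1 p0; rewrite /mob /= => n0.
have n1 : (x + g 1 1 / g 1 0) ^+ 2 + y ^+ 2 != 0.
  suff -> : (x + g 1 1 / g 1 0) ^+ 2 + y ^+ 2 =
    ((g 1 0 * x + g 1 1) ^+ 2 + (g 1 0 * y) ^+ 2) / g 1 0 ^+ 2.
    by rewrite mulf_neq0 ?invr_eq0 ?expf_neq0 // gt_eqF.
  by field.
have n2 := lt0r_neq0 n0.
have bE : g 0 1 = (g 0 0 * g 1 1 - 1) / g 1 0 by rewrite -d2; field.
rewrite bE.
congr pair; field; rewrite ?c0 ?n2 ?n1 //=; rewrite ?andbT.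
all: by [].
Qed.

End Mobius.

Lemma countable_enum (T : choiceType) (A : set T) (a : T) : countable A -> A a ->
  exists e : nat -> T, forall x, A x <-> exists n, e n = x.
Proof.
move=> /pcard_injP [f finj] Aa; pose P n x := A x /\ f x = n.
have /choice [e he] : forall n, exists x, ((exists x, P n x) -> P n x) /\
    (~ (exists x, P n x) -> x = a).
  move=> n; have [[x hx]|hn] := pselect (exists x, P n x).
    by exists x; split=> // hn; case: hn; exists x.
  by exists a; split=> // /hn.
exists e => x; split=> [Ax|[n <-]].
  exists (f x); have [|Ae ee] := (he (f x)).1; first by exists x.
  by apply: finj => //; rewrite inE.
by have [h1 h2] := he n; have [/h1 []|/h2 ->] := pselect (exists x, P n x).
Qed.

Section MobiusGroup.
Variable R : realType.
Local Notation lambda := (@lebesgue_measure R).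
Local Notation TT := (measurableTypeR R * measurableTypeR R)%type.
Local Notation half_plane := (@half_plane R).
Implicit Types (g h : 'M[R]_2) (p q : R * R) (G : set 'M[R]_2).

Lemma mobiusE g p : \det g = 1 -> half_plane p ->
  mobius g (p.1 +i* p.2)%C = ((mob g p).1 +i* (mob g p).2)%C.
Proof.
case: p => x y d1 p0; have n0 := mob_den d1 p0; rewrite det2 in d1.
rewrite /mobius /mob /= in n0 *; simpc.
have -> : y / ((g 1 0 * x + g 1 1) ^+ 2 + (g 1 0 * y) ^+ 2) =
   (g 0 0 * g 1 1 - g 0 1 * g 1 0) * y / ((g 1 0 * x + g 1 1) ^+ 2 + (g 1 0 * y) ^+ 2).
  by rewrite d1 mul1r.
move: n0; set n := _ + _ => n0; have n1 := lt0r_neq0 n0.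
rewrite /GRing.inv /= /GRing.mul /= -/n ?mul0r ?addr0 ?subr0 ?add0r.
move: n n1 {n0 p0 d1} => n n1; move: (g 0 0) (g 0 1) (g 1 0) (g 1 1) => a b c d.
have e1 : (a * x + b) * ((c * x + d) / n) + a * y * (c * y / n) =
  ((a * x + b) * (c * x + d) + a * c * y ^+ 2) / n by field.
have e2 : - ((a * x + b) * (c * y / n)) + a * y * ((c * x + d) / n) =
  (a * d - b * c) * y / n by field.
exact: (congr2 (fun u v => (u +i* v)%C) e1 e2).
Qed.

Lemma mob_half_plane g p : \det g = 1 -> half_plane p -> half_plane (mob g p).
Proof. by move=> d1; exact: (area_preserving_mob d1).1. Qed.

Lemma mob1 p : mob 1 p = p.
Proof.
case: p => x y; rewrite /mob !mxE /= !mul0r !mul1r add0r addr0 expr1n expr0n /= addr0 !divr1 mul0r addr0.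
by rewrite mulr1.
Qed.

Lemma cden_neq0 g p : \det g = 1 -> half_plane p ->
  ((g 1 0)%:C * (p.1 +i* p.2) + (g 1 1)%:C)%C != 0.
Proof.
case: p => x y d1 p0; have := lt0r_neq0 (mob_den d1 p0); apply: contra_neq; simpc.
by case=> -> ->; rewrite expr0n /= addr0.
Qed.

Lemma mobM g h p : \det g = 1 -> \det h = 1 -> half_plane p ->
  mob (g * h) p = mob g (mob h p).
Proof.
move=> dg dh Hp.
have dgh : \det (g * h) = 1 by rewrite det_mulmx dg dh mulr1.
have Hh := mob_half_plane dh Hp.
have := mobiusE dgh Hp; have := mobiusE dg Hh; rewrite -(mobiusE dh Hp).
have n0 := cden_neq0 dh Hp; have n1 := cden_neq0 dgh Hp; have n2 := cden_neq0 dg Hh.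
rewrite -(mobiusE dh Hp) in n2.
suff -> : mobius (g * h) (p.1 +i* p.2)%C = mobius g (mobius h (p.1 +i* p.2)%C).
  move=> e1 e2; rewrite e1 in e2; move: e2.
  by case: (mob _ _) => u v; case: (mob _ _) => u' v' [-> ->].
move: n0 n1 n2; rewrite /mobius; set z := (p.1 +i* p.2)%C.
rewrite !mxE !big_ord_recl !big_ord0 /= !addr0.
have -> : lift ord0 ord0 = 1 :> 'I_2 by apply: val_inj.
have -> : ord0 = 0 :> 'I_2 by [].
rewrite !rmorphD !rmorphM /=.
move: z ((g 0 0)%:C)%C ((g 0 1)%:C)%C ((g 1 0)%:C)%C ((g 1 1)%:C)%C
  ((h 0 0)%:C)%C ((h 0 1)%:C)%C ((h 1 0)%:C)%C ((h 1 1)%:C)%C => z a b c d a' b' c' d' n0 n1 n2.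
have n3 : c * (a' * z + b') + d * (c' * z + d') != 0.
  by have -> : c * (a' * z + b') + d * (c' * z + d') = (c * a' + d * c') * z + (c * b' + d * d') by ring.
by field; rewrite ?n0 ?n1 ?n3.
Qed.

Lemma mobV g p q : \det g = 1 -> half_plane p -> mob g p = q -> mob g^-1 q = p.
Proof.
move=> dg Hp <-; have gu : g \in unitmx by rewrite unitmxE dg unitr1.
rewrite -mobM // ?mulVr // ?mob1 // -?[g \is a GRing.unit]/(g \in unitmx) //.
by rewrite det_inv dg invr1.
Qed.

(* If X meets each G-orbit at most once and G Y contains X, then cutting X along a
   cover by translates of Y and moving the pieces back into Y preserves disjointness. *)
Lemma hyperbolic_area_le_orbit G (X Y : set (R * R)) : PSL2_subgroup G -> countable G ->
  measurable (X : set TT) -> X `<=` half_plane ->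
  measurable (Y : set TT) -> Y `<=` half_plane ->
  (forall p g, X p -> G g -> X (mob g p) -> mob g p = p) ->
  (forall p, X p -> exists2 g, G g & Y (mob g p)) ->
  (hyperbolic_area X <= hyperbolic_area Y)%E.
Proof.
move=> [G1 GN GM GV] cG mX XH mY YH injX cover.
have Gid : G 1 by have := GM _ _ GN GN; rewrite mulrNN mulr1.
have [e eG] := countable_enum cG Gid.
have Ge n : G (e n) by apply/eG; exists n.
have de n : \det (e n) = 1 by exact: G1.
have deV n : \det (e n)^-1 = 1 by rewrite G1 //; exact: GV.
pose Z := seqDU (fun n => X `&` (mob (e n) @^-1` Y `&` half_plane)).
have mZ n : measurable (Z n : set TT).
  have mF k : measurable (X `&` (mob (e k) @^-1` Y `&` half_plane) : set TT).
    apply: measurableI => //; exact: ((area_preserving_mob (de k)).2 _ mY YH).1.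
  by rewrite /Z /seqDU; apply: measurableD => //; apply: bigsetU_measurable => k _; exact: mF.
have UZ : \bigcup_n Z n = X.
  rewrite /Z -seqDU_bigcup_eq; apply/seteqP; split=> [p [n _ [] //]|p Xp].
  have [g Gg Yg] := cover p Xp; have [n en] := (eG g).1 Gg.
  by exists n => //; split=> //; split; [rewrite /= en|exact: XH].
have ZX n : Z n `<=` X by rewrite -UZ; exact: bigcup_sup.
have ZY n p : Z n p -> Y (mob (e n) p) by case=> [[_ []]].
have ZH n : Z n `<=` half_plane := subset_trans (@ZX n) XH.
pose W n := mob (e n)^-1 @^-1` Z n `&` half_plane.
have WP n q : W n q -> exists2 p, Z n p & mob (e n) p = q.
  move=> [/= Zq Hq]; exists (mob (e n)^-1 q) => //.
  have := mobV (deV n) Hq erefl; by rewrite invrK.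
have mW n : measurable (W n : set TT) := ((area_preserving_mob (deV n)).2 _ (mZ n) (@ZH n)).1.
have aW n : hyperbolic_area (W n) = hyperbolic_area (Z n) := ((area_preserving_mob (deV n)).2 _ (mZ n) (@ZH n)).2.
have WH n : W n `<=` half_plane by move=> q [].
have WY : \bigcup_n W n `<=` Y by move=> q [n _ /WP [p Zp <-]]; exact: ZY Zp.
have tZ : trivIset setT Z by exact: trivIset_seqDU.
have tW : trivIset setT W.
  apply/trivIsetP => i j _ _ ij; apply/seteqP; split=> // q [Wi Wj].
  have [p Zp ep] := WP _ _ Wi; have [p' Zp' ep'] := WP _ _ Wj.
  have pp' : p' = p.
    have epj := mobV (de j) (ZH _ _ Zp') ep'.
    have : mob ((e j)^-1 * e i) p = p' by rewrite mobM ?ep //; exact: ZH Zp.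
    move=> h; rewrite -h; apply: injX; [exact: ZX Zp|by apply: GM => //; exact: GV|].
    by rewrite h; exact: ZX Zp'.
  move/trivIsetP : tZ => /(_ i j I I ij) /seteqP [h _].
  by apply: (h p); split=> //; rewrite -pp'.
have mpol (D : set TT) : measurable D -> measurable (@polar R @^-1` D : set TT).
  by move=> mD; rewrite -[X in measurable X]setTI; exact: measurable_polar.
have mU : measurable (\bigcup_n W n : set TT) by exact: bigcup_measurable.
have UH : \bigcup_n W n `<=` half_plane by move=> q [n _]; exact: WH.
apply: (@le_trans _ _ (hyperbolic_area (\bigcup_n W n))); last first.
  rewrite !hyperbolic_area_polar //; apply: le_measure; rewrite ?inE; try exact: mpol.
  by move=> q; exact: WY.
have eZW n : (lambda \x lambda)%E (@polar R @^-1` Z n) = (lambda \x lambda)%E (@polar R @^-1` W n).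
  by rewrite -!hyperbolic_area_polar // aW.
rewrite -UZ !hyperbolic_area_polar //; last by rewrite UZ.
rewrite !preimage_bigcup !measure_bigcup //.
- by rewrite (eq_eseriesr (fun n _ => eZW n)).
- by move=> n _; exact: mpol.
- by apply/trivIsetP => i j _ _ ij; rewrite -preimage_setI; move/trivIsetP: tW => ->; rewrite ?preimage_set0.
- by move=> n _; exact: mpol.
- by apply/trivIsetP => i j _ _ ij; rewrite -preimage_setI; move/trivIsetP: tZ => ->; rewrite ?preimage_set0.
- by rewrite UZ.
Qed.

End MobiusGroup.

Lemma finite_set_min (T : eqType) (A : set T) (r : T -> T -> Prop) (a : T) :
  (forall x y, r x y \/ r y x) -> (forall x y z, r x y -> r y z -> r x z) ->
  finite_set A -> A a -> exists2 m, A m & forall x, A x -> r m x.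
Proof.
move=> tot tr /finite_seqP [s ->]; elim: s a => [//|b s IH] a _.
have rr x : r x x by case: (tot x x).
case: s IH => [|c s] IH.
  by exists b; rewrite /= ?mem_head // => x; rewrite inE => /eqP ->.
have [m ms hm] := IH c (mem_head _ _).
have [bm|mb] := tot b m.
  exists b; rewrite /= ?mem_head // => x; rewrite inE => /predU1P [-> //|xs].
  exact: tr bm (hm _ xs).
exists m; [by move: ms; rewrite /= !inE => ->; rewrite orbT|move=> x /=]; rewrite inE => /predU1P [-> //|xs].
exact: hm.
Qed.

(** * Dirichlet domains *)

Section DirichletDomain.
Variable R : realType.
Local Notation TT := (measurableTypeR R * measurableTypeR R)%type.
Local Notation half_plane := (@half_plane R).
Implicit Types (g h : 'M[R]_2) (p q : R * R) (G : set 'M[R]_2).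

(* 2 cosh of the hyperbolic distance to i. *)
Definition height p : R := (p.1 ^+ 2 + p.2 ^+ 2 + 1) / p.2.

(** Ties of height are broken lexicographically so that the minimum over an orbit is a single point:
    a fundamental set has to meet every orbit exactly once, boundary included. *)
Definition lexle p q : Prop := height p < height q \/
  (height p = height q /\ (p.1 < q.1 \/ (p.1 = q.1 /\ p.2 <= q.2))).

Lemma lexle_total p q : lexle p q \/ lexle q p.
Proof.
rewrite /lexle; have [h|h|->] := ltgtP (height p) (height q); [by left; left|by right; left|].
have [h|h|->] := ltgtP p.1 q.1; [by left; right; split=> //; left|by right; right; split=> //; left|].
by have [h|h] := leP p.2 q.2; [left|right]; right; split=> //; right; split=> //; exact: ltW.
Qed.

Lemma lexle_trans p q s : lexle p q -> lexle q s -> lexle p s.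
Proof.
rewrite /lexle => -[h1|[e1 h1]] [h2|[e2 h2]].
- by left; exact: lt_trans h1 h2.
- by left; rewrite -e2.
- by left; rewrite e1.
right; split; first by rewrite e1.
case: h1 h2 => [h1|[e3 h1]] [h2|[e4 h2]].
- by left; exact: lt_trans h1 h2.
- by left; rewrite -e4.
- by left; rewrite e3.
- by right; split; [rewrite e3|exact: le_trans h1 h2].
Qed.

Lemma lexle_anti p q : lexle p q -> lexle q p -> p = q.
Proof.
case: p q => x y [x' y']; rewrite /lexle /=.
move=> [h1|[e1 h1]] [h2|[e2 h2]]; first by have := lt_trans h1 h2; rewrite ltxx.
- by move: h1; rewrite e2 ltxx.
- by move: h2; rewrite e1 ltxx.
case: h1 h2 => [h1|[-> h1]] [h2|[e4 h2]].
- by have := lt_trans h1 h2; rewrite ltxx.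
- by move: h1; rewrite e4 ltxx.
- by move: h2; rewrite ltxx.
- by congr pair; apply/eqP; rewrite eq_le h1.
Qed.

Lemma height_mob g p : \det g = 1 -> half_plane p -> height (mob g p) =
  ((g 0 0 * p.1 + g 0 1) ^+ 2 + (g 0 0 * p.2) ^+ 2 + (g 1 0 * p.1 + g 1 1) ^+ 2 +
   (g 1 0 * p.2) ^+ 2) / p.2.
Proof.
case: p => x y d1 p0; have n0 := lt0r_neq0 (mob_den d1 p0); have y0 : y != 0 := lt0r_neq0 p0.
rewrite det2 in d1; rewrite /height /mob /= in n0 *.
move: d1 n0; move: (g 0 0) (g 0 1) (g 1 0) (g 1 1) => a b c d e n0.
set n := (c * x + d) ^+ 2 + (c * y) ^+ 2 in n0 *.
have key : ((a * x + b) * (c * x + d) + a * c * y ^+ 2) ^+ 2 + y ^+ 2 =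
  n * ((a * x + b) ^+ 2 + (a * y) ^+ 2).
  transitivity (((a * x + b) * (c * x + d) + a * c * y ^+ 2) ^+ 2 + (a * d - b * c) ^+ 2 * y ^+ 2).
    by rewrite e expr1n mul1r.
  by rewrite /n; ring.
have -> : ((((a * x + b) * (c * x + d) + a * c * y ^+ 2) / n) ^+ 2 + (y / n) ^+ 2 + 1) / (y / n)
   = ((((a * x + b) * (c * x + d) + a * c * y ^+ 2) ^+ 2 + y ^+ 2) / n + n) / y.
  by field; rewrite n0 y0.
by rewrite key mulrAC divff // mul1r /n; congr (_ / _); ring.
Qed.

Variable G : set 'M[R]_2.
Hypotheses (sG : PSL2_subgroup G) (cG : countable G)
  (fG : forall C : R, finite_set [set g | G g /\ forall i j, `|g i j| <= C]).

Definition dirichlet : set (R * R) := [set p | half_plane p /\ forall g, G g -> lexle p (mob g p)].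

Let det1 g : G g -> \det g = 1. Proof. by case: sG => h _ _ _; exact: h. Qed.
Let GM g h : G g -> G h -> G (g * h). Proof. by case: sG => _ _ h' _; exact: h'. Qed.
Let GV g : G g -> G g^-1. Proof. by case: sG => _ _ _ h'; exact: h'. Qed.
Let G1 : G 1.
Proof. by case: sG => _ GN _ _; have := GM GN GN; rewrite mulrNN mulr1. Qed.

Let mpos (f : TT -> R) : measurable_fun [set: TT] (f : TT -> measurableTypeR R) ->
  measurable [set p | 0 < f p].
Proof.
move=> mf; rewrite (_ : [set p | _] = f @^-1` `]0, +oo[%classic); last first.
  by apply/seteqP; split=> x; rewrite /= in_itv /= andbT.
by rewrite -[X in measurable X]setTI; exact: mf.
Qed.

Let mzero (f : TT -> R) : measurable_fun [set: TT] (f : TT -> measurableTypeR R) ->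
  measurable [set p | f p = 0].
Proof.
move=> mf; rewrite (_ : [set p | _] = f @^-1` [set 0]) //.
by rewrite -[X in measurable X]setTI; exact: mf.
Qed.

Let mH : measurable (half_plane : set TT).
Proof. by apply: mpos; exact: measurable_snd. Qed.

(** [F2], [den] and [X2] are the comparisons of [lexle] with denominators cleared; being polynomial,
    they make the domain visibly Borel. *)
Let F2 g (p : TT) : measurableTypeR R := (g 0 0 * p.1 + g 0 1) ^+ 2 + (g 0 0 * p.2) ^+ 2 +
  (g 1 0 * p.1 + g 1 1) ^+ 2 + (g 1 0 * p.2) ^+ 2 - (p.1 ^+ 2 + p.2 ^+ 2 + 1).
Let den g (p : TT) : measurableTypeR R := (g 1 0 * p.1 + g 1 1) ^+ 2 + (g 1 0 * p.2) ^+ 2.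
Let X2 g (p : TT) : measurableTypeR R :=
  (g 0 0 * p.1 + g 0 1) * (g 1 0 * p.1 + g 1 1) + g 0 0 * g 1 0 * p.2 ^+ 2 - p.1 * den g p.

Let msnd : measurable_fun [set: TT] (fun p : TT => p.2 : measurableTypeR R).
Proof. exact: measurable_snd. Qed.
Let mfst : measurable_fun [set: TT] (fun p : TT => p.1 : measurableTypeR R).
Proof. exact: measurable_fst. Qed.
Let mlin (a b : R) : measurable_fun [set: TT] (fun p : TT => a * p.1 + b : measurableTypeR R).
Proof. by apply: measurable_funD => //; exact: measurable_funM. Qed.
Let mlin2 (a : R) : measurable_fun [set: TT] (fun p : TT => a * p.2 : measurableTypeR R).
Proof. exact: measurable_funM. Qed.
Let mden g : measurable_fun [set: TT] (den g).
Proof. by apply: measurable_funD; apply: measurable_funX; [exact: mlin|exact: mlin2]. Qed.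
Let mF2 g : measurable_fun [set: TT] (F2 g).
Proof.
apply: measurable_funB; last first.
  apply: measurable_funD => //; apply: measurable_funD; apply: measurable_funX.
    exact: mfst.
  exact: msnd.
apply: measurable_funD; [apply: measurable_funD; [apply: measurable_funD|]|]; apply: measurable_funX.
- exact: mlin.
- exact: mlin2.
- exact: mlin.
- exact: mlin2.
Qed.
Let mX2 g : measurable_fun [set: TT] (X2 g).
Proof.
apply: measurable_funB; last by apply: measurable_funM; [exact: mfst|exact: mden].
apply: measurable_funD; first by apply: measurable_funM; exact: mlin.
by apply: measurable_funM => //; apply: measurable_funX; exact: msnd.
Qed.

Let lexleE g p : G g -> half_plane p -> lexle p (mob g p) <->
  (0 < F2 g p \/ (F2 g p = 0 /\ (0 < X2 g p \/ (X2 g p = 0 /\ (0 < 1 - den g p \/ 1 - den g p = 0))))).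
Proof.
move=> Gg Hp; have d1 := det1 Gg; have n0 := mob_den d1 Hp.
rewrite /lexle height_mob // /height.
have y0 : 0 < p.2 := Hp.
rewrite ltr_pM2r ?invr_gt0 // /F2 subr_gt0.
have -> : (p.1 < (mob g p).1) = (0 < X2 g p) by rewrite /mob /= ltr_pdivlMr // /X2 subr_gt0.
have -> : (p.2 <= (mob g p).2) = (0 <= 1 - den g p).
  by rewrite /mob /= ler_pdivlMr // ger_pMr // subr_ge0.
have e1 (u v : R) : u / p.2 = v / p.2 <-> v - u = 0.
  split=> [/(mulIf (invr_neq0 (lt0r_neq0 y0))) ->|/subr0_eq -> //]; exact: subrr.
have e2 : p.1 = (mob g p).1 <-> X2 g p = 0.
  rewrite /mob /= /X2; split=> [e|/subr0_eq e]; last by rewrite e mulfK // lt0r_neq0.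
  by apply/eqP; rewrite subr_eq0 [X in _ == X * _]e divfK // lt0r_neq0.
have e3 : 0 <= 1 - den g p <-> 0 < 1 - den g p \/ 1 - den g p = 0.
  by rewrite le_eqVlt; split=> [/predU1P [->|]|[->|->]]; rewrite ?eqxx ?orbT; auto.
by rewrite e1 e2 e3.
Qed.

Lemma measurable_dirichlet : measurable (dirichlet : set TT).
Proof.
have -> : dirichlet = half_plane `&` \bigcap_(g in G) [set p | half_plane p -> lexle p (mob g p)].
  by apply/seteqP; split=> p [Hp h]; split=> // g Gg; [move=> _; exact: h|exact: h].
have -> : half_plane `&` \bigcap_(g in G) [set p | half_plane p -> lexle p (mob g p)] =
  half_plane `&` \bigcap_(g in G) ([set p | 0 < F2 g p] `|` ([set p | F2 g p = 0] `&`
   ([set p | 0 < X2 g p] `|` ([set p | X2 g p = 0] `&`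
    ([set p | 0 < 1 - den g p] `|` [set p | 1 - den g p = 0]))))).
  apply/seteqP; split=> p [Hp h]; split=> // g Gg.
    by have /(lexleE Gg Hp) := h g Gg Hp.
  by move=> _; apply/(lexleE Gg Hp); exact: h.
apply: measurableI => //; have [e eG] := countable_enum cG G1.
rewrite (_ : \bigcap_(g in G) _ = \bigcap_n ([set p | 0 < F2 (e n) p] `|` ([set p | F2 (e n) p = 0] `&`
   ([set p | 0 < X2 (e n) p] `|` ([set p | X2 (e n) p = 0] `&`
    ([set p | 0 < 1 - den (e n) p] `|` [set p | 1 - den (e n) p = 0])))))); last first.
  apply/seteqP; split=> p h; first by move=> n _; apply: h; apply/eG; exists n.
  by move=> g /eG [n <-]; exact: h.
apply: bigcap_measurableType => n _; move: (e n) => g.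
apply: measurableU; first exact: mpos.
apply: measurableI; first exact: mzero.
apply: measurableU; first exact: mpos.
apply: measurableI; first exact: mzero.
by apply: measurableU; [apply: mpos|apply: mzero]; apply: measurable_funB => //; exact: mden.
Qed.

(** A bound on the height of g p bounds the entries of g, so only finitely many g compete for the
    minimum. *)
Let orbit_min p : half_plane p -> exists2 m, G m & dirichlet (mob m p).
Proof.
move=> Hp; have y0 : 0 < p.2 := Hp.
pose A := [set g | G g /\ height (mob g p) <= height p].
have fA : finite_set A.
  pose K := height p.
  have K0 : 0 <= K by rewrite divr_ge0 ?addr_ge0 ?sqr_ge0 // ltW.
  have sqb (t M : R) : t ^+ 2 <= M -> `|t| <= 1 + M.
    move=> h; have [t1|t1] := leP `|t| 1.
      by apply: le_trans t1 _; rewrite lerDl; apply: le_trans h; exact: sqr_ge0.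
    apply: le_trans (_ : M <= _); last by rewrite lerDr.
    apply: le_trans h; rewrite -real_normK ?num_real // expr2.
    by rewrite ler_peMr // ltW.
  apply: (sub_finite_set _ (fG (1 + K * p.2 + (1 + K / p.2) * (1 + `|p.1|)))) => g [Gg hg]; split=> //.
  have d1 := det1 Gg; rewrite height_mob // ler_pdivrMr // in hg.
  have Kp : 0 <= K / p.2 by rewrite divr_ge0 // ltW.
  have Kq : 0 <= K * p.2 by rewrite mulr_ge0 // ltW.
  have col (a b : R) : (a * p.1 + b) ^+ 2 + (a * p.2) ^+ 2 <= K * p.2 ->
      `|a| <= 1 + K / p.2 /\ `|b| <= 1 + K * p.2 + (1 + K / p.2) * `|p.1|.
    move=> h; have ha : `|a| <= 1 + K / p.2.
      apply: sqb; rewrite -(ler_pM2r (exprn_gt0 2 y0)) -exprMn.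
      have -> : K / p.2 * p.2 ^+ 2 = K * p.2 by field; rewrite gt_eqF.
      by apply: le_trans h; rewrite lerDr sqr_ge0.
    split=> //; have hb : `|a * p.1 + b| <= 1 + K * p.2.
      by apply: sqb; apply: le_trans h; rewrite lerDl sqr_ge0.
    have -> : b = (a * p.1 + b) - a * p.1 by rewrite addrAC subrr add0r.
    apply: le_trans (ler_normB _ _) _; apply: lerD => //.
    by rewrite normrM ler_wpM2r.
  have [a1 b1] : `|g 0 0| <= 1 + K / p.2 /\ `|g 0 1| <= 1 + K * p.2 + (1 + K / p.2) * `|p.1|.
    by apply: col; apply: le_trans hg; rewrite -addrA lerDl addr_ge0 ?sqr_ge0.
  have [a2 b2] : `|g 1 0| <= 1 + K / p.2 /\ `|g 1 1| <= 1 + K * p.2 + (1 + K / p.2) * `|p.1|.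
    by apply: col; apply: le_trans hg; rewrite -addrA lerDr addr_ge0 ?sqr_ge0.
  have c1 : 1 + K / p.2 <= 1 + K * p.2 + (1 + K / p.2) * (1 + `|p.1|).
    rewrite mulrDr mulr1 addrCA lerDl !addr_ge0 // mulr_ge0 // addr_ge0 //.
  have c2 : 1 + K * p.2 + (1 + K / p.2) * `|p.1| <= 1 + K * p.2 + (1 + K / p.2) * (1 + `|p.1|).
    by rewrite lerD2l ler_wpM2l ?lerDr // addr_ge0.
  have two (i : 'I_2) : i = 0 \/ i = 1.
    by case: i => [[|[|i]] li] //; [left|right]; apply: val_inj.
  move=> i j; case: (two i) (two j) => -> [] ->.
  - exact: le_trans a1 c1.
  - exact: le_trans b1 c2.
  - exact: le_trans a2 c1.
  - exact: le_trans b2 c2.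
have A1 : A 1 by split=> //; rewrite mob1.
have [m [Gm hm] minm] := finite_set_min (fun g h => lexle_total (mob g p) (mob h p))
  (fun g h k => @lexle_trans (mob g p) (mob h p) (mob k p)) fA A1.
exists m => //; split; first exact: mob_half_plane (det1 Gm) Hp.
move=> g Gg; rewrite -mobM ?det1 //.
have [h|h] := leP (height (mob (g * m) p)) (height p).
  by apply: minm; split=> //; exact: GM.
by left; exact: le_lt_trans hm h.
Qed.

Lemma dirichlet_fundamental : fundamental_set G dirichlet.
Proof.
split; [exact: measurable_dirichlet|by move=> p []|].
move=> z Hz; pose p := (complex.Re z, complex.Im z).
have Hp : half_plane p by [].
have zE : z = (p.1 +i* p.2)%C by rewrite /p; case: (z).
have [m Gm Dm] := orbit_min Hp.
exists (mob m p); split.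
  by split=> //; exists m => //; rewrite zE -mobiusE // det1.
move=> q [Dq [g Gg e]]; have {e} e : q = mob g p.
  move: e; rewrite zE mobiusE ?det1 //; case: (q) => u v; case: (mob g p) => u' v' /= [-> ->] //.
have Hm := mob_half_plane (det1 Gm) Hp; have Hg := mob_half_plane (det1 Gg) Hp.
apply: lexle_anti.
  rewrite e; have -> : mob g p = mob (g * m^-1) (mob m p).
    by rewrite mobM ?det1 //; [rewrite (mobV (det1 Gm) Hp)|exact: GV].
  by apply: Dm.2; apply: GM => //; exact: GV.
rewrite e in Dq; rewrite e; have -> : mob m p = mob (m * g^-1) (mob g p).
  by rewrite mobM ?det1 //; [rewrite (mobV (det1 Gg) Hp)|exact: GV].
by apply: Dq.2; apply: GM => //; exact: GV.
Qed.

End DirichletDomain.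

(** * Areas of a window, a box and a Siegel set *)

Section Areas.
Variable R : realType.
Local Notation lambda := (@lebesgue_measure R).
Local Notation TT := (measurableTypeR R * measurableTypeR R)%type.
Local Notation half_plane := (@half_plane R).

Let mge (f : TT -> R) : measurable_fun [set: TT] (f : TT -> measurableTypeR R) ->
  measurable [set p | 0 <= f p].
Proof.
move=> mf; rewrite (_ : [set p | _] = f @^-1` `[0, +oo[%classic); last first.
  by apply/seteqP; split=> x; rewrite /= in_itv /= andbT.
by rewrite -[X in measurable X]setTI; exact: mf.
Qed.

Let mlin (a b c : R) : measurable_fun [set: TT] (fun p : TT => a * p.1 + b * p.2 + c : measurableTypeR R).
Proof.
by apply: measurable_funD => //; apply: measurable_funD; apply: measurable_funM.
Qed.

Let mpolar (D : set TT) : measurable D -> measurable (@polar R @^-1` D : set TT).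
Proof. by move=> mD; rewrite -[X in measurable X]setTI; exact: measurable_polar. Qed.

Let rect (a b c d : R) : (lambda \x lambda)%E (`[a, b]%classic `*` `[c, d]%classic) =
  (lambda `[a, b]%classic * lambda `[c, d]%classic)%E.
Proof. exact: product_measure1E. Qed.

(** In the coordinates x / y and ln y the window is the rectangle [K, 4K/3] x
    [- ln K, ln(3/2) - ln K]. Its area K ln(3/2) / 3 grows with K while x stays between 1 and 2. *)
Lemma large_window (V : R) : exists (W : set (R * R)) (K : R),
  [/\ measurable (W : set TT), 0 < K,
   forall p, W p -> [/\ 0 < p.2, 1 <= p.1 <= 2, K^-1 <= p.2 & p.2 <= 1]
   & (V%:E < hyperbolic_area W)%E].
Proof.
pose l := ln (3 / 2 : R); have l0 : 0 < l by apply: ln_gt0; lra.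
pose K := 2 + 3 * `|V| / l.
have K2 : 2 <= K by rewrite lerDl divr_ge0 ?mulr_ge0 // ltW.
have K0 : 0 < K by lra.
pose W : set (R * R) := [set p | [/\ 0 <= 0 * p.1 + 1 * p.2 + (- K^-1),
  0 <= 0 * p.1 + (-1) * p.2 + 3 / 2 / K, 0 <= 1 * p.1 + (- K) * p.2 + 0
  & 0 <= (-1) * p.1 + (4 / 3 * K) * p.2 + 0]].
have mW : measurable (W : set TT).
  rewrite (_ : W = [set p | 0 <= 0 * p.1 + 1 * p.2 + (- K^-1)] `&`
    ([set p | 0 <= 0 * p.1 + (-1) * p.2 + 3 / 2 / K] `&`
    ([set p | 0 <= 1 * p.1 + (- K) * p.2 + 0] `&`
     [set p | 0 <= (-1) * p.1 + (4 / 3 * K) * p.2 + 0]))).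
    by apply: measurableI; [|apply: measurableI; [|apply: measurableI]]; apply: mge; exact: mlin.
  by apply/seteqP; split=> p; [case|case=> ? [? []]].
have KV0 : 0 < K^-1 by rewrite invr_gt0.
have KK : K * K^-1 = 1 by rewrite divff // gt_eqF.
have Wp p : W p -> [/\ 0 < p.2, 1 <= p.1 <= 2, K^-1 <= p.2 & p.2 <= 1].
  case: p => x y [/= h1 h2 h3 h4].
  have y1 : K^-1 <= y by lra.
  have y2 : y <= 3 / 2 * K^-1 by lra.
  have k1 : K^-1 <= 1 / 2 by rewrite -[1/2]/(1 * 2^-1) mul1r lef_pV2 ?posrE.
  split; [lra| |lra|lra].
  have : K * K^-1 <= K * y by rewrite ler_pM2l.
  have : K * y <= K * (3 / 2 * K^-1) by rewrite ler_pM2l.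
  have -> : K * (3 / 2 * K^-1) = 3 / 2 * (K * K^-1) by ring.
  rewrite KK => u1 u2; apply/andP; split; lra.
exists W, K; split=> //.
rewrite hyperbolic_area_polar //; last by move=> p /Wp [].
have -> : @polar R @^-1` W = `[K, 4 / 3 * K]%classic `*` `[- ln K, l - ln K]%classic.
  have ex s : (K^-1 <= expR s) = (- ln K <= s).
    by rewrite -[K^-1]lnK ?posrE // lnV ?posrE // ler_expR.
  have ex2 s : (expR s <= 3 / 2 / K) = (s <= l - ln K).
    have h : 0 < 3 / 2 / K by rewrite !divr_gt0.
    by rewrite -[3 / 2 / K]lnK ?posrE // ler_expR ln_div ?posrE // divr_gt0.
  apply/seteqP; split=> -[c s]; rewrite /W /polar /= !in_itv /= -ex -ex2.
    have e0 := expR_gt0 s; move=> [h1 h2 h3 h4].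
    split; apply/andP; split; try lra.
      by rewrite -(ler_pM2r e0); lra.
    by rewrite -(ler_pM2r e0); lra.
  have e0 := expR_gt0 s; move=> [/andP [h1 h2] /andP [h3 h4]].
  rewrite -(ler_pM2r e0) in h1; rewrite -(ler_pM2r e0) in h2.
  split; lra.
rewrite rect !lebesgue_measure_itv /= !lte_fin.
rewrite ifT; last by lra.
rewrite ifT; last by lra.
rewrite -!EFinB -EFinM lte_fin.
have -> : (4 / 3 * K - K) * (l - ln K - - ln K) = K * l / 3 by field.
have -> : K * l / 3 = 2 * l / 3 + `|V| by rewrite /K; field; rewrite gt_eqF.
have := ler_norm V; nra.
Qed.

Lemma box_area (C : R) : 1 < C -> let E := [set p : R * R | `|p.1| <= C /\ C^-1 <= p.2 <= C] in
  [/\ measurable (E : set TT), E `<=` half_plane & (hyperbolic_area E < +oo)%E].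
Proof.
move=> C1 E; have C0 : 0 < C by lra.
have CV0 : 0 < C^-1 by rewrite invr_gt0.
have mE : measurable (E : set TT).
  rewrite (_ : E = [set p | 0 <= 0 * p.1 + 1 * p.2 + (- C^-1)] `&`
    ([set p | 0 <= 0 * p.1 + (-1) * p.2 + C] `&`
    ([set p | 0 <= 1 * p.1 + 0 * p.2 + C] `&`
     [set p | 0 <= (-1) * p.1 + 0 * p.2 + C]))).
    by apply: measurableI; [|apply: measurableI; [|apply: measurableI]]; apply: mge; exact: mlin.
  apply/seteqP; split=> p; rewrite /E /= ler_norml.
    by move=> [/andP [h1 h2] /andP [h3 h4]]; do 3 (split; first by lra); lra.
  by move=> [h1 [h2 [h3 h4]]]; split; apply/andP; split; lra.
have EH : E `<=` half_plane by move=> p [_ /andP [h _]]; exact: lt_le_trans h.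
split=> //; rewrite hyperbolic_area_polar //.
pose Q : set TT := `[- C ^+ 2, C ^+ 2]%classic `*` `[- ln C, ln C]%classic.
apply: (@le_lt_trans _ _ ((lambda \x lambda)%E Q)).
  apply: le_measure; rewrite ?inE; [exact: mpolar|exact: measurableX|].
  move=> [c s] [/= h1 /andP [h2 h3]]; split; rewrite /= in_itv /=.
    rewrite -ler_norml -[X in _ <= X]mulr1 -(divff (lt0r_neq0 C0)) expr2.
    have e0 := expR_gt0 s.
    rewrite normrM (gtr0_norm e0) in h1.
    have : `|c| * C^-1 <= C by apply: le_trans h1; rewrite ler_wpM2l.
    rewrite -ler_pdivlMr // invrK => h; rewrite divff ?mulr1 // gt_eqF //.
  apply/andP; split; first by rewrite -[- ln C]opprK opprK -lnV ?posrE // -ler_expR lnK ?posrE.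
  by rewrite -ler_expR lnK ?posrE.
rewrite rect !lebesgue_measure_itv /= !lte_fin.
by case: ifP => _; case: ifP => _; rewrite -?EFinB -?EFinM ?mul0e ?mule0 ?ltry // ltey.
Qed.

Lemma siegel_area : let E := [set p : R * R | `|p.1| <= 1 /\ 2^-1 <= p.2] in
  [/\ measurable (E : set TT), E `<=` half_plane & (hyperbolic_area E < +oo)%E].
Proof.
move=> E.
have mE : measurable (E : set TT).
  rewrite (_ : E = [set p | 0 <= 0 * p.1 + 1 * p.2 + (- 2^-1)] `&`
    ([set p | 0 <= 1 * p.1 + 0 * p.2 + 1] `&`
     [set p | 0 <= (-1) * p.1 + 0 * p.2 + 1])).
    by apply: measurableI; [|apply: measurableI]; apply: mge; exact: mlin.
  apply/seteqP; split=> p; rewrite /E /= ler_norml.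
    by move=> [/andP [h1 h2] h3]; do 2 (split; first by lra); lra.
  by move=> [h1 [h2 h3]]; split; [apply/andP; split|]; lra.
have EH : E `<=` half_plane by move=> p [_ h]; apply: lt_le_trans h; lra.
split=> //; rewrite hyperbolic_area_polar //.
rewrite (product_measure_unique _ _ (m' := (lambda \x^ lambda)%E)); first last.
- exact: mpolar.
- by move=> A B mA mB; exact: product_measure2E.
rewrite /product_measure2.
rewrite [X in (X < _)%E](_ : _ = \int[lambda]_(s in `[(- ln 2)%R, +oo[) (2 * expR (- s))%:E)%E; last first.
  rewrite [RHS]integral_mkcond; apply: eq_integral => s _ /=.
  have e0 := expR_gt0 s; have e1 := expR_gt0 (- s).
  have ee : expR s * expR (- s) = 1 by rewrite -expRD subrr expR0.
  have hs : (s \in `[- ln 2, +oo[%classic) = (2^-1 <= expR s).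
    rewrite mem_setE in_itv /= andbT -[2^-1]lnK ?posrE ?invr_gt0 // lnV ?posrE //.
    by rewrite ler_expR.
  rewrite patchE hs; case: ifP => h; last first.
    rewrite (_ : ysection _ _ = set0) ?measure0 //; apply/seteqP; split=> // c.
    by rewrite /ysection /= inE /E /polar /= h => -[].
  rewrite (_ : ysection _ _ = `[- expR (- s), expR (- s)]%classic).
    rewrite lebesgue_measure_itv /= lte_fin ifT; last by lra.
    by rewrite -EFinB; congr EFin; ring.
  have hE c : (`|c * expR s| <= 1) = (`|c| <= expR (- s)).
    by rewrite normrM (gtr0_norm e0) -ler_pdivlMr // div1r expRN.
  apply/seteqP; split=> c; rewrite /ysection /= inE /E /polar /= in_itv /= -ler_norml hE.
    by case.
  by [].
have cexp (k : R) : continuous (fun s : R => k * expR (- s)).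
  move=> s; apply: cvgM; first exact: cvg_cst.
  by apply: continuous_comp; [exact: continuousN|exact: continuous_expR].
rewrite (@ge0_continuous_FTC2y R (fun s : R => 2 * expR (- s)) (fun s : R => - 2 * expR (- s)) _ 0).
- by rewrite -EFinB ltry.
- by move=> s _; rewrite mulr_ge0 // expR_ge0.
- exact: continuous_subspaceT.
- rewrite -(mulr0 (- 2 : R)); apply: cvgM; first exact: cvg_cst.
  exact: cvgr_expR.
- by move=> s _; apply: ex_derive.
- by apply: cvg_at_right_filter; exact: cexp.
- move=> s _; rewrite derive1E derive_val /GRing.scale /=; ring.
Qed.

End Areas.

(** * Unit groups acting on the half-plane *)

(** The span of the image of any basis contains the image of every element, so with equal dimensions
    one family with spanning image is enough. *)
Lemma base_change_spanning (F E : fieldType) (s : {rmorphism F -> E}) (B : falgType F)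
    (A : falgType E) (iota : {lrmorphism B -> A | s \; *:%R}) (Y : seq B) :
  \dim {:B}%VS = \dim {:A}%VS -> span (map iota Y) = {:A}%VS -> base_change iota.
Proof.
move=> dBA sY X bX; have sX : size X = \dim {:B}%VS by rewrite -(span_basis bX) (eqP (basis_free bX)).
rewrite basisEdim size_map sX dBA leqnn andbT -sY.
apply/span_subvP => _ /mapP [y _ ->].
have := memvf y; rewrite -(span_basis bX) => /(@coord_span _ _ _ (in_tuple X)) ->.
rewrite linear_sum; apply: rpred_sum => i _; rewrite linearZ /=.
apply: rpredZ; apply: memv_span; apply: map_f; exact: mem_nth.
Qed.

Lemma forall_I2 (P : 'I_2 -> Prop) : P 0 -> P 1 -> forall i, P i.
Proof.
move=> h0 h1 [[|[|i]] li] //.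
  by rewrite (_ : Ordinal li = 0) //; exact: val_inj.
by rewrite (_ : Ordinal li = 1) //; exact: val_inj.
Qed.

Lemma mx2P (K : Type) (A C : 'M[K]_2) :
  A 0 0 = C 0 0 -> A 0 1 = C 0 1 -> A 1 0 = C 1 0 -> A 1 1 = C 1 1 -> A = C.
Proof.
move=> e1 e2 e3 e4; apply/matrixP.
by apply: forall_I2; apply: forall_I2.
Qed.

Definition mx2 (K : Type) (a b c d : K) : 'M[K]_2 :=
  \matrix_(i, j) (if i == 0 then (if j == 0 then a else b) else (if j == 0 then c else d)).

Lemma mx2E (K : Type) (a b c d : K) : (mx2 a b c d 0 0 = a) * (mx2 a b c d 0 1 = b) *
  (mx2 a b c d 1 0 = c) * (mx2 a b c d 1 1 = d).
Proof. by rewrite /mx2 !mxE. Qed.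

Lemma mulmx2E (K : comNzRingType) (A C : 'M[K]_2) i j : (A * C) i j = A i 0 * C 0 j + A i 1 * C 1 j.
Proof.
rewrite mxE big_ord_recl big_ord1 (_ : lift ord0 ord0 = 1) //; exact: val_inj.
Qed.

Lemma one_mx2 (K : comNzRingType) : (1 : 'M[K]_2) = mx2 1 0 0 1.
Proof. by apply: mx2P; rewrite !mx2E !mxE. Qed.

Section QuaternionRepresentation.
Variables (R : realType) (F : fieldType) (nu : {rmorphism F -> R}) (a b : F) (s : R).
Hypothesis sE : s ^+ 2 = nu a.
Local Notation B := (quaternion a b).

(** i acts as diag(s, -s) and j as the matrix with rows (0, b) and (1, 0). The equation for s is an
    argument so that the morphism structures can be attached. *)
Definition qrep (_ : s ^+ 2 = nu a) (x : B) : 'M[R]_2 :=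
  mx2 (nu (q0 x) + nu (q1 x) * s) (nu b * (nu (q2 x) + nu (q3 x) * s))
      (nu (q2 x) - nu (q3 x) * s) (nu (q0 x) - nu (q1 x) * s).
Local Notation rho := (qrep sE).

Let rhoB : zmod_morphism rho.
Proof. by move=> x y; apply: mx2P; rewrite /qrep /mx2 !mxE /= !qE !rmorphB /=; ring. Qed.

Let nuaE : nu a = s * s. Proof. by rewrite -sE expr2. Qed.

Let rhoM : monoid_morphism rho.
Proof.
split.
  by rewrite one_mx2; apply: mx2P; rewrite /qrep !mx2E !qE ?rmorph1 ?rmorph0; ring.
move=> x y; apply: mx2P; rewrite mulmx2E /qrep !mx2E !qmul_E /qmul !qE
  !(rmorphD, rmorphN, rmorphM) /= !nuaE; ring.
Qed.

Let rhoZ : scalable_for (nu \; *:%R) rho.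
Proof.
by move=> c x; apply: mx2P; rewrite /qrep /mx2 !mxE /= !qE !rmorphM /=; ring.
Qed.

HB.instance Definition _ := GRing.isZmodMorphism.Build B 'M[R]_2 rho rhoB.
HB.instance Definition _ := GRing.isMonoidMorphism.Build B 'M[R]_2 rho rhoM.
HB.instance Definition _ := GRing.isScalable.Build F B 'M[R]_2 (nu \; *:%R) rho rhoZ.

Definition qrep_lrmorphism : {lrmorphism B -> 'M[R]_2 | nu \; *:%R} := rho.

Lemma qrep_det x : \det (rho x) = nu (qnrd x).
Proof.
rewrite det2 /qrep !mx2E /qnrd !(rmorphD, rmorphN, rmorphM, rmorphXn) /= !nuaE; ring.
Qed.

Lemma qrep_tr x : \tr (rho x) = nu (qtr x).
Proof.
rewrite /mxtrace big_ord_recl big_ord1 (_ : lift ord0 ord0 = 1); last exact: val_inj.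
by rewrite /qrep !mx2E /qtr rmorphD; ring.
Qed.

End QuaternionRepresentation.

Section QuaternionAlgebra.
Variables (F : fieldType) (a b : F).
Hypotheses (two0 : (2 : F) != 0) (a0 : a != 0) (b0 : b != 0).
Local Notation B := (quaternion a b).

Lemma quaternion_central : central_algebra B.
Proof.
move=> x hx; have := hx (mkq a b 0 1 0 0); have := hx (mkq a b 0 0 1 0).
move=> hj hi; exists (q0 x).
have e1 := congr1 (@q3 _ _ _) hj; have e2 := congr1 (@q1 _ _ _) hj.
have e3 := congr1 (@q2 _ _ _) hi.
rewrite !qmul_E /qmul !qE in e1 e2 e3.
have z1 : q1 x = 0.
  have : 2 * q1 x = (q0 x * 0 + q3 x * 0 + q1 x * 1 - q2 x * 0) - (0 * q3 x + 0 * q0 x + 0 * q2 x - 1 * q1 x) by ring.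
  by rewrite e1 subrr => /eqP; rewrite mulf_eq0 (negPf two0) => /eqP.
have z3 : q3 x = 0.
  have : 2 * b * q3 x = (q0 x * 0 + q1 x * 0 - b * q2 x * 0 + b * q3 x * 1) - (0 * q1 x + 0 * q0 x - b * 1 * q3 x + b * 0 * q2 x) by ring.
  by rewrite e2 subrr => /eqP; rewrite !mulf_eq0 (negPf two0) (negPf b0) => /eqP.
have z2 : q2 x = 0.
  have e4 := congr1 (@q3 _ _ _) hi; rewrite !qmul_E /qmul !qE in e4.
  have : 2 * q2 x = (0 * q3 x + 0 * q0 x + 1 * q2 x - 0 * q1 x) - (q0 x * 0 + q3 x * 0 + q1 x * 0 - q2 x * 1) by ring.
  by rewrite e4 subrr => /eqP; rewrite mulf_eq0 (negPf two0) => /eqP.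
by apply: quatP; rewrite !qE ?z1 ?z2 ?z3; ring.
Qed.

Lemma quaternion_simple : simple_algebra B.
Proof.
move=> I hI; have [->|I0] := eqVneq I 0%VS; first by left.
pose x := vpick I; have x0 : x <> 0 by move/eqP; rewrite vpick0 (negPf I0).
right.
have Ix : x \in I by exact: memv_pick.
have Il y z : z \in I -> y * z \in I by move=> /(fun h => hI z y h) [].
have Ir y z : z \in I -> z * y \in I by move=> /(fun h => hI z y h) [].
have key z : z \in I -> q0 z *: 1 \in I.
  move=> Iz; pose i := mkq a b 0 1 0 0; pose j := mkq a b 0 0 1 0.
  pose u := z + a^-1 *: (i * z * i); pose v := u + b^-1 *: (j * u * j).
  have Iu : u \in I by apply: rpredD => //; apply: rpredZ; apply: Ir; exact: Il.
  have Iv : v \in I by apply: rpredD => //; apply: rpredZ; apply: Ir; exact: Il.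
  have uE : u = mkq a b (2 * q0 z) (2 * q1 z) 0 0.
    rewrite /u /i; apply: quatP; rewrite ?qE /qmul ?qE; by field.
  have vE : v = mkq a b ((2 * 2) * q0 z) 0 0 0.
    rewrite /v uE /j; apply: quatP; rewrite ?qE /qmul ?qE; by field.
  have -> : q0 z *: (1 : B) = (2 * 2)^-1 *: v.
    have n4 : (2 * 2 : F) != 0 by rewrite mulf_neq0.
    by rewrite vE; apply: quatP; rewrite !qE ?mulr0 // mulr1 mulKf.
  exact: rpredZ.
have one z : z \in I -> q0 z != 0 -> I = fullv.
  move=> /key Iz z0; apply/eqP; rewrite eqEsubv subvf /=; apply/subvP => y _.
  have -> : y = ((q0 z)^-1 *: y) * (q0 z *: 1).
    by rewrite -scalerAr mulr1 scalerA mulfV // scale1r.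
  exact: Il.
have [h0|] := eqVneq (q0 x) 0; last exact: one.
have [h1|h1] := eqVneq (q1 x) 0; last first.
  apply: (one (x * mkq a b 0 1 0 0)); first exact: Ir.
  rewrite qmul_E /qmul !qE.
  have -> : q0 x * 0 + a * q1 x * 1 + b * q2 x * 0 - a * b * q3 x * 0 = a * q1 x by ring.
  by rewrite mulf_neq0.
have [h2|h2] := eqVneq (q2 x) 0; last first.
  apply: (one (x * mkq a b 0 0 1 0)); first exact: Ir.
  rewrite qmul_E /qmul !qE.
  have -> : q0 x * 0 + a * q1 x * 0 + b * q2 x * 1 - a * b * q3 x * 0 = b * q2 x by ring.
  by rewrite mulf_neq0.
have [h3|h3] := eqVneq (q3 x) 0; last first.
  apply: (one (x * mkq a b 0 0 0 1)); first exact: Ir.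
  rewrite qmul_E /qmul !qE.
  have -> : q0 x * 0 + a * q1 x * 0 + b * q2 x * 0 - a * b * q3 x * 1 = - (a * b * q3 x) by ring.
  by rewrite oppr_eq0 !mulf_neq0.
by case: x0; apply: quatP; rewrite ?h0 ?h1 ?h2 ?h3 !qE.
Qed.

Lemma dim_quaternion : \dim {:B}%VS = 4%N.
Proof. by rewrite dimvf /dim /=. Qed.

Lemma quaternion_algebra_quat : quaternion_algebra B.
Proof. by split; [exact: quaternion_central|exact: quaternion_simple|exact: dim_quaternion]. Qed.

End QuaternionAlgebra.

Lemma qrep_base_change (R : realType) (F : fieldType) (nu : {rmorphism F -> R}) (a b : F) (s : R)
  (sE : s ^+ 2 = nu a) : s != 0 -> b != 0 -> base_change (qrep_lrmorphism b sE).
Proof.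
move=> s0 b0; have nb0 : nu b != 0 by rewrite fmorph_eq0.
pose Y := [:: mkq a b 1 0 0 0; mkq a b 0 1 0 0; mkq a b 0 0 1 0; mkq a b 0 0 0 1].
apply: (@base_change_spanning _ _ _ _ _ _ Y).
  by rewrite dim_quaternion dimvf.
apply/eqP; rewrite eqEsubv subvf /=; apply/subvP => m _.
pose r := qrep_lrmorphism b sE.
have -> : m = ((m 0 0 + m 1 1) / 2) *: r (mkq a b 1 0 0 0) + ((m 0 0 - m 1 1) / (2 * s)) *: r (mkq a b 0 1 0 0) +
  ((m 0 1 / nu b + m 1 0) / 2) *: r (mkq a b 0 0 1 0) + ((m 0 1 / nu b - m 1 0) / (2 * s)) *: r (mkq a b 0 0 0 1).
  apply: mx2P; rewrite /r /= /qrep /mx2 !mxE /= !qE ?rmorph0 ?rmorph1; field; by rewrite ?s0 ?nb0.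
by apply: rpredD; [apply: rpredD; [apply: rpredD|]|]; apply: rpredZ; apply: memv_span; rewrite !inE eqxx ?orbT.
Qed.

(** * A pigeonhole principle for sheared lattices *)

Section ShearPigeonhole.
Variable R : realType.

Lemma truncn_eq_lt1 (x y : R) : 0 <= x -> 0 <= y -> Num.truncn x = Num.truncn y -> `|x - y| <= 1.
Proof.
move=> x0 y0 e; have /andP [h1 h2] := truncn_itv x0; have /andP [h3 h4] := truncn_itv y0.
rewrite e -!natr1 in h1 h2 h3 h4; rewrite ler_norml; apply/andP; split; lra.
Qed.

(* The plane lattice is sheared by v: the cell of the first coordinate is used to
   offset the second one, so that the number of cells does not depend on v to first
   order in Q. *)
Lemma shear_pigeonhole (c u v : R) : 0 < c -> 0 < u -> exists Q : nat,
  forall (T : finType) (A A' B B' : T -> R), #|T| = (Q ^ 4)%N ->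
  (forall x, `|A x| <= c * Q%:R) -> (forall x, `|A' x| <= c * Q%:R) ->
  (forall x, `|B x| <= c * Q%:R) -> (forall x, `|B' x| <= c * Q%:R) ->
  exists x y, [/\ x != y, `|(A x - A y) * u| <= 4 * c, `|(A' x - A' y) * u| <= 4 * c,
    `|(A x - A y) * v + (B x - B y) / u| <= 4 * c &
    `|(A' x - A' y) * v + (B' x - B' y) / u| <= 4 * c].
Proof.
move=> c0 u0; pose w := 2 * `|v| / u + 1.
have w1 : 1 <= w by rewrite lerDr divr_ge0 ?mulr_ge0 // ltW.
(* There are at most the square of (Q u / 2 + 1) (Q / (2 u) + w) cells, and this product is Q^2 / 4
   plus terms that K bounds linearly in Q. A large Q thus makes the number of cells less than
   Q^4. *)
pose K := u * w / 2 + (2 * u)^-1 + w.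
have uV : 0 < u^-1 by rewrite invr_gt0.
have K0 : 0 <= K by rewrite !addr_ge0 ?mulr_ge0 ?invr_ge0 ?mulr_ge0 //; lra.
have [Q Qp QK] : exists2 Q : nat, (0 < Q)%N & 2 * K + 1 < Q%:R.
  have K20 : 0 <= 2 * K + 1 by lra.
  by have /andP [_ h] := truncn_itv K20; exists (Num.truncn (2 * K + 1)).+1.
exists Q => T A A' B B' cT hA hA' hB hB'.
have Q0 : (0 : R) <= Q%:R by exact: ler0n.
pose d := 4 * c; have d0 : 0 < d by rewrite mulr_gt0.
pose n1 := Num.truncn (Q%:R * u / 2); pose n2 := Num.truncn (Q%:R / (2 * u) + 2 * `|v| / u).
have b1 : 0 <= Q%:R * u / 2 by rewrite !mulr_ge0 // ltW.
have b2 : 0 <= Q%:R / (2 * u) + 2 * `|v| / u.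
  by rewrite addr_ge0 // ?divr_ge0 ?mulr_ge0 // ltW.
pose i1 (a : R) := Num.truncn ((a + c * Q%:R) * u / d).
pose base (i : nat) : R := i%:R * d / u - c * Q%:R.
pose W := d * `|v| / u + c * Q%:R / u.
pose i2 (a e : R) := Num.truncn (((a - base (i1 a)) * v + e / u + W) / d).
have r1 a : `|a| <= c * Q%:R -> 0 <= (a + c * Q%:R) * u / d <= Q%:R * u / 2.
  rewrite ler_norml => /andP [h1 h2]; apply/andP; split.
    by rewrite divr_ge0 ?mulr_ge0 //; [lra|exact: ltW|exact: ltW].
  rewrite ler_pdivrMr // /d; have : (a + c * Q%:R) * u <= (2 * c * Q%:R) * u by rewrite ler_pM2r //; lra.
  by move/le_trans; apply; rewrite le_eqVlt; apply/orP; left; apply/eqP; field.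
have r1' a : `|a| <= c * Q%:R -> 0 <= a - base (i1 a) <= d / u.
  move=> ha; have /andP [h1 h2] := r1 a ha; have /andP [h3 h4] := truncn_itv h1.
  rewrite -/(i1 a) ler_pdivlMr // in h3; rewrite -/(i1 a) -natr1 ltr_pdivrMr // in h4.
  rewrite /base; have -> : a - ((i1 a)%:R * d / u - c * Q%:R) = ((a + c * Q%:R) * u - (i1 a)%:R * d) / u.
    by field; rewrite gt_eqF.
  apply/andP; split; first by rewrite divr_ge0 ?subr_ge0 // ltW.
  by rewrite ler_pM2r //; lra.
have r2 a e : `|a| <= c * Q%:R -> `|e| <= c * Q%:R ->
    0 <= ((a - base (i1 a)) * v + e / u + W) / d <= Q%:R / (2 * u) + 2 * `|v| / u.
  move=> ha he; have /andP [h1 h2] := r1' a ha.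
  have hx : `|(a - base (i1 a)) * v + e / u| <= W.
    apply: le_trans (ler_normD _ _) _; rewrite /W; apply: lerD.
      by rewrite normrM (ger0_norm h1) mulrAC ler_wpM2r.
    by rewrite normrM (gtr0_norm uV) ler_pM2r.
  move: hx; rewrite ler_norml => /andP [h3 h4]; apply/andP; split.
    by rewrite divr_ge0 //; [lra|exact: ltW].
  rewrite ler_pdivrMr //.
  have -> : (Q%:R / (2 * u) + 2 * `|v| / u) * d = 2 * W.
    by rewrite /W /d; field; rewrite gt_eqF.
  lra.
pose f (x : T) : 'I_n1.+1 * 'I_n1.+1 * 'I_n2.+1 * 'I_n2.+1 :=
  (inord (i1 (A x)), inord (i1 (A' x)), inord (i2 (A x) (B x)), inord (i2 (A' x) (B' x))).
have l1 a : `|a| <= c * Q%:R -> (i1 a < n1.+1)%N.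
  by move=> /r1 /andP [h1 h2]; rewrite ltnS; exact: le_truncn.
have l2 a e : `|a| <= c * Q%:R -> `|e| <= c * Q%:R -> (i2 a e < n2.+1)%N.
  by move=> ha he; have /andP [h1 h2] := r2 _ _ ha he; rewrite ltnS; exact: le_truncn.
have ninj : ~~ injectiveb f.
  apply/negP => /injectiveP inj; have := leq_card _ inj.
  rewrite cT !card_prod !card_ord leqNgt => /negP; apply.
  have lt : (n1.+1 * n2.+1 < Q ^ 2)%N.
    rewrite -(ltr_nat R) natrM natrX -!natr1.
    have /andP [t1 _] := truncn_itv b1; have /andP [t2 _] := truncn_itv b2.
    rewrite -/n1 in t1; rewrite -/n2 in t2.
    have n10 : (0 : R) <= n1%:R by exact: ler0n.
    have n20 : (0 : R) <= n2%:R by exact: ler0n.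
    have le1 : (n1%:R + 1) * (n2%:R + 1) <= (Q%:R * u / 2 + 1) * (Q%:R / (2 * u) + w).
      by apply: ler_pM; rewrite ?addr_ge0 // ?lerD2r // /w addrA lerD2r.
    apply: (le_lt_trans le1).
    have -> : (Q%:R * u / 2 + 1) * (Q%:R / (2 * u) + w) =
       Q%:R ^+ 2 / 4 + Q%:R * (u * w / 2 + (2 * u)^-1) + w by field; rewrite gt_eqF.
    have Q1 : 1 <= Q%:R :> R by rewrite ler1n.
    have : w <= Q%:R * w by rewrite ler_peMl //; lra.
    have : Q%:R * (2 * K + 1) <= Q%:R * Q%:R by rewrite ler_wpM2l // ltW.
    have Q2 : 1 <= Q%:R * Q%:R :> R by rewrite mulr_ege1.
    rewrite /K expr2; move: (u * w / 2 + (2 * u)^-1) => k1; nra.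
  have -> : (n1.+1 * n1.+1 * n2.+1 * n2.+1 = (n1.+1 * n2.+1) ^ 2)%N by ring.
  by rewrite -[4%N]/(2 * 2)%N expnM ltn_exp2r.
have /injectivePn [x [y xy fxy]] := ninj.
exists y, x; move: fxy => [/(congr1 (@nat_of_ord _)) e1 /(congr1 (@nat_of_ord _)) e2 /(congr1 (@nat_of_ord _)) e3 /(congr1 (@nat_of_ord _)) e4].
rewrite !inordK ?l1 ?l2 // in e1 e2 e3 e4.
have far a a' : `|a| <= c * Q%:R -> `|a'| <= c * Q%:R -> i1 a = i1 a' -> `|(a' - a) * u| <= 4 * c.
  move=> ha ha' e; have /andP [h1 _] := r1 a ha; have /andP [h2 _] := r1 a' ha'.
  have := truncn_eq_lt1 h2 h1 (esym e).
  have -> : (a' + c * Q%:R) * u / d - (a + c * Q%:R) * u / d = ((a' - a) * u) / d by field; rewrite gt_eqF.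
  by rewrite normrM normfV (gtr0_norm d0) ler_pdivrMr // mul1r.
have far2 a a' e e' : `|a| <= c * Q%:R -> `|a'| <= c * Q%:R -> `|e| <= c * Q%:R -> `|e'| <= c * Q%:R ->
    i1 a = i1 a' -> i2 a e = i2 a' e' -> `|(a' - a) * v + (e' - e) / u| <= 4 * c.
  move=> ha ha' he he' ee ee'; have /andP [h1 _] := r2 a e ha he; have /andP [h2 _] := r2 a' e' ha' he'.
  have := truncn_eq_lt1 h2 h1 (esym ee'); rewrite ee.
  have -> : ((a' - base (i1 a')) * v + e' / u + W) / d - ((a - base (i1 a')) * v + e / u + W) / d
    = ((a' - a) * v + (e' - e) / u) / d by field; rewrite gt_eqF //= gt_eqF.
  by rewrite normrM normfV (gtr0_norm d0) ler_pdivrMr // mul1r.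
split; [by rewrite eq_sym|exact: far|exact: far|exact: far2|exact: far2].
Qed.

End ShearPigeonhole.

Section LocallyFinite.
Variable R : realType.
Implicit Types (G : set 'M[R]_2).

(** Finiteness in every ball of matrices yields countability and discreteness, and is what the
    construction of the Dirichlet domain uses. *)
Definition locally_finite G := forall C : R, finite_set [set g | G g /\ forall i j, `|g i j| <= C].

Lemma locally_finite_countable G : locally_finite G -> countable G.
Proof.
move=> fG; have -> : G = \bigcup_(n in [set: nat]) [set g | G g /\ forall i j, `|g i j| <= n%:R].
  apply/seteqP; split=> [g Gg|g [n _ []] //].
  pose C := `|g 0 0| + `|g 0 1| + `|g 1 0| + `|g 1 1|.
  have C0 : 0 <= C by rewrite !addr_ge0.
  exists (Num.truncn C).+1 => //; split=> // i j.
  have /andP [_ /ltW h] := truncn_itv C0; apply: le_trans h; rewrite /C.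
  move: i j; apply: forall_I2; apply: forall_I2;
    have := normr_ge0 (g 0 0); have := normr_ge0 (g 0 1); have := normr_ge0 (g 1 0);
    have := normr_ge0 (g 1 1); lra.
by apply: bigcup_countable => // n _; apply: finite_set_countable; exact: fG.
Qed.

Lemma locally_finite_discrete G : locally_finite G -> discrete_group G.
Proof.
move=> fG g Gg; pose C := `|g 0 0| + `|g 0 1| + `|g 1 0| + `|g 1 1| + 1.
have /finite_seqP [l lE] := fG C.
have [e e0 he] : exists2 e : R, 0 < e & forall h, h \in l -> (forall i j, `|g i j - h i j| < e) -> h = g.
  elim: l {lE} => [|h l [e e0 IH]]; first by exists 1.
  have [->|hg] := eqVneq h g.
    by exists e => // k; rewrite inE => /predU1P [//|]; exact: IH.
  have [i [j hij]] : exists i j, h i j != g i j.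
    apply: contrapT => none; move/eqP: hg; apply; apply/matrixP => i j.
    by apply: contrapT => /eqP nij; apply: none; exists i, j.
  have d0 : 0 < `|g i j - h i j| by rewrite normr_gt0 subr_eq0 eq_sym.
  exists (Num.min e `|g i j - h i j|); first by rewrite lt_min e0.
  move=> k; rewrite inE => /predU1P [-> hk|kl hk].
    by have := hk i j; rewrite lt_min ltxx andbF.
  by apply: IH => // i' j'; have := hk i' j'; rewrite lt_min => /andP [].
apply/nbhs_ballP; exists (Num.min e 1); first by rewrite /= lt_min e0 ltr01.
move=> h hb Gh.
have hb' i j : `|g i j - h i j| < Num.min e 1 by exact: (hb.2 i j).
apply: he; last by move=> i j; have := hb' i j; rewrite lt_min => /andP [].
have : [set` l] h; last by [].
rewrite -lE; split=> // i j.
have := hb' i j; rewrite lt_min => /andP [_ h1].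
have : `|h i j| <= `|g i j| + 1.
  rewrite -[h i j](subrK (g i j)); apply: le_trans (ler_normD _ _) _.
  by rewrite addrC lerD2l distrC ltW.
move/le_trans; apply; rewrite /C lerD2r.
by move: i j {h1}; apply: forall_I2; apply: forall_I2;
    have := normr_ge0 (g 0 0); have := normr_ge0 (g 0 1); have := normr_ge0 (g 1 0);
    have := normr_ge0 (g 1 1); lra.
Qed.

End LocallyFinite.

(** * Unit groups as groups of real matrices *)

Section StandardGroup.
Variables (R : realType) (D b : rat) (s : R).
Hypotheses (sE : s ^+ 2 = ratr D) (s0 : 0 < s) (b0 : b != 0).
Local Notation B := (quaternion D b).
Local Notation rho := (@qrep R rat (@ratr R) D b s sE).
Implicit Types (x y : B) (O : set B).

Definition unit_group O : set 'M[R]_2 := [set rho x | x in [set x | O x /\ qnrd x = 1]].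

Lemma qrep_inv x : qnrd x = 1 -> (rho x)^-1 = rho (qconj x).
Proof.
move=> nx; have u : rho x \in unitmx by rewrite unitmxE qrep_det nx rmorph1 unitr1.
apply: (mulrI (u : rho x \is a GRing.unit)); rewrite divrr // -rmorphM mul_qconj nx scale1r.
by rewrite rmorph1.
Qed.

Lemma unit_group_PSL2 O : qorder O -> PSL2_subgroup (unit_group O).
Proof.
move=> oO; have [Oone OB OM _] := oO; split.
- by move=> _ [x [_ nx] <-]; rewrite qrep_det nx rmorph1.
- exists (-1); last by rewrite rmorphN rmorph1.
  by split; [apply: zsubN => //; exact: qorder_zsub|rewrite qnrdN qnrd1].
- move=> _ _ [x [Ox nx] <-] [y [Oy ny] <-]; exists (x * y); last by rewrite rmorphM.
  by split; [exact: OM|rewrite qnrdM nx ny mulr1].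
- move=> _ [x [Ox nx] <-]; exists (qconj x); last by rewrite qrep_inv.
  by split; [exact: qorder_conj|rewrite qnrd_conj].
Qed.

Let nb0 : 0 < `|ratr b : R|. Proof. by rewrite normr_gt0 fmorph_eq0. Qed.

Lemma qrep_coord_bound x (C : R) : (forall i j, `|rho x i j| <= C) ->
  let C1 := (C / `|ratr b| + C) * (1 + s^-1) in
  [/\ `|ratr (q0 x)| <= C1, `|ratr (q1 x)| <= C1, `|ratr (q2 x)| <= C1 & `|ratr (q3 x)| <= C1 :> R].
Proof.
move=> hC C1.
have := hC 0 0; have := hC 0 1; have := hC 1 0; have := hC 1 1; rewrite /qrep !mx2E.
set y0 : R := ratr (q0 x); set y1 : R := ratr (q1 x); set y2 : R := ratr (q2 x); set y3 : R := ratr (q3 x).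
rewrite [`|ratr b * _|]normrM -ler_pdivlMl // => h11 h10 h01 h00.
have C0 : 0 <= C by exact: le_trans (normr_ge0 _) h00.
set K := C / `|ratr b|; have K0 : 0 <= K by rewrite divr_ge0 // ltW.
have h01' : `|y2 + y3 * s| <= K by rewrite /K [C / _]mulrC.
have sV0 : 0 < s^-1 by rewrite invr_gt0.
have tri (u v c1 c2 : R) : `|u + v| <= c1 -> `|u - v| <= c2 -> `|u| <= c1 + c2 /\ `|v| <= c1 + c2.
  by rewrite !ler_norml => /andP [a1 a2] /andP [a3 a4]; split; apply/andP; split; lra.
have tri2 (u v c1 c2 : R) : `|u + v * s| <= c1 -> `|u - v * s| <= c2 -> `|u| <= (c1 + c2) / 2 /\ `|v| <= (c1 + c2) / 2 * s^-1.
  rewrite !ler_norml => /andP [a1 a2] /andP [a3 a4]; split; first by apply/andP; split; lra.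
  by rewrite -ler_norml ler_pdivlMr // -[X in _ * X](gtr0_norm s0) -normrM ler_norml; apply/andP; split; lra.
have [g0 g1] := tri2 _ _ _ _ h00 h11; have [g2 g3] := tri2 _ _ _ _ h01' h10.
have p1 : 0 <= C * s^-1 by rewrite mulr_ge0 // ltW.
have p2 : 0 <= K * s^-1 by rewrite mulr_ge0 // ltW.
have e1 : (C + C) / 2 * s^-1 = C * s^-1 by field; rewrite gt_eqF.
have e2 : (K + C) / 2 * s^-1 = (K * s^-1 + C * s^-1) / 2 by field; rewrite gt_eqF.
rewrite /C1 -/K mulrDr mulr1 mulrDl; rewrite e1 in g1; rewrite e2 in g3.
by split; lra.
Qed.

Lemma unit_group_locally_finite O : qorder O -> locally_finite (unit_group O).
Proof.
move=> [_ _ _ [N [N0 hN _]]] C.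
pose C1 := (C / `|ratr b| + C) * (1 + s^-1).
pose M := (Num.truncn (`|N%:R * C1|)).+1.
have NM (r : rat) : N%:R * r \is a Num.int -> `|ratr r : R| <= C1 ->
    exists i : 'I_(M + M).+1, N%:R * r = i%:R - M%:R.
  move=> /intrP [z ez] hr.
  have lt : `|z%:~R : R| < M%:R.
    have -> : (z%:~R : R) = N%:R * ratr r by rewrite -(ratr_int R z) -ez rmorphM /= ratr_nat.
    rewrite normrM ger0_norm ?ler0n //.
    have /andP [_] := truncn_itv (normr_ge0 (N%:R * C1)); apply: le_lt_trans.
    by apply: le_trans (ler_norm _); rewrite ler_wpM2l ?ler0n.
  have {lt} /andP [l1 l2] : (- (M%:Z) < z) && (z < M%:Z).
    move: lt; rewrite -[M%:R]/((M%:Z)%:~R) ltr_norml -rmorphN /= !ltr_int => /andP [-> ->] //.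
  have iM : (`|(z + M%:Z)%R|%N < (M + M).+1)%N by move: l1 l2; clear; lia.
  exists (Ordinal iM) => /=; rewrite ez.
  have -> : `|(z + M%:Z)%R|%N%:R = (z + M%:Z)%:~R :> rat.
    by rewrite -[LHS]/((`|(z + M%:Z)%R|%N%:Z)%:~R); congr (_%:~R); move: l1; clear; lia.
  by rewrite rmorphD /= addrK.
pose T := ('I_(M + M).+1 * 'I_(M + M).+1 * 'I_(M + M).+1 * 'I_(M + M).+1)%type.
pose f (c : T) : 'M[R]_2 := rho (N%:R^-1 *: mkq D b (c.1.1.1%:R - M%:R) (c.1.1.2%:R - M%:R)
   (c.1.2%:R - M%:R) (c.2%:R - M%:R)).
apply: (@sub_finite_set _ _ (f @` [set: T])); last by apply: finite_image; exact: finite_finset.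
move=> _ [[x [Ox nx] <-] hC].
have [h0 h1 h2 h3] := qrep_coord_bound hC.
have [l0 l1 l2 l3] := hN _ Ox; rewrite !qE in l0 l1 l2 l3.
have [i0 e0] := NM _ l0 h0; have [i1 e1] := NM _ l1 h1.
have [i2 e2] := NM _ l2 h2; have [i3 e3] := NM _ l3 h3.
exists (i0, i1, i2, i3) => //; rewrite /f /= -e0 -e1 -e2 -e3; congr rho.
have N00 : (N%:R : rat) != 0 by rewrite pnatr_eq0 -lt0n.
by apply: quatP; rewrite !qE mulKf.
Qed.

(** (a^2 + b^2) (c^2 + d^2) = 1 + (a c + b d)^2 bounds the denominator c^2 + d^2 of the image of i
    from below. *)
Lemma mob_i_box (h : 'M[R]_2) (M : R) : 1 <= M -> \det h = 1 -> (forall i j, `|h i j| <= M) ->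
  let C := 4 * M ^+ 4 + 2 in `|(mob h (0, 1)).1| <= C /\ C^-1 <= (mob h (0, 1)).2 <= C.
Proof.
move=> M1 d1 hM C; have n0 := mob_den d1 (ltr01 : half_plane (0, 1 : R)).
rewrite /mob /= !mulr0 !mulr1 !add0r expr1n mulr1 in n0 *; rewrite det2 in d1.
have := hM 0 0; have := hM 0 1; have := hM 1 0; have := hM 1 1; move: d1 n0.
move: (h 0 0) (h 0 1) (h 1 0) (h 1 1) => a b' c d e n0 h4 h3 h2 h1.
set n := d ^+ 2 + c ^+ 2 in n0 *.
have M0 : 0 < M by lra.
have sq (t : R) : `|t| <= M -> t ^+ 2 <= M ^+ 2.
  by move=> ht; rewrite -real_normK ?num_real // lerXn2r ?nnegrE // ltW.
have k1 := sq _ h1; have k2 := sq _ h2; have k3 := sq _ h3; have k4 := sq _ h4.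
have nU : n <= 2 * M ^+ 2 by rewrite /n; lra.
have key : 1 <= (a ^+ 2 + b' ^+ 2) * n.
  have -> : (a ^+ 2 + b' ^+ 2) * n = (a * d - b' * c) ^+ 2 + (b' * d + a * c) ^+ 2 by rewrite /n; ring.
  by rewrite e expr1n lerDl sqr_ge0.
have nL : 1 <= 2 * M ^+ 2 * n.
  by apply: le_trans key _; rewrite ler_pM2r //; lra.
have M2 : 1 <= M ^+ 2 by rewrite expr_ge1 // ltW.
have yU : n^-1 <= 2 * M ^+ 2 by rewrite -ler_pdivrMr // in nL; rewrite -[n^-1]mul1r.
have nV : 0 < n^-1 by rewrite invr_gt0.
have M4 : M ^+ 4 = M ^+ 2 * M ^+ 2 by rewrite -exprD.
have M42 : M ^+ 2 <= M ^+ 4 by rewrite M4 ler_peMl // ltW // exprn_gt0.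
have C0 : 0 < C by rewrite /C; lra.
split.
  rewrite normrM (gtr0_norm nV).
  have hx : `|b' * d + a * c| <= 2 * M ^+ 2.
    apply: le_trans (ler_normD _ _) _; rewrite !normrM.
    have : `|b'| * `|d| <= M * M by apply: ler_pM.
    have : `|a| * `|c| <= M * M by apply: ler_pM.
    by rewrite expr2; lra.
  have : `|b' * d + a * c| * n^-1 <= (2 * M ^+ 2) * (2 * M ^+ 2) by apply: ler_pM => //; exact: ltW.
  by rewrite /C M4; lra.
rewrite mul1r; apply/andP; split; last by rewrite /C; lra.
by rewrite lef_pV2 ?posrE //; rewrite /C; lra.
Qed.

End StandardGroup.

(** * Cocompactness for division algebras *)

Section Cocompact.
Variables (R : realType) (D b : rat) (s : R).
Hypotheses (sE : s ^+ 2 = ratr D) (s0 : 0 < s) (b0 : b != 0).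
Local Notation B := (quaternion D b).
Local Notation rho := (@qrep R rat (@ratr R) D b s sE).
Implicit Types (x y : B) (O : set B).
Hypothesis division : forall x : B, x != 0 -> qnrd x != 0.

(* Finitely many elements of O represent its elements of bounded norm up to left
   multiplication by units of norm one. *)
Lemma bounded_norm_reps O (n : nat) : qorder O -> exists E : R, forall x, O x ->
  qnrd x != 0 -> `|qnrd x| <= n%:R -> exists y, [/\ O y, qnrd y = qnrd x,
    O ((qnrd x)^-1 *: (qconj y * x)) & forall i j, `|rho (qconj y) i j| <= E].
Proof.
move=> oO; have [Oone OB OM [N [N0 hN hN']]] := oO.
(* If x and y have the same norm, of absolute value at most n, and agree modulo n! N, then conj(y) x
   is nrd(x) times an element of O, because nrd x divides n!. *)
pose L := (n`! * N)%N; have L0 : (0 < L)%N by rewrite muln_gt0 fact_gt0.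
pose T := ('I_(N * L) * 'I_(N * L) * 'I_(N * L) * 'I_(N * L) * ('I_n.+1 * bool))%type.
pose P (k : T) y := O y /\ (exists z, qlat0 z /\ y = lat_rep D b N k.1 + L%:R *: z) /\
  qnrd y = (if k.2.2 then 1 else -1) * (k.2.1 : nat)%:R.
have /choice [f hf] : forall k, exists y, (exists y, P k y) -> P k y.
  move=> k; have [[y hy]|h] := pselect (exists y, P k y); first by exists y.
  by exists 0 => /h.
exists (\sum_k \sum_i \sum_j `|rho (qconj (f k)) i j|) => x Ox nx bx.
have [c [z [lz xE]]] := lat_repP N0 L0 (hN _ Ox).
have /intrP [m em] := qorder_nrd_int oO Ox.
have mn : (`|m| < n.+1)%N.
  by rewrite ltnS -(ler_nat rat) -[_%:R]/((`|m|%N%:Z)%:~R) abszE intr_norm -em.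
pose k : T := (c, (Ordinal mn, 0 <= m)).
have nxE : qnrd x = (if k.2.2 then 1 else -1) * (k.2.1 : nat)%:R.
  rewrite /= em; case: (leP 0 m) => hm.
    by rewrite mul1r -[in LHS](gez0_abs hm).
  by rewrite mulN1r -[in LHS](opprK m) -(ltz0_abs hm) rmorphN.
have [Oy [[z' [lz' yE]] ny]] : P k (f k).
  by apply: hf; exists x; split=> //; split=> //; exists z.
have m0 : m != 0 by rewrite -(intr_eq0 rat) -em.
exists (f k); split=> //; first by rewrite ny nxE.
  have [q qE] : exists q : nat, (n`! = q * `|m|)%N.
    by apply/dvdnP; apply: dvdn_fact; rewrite absz_gt0 m0 -ltnS.
  have zO := qorder_zsub oO.
  have dE : x - f k = n`!%:R *: (N%:R *: (z - z')).
    by rewrite xE yE /= opprD addrACA subrr add0r -scalerBr scalerA natrM.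
  have Od : O (N%:R *: (z - z')) by apply: hN'; exact: (qlat0_zsub D b).2.
  have e1 : (qnrd x)^-1 *: (qconj (f k) * x) = 1 + qconj (f k) * ((n`!%:R / qnrd x) *: (N%:R *: (z - z'))).
    have ee : qnrd (f k) = qnrd x by rewrite ny nxE.
    have -> : qconj (f k) * x = qnrd x *: 1 + qconj (f k) * (n`!%:R *: (N%:R *: (z - z'))).
      by rewrite -ee -qconj_mul -mulrDr -dE addrC subrK.
    by rewrite scalerDr [_ *: (qnrd x *: 1)]scalerA mulVf // scale1r scalerAr [_ *: (n`!%:R *: _)]scalerA [_^-1 * _]mulrC.
  rewrite e1; apply: zsubD => //; apply: OM; first exact: qorder_conj.
  apply: zsubZ => //; rewrite em qE natrM -mulrA rpredM ?natr_int //.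
  rewrite [m in X in _ / X]intEsg rmorphM /= invfM mulrCA mulrA -[X in _ / X]/(`|m|%N%:R) mulfK ?pnatr_eq0 ?absz_eq0 //.
  by case: sgzP => // _; rewrite ?rmorphN1 ?invrN1 ?rmorph1 ?invr1 // ?rpredN ?rpred1.
move=> i j; rewrite (bigD1 k) //= (bigD1 i) //= (bigD1 j) //= -!addrA lerDl.
by rewrite !addr_ge0 // ?sumr_ge0 // => ? _; rewrite ?sumr_ge0 // => ? _; rewrite sumr_ge0.
Qed.

(** Minkowski's argument: for a matrix gz taking i to p, the pigeonhole finds a nonzero xi in O with
    rho(xi) gz bounded. Its norm is bounded and, in a division algebra, nonzero. Dividing by one of
    finitely many elements of that norm leaves a unit U with rho(U) gz bounded, so that U p stays in
    a box. *)
Lemma unit_group_cocompact O : qorder O -> exists2 C : R, 1 < C &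
  forall p : R * R, half_plane p -> exists2 g, unit_group sE O g &
    `|(mob g p).1| <= C /\ C^-1 <= (mob g p).2 <= C.
Proof.
move=> oO; have [Oone OB OM [L [L0 _ hL]]] := oO.
have [c c1 c2] : exists2 c : R, 1 + s <= c & `|ratr b| * (1 + s) <= c.
  have p0 : 0 <= `|ratr b| * (1 + s) by apply: mulr_ge0 => //; apply: addr_ge0 => //; exact: ltW.
  exists (1 + s + `|ratr b| * (1 + s)); first by rewrite lerDl.
  by rewrite lerDr addr_ge0 // ltW.
have c0 : 0 < c by apply: lt_le_trans c1; exact: addr_gt0.
pose M0 : R := L%:R * (4 * c); have M00 : 0 < M0 by rewrite !mulr_gt0 // ltr0n.
pose n := (Num.truncn (2 * M0 ^+ 2)).+1.
have [E hE] := bounded_norm_reps n oO.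
have E1 : 0 <= `|E| by [].
pose M := 1 + 2 * `|E| * M0; have M1 : 1 <= M by rewrite lerDl !mulr_ge0 // ltW.
exists (4 * M ^+ 4 + 2); first by have : 0 <= M ^+ 4 by [rewrite exprn_ge0 //; lra]; lra.
move=> [x y] y0; rewrite /half_plane /= in y0.
pose u := Num.sqrt y; have u0 : 0 < u by rewrite sqrtr_gt0.
have uu : u * u = y by rewrite -expr2 sqr_sqrtr // ltW.
pose v := x / u.
have [Q hQ] := shear_pigeonhole v c0 u0.
pose T := ('I_Q * 'I_Q * 'I_Q * 'I_Q)%type.
have fQ (i : 'I_Q) : `|(i : nat)%:R : R| <= Q%:R by rewrite ger0_norm ?ler0n // ler_nat ltnW.
have bnd (i j : 'I_Q) : `|(i : nat)%:R + (j : nat)%:R * s| <= (1 + s) * Q%:R :> R.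
  apply: le_trans (ler_normD _ _) _; rewrite mulrDl mul1r normrM (gtr0_norm s0) mulrC.
  by apply: lerD => //; rewrite ler_wpM2l // ltW.
have bnd' (i j : 'I_Q) : `|(i : nat)%:R - (j : nat)%:R * s| <= (1 + s) * Q%:R :> R.
  apply: le_trans (ler_normB _ _) _; rewrite mulrDl mul1r normrM (gtr0_norm s0) mulrC.
  by apply: lerD => //; rewrite ler_wpM2l // ltW.
have Q0 : (0 : R) <= Q%:R by exact: ler0n.
have cQ : (1 + s) * Q%:R <= c * Q%:R by rewrite ler_wpM2r.
have [||||| k [k' [kk h1 h2 h3 h4]]] := hQ T
   (fun k => (k.1.1.1 : nat)%:R + (k.1.1.2 : nat)%:R * s)
   (fun k => (k.1.2 : nat)%:R - (k.2 : nat)%:R * s)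
   (fun k => ratr b * ((k.1.2 : nat)%:R + (k.2 : nat)%:R * s))
   (fun k => (k.1.1.1 : nat)%:R - (k.1.1.2 : nat)%:R * s).
- by rewrite !card_prod !card_ord !expnS expn0; ring.
- by move=> k; apply: le_trans cQ.
- by move=> k; apply: le_trans cQ.
- move=> k; rewrite normrM; apply: (@le_trans _ _ (`|ratr b| * ((1 + s) * Q%:R))).
    by rewrite ler_wpM2l.
  by rewrite mulrA ler_wpM2r.
- by move=> k; apply: le_trans cQ.
pose d0 : rat := (k.1.1.1 : nat)%:R - (k'.1.1.1 : nat)%:R.
pose d1 : rat := (k.1.1.2 : nat)%:R - (k'.1.1.2 : nat)%:R.
pose d2 : rat := (k.1.2 : nat)%:R - (k'.1.2 : nat)%:R.
pose d3 : rat := (k.2 : nat)%:R - (k'.2 : nat)%:R.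
pose xi : B := L%:R *: mkq D b d0 d1 d2 d3.
have Oxi : O xi by apply: hL; rewrite /qlat0 !qE; split; rewrite rpredB ?natr_int.
have L00 : (L%:R : rat) != 0 by rewrite pnatr_eq0 -lt0n.
have xi0 : xi != 0.
  apply: contra_neq kk => /eqP; rewrite /xi scaler_eq0 (negPf L00) /= => /eqP e.
  have := congr1 (@q0 _ _ _) e; have := congr1 (@q1 _ _ _) e.
  have := congr1 (@q2 _ _ _) e; have := congr1 (@q3 _ _ _) e; rewrite !qE.
  move=> /eqP; rewrite subr_eq0 eqr_nat => /eqP e3 /eqP; rewrite subr_eq0 eqr_nat => /eqP e2.
  move=> /eqP; rewrite subr_eq0 eqr_nat => /eqP e1 /eqP; rewrite subr_eq0 eqr_nat => /eqP e0.
  case: k k' e0 e1 e2 e3 {h1 h2 h3 h4 d0 d1 d2 d3 xi Oxi e} => [[[i0 i1] i2] i3] [[[j0 j1] j2] j3] /= e0 e1 e2 e3.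
  by rewrite (val_inj e0) (val_inj e1) (val_inj e2) (val_inj e3).
have nxi := division xi0.
pose gz : 'M[R]_2 := mx2 u v 0 u^-1.
have dgz : \det gz = 1 by rewrite det2 !mx2E mulr0 subr0 divff // gt_eqF.
pose h := rho xi * gz.
have rd (i j : nat) : ratr (i%:R - j%:R) = i%:R - j%:R :> R by rewrite rmorphB /= !ratr_nat.
have hM0 : forall i j, `|h i j| <= M0.
  have L1 : (0 : R) < L%:R by rewrite ltr0n.
  have lem (t w : R) : t = L%:R * w -> `|w| <= 4 * c -> `|t| <= M0.
    by move=> -> hw; rewrite normrM (gtr0_norm L1) ler_pM2l.
  apply: forall_I2; apply: forall_I2; rewrite /h mulmx2E /gz /qrep !mx2E !qE !rmorphM /= !ratr_nat !rd.
  - by apply: lem h1; ring.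
  - by apply: lem h3; rewrite /v; ring.
  - by apply: lem h2; ring.
  - by apply: lem h4; rewrite /v; ring.
have dh : \det h = ratr (qnrd xi) by rewrite det_mulmx dgz mulr1 qrep_det.
have nb : `|qnrd xi| <= n%:R.
  rewrite -(ler_rat R) ratr_nat.
  have -> : ratr `|qnrd xi| = `|ratr (qnrd xi)| :> R by exact: ratr_norm.
  rewrite -dh det2; have M20 : 0 <= 2 * M0 ^+ 2 by rewrite mulr_ge0 ?sqr_ge0.
  have /andP [_ /ltW] := truncn_itv M20; apply: le_trans.
  apply: le_trans (ler_normB _ _) _; rewrite !normrM mulr_natl mulr2n expr2.
  by apply: lerD; apply: ler_pM => //; exact: hM0.
have [yk [Oy ny Oyx hy]] := hE xi Oxi nxi nb.
pose U := (qnrd xi)^-1 *: (qconj yk * xi).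
have nU : qnrd U = 1.
  by rewrite /U qnrdZ qnrdM qnrd_conj ny; field.
exists (rho U); first by exists U.
have gzp : mob gz (0, 1) = (x, y).
  rewrite /mob /gz !mx2E /=.
  have -> : (0 * 0 + u^-1) ^+ 2 + (0 * 1) ^+ 2 = u^-1 ^+ 2 by ring.
  have un : u != 0 by rewrite gt_eqF.
  by congr pair; rewrite /v -?uu; field; rewrite un.
have dU : \det (rho U) = 1 by rewrite qrep_det nU rmorph1.
rewrite -gzp -mobM //; last exact: ltr01.
apply: mob_i_box => //; first by rewrite det_mulmx dU dgz mulr1.
move=> i j.
have -> : rho U * gz = (ratr (qnrd xi))^-1 *: (rho (qconj yk) * h).
  rewrite /U linearZ /= rmorphM /h mulrA -scalerAl; congr (_ *: _).
  by rewrite fmorphV.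
rewrite mxE normrM mulmx2E.
have n1 : `|(ratr (qnrd xi) : R)^-1| <= 1.
  have /intrP [m em] := qorder_nrd_int oO Oxi.
  have m0 : m != 0 by rewrite -(intr_eq0 rat) -em.
  rewrite normfV em ratr_int invf_le1 -?intr_norm ?ltr0z ?normr_gt0 //.
  by rewrite ler1z -gtz0_ge1 normr_gt0.
have hh (i' j' l : 'I_2) : `|rho (qconj yk) i' l * h l j'| <= `|E| * M0.
  by rewrite normrM; apply: ler_pM => //; apply: le_trans (hy _ _) (ler_norm _).
have := le_trans (ler_normD _ _) (lerD (hh i j 0) (hh i j 1)).
set t := `|_ + _| => ht.
have t0 : 0 <= t by exact: normr_ge0.
apply: (@le_trans _ _ (1 * t)); first by rewrite ler_wpM2r.
by rewrite mul1r /M; apply: le_trans ht _; rewrite -mulrA mulr_natl mulr2n lerDr.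
Qed.

End Cocompact.

(** * Groups with rational traces *)

(** A free family extends to a basis, and bases go to bases. *)
Lemma base_change_free (F E : fieldType) (s : {rmorphism F -> E}) (B : falgType F)
    (A : falgType E) (iota : {lrmorphism B -> A | s \; *:%R}) (Y : seq B) :
  base_change iota -> free Y -> free (map iota Y).
Proof.
move=> bc fY.
have h : basis_of {:B}%VS (Y ++ vbasis (span Y)^C).
  rewrite -(addv_complf (span Y)); apply: cat_basis; last exact: vbasisP.
    by apply/directv_addP; exact: capv_compl.
  by rewrite basisEfree fY !subvv /= (eqnP fY).
by have := basis_free (bc _ h); rewrite map_cat => /catl_free.
Qed.

Lemma tr2 (K : comNzRingType) (g : 'M[K]_2) : \tr g = g 0 0 + g 1 1.
Proof. by rewrite /mxtrace !big_ord_recl big_ord0 addr0; congr (g _ _ + g _ _); exact: val_inj. Qed.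

Lemma cayley_hamilton2 (K : realType) (g : 'M[K]_2) : g * g = \tr g *: g - (\det g)%:M.
Proof. by apply: mx2P; rewrite mulmx2E tr2 det2 !mxE /=; ring. Qed.

Lemma scalar_free (F : fieldType) (B : falgType F) (x : B) :
  (forall c : F, x <> c%:A) -> free [:: x; 1].
Proof.
move=> h; rewrite free_cons seq1_free oner_neq0 andbT span_seq1.
by apply/negP => /vlineP[c]; exact: h.
Qed.

Section AbstractQuaternion.
Variables (R : realType) (F : fieldType) (B : falgType F) (nu : {rmorphism F -> R}).
Variable rho : {lrmorphism B -> 'M[R]_2 | nu \; *:%R}.
Hypothesis bc : base_change rho.

Lemma base_change_inj : injective rho.
Proof.
move=> x y; rewrite -[x](subrK y) rmorphD /= => /(canRL (addrK _)); rewrite subrr => h.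
have [->|z0] := eqVneq (x - y) 0; first by rewrite add0r.
have := @base_change_free _ _ _ _ _ rho [:: x - y] bc.
by rewrite !seq1_free z0 /= h eqxx => /(_ isT).
Qed.

Lemma rho_scalar (c : F) : rho c%:A = (nu c)%:M.
Proof. by rewrite linearZ rmorph1 /= scalemx1. Qed.

Lemma rho_quadratic (x : B) : exists t n : F,
  [/\ \tr (rho x) = nu t, \det (rho x) = nu n & x * x = t *: x - n%:A].
Proof.
have [[c xc]|h] := pselect (exists c : F, x = c%:A).
  exists (c + c), (c ^+ 2); rewrite xc rho_scalar tr2 det2 !mxE /=.
  split; [by rewrite rmorphD|by rewrite mulr0n mul0r subr0 rmorphXn|].
  by rewrite -scalerAl mul1r !scalerA -scalerBl; congr (_ *: _); ring.
have fx : free [:: x; 1] by apply: scalar_free => c e; apply: h; exists c.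
have : x * x \in span [:: x; 1].
  apply/negPn/negP => nx.
  have : free [:: x * x; x; 1] by rewrite free_cons nx.
  move/(base_change_free bc) => /=; rewrite free_cons => /andP[/negP + _]; apply.
  rewrite rmorphM /= cayley_hamilton2 rmorph1 -scalemx1 span_cons span_seq1.
  by apply/memv_addP; exists (\tr (rho x) *: rho x); [exact: memvZ (memv_line _)|
    exists (- (\det (rho x) *: 1)); [rewrite memvN; exact: memvZ (memv_line _)|]].
rewrite span_cons span_seq1 => /memv_addP[_ /vlineP[t ->] [_ /vlineP[n ->] e]].
have eR : rho x * rho x = nu t *: rho x + (nu n)%:M.
  by rewrite -rmorphM /= e linearD linearZ /= rho_scalar.
have f2 := base_change_free bc fx; rewrite /= rmorph1 free_cons span_seq1 in f2.
move/andP: f2 => [/negP f2 _].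
have e2 : (\tr (rho x) - nu t) *: rho x = (\det (rho x) + nu n)%:M.
  by rewrite scalerBl raddfD /=; move/eqP: eR; rewrite cayley_hamilton2 subr_eq => /eqP ->;
    rewrite addrC -!addrA addKr addrC.
have t0 : \tr (rho x) = nu t.
  apply/eqP; rewrite -subr_eq0; apply/negPn/negP => u0; apply: f2; apply/vlineP.
  exists ((\tr (rho x) - nu t)^-1 * (\det (rho x) + nu n)).
  by rewrite -scalerA scalemx1 -e2 scalerA mulVf // scale1r.
exists t, (- n); split=> //; last by rewrite scaleNr opprK.
move: e2; rewrite t0 subrr scale0r => /matrixP/(_ 0 0).
by rewrite !mxE /= mulr1n rmorphN => /esym/eqP; rewrite addr_eq0 => /eqP.
Qed.

End AbstractQuaternion.

Section RealPart.
Variables (R : realType) (F : fieldType) (s : {rmorphism F -> R[i]}).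
Hypothesis im0 : forall x, complex.Im (s x) = 0.

Definition real_part_emb (_ : forall x, complex.Im (s x) = 0) (x : F) : R := complex.Re (s x).

Let reB : zmod_morphism (real_part_emb im0).
Proof. by move=> x y; rewrite /real_part_emb rmorphB /=; case: (s x) (s y) => [? ?] [? ?]. Qed.

Let reM : monoid_morphism (real_part_emb im0).
Proof.
split=> [|x y]; rewrite /real_part_emb ?rmorph1 // rmorphM /=.
by move: (im0 x) (im0 y); case: (s x) (s y) => [? ?] [? ?] /= -> ->; rewrite mul0r subr0.
Qed.

HB.instance Definition _ := GRing.isZmodMorphism.Build F R (real_part_emb im0) reB.
HB.instance Definition _ := GRing.isMonoidMorphism.Build F R (real_part_emb im0) reM.

Lemma real_embedding : exists w : {rmorphism F -> R}, forall x, s x = (w x)%:C%C.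
Proof.
exists (real_part_emb im0) => x; rewrite /= /real_part_emb.
by have := im0 x; case: (s x) => ? ? /= ->.
Qed.

End RealPart.

Section RootEmbedding.
Variables (K : numFieldType) (F : fieldExtType rat) (z : F) (r : K) (P : F -> {poly rat}).
Hypothesis Pz : forall x, x = (map_poly (in_alg F) (P x)).[z].
Hypothesis zr : forall p : {poly rat}, (map_poly (in_alg F) p).[z] = 0 -> (map_poly ratr p).[r] = 0.

(** Every element is a polynomial in z; [zr] makes the evaluation of that polynomial at r
    independent of its choice. *)
Definition root_emb (_ : forall p : {poly rat}, (map_poly (in_alg F) p).[z] = 0 ->
  (map_poly ratr p).[r] = 0) (x : F) : K := (map_poly ratr (P x)).[r].

Let rootE p x : (map_poly (in_alg F) p).[z] = x -> root_emb zr x = (map_poly ratr p).[r].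
Proof.
move=> e; apply/eqP; rewrite -subr_eq0 /root_emb -hornerN -hornerD -rmorphB /= zr //.
by rewrite rmorphB hornerD hornerN /= -Pz e subrr.
Qed.

Let rB : zmod_morphism (root_emb zr).
Proof.
move=> x y; rewrite (rootE (p := P x - P y)); first by rewrite rmorphB hornerD hornerN.
by rewrite rmorphB hornerD hornerN /= -!Pz.
Qed.

Let rM : monoid_morphism (root_emb zr).
Proof.
split=> [|x y].
  by rewrite (rootE (p := 1)) ?rmorph1 ?hornerC.
by rewrite (rootE (p := P x * P y)) rmorphM hornerM //= -!Pz.
Qed.

HB.instance Definition _ := GRing.isZmodMorphism.Build F K (root_emb zr) rB.
HB.instance Definition _ := GRing.isMonoidMorphism.Build F K (root_emb zr) rM.

Lemma root_embedding : exists w : {rmorphism F -> K}, w z = r.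
Proof. by exists (root_emb zr); rewrite /= (rootE (p := 'X)) map_polyX hornerX. Qed.

End RootEmbedding.

(** Each complex root of the minimal polynomial of a primitive element gives an embedding, which is
    real and therefore equal to nu. All roots coincide, and their sum, a coefficient up to sign,
    shows that nu z is rational. *)
Lemma field_rational (R : realType) (F : fieldExtType rat) (nu : {rmorphism F -> R}) :
  totally_real R F -> (forall w : {rmorphism F -> R}, w =1 nu) ->
  forall x : F, exists q : rat, x = q%:A.
Proof.
move=> tr uniq_nu.
pose z := separable_generator 1%AS {:F}%AS.
have Fz : (<<1; z>> = {:F})%VS.
  symmetry; apply: eq_adjoin_separable_generator; last exact: sub1v.
  by apply/separableP => y _; apply: pcharf0_separable => p; rewrite (pchar_lalg F) pchar_num.
have exP x : exists p : {poly rat}, x = (map_poly (in_alg F) p).[z].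
  have /Fadjoin_polyP[q /polyOver1P[p ->] ->] : x \in <<1; z>>%VS by rewrite Fz memvf.
  by exists p.
have [P Pz] := choice exP.
have /polyOver1P[m0 m0E] := minPolyOver 1 z.
have monm : m0 \is monic by rewrite -(map_monic (in_alg F)) -m0E monic_minPoly.
have emb (r : R[i]) : root (map_poly ratr m0) r -> r = (nu z)%:C%C.
  move=> rr; have [p hp|w <-] := @root_embedding _ F z r P Pz.
    have : map_poly (in_alg F) m0 %| map_poly (in_alg F) p.
      by rewrite -m0E minPoly_dvdp //; [apply/polyOver1P; exists p|apply/rootP].
    rewrite dvdp_map => /dvdpP[u ->]; rewrite rmorphM hornerM /=.
    by move/rootP: rr => ->; rewrite mulr0.
  by have [v hv] := real_embedding (tr w); rewrite hv uniq_nu.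
have [s sE] := closed_field_poly_normal (map_poly (ratr : rat -> R[i]) m0).
have monC : map_poly (ratr : rat -> R[i]) m0 \is monic by rewrite map_monic.
rewrite (monicP monC) scale1r in sE.
have s1 : {in s, forall r, r = (nu z)%:C%C}.
  by move=> r rs; apply: emb; rewrite sE root_prod_XsubC.
have ss : (0 < size s)%N.
  rewrite -ltnS -(size_prod_XsubC s id) -sE size_map_poly -(size_map_poly (in_alg F)) -m0E.
  by rewrite size_minPoly.
have : (\prod_(x <- s) ('X - x%:P))`_(size s).-1 = - \sum_(x <- s) x by apply: coefPn_prod_XsubC; rewrite -lt0n.
rewrite -sE coef_map /= (eq_big_seq (fun=> (nu z)%:C%C)) //.
rewrite big_const_seq count_predT iter_addr_0 => e.
have [q nuq] : exists q : rat, nu z = ratr q.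
  exists (- m0`_(size s).-1 / (size s)%:R).
  apply: (@complexI R); rewrite [RHS](fmorph_rat (real_complex R)) /= fmorph_div rmorphN /= e opprK ratr_nat -(mulr_natr (nu z)%:C%C).
  by rewrite mulfK // pnatr_eq0 -lt0n.
have zq : z = q%:A by apply: (fmorph_inj nu); rewrite nuq; have := fmorph_eq_rat (nu \o in_alg F) q => /= ->.
move=> x; rewrite (Pz x) zq; exists (P x).[q].
by rewrite -[RHS]/(in_alg F _) -horner_map.
Qed.

Section PlaceNotDivision.
Variables (R : realType) (F : fieldExtType rat) (B : falgType F) (nu w : {rmorphism F -> R}).
Variable rho : {lrmorphism B -> 'M[R]_2 | nu \; *:%R}.
Hypothesis bc : base_change rho.

Lemma rmorph_in_alg (v : {rmorphism F -> R}) (q : rat) : v q%:A = ratr q.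
Proof. by have := fmorph_eq_rat (v \o in_alg F) q => /= ->. Qed.

Lemma hyperbolic_nonscalar x : \det (rho x) = 1 -> hyperbolic (rho x) -> free [:: x; 1].
Proof.
move=> d1 hy; apply: scalar_free => c xc.
move: d1 hy; rewrite xc rho_scalar /hyperbolic tr2 det2 !mxE /= mulr0n mul0r subr0 mulr1n => c2 /lt_geF/negP[].
have : (nu c - 1) * (nu c + 1) = 0.
  by transitivity (nu c * nu c - 1); [ring|rewrite c2 subrr].
by move/eqP; rewrite mulf_eq0 => /orP[]; rewrite ?subr_eq0 ?addr_eq0 => /eqP ->;
  rewrite ?normrE -?opprD ?normrN ger0_norm ?addr_ge0.
Qed.

(** The trace t of x satisfies t^2 = q + 2, a rational number exceeding 4 at nu and hence at w. The
    characteristic polynomial then has real roots at w, and its linear factors produce zero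
    divisors. *)
Lemma hyperbolic_not_division_at x (q : rat) : \det (rho x) = 1 -> hyperbolic (rho x) ->
  \tr (rho x ^+ 2) = ratr q -> ~ division_at B w.
Proof.
move=> d1 hy trq [A [iota [bci div]]].
have [t [n [tE nE xE]]] := rho_quadratic bc x.
have n1 : n = 1 by apply: (fmorph_inj nu); rewrite -nE d1 rmorph1.
have t2 : t ^+ 2 = (q + 2)%:A.
  apply: (fmorph_inj nu); rewrite rmorph_in_alg rmorphXn rmorphD /= -tE -trq.
  by rewrite [_ ^+ 2 in RHS]expr2 cayley_hamilton2 d1 !tr2 !mxE /= ratr_nat; ring.
have q4 : 4 < ratr (q + 2) :> R.
  rewrite -(rmorph_in_alg nu) -t2 rmorphXn /= -tE -real_normK ?num_real //.
  by have : 2 < `|\tr (rho x)| := hy; nra.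
have w2 : w t ^+ 2 = ratr (q + 2) by rewrite -rmorphXn t2 rmorph_in_alg.
have [sd sdE] : exists sd, sd ^+ 2 = w t ^+ 2 - 4.
  by exists (Num.sqrt (w t ^+ 2 - 4)); rewrite sqr_sqrtr // w2; lra.
pose r1 := (w t + sd) / 2; pose r2 := (w t - sd) / 2.
have r12 : r1 + r2 = w t by rewrite /r1 /r2; lra.
have r12M : r1 * r2 = 1 by rewrite /r1 /r2; nra.
have yE : iota x * iota x = w t *: iota x - 1.
  by rewrite -rmorphM xE n1 scale1r rmorphB /= linearZ rmorph1.
have e : (iota x - r1%:A) * (iota x - r2%:A) = 0.
  rewrite mulrBl !mulrBr yE -scalerAl -scalerAr mul1r mulr1 -scalerAl mul1r scalerA r12M scale1r.
  by rewrite -r12 scalerDl (addrAC (r1 *: _ + _)) addrK subrr.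
have f2 := base_change_free bci (hyperbolic_nonscalar d1 hy); rewrite /= rmorph1 free_cons span_seq1 in f2.
have ns r : iota x - r%:A != 0.
  by rewrite subr_eq0; apply/eqP => ix; move: f2; rewrite ix memvZ ?memv_line.
have u1 := div _ (ns r1); have u2 := div _ (ns r2).
by have := unitrM_comm; move/(congr1 (fun z => z * (iota x - r2%:A)^-1)): e; rewrite mulrK // mul0r => /eqP;
  rewrite (negPf (ns r1)).
Qed.

End PlaceNotDivision.

(** * Rational algebras and orders inside real matrices *)

Section RationalCombinations.
Variable R : realType.
Local Notation M2 := 'M[R]_2.
Implicit Types (l : seq M2) (H : set M2).

Definition qcombs l : set M2 :=
  [set x | exists c : nat -> rat, x = \sum_(i < size l) ratr (c i) *: l`_i].

Definition zcombs l : set M2 := [set x | exists c : nat -> rat,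
  (forall i, c i \is a Num.int) /\ x = \sum_(i < size l) ratr (c i) *: l`_i].

Definition rational_algebra (A : set M2) : Prop :=
  [/\ A 1, forall x y, A x -> A y -> A (x - y), forall x y, A x -> A y -> A (x * y),
      forall (q : rat) x, A x -> A (ratr q *: x) & forall x, A x -> exists q : rat, \tr x = ratr q].

(** The second condition, nondegeneracy under the trace, expresses that the real span of the algebra
    is all of M_2(R). *)
Definition rational_order l : Prop :=
  [/\ rational_algebra (qcombs l),
      forall N : M2, (forall x, qcombs l x -> \tr (N * x) = 0) -> N = 0,
      zcombs l 1 & forall x y, zcombs l x -> zcombs l y -> zcombs l (x * y)].

Lemma trace_dual0 (N : M2) : (forall x : M2, \tr (N * x) = 0) -> N = 0.
Proof.
move=> h; have := (h (mx2 1 0 0 0), h (mx2 0 1 0 0), h (mx2 0 0 1 0), h (mx2 0 0 0 1)).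
rewrite !tr2 !mulmx2E !mx2E !(mulr0, mulr1, addr0, add0r) => -[[[h0 h1] h2] h3].
by apply: mx2P; rewrite mxE.
Qed.

(** The hyperbolic element excludes division at every real place, so nu is the only one and
    [field_rational] gives F = Q. The order is then the Z-span of finitely many matrices. *)
Lemma rational_Gamma_O H g : is_Gamma_O H -> H g -> hyperbolic g ->
  (exists q : rat, \tr (g ^+ 2) = ratr q) -> exists l, rational_order l /\
  H = [set h | [/\ zcombs l h, exists2 y, zcombs l y & h * y = 1 & \det h = 1]].
Proof.
move=> [F [B [nu [rho [ O [tr qB bc div [[oO _] HE]]]]]]] Hg hy [q trq].
have det1 x : norm_one_units rho O x -> \det (rho x) = 1.
  by case=> _ _; rewrite /reduced_norm rmorph1.
have ratF : forall x : F, exists q : rat, x = q%:A.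
  apply: (field_rational tr (nu := nu)) => w; apply: contrapT => wnu.
  move: Hg; rewrite HE => -[x Ox xg]; rewrite -xg in hy trq.
  by apply: (hyperbolic_not_division_at bc (det1 _ Ox) hy trq); exact: div wnu.
have [ Oone OB OM [s sB OE]] := oO.
pose l := map rho s.
have sumE (c : 'I_(size s) -> F) (d : nat -> rat) : (forall i, c i = (d i)%:A) ->
    rho (\sum_(i < size s) c i *: s`_i) = \sum_(i < size l) ratr (d i) *: l`_i.
  move=> cd; rewrite /l size_map linear_sum; apply: eq_bigr => i _ /=.
  by rewrite linearZ cd /= rmorph_in_alg (nth_map 0).
have qA : qcombs l = range rho.
  apply/seteqP; split=> [_ [d ->]|_ [x _ <-]].
    by exists (\sum_(i < size s) (d i)%:A *: s`_i) => //; rewrite (sumE _ d).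
  have : x \in span (in_tuple s) by rewrite sB memvf.
  move=> /coord_span ->; have [d dE] := choice (fun i => ratF (coord (in_tuple s) i x)).
  exists (fun n => oapp d 0 (insub n)).
  apply: (sumE (fun i => coord (in_tuple s) i x) (fun n => oapp d 0 (insub n))) => i.
  by rewrite valK dE.
have int_ring (r : rat) : ring_of_integers (r%:A : F) <-> r \is a Num.int.
  split=> [[p mp rp]|/intrP[z ->]]; last first.
    by rewrite -[_%:A]/(in_alg F _) rmorph_int; exact: integral_intr.
  apply: rat_integral_int; exists p => //.
  rewrite -(fmorph_root (in_alg F)) -map_poly_comp.
  by rewrite (_ : map_poly _ p = map_poly intr p) //; apply: eq_map_poly => z /=; exact: (rmorph_int (in_alg F)).
have zO x : O x <-> zcombs l (rho x).
  split=> [|[d [di e]]].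
    rewrite OE => -[c ci <-]; have [d dE] := choice (fun i => ratF (c i)).
    exists (fun n => oapp d 0 (insub n)); split=> [n|].
      by case: insubP => [i _ _|_]; rewrite //=; apply/int_ring; rewrite -dE; exact: ci.
    by apply: (sumE c (fun n => oapp d 0 (insub n))) => i; rewrite valK dE.
  rewrite OE; exists (fun i : 'I_(size s) => (d i)%:A) => [i|].
    exact/int_ring.
  by apply: (base_change_inj bc); rewrite e; exact: (sumE _ d).
have zq x : zcombs l x -> exists y, x = rho y.
  move=> [d [_ e]]; have : qcombs l x by exists d.
  by rewrite qA => -[y _ <-]; exists y.
exists l; split.
  split.
  - rewrite qA; split=> [|_ _ [x _ <-] [y _ <-]|_ _ [x _ <-] [y _ <-]|r _ [x _ <-]|_ [x _ <-]].
    + by exists 1 => //; rewrite rmorph1.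
    + by exists (x - y) => //; rewrite rmorphB.
    + by exists (x * y) => //; rewrite rmorphM.
    + by exists (r%:A *: x) => //; rewrite linearZ /= rmorph_in_alg.
    + have [t [n [-> _ _]]] := rho_quadratic bc x.
      by have [r ->] := ratF t; exists r; rewrite rmorph_in_alg.
  - move=> N hN; apply: trace_dual0 => x.
    have : x \in span (map_tuple rho (vbasis {:B}%VS)).
      by rewrite (span_basis (bc _ (vbasisP _))) memvf.
    move=> /coord_span ->; rewrite mulr_sumr raddf_sum big1 //= => i _.
    rewrite -scalerAr linearZ /= (nth_map 0) ?size_tuple //.
    by rewrite hN ?mulr0 // qA; exists (vbasis {:B})`_i.
  - by rewrite -(rmorph1 rho); apply/zO.
  - move=> x y zx zy; have [x' ex] := zq _ zx; have [y' ey] := zq _ zy.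
    by move: zx zy; rewrite ex ey -rmorphM => /zO Ox /zO Oy; apply/zO; exact: OM.
rewrite HE; apply/seteqP; split=> [_ [x Ux <-]|h [zh [y zy hy1] dh]].
  split; [by apply/zO; case: Ux| |exact: det1].
  by case: Ux => Ox [y Oy [xy _]] _; exists (rho y); [apply/zO|rewrite -rmorphM xy rmorph1].
have [x' ex] := zq _ zh; have [y' ey] := zq _ zy; rewrite ex ey in zh zy hy1 dh *.
exists x' => //; split; [exact/zO| |by rewrite /reduced_norm rmorph1].
have xy : x' * y' = 1 by apply: (base_change_inj bc); rewrite rmorphM hy1 rmorph1.
exists y'; [exact/zO|split=> //; apply: (base_change_inj bc)].
by rewrite rmorphM rmorph1; exact: mulmx1C hy1.
Qed.

End RationalCombinations.

(** * Standard position of a hyperbolic element *)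

Section Standardization.
Variable R : realType.
Local Notation M2 := 'M[R]_2.
Implicit Types (A : set M2) (T P N x g : M2).

Lemma det1_unit T : \det T = 1 -> T \is a GRing.unit.
Proof. by move=> d; rewrite -[_ \is a _]/(T \in unitmx) unitmxE d unitr1. Qed.

Definition conjset T A : set M2 := [set x | A (T^-1 * x * T)].

Lemma tr_conj T x : T \is a GRing.unit -> \tr (T^-1 * x * T) = \tr x.
Proof. by move=> u; rewrite mxtrace_mulC mulmxA -[_ *m T^-1]/(T * T^-1) divrr // mul1mx. Qed.

Lemma conjgM T x y : T \is a GRing.unit -> T^-1 * (x * y) * T = (T^-1 * x * T) * (T^-1 * y * T).
Proof. by move=> u; rewrite !mulrA mulrK. Qed.

Lemma rational_algebra_conj T A : T \is a GRing.unit -> rational_algebra A -> rational_algebra (conjset T A).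
Proof.
move=> u [ Aone AB AM AZ At]; split=> [|x y|x y|q x|x]; rewrite /conjset /=.
- by rewrite mulr1 mulVr.
- by move=> h1 h2; rewrite mulrBr mulrBl; exact: AB.
- by move=> h1 h2; rewrite conjgM //; exact: AM.
- by move=> h; rewrite -scalerAr -scalerAl; exact: AZ.
- by move/At; rewrite tr_conj.
Qed.

Lemma rational_algebraD A x y : rational_algebra A -> A x -> A y -> A (x + y).
Proof.
move=> [ Aone AB _ _ _] Ax Ay; rewrite -[y]opprK -[X in _ - X]sub0r.
by apply: (AB) => //; apply: (AB) => //; rewrite -(subrr 1); exact: AB.
Qed.

Definition nondegenerate A := forall N, (forall x, A x -> \tr (N * x) = 0) -> N = 0.

Lemma nondegenerate_conj T A : T \is a GRing.unit -> nondegenerate A -> nondegenerate (conjset T A).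
Proof.
move=> u nd N hN; have e : T^-1 * N * T = 0.
  apply: nd => x Ax; have := hN (T * x * T^-1); rewrite /conjset /=.
  rewrite !mulrA mulVr // mul1r mulrVK // => /(_ Ax) <-.
  rewrite -[LHS](tr_conj _ (_ : T^-1 \is a GRing.unit)) ?unitrV // invrK.
  by rewrite !mulrA divrr // mul1r.
by have := congr1 (fun z => T * z * T^-1) e; rewrite !mulrA divrr // mul1r mulrK // mulr0 mul0r.
Qed.

Lemma conjset_comp T P A : T \is a GRing.unit -> P \is a GRing.unit ->
  conjset P (conjset T A) = conjset (P * T) A.
Proof. by move=> uT uP; apply/seteqP; split=> x; rewrite /conjset /= invrM // !mulrA. Qed.

Section Sub.
Variables (D b : rat) (s : R).
Hypotheses (sE : s ^+ 2 = ratr D) (s0 : 0 < s) (b0 : b != 0).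
Local Notation rho := (@qrep R rat (@ratr R) D b s sE).

Lemma qrep_i : rho (mkq D b 0 1 0 0) = mx2 s 0 0 (- s).
Proof. by apply: mx2P; rewrite /qrep !mx2E !qE ?rmorph1 ?rmorph0; ring. Qed.

Lemma qrep_j : rho (mkq D b 0 0 1 0) = mx2 0 (ratr b) 1 0.
Proof. by apply: mx2P; rewrite /qrep !mx2E !qE ?rmorph1 ?rmorph0; ring. Qed.

Lemma rational_algebra_sub A : rational_algebra A -> A (rho (mkq D b 0 1 0 0)) ->
  A (rho (mkq D b 0 0 1 0)) -> forall x, A x -> exists y, x = rho y.
Proof.
rewrite qrep_i qrep_j => -[ Aone AB AM AZ At] Ai Aj x Ax.
have [u0 e0] := At _ Ax; have [u1 e1] := At _ (AM _ _ Ai Ax).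
have [u2 e2] := At _ (AM _ _ Aj Ax); have [u3 e3] := At _ (AM _ _ (AM _ _ Ai Aj) Ax).
move: e0 e1 e2 e3; rewrite !tr2 !mulmx2E !mx2E => e0 e1 e2 e3.
exists (mkq D b (u0 / 2) (u1 / (2 * D)) (u2 / (2 * b)) (- u3 / (2 * b * D))).
have rb0 : ratr b != 0 :> R by rewrite fmorph_eq0.
have s1 : s != 0 by rewrite gt_eqF.
by apply: mx2P; rewrite /qrep !mx2E !qE !(fmorph_div, rmorphM, rmorphN) /= ratr_nat -sE -?e0 -?e1 -?e2 -?e3 /=;
  field; rewrite ?s1 ?rb0.
Qed.

Lemma qrep_generated A : rational_algebra A -> A (rho (mkq D b 0 1 0 0)) ->
  A (rho (mkq D b 0 0 1 0)) -> forall y, A (rho y).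
Proof.
move=> rA; have [ Aone AB AM AZ At] := rA; move=> Ai Aj y.
have AD u v : A u -> A v -> A (u + v) by exact: rational_algebraD.
have -> : rho y = ratr (q0 y) *: 1 + ratr (q1 y) *: rho (mkq D b 0 1 0 0) +
    ratr (q2 y) *: rho (mkq D b 0 0 1 0) + ratr (q3 y) *: (rho (mkq D b 0 1 0 0) * rho (mkq D b 0 0 1 0)).
  rewrite qrep_i qrep_j one_mx2; apply: mx2P; rewrite !mxE /= -?[\sum_(i < 2) _]/((_ *m _) _ _);
    rewrite /qrep ?mx2E ?big_ord_recl ?big_ord0 ?mxE /=; ring.
by apply: (AD); [apply: (AD); [apply: (AD)|]|]; apply: AZ => //; exact: AM.
Qed.

End Sub.

Lemma diagonalize g (t l m : R) : \det g = 1 -> \tr g = t -> l + m = t -> l * m = 1 -> m < l ->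
  exists T, \det T = 1 /\ T * g * T^-1 = mx2 l 0 0 m.
Proof.
rewrite det2 tr2 => dg tg lm lm1 ml.
have suffT : (exists T, \det T = 1 /\ T * g = mx2 l 0 0 m * T) ->
    exists T, \det T = 1 /\ T * g * T^-1 = mx2 l 0 0 m.
  by move=> [T [d e]]; exists T; split=> //; rewrite e mulrK // det1_unit.
set a := g 0 0 in dg tg *; set b := g 0 1 in dg *; set c := g 1 0 in dg *; set d := g 1 1 in dg tg *.
have dE : d = l + m - a by rewrite lm -tg; ring.
have [c0|c0] := eqVneq c 0.
  have : (a - l) * (a - m) = 0.
    by transitivity (1 - (a * d - b * c)); [rewrite c0 dE -lm1; ring|rewrite dg subrr].
  move/eqP; rewrite mulf_eq0 !subr_eq0 => /orP[] /eqP aE.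
    apply: suffT; exists (mx2 1 (b / (l - m)) 0 1); split; first by rewrite det2 !mx2E; ring.
    have lm0 : l - m != 0 by rewrite gt_eqF // subr_gt0.
    apply: mx2P; rewrite !mulmx2E !mx2E -/a -/b -/c -/d ?c0 ?dE aE; by [ring|field; rewrite ?lm0].
  apply: suffT; exists (mx2 0 1 (- 1) (- (b / (m - l)))); split; first by rewrite det2 !mx2E; ring.
  have lm0 : m - l != 0 by rewrite lt_eqF // subr_lt0.
  apply: mx2P; rewrite !mulmx2E !mx2E -/a -/b -/c -/d ?c0 ?dE aE; by [ring|field; rewrite ?lm0].
have lm0 : m - l != 0 by rewrite lt_eqF // subr_lt0.
apply: suffT; exists (mx2 c (l - a) (m - l)^-1 ((m - a) / (c * (m - l)))); split.
  by rewrite det2 !mx2E; field; rewrite lm0 c0.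
have bE : b = (a * d - 1) / c by rewrite -dg; field.
apply: mx2P; rewrite !mulmx2E !mx2E -/a -/b -/c -/d ?bE ?dE -?lm1; by [ring|field; rewrite ?lm0 ?c0].
Qed.

(** Diagonalising g puts the matrix diag(s, -s) of i in the algebra. The algebra is closed under
    taking off-diagonal parts; one with both entries nonzero has a rational square b and becomes j
    after conjugation by a diagonal matrix. *)
Lemma standardize (t : rat) (s : R) (sE : s ^+ 2 = ratr (t ^+ 2 - 4)) A g : 0 < s ->
  rational_algebra A -> nondegenerate A -> A g -> \det g = 1 -> \tr g = ratr t ->
  exists T b, [/\ \det T = 1, b != 0,
    T * g * T^-1 = @qrep R rat (@ratr R) _ b s sE (mkq _ b (t / 2) (1 / 2) 0 0)
    & forall x, A x <-> exists y, T * x * T^-1 = @qrep R rat (@ratr R) _ b s sE y].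
Proof.
move=> s0 rA nA Ag dg tg; set D := t ^+ 2 - 4 in sE *.
pose l := (ratr t + s) / 2; pose m := (ratr t - s) / 2.
have tsE : ratr t ^+ 2 - s ^+ 2 = 4 :> R by rewrite sE rmorphB rmorphXn /= ratr_nat; ring.
clearbody D; have [| | |T0 [dT0 gE]] := @diagonalize g (ratr t) l m dg tg.
- by rewrite /l /m; field.
- transitivity ((ratr t ^+ 2 - s ^+ 2) / 4 : R); first by rewrite /l /m; field.
  by rewrite tsE divff.
- by rewrite /l /m; lra.
have uT := det1_unit dT0.
pose A0 := conjset T0 A; have rA0 : rational_algebra A0 by exact: rational_algebra_conj.
have nA0 : nondegenerate A0 by exact: nondegenerate_conj.
have s1 : s != 0 by rewrite gt_eqF.
have [ Aone AB AM AZ At] := rA0.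
have AD u v : A0 u -> A0 v -> A0 (u + v) by exact: rational_algebraD.
pose de := mx2 s 0 0 (- s).
have Ade : A0 de.
  have -> : de = ratr 2 *: mx2 l 0 0 m - ratr t *: 1.
    by rewrite one_mx2; apply: mx2P; rewrite !mxE /= ratr_nat /l /m; field.
  apply: (AB); apply: (AZ) => //; rewrite /A0 /conjset /= -gE !mulrA mulVr // mul1r mulrVK //.
have Aoff x : A0 x -> A0 (mx2 0 (x 0 1) (x 1 0) 0).
  move=> Ax; have -> : mx2 0 (x 0 1) (x 1 0) 0 = ratr (1 / 2) *: (x - ratr D^-1 *: (de * x * de)).
    have eD : ratr D^-1 = (s ^+ 2)^-1 :> R by rewrite fmorphV sE.
    have e2 : ratr (1 / 2) = 2^-1 :> R by rewrite mul1r fmorphV /= ratr_nat.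
    have sc r (X : M2) i j : (r *: X) i j = r * X i j by rewrite mxE.
    have sb (X Y : M2) i j : (X - Y) i j = X i j - Y i j by rewrite !mxE.
    apply: mx2P; rewrite sc sb sc !mulmx2E !mx2E; by rewrite eD e2; field.
  by apply: (AZ); apply: (AB) => //; apply: (AZ); apply: (AM) => //; exact: AM.
have [x1 Ax1 x1n] : exists2 x, A0 x & x 1 0 != 0.
  apply: contrapT => h; have : mx2 0 (1 : R) 0 0 = 0.
    apply: nA0 => x Ax; rewrite tr2 !mulmx2E !mx2E !(mul0r, mul1r, addr0, add0r).
    by apply/eqP/negPn/negP => n; apply: h; exists x.
  by move/matrixP/(_ 0 1)/eqP; rewrite mx2E mxE oner_eq0.
have [x2 Ax2 x2n] : exists2 x, A0 x & x 0 1 != 0.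
  apply: contrapT => h; have : mx2 0 0 (1 : R) 0 = 0.
    apply: nA0 => x Ax; rewrite tr2 !mulmx2E !mx2E !(mul0r, mul1r, addr0, add0r).
    by apply/eqP/negPn/negP => n; apply: h; exists x.
  by move/matrixP/(_ 1 0)/eqP; rewrite mx2E mxE oner_eq0.
have [x Ax [x01 x10]] : exists2 x, A0 x & x 0 1 != 0 /\ x 1 0 != 0.
  have [h1|h1] := eqVneq (x1 0 1) 0; last by exists x1.
  have [h2|h2] := eqVneq (x2 1 0) 0; last by exists x2.
  by exists (x1 + x2); [exact: AD|rewrite !mxE h1 h2 add0r addr0].
(* The lower left entry is normalised to 1 by a square root, so it has to be positive;
   multiplication by i changes its sign. *)
have [be [c [Aw c0 be0]]] : exists be c, [/\ A0 (mx2 0 be c 0), 0 < c & be != 0].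
  have [c0|c0] := ltP 0 (x 1 0); first by exists (x 0 1), (x 1 0); split=> //; exact: Aoff.
  exists (s * x 0 1), (- s * x 1 0); split; last by rewrite mulf_neq0.
    have -> : mx2 0 (s * x 0 1) (- s * x 1 0) 0 = de * mx2 0 (x 0 1) (x 1 0) 0.
      by apply: mx2P; rewrite !mulmx2E !mx2E; ring.
    by apply: (AM) => //; exact: Aoff.
  by rewrite mulNr oppr_gt0 pmulr_rlt0 // lt_neqAle x10.
have [u uE] := At _ (AM _ _ Aw Aw).
pose b := u / 2.
have bE : ratr b = be * c.
  by rewrite /b fmorph_div /= -uE tr2 !mulmx2E !mx2E ratr_nat; field.
have b0 : b != 0 by rewrite -(fmorph_eq0 (@ratr R)) /= bE mulf_neq0 // gt_eqF.
clearbody b.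
pose p := Num.sqrt c; have p0 : p != 0 by rewrite gt_eqF // sqrtr_gt0.
have p2 : p ^+ 2 = c by rewrite sqr_sqrtr // ltW.
pose P := mx2 p 0 0 p^-1.
have dP : \det P = 1 by rewrite det2 !mx2E mulr0 subr0 divff.
have uP := det1_unit dP.
have conjP x0 y0 : P * x0 = y0 * P -> P * x0 * P^-1 = y0 by move=> ->; rewrite mulrK.
have conjP' x0 y0 : P * x0 = y0 * P -> conjset P A0 y0 <-> A0 x0.
  by move=> e; rewrite /conjset /= -mulrA -e mulrA mulVr // mul1r.
have rA1 := rational_algebra_conj uP rA0.
have A1i : conjset P A0 (@qrep R rat (@ratr R) D b s sE (mkq _ b 0 1 0 0)).
  by rewrite qrep_i; apply/(conjP' de) => //; apply: mx2P; rewrite !mulmx2E !mx2E; ring.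
have A1j : conjset P A0 (@qrep R rat (@ratr R) D b s sE (mkq _ b 0 0 1 0)).
  rewrite qrep_j; apply/(conjP' (mx2 0 be c 0)) => //; apply: mx2P; rewrite !mulmx2E !mx2E ?bE -?p2; by [ring|field].
exists (P * T0), b; split=> //.
- by rewrite detM dP dT0 mulr1.
- have -> : P * T0 * g * (P * T0)^-1 = P * (T0 * g * T0^-1) * P^-1 by rewrite invrM // !mulrA.
  rewrite gE; apply: conjP.
  have -> : @qrep R rat (@ratr R) D b s sE (mkq _ b (t / 2) (1 / 2) 0 0) = mx2 l 0 0 m.
    by apply: mx2P; rewrite /qrep !mx2E !qE ?fmorph_div /= ?rmorph1 ?rmorph0 ?ratr_nat /l /m; field.
  by apply: mx2P; rewrite !mulmx2E !mx2E; ring.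
- move=> y; have yE : A y <-> conjset (P * T0) A (P * T0 * y * (P * T0)^-1).
    have uQ : P * T0 \is a GRing.unit by rewrite unitrMl.
    by move: (P * T0) uQ => Q uQ; rewrite /conjset /= !mulrA mulVr // mul1r mulrVK.
  rewrite yE -conjset_comp //; split=> [h|[z ->]].
    exact: (rational_algebra_sub s0 b0 rA1 A1i A1j).
  exact: qrep_generated rA1 A1i A1j z.
Qed.

End Standardization.

(** * Commensurability classes *)

Section FiniteIndex.
Variable R : realType.
Local Notation M2 := 'M[R]_2.
Implicit Types (G H K L A : set M2) (T P : M2).

Lemma conjset_image T G : T \is a GRing.unit -> [set T * h * T^-1 | h in G] = conjset T G.
Proof.
move=> u; apply/seteqP; split=> [_ [h Gh <-]|x Gx]; rewrite /conjset /=.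
  by rewrite !mulrA mulVr // mul1r mulrVK.
by exists (T^-1 * x * T) => //; rewrite !mulrA divrr // mul1r mulrK.
Qed.

Lemma conjset1 G : conjset 1 G = G.
Proof. by apply/seteqP; split=> x; rewrite /conjset /= invr1 mul1r mulr1. Qed.

Lemma PSL2_unit G g : PSL2_subgroup G -> G g -> g \is a GRing.unit.
Proof. by case=> h _ _ _ /h; exact: det1_unit. Qed.

Lemma PSL2_one G : PSL2_subgroup G -> G 1.
Proof. by case=> _ h GM _; have := GM _ _ h h; rewrite mulrNN mulr1. Qed.

Lemma PSL2_conj T G : T \is a GRing.unit -> PSL2_subgroup G -> PSL2_subgroup (conjset T G).
Proof.
move=> u [dG G1 GM GV]; split; rewrite /conjset /=.
- move=> g /dG; rewrite !detM => <-; rewrite mulrAC -detM mulVr // det1 mul1r //.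
- by rewrite mulrN1 mulNr mulVr.
- by move=> g h h1 h2; rewrite conjgM //; exact: GM.
- move=> g Gg; have ug : T^-1 * g * T \is a GRing.unit by apply: det1_unit; exact: dG.
  have ug' : g \is a GRing.unit by rewrite unitrMl // unitrMr ?unitrV // in ug.
  by have := GV _ Gg; rewrite !invrM ?unitrMr ?unitrV // invrK mulrA.
Qed.

Lemma PSL2_setI G H : PSL2_subgroup G -> PSL2_subgroup H -> PSL2_subgroup (G `&` H).
Proof.
move=> [dG G1 GM GV] [dH H1 HM HV]; split=> //.
- by move=> g [/dG].
- by move=> g h [? ?] [? ?]; split; [exact: GM|exact: HM].
- by move=> g [? ?]; split; [exact: GV|exact: HV].
Qed.

Lemma PSL2_expr G g n : PSL2_subgroup G -> G g -> G (g ^+ n).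
Proof.
move=> sG Gg; elim: n => [|n IH]; first by rewrite expr0; exact: PSL2_one.
by rewrite exprS; case: sG => _ _ GM _; exact: GM.
Qed.

Lemma finite_index_refl G : PSL2_subgroup G -> finite_index G G.
Proof.
move=> sG; split=> //; exists [:: 1] => g Gg.
by exists 1; [rewrite mem_head|exists g; rewrite ?mul1r].
Qed.

Lemma finite_index_trans K H G : finite_index K H -> finite_index H G -> finite_index K G.
Proof.
move=> [KH [s hs]] [HG [r hr]]; split; first exact: subset_trans KH HG.
exists [seq t * u | t <- r, u <- s] => g /hr[t tr [h /hs[u us [k Kk ->]] ->]].
by exists (t * u); [exact: allpairs_f|exists k; rewrite ?mulrA].
Qed.

Lemma finite_index_super K H G : finite_index K G -> K `<=` H -> H `<=` G -> finite_index H G.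
Proof.
move=> [KG [s hs]] KH HG; split=> //; exists s => g /hs[t ts [k Kk ->]].
by exists t => //; exists k => //; exact: KH.
Qed.

Lemma finite_index_conj T H G : T \is a GRing.unit -> finite_index H G ->
  finite_index (conjset T H) (conjset T G).
Proof.
move=> u [HG [s hs]]; split=> [x|]; first exact: HG.
exists [seq T * t * T^-1 | t <- s] => g /hs[t ts [h Hh e]].
exists (T * t * T^-1); first exact: map_f.
exists (T * h * T^-1); first by rewrite /conjset /= !mulrA mulVr // mul1r mulrVK.
rewrite !mulrA mulrVK // -(mulrA T) -e !mulrA divrr // mul1r mulrK //.
Qed.

Lemma finite_index_setI H G K : PSL2_subgroup H -> PSL2_subgroup K -> finite_index H G -> K `<=` G ->
  finite_index (H `&` K) K.
Proof.
move=> sH sK [HG [s hs]] KG; split=> [x []//|].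
have rep (t : M2) : exists k : M2, (exists2 k, K k & exists2 h, H h & k = t * h) ->
    K k /\ exists2 h, H h & k = t * h.
  have [[k Kk e]|n] := pselect (exists2 k, K k & exists2 h, H h & k = t * h).
    by exists k.
  by exists 1 => /n.
have [r rP] := choice rep.
exists (map r s) => g Kg; have [t ts [h Hh e]] := hs _ (KG _ Kg).
have [|Kr [h' Hh' e']] := rP t; first by exists g => //; exists h.
exists (r t); first exact: map_f.
have ur := PSL2_unit sK Kr.
exists ((r t)^-1 * g); last by rewrite mulrA divrr // mul1r.
have ut : t \is a GRing.unit by move: ur; rewrite e' unitrMl // (PSL2_unit sH Hh').
case: sH sK => dH _ HM HV [dK _ KM KV]; split; last by apply: (KM) => //; exact: KV.
rewrite e e' invrM ?(det1_unit (dH _ Hh')) //.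
by rewrite mulrA mulrVK //; apply: HM => //; exact: HV.
Qed.

Lemma commensurable_sym G H : commensurable_groups G H -> commensurable_groups H G.
Proof. by case=> h1 h2; split; rewrite setIC. Qed.

Lemma commensurable_trans G H L : PSL2_subgroup G -> PSL2_subgroup H -> PSL2_subgroup L ->
  commensurable_groups G H -> commensurable_groups H L -> commensurable_groups G L.
Proof.
suff half G' H' L' : PSL2_subgroup G' -> PSL2_subgroup H' -> PSL2_subgroup L' ->
    commensurable_groups G' H' -> commensurable_groups H' L' -> finite_index (G' `&` L') G'.
  move=> sG sH sL c1 c2; split; first exact: half c1 c2.
  by rewrite setIC; apply: (half _ H) => //; exact: commensurable_sym.
move=> sG sH sL [GHG GHH] [HLH HLL].
have fi := finite_index_setI (PSL2_setI sH sL) (PSL2_setI sG sH) HLH (fun x h => h.2).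
apply: (finite_index_super (finite_index_trans fi GHG)) => [x [[_ Lx] [Gx _]] //|x [] //].
Qed.

Lemma commensurable_conj T G H : T \is a GRing.unit -> commensurable_groups G H ->
  commensurable_groups (conjset T G) (conjset T H).
Proof.
move=> u [h1 h2]; rewrite /commensurable_groups -[_ `&` _]/(conjset T (G `&` H)).
by split; exact: finite_index_conj.
Qed.

Lemma finite_index_power H G g : PSL2_subgroup G -> PSL2_subgroup H -> finite_index H G -> G g ->
  exists2 k, (0 < k)%N & H (g ^+ k).
Proof.
move=> sG sH [HG [s hs]] Gg.
have ex n : exists t, t \in s /\ exists2 h, H h & g ^+ n = t * h.
  by have [t ts h] := hs _ (PSL2_expr n sG Gg); exists t.
have [t tP] := choice ex.
have [i [j [ij _ e]]] := pigeonhole_nat (fun n => inord (index (t n) s) : 'I_(size s).+1).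
have {e}tij : t i = t j.
  have lt n : (index (t n) s < (size s).+1)%N by rewrite ltnS index_size.
  have := congr1 (fun x : 'I_(size s).+1 => nth 0 s x) e.
  by rewrite /= !inordK // !nth_index //; [have [] := tP j|have [] := tP i].
have [_ [h Hh eh]] := tP i; have [_ [h' Hh' eh']] := tP j.
exists (j - i)%N; first by rewrite subn_gt0.
have ug := PSL2_unit sG Gg; have uh := PSL2_unit sH Hh.
have ui : g ^+ i \is a GRing.unit by rewrite unitrX.
have ut : t i \is a GRing.unit by move: ui; rewrite eh unitrMl.
have -> : g ^+ (j - i) = h^-1 * h'.
  apply: (mulrI ui); rewrite -exprD subnKC ?(ltnW ij) // eh' eh tij mulrA mulrK //.
by case: sH => _ _ HM HV; apply: HM => //; exact: HV.
Qed.

Lemma commensurable_surfaces_conj G H P : PSL2_subgroup G -> PSL2_subgroup H -> discrete_group G ->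
  P \is a GRing.unit -> commensurable_groups G (conjset P H) -> commensurable_surfaces G H.
Proof.
move=> sG sH dG uP [h1 h2]; exists (G `&` conjset P H); split.
- by apply: PSL2_setI => //; exact: PSL2_conj.
- move=> g [Gg _]; have := dG _ Gg; apply: filterS => h hg [Gh _]; exact: hg.
- by exists 1; rewrite ?unitmx1 // conjset_image ?unitr1 // conjset1.
- exists P^-1; first by rewrite -[_ \in _]/(P^-1 \is a GRing.unit) unitrV.
  rewrite conjset_image ?unitrV //.
  by have := finite_index_conj (T := P^-1) _ h2; rewrite conjset_comp ?unitrV // mulVr // conjset1; apply.
Qed.

End FiniteIndex.

Lemma qorder_intro a b (O : set (quaternion a b)) (Y : seq (quaternion a b)) : O 1 ->
  (forall x y, O x -> O y -> O (x - y)) -> (forall x y, O x -> O y -> O (x * y)) ->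
  (forall x, O x -> zcomb Y x) -> (forall x, exists n : nat, (0 < n)%N /\ O (n%:R *: x)) -> qorder O.
Proof.
move=> h1 hB hM hY hn; split=> //.
have zO : zsub O by split=> //; rewrite -(subrr 1); exact: hB.
have [n1 [p1 H1]] := hn 1; have [n2 [p2 H2]] := hn (mkq a b 0 1 0 0).
have [n3 [p3 H3]] := hn (mkq a b 0 0 1 0); have [n4 [p4 H4]] := hn (mkq a b 0 0 0 1).
have [m [m0 hm]] := qlat0_multiple_seq Y.
have mul (N n : nat) (x : quaternion a b) : (n %| N)%N -> O (n%:R *: x) -> O (N%:R *: x).
  by move=> /dvdnP[k ->] h; rewrite natrM -scalerA; apply: zsubZ; rewrite ?natr_int.
exists (n1 * n2 * n3 * n4 * m)%N; split; first by rewrite !muln_gt0 p1 p2 p3 p4 m0.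
- move=> x /hY hx; rewrite natrM -scalerA; apply: zsubZ; rewrite ?natr_int //; first exact: qlat0_zsub.
  case: hx => c [ci ->]; rewrite scaler_sumr; apply: (big_ind (@qlat0 a b)); first by have [] := qlat0_zsub a b.
    by move=> u v; apply: zsubD; exact: qlat0_zsub.
  move=> i _; rewrite scalerA mulrC -scalerA; apply: zsubZ => //; first exact: qlat0_zsub.
  by apply: hm; exact: mem_nth.
- move=> x [x0 x1 x2 x3]; rewrite qlat0E; apply: (zsubD zO); [apply: (zsubD zO); [apply: (zsubD zO)|]|];
    (apply: (zsubZ zO) => //; [apply: mul; [|eassumption]]).
  + by rewrite -!mulnA dvdn_mulr.
  + by rewrite -!mulnA dvdn_mull // dvdn_mulr.
  + by rewrite -!mulnA dvdn_mull // dvdn_mull // dvdn_mulr.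
  + by rewrite dvdn_mulr // dvdn_mull.
Qed.

(* The images of the lattice spanned by 1/N, i/N, j/N, k/N bound a twisted order. *)
Lemma qorder_transport a b a' b' (psi : quaternion a' b' -> quaternion a b)
    (phi : quaternion a b -> quaternion a' b') (O : set (quaternion a b)) :
  psi 1 = 1 -> (forall x y, psi (x - y) = psi x - psi y) -> (forall x y, psi (x * y) = psi x * psi y) ->
  (forall c x, psi (c *: x) = c *: psi x) -> (forall x, psi (phi x) = x) -> (forall x, phi (psi x) = x) ->
  qorder O -> qorder [set x | O (psi x)].
Proof.
move=> h1 hB hM hZ psiK phiK oO; have [ oone oB oM [N [N0 NO _]]] := oO.
have h0 : psi 0 = 0 by have := hB 0 0; rewrite !subrr.
have hD x y : psi (x + y) = psi x + psi y.
  by rewrite -[y]opprK hB -[- y]sub0r hB h0 sub0r opprK sub0r opprK.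
pose e : seq (quaternion a b) := [seq N%:R^-1 *: x | x <- [:: 1; mkq a b 0 1 0 0; mkq a b 0 0 1 0; mkq a b 0 0 0 1]].
apply: (@qorder_intro _ _ _ (map phi e)) => [|x y|x y|x /NO [x0 x1 x2 x3]|x] /=.
- by rewrite h1.
- by rewrite hB; exact: oB.
- by rewrite hM; exact: oM.
- have xE : x = q0 (N%:R *: psi x) *: phi (N%:R^-1 *: 1) + q1 (N%:R *: psi x) *: phi (N%:R^-1 *: mkq a b 0 1 0 0) +
      q2 (N%:R *: psi x) *: phi (N%:R^-1 *: mkq a b 0 0 1 0) + q3 (N%:R *: psi x) *: phi (N%:R^-1 *: mkq a b 0 0 0 1).
    have inj : injective psi by move=> u v /(congr1 phi); rewrite !phiK.
    by apply: (inj); rewrite !hD !hZ !psiK -qlat0E scalerA mulVf ?scale1r // pnatr_eq0 -lt0n.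
  rewrite xE; have zz := zcomb_zsub (map phi e).
  by apply: (zsubD zz); [apply: (zsubD zz); [apply: (zsubD zz)|]|]; apply: (zsubZ zz) => //;
    apply: zcomb_mem; rewrite !inE eqxx ?orbT.
- by have [n [n0 hn]] := qorder_multiple (psi x) oO; exists n; rewrite hZ.
Qed.

(** * Commensurability of unit groups *)

Section UnitGroups.
Variables (R : realType) (D : rat) (s : R).
Hypotheses (sE : s ^+ 2 = ratr D) (s0 : 0 < s).
Local Notation rho b := (@qrep R rat (@ratr R) D b s sE).

Lemma qorder_setI b (O O' : set (quaternion D b)) : qorder O -> qorder O' -> qorder (O `&` O').
Proof.
move=> oO oO'; have [ oone oB oM [N [N0 NO ON]]] := oO; have [ oone' oB' oM' [N' [N0' NO' ON']]] := oO'.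
split=> //.
- by move=> x y [? ?] [? ?]; split; [exact: oB|exact: oB'].
- by move=> x y [? ?] [? ?]; split; [exact: oM|exact: oM'].
- exists (N * N')%N; split; first by rewrite muln_gt0 N0.
    move=> x [Ox _]; rewrite mulnC natrM -scalerA.
    by apply: zsubZ; [exact: qlat0_zsub|exact: natr_int|exact: NO].
  move=> x lx; split; last by rewrite natrM -scalerA; apply: zsubZ; [exact: qorder_zsub|exact: natr_int|exact: ON'].
  by rewrite mulnC natrM -scalerA; apply: zsubZ; [exact: qorder_zsub|exact: natr_int|exact: ON].
Qed.

(** If units r and x are congruent modulo L U L times the standard lattice, then conj(r) x - 1 lies
    in L times that lattice, hence in O1. So finitely many cosets suffice. *)
Lemma unit_group_finite_index b (O O1 : set (quaternion D b)) : b != 0 -> qorder O -> qorder O1 -> O1 `<=` O ->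
  finite_index (unit_group sE O1) (unit_group sE O).
Proof.
move=> b0 oO oO1 O1O; have [ oone oB oM [U [U0 UO _]]] := oO; have [_ _ _ [L [L0 _ LO1]]] := oO1.
split=> [_ [x [Ox nx] <-]|]; first by exists x => //; split=> //; exact: O1O.
pose N := (L * U * L)%N; have N0 : (0 < N)%N by rewrite !muln_gt0 L0 U0.
have ex (c : 'I_(U * N) * 'I_(U * N) * 'I_(U * N) * 'I_(U * N)) : exists r : quaternion D b,
    (exists x y, [/\ O x, qnrd x = 1, qlat0 y & x = lat_rep D b U c + N%:R *: y]) ->
    exists y, [/\ O r, qnrd r = 1, qlat0 y & r = lat_rep D b U c + N%:R *: y].
  have [[x [y h]]|n] := pselect (exists x y, [/\ O x, qnrd x = 1, qlat0 y & x = lat_rep D b U c + N%:R *: y]).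
    by exists x => _; exists y.
  by exists 1 => /n.
have [rep repP] := choice ex.
exists [seq rho b (rep c) | c <- enum {: 'I_(U * N) * 'I_(U * N) * 'I_(U * N) * 'I_(U * N)}].
move=> _ [x [Ox nx] <-].
have [c [y [ly xE]]] := lat_repP U0 N0 (UO _ Ox).
have [|y' [Or nr ly' rE]] := repP c; first by exists x, y.
exists (rho b (rep c)); first by apply: (map_f (fun c => rho b (rep c))); rewrite mem_enum.
exists (rho b (qconj (rep c) * x)); last by rewrite -rmorphM mulrA mul_qconj nr scale1r mul1r.
exists (qconj (rep c) * x) => //; split; last by rewrite qnrdM qnrd_conj nr nx mulr1.
have -> : qconj (rep c) * x = 1 - L%:R *: (U%:R *: (qconj (rep c) * (L%:R *: (y' - y)))).
  have -> : x = rep c + N%:R *: (y - y') by rewrite scalerBr rE {1}xE -addrA; congr (_ + _); rewrite addrC subrK.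
  rewrite mulrDr qconj_mul nr scale1r; congr (_ + _).
  by rewrite -scalerAr -[y - y']opprB mulrN scalerN -scalerAr !scalerA -!natrM.
have [ oone1 oB1 oM1 _] := oO1; apply: (oB1) => //; apply: (LO1); apply: UO; apply: (oM); first exact: qorder_conj.
by apply: O1O; apply: (LO1); apply: (qlat0_zsub _ _).2.
Qed.

Lemma unit_groups_commensurable b (O O' : set (quaternion D b)) : b != 0 -> qorder O -> qorder O' ->
  commensurable_groups (unit_group sE O) (unit_group sE O').
Proof.
move=> b0 oO oO'; have oI := qorder_setI oO oO'.
have sO := unit_group_PSL2 sE oO; have sO' := unit_group_PSL2 sE oO'.
have sub1 : unit_group sE (O `&` O') `<=` unit_group sE O `&` unit_group sE O'.
  by move=> _ [x [[Ox Ox'] nx] <-]; split; exists x.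
split; (apply: finite_index_super; [|exact: sub1|by move=> x []]);
  by apply: unit_group_finite_index => // x [].
Qed.

(* rho_b and rho_b' are conjugate by diag(z + w s, 1) when b' = b N(z + w s). *)
Lemma unit_group_twist b b' (O : set (quaternion D b)) z w : b != 0 -> b' = b * (z ^+ 2 - D * w ^+ 2) ->
  z ^+ 2 - D * w ^+ 2 != 0 -> qorder O ->
  exists (T : 'M[R]_2) (O' : set (quaternion D b')), [/\ T \is a GRing.unit, qorder O' & conjset T (unit_group sE O) = unit_group sE O'].
Proof.
set n := z ^+ 2 - D * w ^+ 2 => b0 b'E n0 oO.
pose phi (x : quaternion D b) := mkq D b' (q0 x) (q1 x) ((q2 x * z + D * q3 x * w) / n) ((q2 x * w + q3 x * z) / n).
pose psi (x : quaternion D b') := mkq D b (q0 x) (q1 x) (q2 x * z - D * q3 x * w) (q3 x * z - q2 x * w).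
have rn : z ^+ 2 - D * w ^+ 2 != 0 by [].
have phiK x : psi (phi x) = x.
  by apply: quatP; rewrite /psi /phi ?q0_mk ?q1_mk ?q2_mk ?q3_mk //; rewrite /n; field.
have psiK x : phi (psi x) = x.
  by apply: quatP; rewrite /psi /phi ?q0_mk ?q1_mk ?q2_mk ?q3_mk //; rewrite /n; field.
have psiM x y : psi (x * y) = psi x * psi y.
  by apply: quatP; rewrite /psi !qE b'E /n; ring.
have psin x : qnrd (psi x) = qnrd x by rewrite /qnrd /psi !qE b'E /n; ring.
pose a : R := ratr z + ratr w * s; pose a' : R := ratr z - ratr w * s.
have aa' : a * a' = ratr n by rewrite /n rmorphB /= !(rmorphXn, rmorphM) /= -sE /a /a'; ring.
have a0 : a != 0.
  by apply: contra_neq n0 => e; apply: (fmorph_inj (@ratr R)); rewrite /= -aa' e mul0r rmorph0.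
pose T := mx2 a 0 0 1.
have uT : T \is a GRing.unit.
  by rewrite -[_ \is a _]/(T \in unitmx) unitmxE det2 !mx2E mulr0 subr0 mulr1 unitfE.
have key x : T * rho b (psi x) = rho b' x * T.
  have rbE : ratr b' = ratr b * (a * a') by rewrite b'E rmorphM /= aa'.
  apply: mx2P; rewrite !mulmx2E !mx2E /qrep ?mx2E /psi !qE !(rmorphB, rmorphM) /= ?rbE /a /a' -?sE; ring.
exists T, [set x | O (psi x)]; split=> //.
- apply: (qorder_transport (phi := phi)) => //.
  + by apply: quatP; rewrite /psi !qE; ring.
  + by move=> x y; apply: quatP; rewrite /psi !qE; ring.
  + by move=> c x; apply: quatP; rewrite /psi !qE; ring.
- apply/seteqP; split=> [x [y [Oy ny] e]|_ [x [Ox nx] <-]]; last first.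
    exists (psi x); first by split=> //; rewrite psin.
    by rewrite -mulrA -key mulrA mulVr // mul1r.
  exists (phi y); first by split; rewrite /= ?phiK // -psin phiK.
  have := key (phi y); rewrite phiK e -mulrA !mulrA divrr // mul1r => h.
  by apply: (mulIr uT); rewrite -h.
Qed.

Definition std_form (G : set 'M[R]_2) (b : rat) : Prop := exists T (O : set (quaternion D b)),
  [/\ T \is a GRing.unit, b != 0, qorder O & commensurable_groups (conjset T G) (unit_group sE O)].

Lemma std_form_twist G b b' : PSL2_subgroup G -> qnorm D (b * b') -> std_form G b -> std_form G b'.
Proof.
move=> sG [bb0 [u [v bbE]]] [T [ O [uT b0 oO com]]].
have n0 : (u / b) ^+ 2 - D * (v / b) ^+ 2 != 0.
  have -> : (u / b) ^+ 2 - D * (v / b) ^+ 2 = (b * b') / b ^+ 2 by rewrite bbE; field.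
  by rewrite mulf_neq0 // invr_neq0 // expf_neq0.
have b'E : b' = b * ((u / b) ^+ 2 - D * (v / b) ^+ 2).
  by have -> : b' = (b * b') / b; [field|rewrite bbE; field].
have [P [ O' [uP oO' e]]] := unit_group_twist b0 b'E n0 oO.
exists (P * T), O'; split=> //; first by rewrite unitrMl.
  by rewrite b'E mulf_neq0.
by rewrite -conjset_comp // -e; exact: commensurable_conj.
Qed.

Lemma std_form_commensurable G H b : PSL2_subgroup G -> PSL2_subgroup H -> discrete_group G ->
  std_form G b -> std_form H b -> commensurable_surfaces G H.
Proof.
move=> sG sH dG [T [ O [uT b0 oO cG]]] [P [ O' [uP _ oO' cH]]].
apply: (@commensurable_surfaces_conj _ _ _ (T^-1 * P)) => //; first by rewrite unitrMl // unitrV.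
rewrite -conjset_comp ?unitrV //.
have -> : G = conjset T^-1 (conjset T G) by rewrite conjset_comp ?unitrV // mulVr // conjset1.
apply: commensurable_conj; rewrite ?unitrV //.
have sU := unit_group_PSL2 sE oO; have sU' := unit_group_PSL2 sE oO'.
apply: (commensurable_trans (H := unit_group sE O)) => //; try exact: PSL2_conj.
apply: (commensurable_trans (H := unit_group sE O')) => //; try exact: PSL2_conj.
  exact: unit_groups_commensurable.
exact: commensurable_sym.
Qed.

End UnitGroups.

Lemma expr_conj (U : unitRingType) (u x : U) n : u \is a GRing.unit ->
  (u * x * u^-1) ^+ n = u * x ^+ n * u^-1.
Proof.
move=> uu; elim: n => [|n IH]; first by rewrite !expr0 mulr1 divrr.
by rewrite [in LHS]exprS [in RHS]exprS IH !mulrA mulrVK.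
Qed.

Lemma scaled_square_neq1 (K : numFieldType) (b : K) : exists2 r, r != 0 & 1 - b * r ^+ 2 != 0.
Proof.
have [->|b1] := eqVneq b 1; last by exists 1; rewrite ?oner_eq0 // expr1n mulr1 subr_eq0 eq_sym.
exists 2; first by rewrite pnatr_eq0.
by rewrite mul1r subr_eq0 -natrX eq_sym (eqr_nat _ _ 1).
Qed.

(** The conjugate of i by 1 + r j is a combination of i and i j with nonzero i j part, so the
    conjugates of i generate the algebra. *)
Lemma quaternion_j_conj (D b r : rat) : D != 0 -> r != 0 -> 1 - b * r ^+ 2 != 0 ->
  mkq D b 0 0 1 0 = (- (1 - b * r ^+ 2) / (2 * r * D)) *: (mkq D b 0 1 0 0 *
    (mkq D b 1 0 r 0 * mkq D b 0 1 0 0 * ((1 - b * r ^+ 2)^-1 *: qconj (mkq D b 1 0 r 0)) -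
     ((1 + b * r ^+ 2) / (1 - b * r ^+ 2)) *: mkq D b 0 1 0 0)).
Proof. by move=> D1 r0 rb0; apply: quatP; rewrite /qconj !qE; field; rewrite ?r0 ?rb0 ?D1. Qed.

Lemma quat_ii (D b : rat) : mkq D b 0 1 0 0 * mkq D b 0 1 0 0 = D%:A.
Proof. by apply: quatP; rewrite !qE; ring. Qed.

Lemma quat_jj (D b : rat) : mkq D b 0 0 1 0 * mkq D b 0 0 1 0 = b%:A.
Proof. by apply: quatP; rewrite !qE; ring. Qed.

Lemma quat_ijN (D b : rat) : mkq D b 0 1 0 0 * mkq D b 0 0 1 0 = - (mkq D b 0 0 1 0 * mkq D b 0 1 0 0).
Proof. by apply: quatP; rewrite !qE; ring. Qed.

(* An embedding of quaternion D b into quaternion D b' is conjugate to one fixing i. *)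
Lemma quaternion_embedding (D b b' : rat) (x y : quaternion D b') : D != 0 -> b != 0 ->
  (forall z : quaternion D b', z != 0 -> qnrd z != 0) ->
  x * x = D%:A -> y * y = b%:A -> x * y = - (y * x) -> qnorm D (b * b').
Proof.
move=> D1 b0 div xx yy xy; pose i := mkq D b' 0 1 0 0.
have ii : i * i = D%:A by apply: quatP; rewrite /i !qE; ring.
(* i x + D intertwines x with i; it vanishes only for x = -i, and then j does the same. *)
have [c c0 cx] : exists2 c, c != 0 & c * x = i * c.
  have [h|h] := eqVneq (i * x + D%:A) 0; last first.
    exists (i * x + D%:A) => //; rewrite mulrDl mulrDr -mulrA xx mulrA ii.
    by apply: quatP; rewrite /i !qE; ring.
  have xi : x = - i.
    have : i * (i * x + D%:A) = 0 by rewrite h mulr0.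
    rewrite mulrDr mulrA ii -!scalerAl -scalerAr mul1r mulr1 -scalerDr => /eqP.
    by rewrite scaler_eq0 (negPf D1) /= addr_eq0 => /eqP.
  exists (mkq D b' 0 0 1 0).
    by apply/eqP => /(congr1 (@q2 _ _ _)); rewrite !qE => /eqP; rewrite oner_eq0.
  by rewrite xi; apply: quatP; rewrite /i !qE; ring.
have nc := div _ c0; have uc := qunitP nc.
have conjM u v : c * u * c^-1 * (c * v * c^-1) = c * (u * v) * c^-1.
  by rewrite -!mulrA (mulrA c^-1) mulVr // mul1r.
have [w wE] : exists w, w = c * y * c^-1 by eexists.
have wi : i * w = - (w * i).
  have -> : i = c * x * c^-1 by rewrite cx mulrK.
  by rewrite wE !conjM xy mulrN mulNr.
have ww : w * w = b%:A.
  by rewrite wE conjM yy -scalerAr mulr1 -scalerAl divrr.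
have w0 : q0 w = 0.
  move: (congr1 (@q1 _ _ _) wi); rewrite /i !qE => e; lra.
have w1 : q1 w = 0.
  by move: (congr1 (@q0 _ _ _) wi); rewrite /i !qE => e; apply: (mulfI D1); rewrite mulr0; lra.
have bE : b = b' * (q2 w ^+ 2 - D * q3 w ^+ 2).
  by move: (congr1 (@q0 _ _ _) ww); rewrite !qE w0 w1 => e; rewrite -[LHS]mulr1 -e; ring.
have b'0 : b' != 0 by apply: contra_neq b0 => e; rewrite bE e mul0r.
split; first by rewrite mulf_neq0.
by exists (b' * q2 w), (b' * q3 w); rewrite [in LHS]bE; ring.
Qed.

(** * Subgroups of finite index generate the algebra *)

Section Generation.
Variables (R : realType) (t : int) (s : R).
Hypothesis t2 : 2 < t.
Local Notation D := (t%:~R ^+ 2 - 4 : rat).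
Hypotheses (sE : s ^+ 2 = ratr D) (s0 : 0 < s).
Local Notation rho b := (@qrep R rat (@ratr R) D b s sE).

Let D0 : 0 < D.
Proof.
have h : (2%:~R : rat) < t%:~R by rewrite ltr_int.
by nra.
Qed.

Let rhoZ b c (x : quaternion D b) : rho b (c *: x) = ratr c *: rho b x.
Proof. by apply: mx2P; rewrite [RHS]mxE /qrep !mx2E !qE !rmorphM /=; ring. Qed.

(* Units u (tau + sigma i)/2 u^-1 close to 1 lie in every order, and a power of
   each lies in any subgroup of finite index. *)
Lemma finite_index_contains_conj b (O : set (quaternion D b)) K A (u : quaternion D b) : qorder O -> PSL2_subgroup K ->
  finite_index K (unit_group sE O) -> rational_algebra A -> K `<=` A -> qnrd u != 0 ->
  A (rho b (u * mkq D b 0 1 0 0 * u^-1)).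
Proof.
move=> oO sK fK rA KA nu; have [ oone oB oM _] := oO; have zO := qorder_zsub oO.
have uu := qunitP nu.
set e := _ * u^-1; have [n [n0 On]] := qorder_multiple e oO.
have n20 : (0 < 2 * n)%N by rewrite muln_gt0.
have [v0 hv] := pell_valuation b t2 (isT : prime 2) n20.
have [tau [sigma [s' [ip d1 d2 [se ns] _]]]] := hv v0 (leqnn _).
have sg0 : sigma != 0.
  by apply: contraNneq ns => s00; move/eqP: se; rewrite s00 eq_sym mulf_eq0 expf_eq0 /= andbF /= => /eqP ->; exact: dvdz0.
pose x : quaternion D b := (tau%:~R / 2) *: 1 + (sigma%:~R / 2) *: e.
have xE : x = u * pell t b tau sigma * u^-1.
  have -> : pell t b tau sigma = (tau%:~R / 2) *: 1 + (sigma%:~R / 2) *: mkq D b 0 1 0 0.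
    by apply: quatP; rewrite /pell !qE; ring.
  by rewrite mulrDr mulrDl -!scalerAr -!scalerAl mulr1 divrr.
have nx : qnrd x = 1 by rewrite xE qnrd_conjg // pell_nrd.
have Ox : O x.
  have /dvdzP[c1 e1] := d1; have /dvdzP[c2 e2] := d2.
  have -> : x = 1 + ((c1 * n)%:~R *: 1 + c2%:~R *: (n%:R *: e)).
    transitivity ((1 + (c1 * n)%:~R) *: (1 : quaternion D b) + (c2%:~R * n%:R) *: e); last first.
      by rewrite scalerDl scale1r -scalerA addrA.
    rewrite /x; congr (_ *: _ + _ *: _).
      have -> : tau = 2 * (c1 * n%:Z) + 2 by rewrite -[LHS](subrK 2) e1 PoszM; ring.
      by rewrite rmorphD rmorphM /=; field.
    have -> : sigma = 2 * (c2 * n%:Z) by rewrite e2 PoszM; ring.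
    by rewrite pmulrn !rmorphM /=; field.
  by apply: (zsubD zO) => //; apply: (zsubD zO); apply: (zsubZ zO) => //; exact: intr_int.
(* Squaring makes the trace exceed 2 whatever the sign of tau, so the Chebyshev values of further
   powers are positive and their i-part does not vanish. *)
pose tau2 := tau ^+ 2 - 2; pose sg2 := sigma * tau.
have ip2 : is_pell t tau2 sg2.
  move: ip; rewrite /is_pell /tau2 /sg2 !(rmorphXn, rmorphB, rmorphM) /= => ip.
  have -> : (t%:~R ^+ 2 - 4) * (sigma%:~R * tau%:~R) ^+ 2 = (tau%:~R ^+ 2 - 4) * tau%:~R ^+ 2 :> rat.
    by rewrite -[in RHS]ip; ring.
  by ring.
have tau4 : 4 < tau ^+ 2.
  rewrite -(ltr_int rat) rmorphXn /=; have ip' : tau%:~R ^+ 2 - D * sigma%:~R ^+ 2 = 4 := ip.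
  by rewrite -subr_gt0 -[4%:~R]/(4 : rat) -ip' opprB addrC subrK mulr_gt0 // exprn_even_gt0 //= intr_eq0.
have tau22 : 2 < tau2 by rewrite /tau2; lia.
have x2E : x ^+ 2 = u * pell t b tau2 sg2 * u^-1.
  have -> : pell t b tau2 sg2 = pell t b tau sigma ^+ 2.
    move: ip; rewrite /is_pell => ip.
    apply: quatP; rewrite /pell expr2 !qE /tau2 /sg2 ?(rmorphXn, rmorphB, rmorphM) /= ?(rmorphXn, rmorphB, rmorphM) /=; try by field.
    have ipD : (t%:~R ^+ 2 - 4) * sigma%:~R ^+ 2 = tau%:~R ^+ 2 - 4 :> rat by move: ip; lra.
    rewrite [LHS](_ : _ = tau%:~R ^+ 2 / 4 + (tau%:~R ^+ 2 - 4) / 4); last by field.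
    by rewrite -ipD; field.
  by rewrite xE expr_conj.
have Ux : unit_group sE O (rho b (x ^+ 2)).
  by exists (x ^+ 2) => //; split; [exact: qorderX|rewrite qnrdX nx expr1n].
have sU := unit_group_PSL2 sE oO.
have [[//|k] _ Kk] := finite_index_power sU sK fK Ux.
have := KA _ Kk; rewrite -rmorphXn x2E.
rewrite expr_conj // pellX //; set tau3 := pellT _ _; set sg3 := _ * chebU _ _ => Ap.
have sg30 : sg3 != 0.
  have cU : chebU tau2 k.+1 != 0 by rewrite gt_eqF // chebU_gt0.
  have tau0 : tau != 0 by apply: contraTneq tau4 => ->.
  by apply: mulf_neq0 => //; apply: mulf_neq0.
have eE : rho b e = ratr (2 / sg3%:~R) *: (rho b (u * pell t b tau3 sg3 * u^-1) - ratr (tau3%:~R / 2) *: 1).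
  have -> : pell t b tau3 sg3 = (tau3%:~R / 2) *: 1 + (sg3%:~R / 2) *: mkq D b 0 1 0 0.
    by apply: quatP; rewrite /pell !qE; ring.
  rewrite mulrDr mulrDl -!scalerAr -!scalerAl mulr1 divrr // rmorphD /= !rhoZ rmorph1.
  rewrite [X in _ *: (X - _)]addrC addrK scalerA -rmorphM /=.
  by rewrite (_ : _ * _ = 1) ?rmorph1 ?scale1r //; field; rewrite intr_eq0.
case: rA => Aone AB AM AZ _; rewrite eE; apply: (AZ); apply: (AB) => //; exact: AZ.
Qed.

Lemma finite_index_generates b (O : set (quaternion D b)) K A : b != 0 -> qorder O -> PSL2_subgroup K ->
  finite_index K (unit_group sE O) -> rational_algebra A -> K `<=` A ->
  A (rho b (mkq D b 0 1 0 0)) /\ A (rho b (mkq D b 0 0 1 0)).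
Proof.
move=> b0 oO sK fK rA KA.
have key := fun u => @finite_index_contains_conj b O K A u oO sK fK rA KA.
have Ai : A (rho b (mkq D b 0 1 0 0)).
  by have := key 1; rewrite mul1r invr1 mulr1; apply; rewrite (_ : qnrd 1 = 1) ?oner_eq0 // /qnrd !qE; ring.
split=> //.
have [r r0 br] := scaled_square_neq1 b.
pose u := mkq D b 1 0 r 0.
have nu : qnrd u = 1 - b * r ^+ 2 by rewrite /qnrd /u !qE; ring.
have nu0 : qnrd u != 0 by rewrite nu.
have := key u nu0; rewrite qinvE // nu.
set e := _ * (_ *: _) => Ae.
have D1 : D != 0 by rewrite gt_eqF.
rewrite (quaternion_j_conj D1 r0 br) rhoZ; case: rA => Aone AB AM AZ _; apply: (AZ); rewrite rmorphM /=.
by apply: (AM) => //; rewrite rmorphB /= rhoZ; apply: (AB) => //; exact: AZ.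
Qed.

(** The common subgroup of finite index generates, so the conjugation carries i and j into the
    algebra of b'. This embeds (D, b) in (D, b'), and [quaternion_embedding] compares the
    classes. *)
Lemma commensurable_unit_groups b b' (O : set (quaternion D b)) (O' : set (quaternion D b')) : b != 0 -> b' != 0 -> qorder O -> qorder O' ->
  (forall z : quaternion D b', z != 0 -> qnrd z != 0) ->
  commensurable_surfaces (@unit_group R D b s sE O) (@unit_group R D b' s sE O') -> qnorm D (b * b').
Proof.
move=> b0 b'0 oO oO' div [L [sL dL [g1 u1 f1] [g2 u2 f2]]].
have {}u1 : g1 \is a GRing.unit by []; have {}u2 : g2 \is a GRing.unit by [].
rewrite !conjset_image // in f1 f2.
pose P := g1 * g2^-1; have uP : P \is a GRing.unit by rewrite unitrMl // unitrV.
pose A := conjset P (range (rho b')).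
have rA : rational_algebra A.
  apply: rational_algebra_conj => //; split=> [|_ _ [x _ <-] [y _ <-]|_ _ [x _ <-] [y _ <-]|q _ [x _ <-]|_ [x _ <-]].
  - by exists 1; rewrite ?rmorph1.
  - by exists (x - y); rewrite ?rmorphB.
  - by exists (x * y); rewrite ?rmorphM.
  - by exists (q *: x); rewrite ?rhoZ.
  - by exists (qtr x); rewrite qrep_tr.
have KA : conjset g1 L `<=` A.
  move=> x Lx; have [y _ ye] : unit_group sE O' (P^-1 * x * P).
    apply: f2.1; rewrite /conjset /= /P invrM ?unitrV // invrK !mulrA mulVr // mul1r mulrVK //.
  by exists y.
have [[x _ xe] [y _ ye]] := finite_index_generates b0 oO (PSL2_conj u1 sL) f1 rA KA.
have inj : injective (qrep_lrmorphism b' sE).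
  by apply: base_change_inj; apply: qrep_base_change; rewrite ?(gt_eqF s0).
have xyz (z1 z2 z3 : 'M[R]_2) : P^-1 * z1 * P * (P^-1 * z2 * P) = P^-1 * (z1 * z2) * P by rewrite conjgM.
apply: (@quaternion_embedding D b b' x y) => //; try (by rewrite gt_eqF); apply: (inj : injective (rho b')).
- rewrite rmorphM /= xe -conjgM // -rmorphM.
  rewrite quat_ii.
  by rewrite /= !rhoZ !rmorph1 /= -scalerAr mulr1 -scalerAl mulVr.
- rewrite rmorphM /= ye -conjgM // -rmorphM.
  rewrite quat_jj.
  by rewrite /= !rhoZ !rmorph1 /= -scalerAr mulr1 -scalerAl mulVr.
- rewrite rmorphN !rmorphM /= xe ye -!conjgM // -!rmorphM -mulNr -mulrN -rmorphN.
  by rewrite quat_ijN.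
Qed.

End Generation.

(** * Integral spans of matrices as quaternion orders *)

Section RationalOrders.
Variable R : realType.
Local Notation M2 := 'M[R]_2.

Lemma qcombs_nth (l : seq M2) i : (i < size l)%N -> qcombs l l`_i.
Proof.
move=> il; exists (fun j => (j == i)%:R).
rewrite (bigD1 (Ordinal il)) //= eqxx rmorph1 scale1r big1 ?addr0 // => j ji.
by rewrite (_ : (j == i :> nat) = false) ?rmorph0 ?scale0r //; apply: negbTE.
Qed.

Lemma zcombsB (l : seq M2) x y : zcombs l x -> zcombs l y -> zcombs l (x - y).
Proof.
move=> [c [ci ->]] [d [di ->]]; exists (fun i => c i - d i); split=> [i|]; first exact: rpredB.
by rewrite -sumrB; apply: eq_bigr => i _; rewrite rmorphB scalerBl.
Qed.

Lemma common_multiple (d : nat -> rat) n : exists2 N : nat, (0 < N)%N &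
  forall i, (i < n)%N -> N%:R * d i \is a Num.int.
Proof.
elim: n => [|n [N N0 h]]; first by exists 1%N.
have [k [k0 hk]] := rat_multiple (d n); exists (N * k)%N; first by rewrite muln_gt0 N0.
move=> i; rewrite ltnS leq_eqVlt => /orP[/eqP ->|/h hi].
  by rewrite natrM -mulrA; apply: rpredM => //; exact: natr_int.
by rewrite mulnC natrM -mulrA; apply: rpredM => //; exact: natr_int.
Qed.

Section Order.
Variables (D b : rat) (s : R).
Hypotheses (sE : s ^+ 2 = ratr D) (s0 : 0 < s) (b0 : b != 0).
Local Notation rho := (@qrep R rat (@ratr R) D b s sE).

Lemma qrep_inj : injective rho.
Proof.
have : injective (qrep_lrmorphism b sE); last by [].
by apply: base_change_inj; apply: qrep_base_change; rewrite ?(gt_eqF s0).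
Qed.

Lemma qrepZ c x : rho (c *: x) = ratr c *: rho x.
Proof. by apply: mx2P; rewrite [RHS]mxE /qrep !mx2E !qE !rmorphM /=; ring. Qed.

Lemma rational_order_qorder l T : T \is a GRing.unit -> rational_order l ->
  (forall x, qcombs l x <-> exists y, T * x * T^-1 = rho y) ->
  qorder [set x | zcombs l (T^-1 * rho x * T)].
Proof.
move=> uT [rA _ z1 zM] AE.
have fP z : exists y, qcombs l z -> T * z * T^-1 = rho y.
  have [/AE[y e]|n] := pselect (qcombs l z); first by exists y.
  by exists 0 => /n.
have [f fE] := choice fP.
apply: (@qorder_intro _ _ _ (map f l)) => [|x y|x y|x [c [ci e]]|x] /=.
- by rewrite rmorph1 mulr1 mulVr.
- by move=> hx hy; rewrite rmorphB /= mulrBr mulrBl; exact: zcombsB.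
- by move=> hx hy; rewrite rmorphM /= conjgM //; exact: zM.
- have xE : x = \sum_(i < size (map f l)) c i *: (map f l)`_i.
    apply: qrep_inj; rewrite size_map raddf_sum /=.
    have -> : rho x = T * (T^-1 * rho x * T) * T^-1 by rewrite !mulrA divrr // mul1r mulrK.
    rewrite e mulr_sumr mulr_suml; apply: eq_bigr => i _.
    by rewrite (nth_map 0) // qrepZ -(fE _ (qcombs_nth (ltn_ord i))) -scalerAr -scalerAl.
  by exists (fun i => c i).
- have /AE[] : qcombs l (T^-1 * rho x * T).
    by apply/AE; exists x; rewrite !mulrA divrr // mul1r mulrK.
  move=> _ _; have [d e] : qcombs l (T^-1 * rho x * T).
    by apply/AE; exists x; rewrite !mulrA divrr // mul1r mulrK.
  have [N N0 hN] := common_multiple d (size l); exists N; split=> //.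
  exists (fun i => if (i < size l)%N then N%:R * d i else 0); split=> [i|].
    by case: ifP => // /hN.
  rewrite qrepZ -scalerAr -scalerAl e scaler_sumr; apply: eq_bigr => i _.
  by rewrite ltn_ord scalerA -rmorphM.
Qed.

Lemma rational_order_units l T : T \is a GRing.unit -> rational_order l ->
  (forall x, qcombs l x <-> exists y, T * x * T^-1 = rho y) ->
  conjset T [set h | [/\ zcombs l h, exists2 y, zcombs l y & h * y = 1 & \det h = 1]] =
  unit_group sE [set x | zcombs l (T^-1 * rho x * T)].
Proof.
move=> uT lO AE; have oO := rational_order_qorder uT lO AE.
have dc x : \det (T^-1 * x * T) = \det x by rewrite !detM mulrAC -detM mulVr // det1 mul1r.
apply/seteqP; split=> [x [zx [y zy xy] dx]|_ [x [Ox nx] <-]].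
  have [z zE] : exists z, x = rho z.
    have /AE[z e] : qcombs l (T^-1 * x * T) by case: zx => c [_ ?]; exists c.
    by exists z; rewrite -e !mulrA divrr // mul1r mulrK.
  rewrite dc zE qrep_det in dx; exists z => //; split; first by rewrite /= -zE.
  by apply: (fmorph_inj (@ratr R)); rewrite dx rmorph1.
split=> //; last by rewrite dc qrep_det nx rmorph1.
exists (T^-1 * rho (qconj x) * T); first exact: (qorder_conj oO).
by rewrite -conjgM // -rmorphM mul_qconj nx scale1r rmorph1 mulr1 mulVr.
Qed.

End Order.
End RationalOrders.

(** * Structure of derived groups with rational traces *)

Section Structure.
Variable R : realType.
Local Notation M2 := 'M[R]_2.
Implicit Types (G H : set M2).

Lemma Gamma_O_PSL2 H : is_Gamma_O H -> PSL2_subgroup H.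
Proof.
move=> [F [B [nu [rho [ O [_ _ _ _ [[[ Oone OB OM _] _] ->]]]]]]].
have ON x : O x -> O (- x) by move=> Ox; rewrite -sub0r; apply: (OB) => //; rewrite -(subrr 1); exact: OB.
split.
- by move=> _ [x [_ _ dx] <-]; rewrite dx rmorph1.
- exists (-1); last by rewrite rmorphN rmorph1.
  split; [exact: ON|exists (-1); [exact: ON|by rewrite mulrNN mulr1]|].
  by rewrite /reduced_norm rmorphN !rmorph1 det2 !mxE /=; ring.
- move=> _ _ [x [Ox [x' Ox' [xx' x'x]] dx] <-] [y [Oy [y' Oy' [yy' y'y]] dy] <-].
  exists (x * y); last by rewrite rmorphM.
  split; [exact: OM|exists (y' * x'); [exact: OM|]|by rewrite /reduced_norm rmorphM detM dx dy !rmorph1 mulr1].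
  by rewrite mulrA -(mulrA x) yy' mulr1 xx' mulrA -(mulrA y') x'x mulr1 y'y.
- move=> _ [x [Ox [x' Ox' [xx' x'x]] dx] <-].
  have rxx : rho x * rho x' = 1 by rewrite -rmorphM xx' rmorph1.
  have ux : rho x \is a GRing.unit by apply: det1_unit; rewrite dx rmorph1.
  exists x'; last by rewrite -[LHS](mulKr ux) rxx mulr1.
  split=> //; first by exists x.
  have := congr1 determinant rxx; rewrite detM dx rmorph1 mul1r det1 /reduced_norm => ->.
  by rewrite rmorph1.
Qed.

Definition rational_square_traces G := forall g, G g -> exists q : rat, \tr (g ^+ 2) = ratr q.

Lemma sqrt_disc (t : rat) : 2 < t -> exists s : R, 0 < s /\ s ^+ 2 = ratr (t ^+ 2 - 4).
Proof.
move=> t2; have D0 : 0 < t ^+ 2 - 4 by nra.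
by exists (Num.sqrt (ratr (t ^+ 2 - 4))); rewrite sqrtr_gt0 sqr_sqrtr ?ler0q ?ltr0q // ltW.
Qed.

(** The trace t is rational because g lies in a rational algebra. In standard position g is (t + i)
    / 2 and lies in an order, where traces are integral; the sign is normalised beforehand. *)
Lemma hyperbolic_trace_int G g : derived_from_quaternion_algebra G -> rational_square_traces G ->
  G g -> hyperbolic g -> exists t : int, \tr g = t%:~R.
Proof.
move=> [[sG _ _] [H gH GH]] rG.
suff pos g' : G g' -> 2 < \tr g' -> exists t : int, \tr g' = t%:~R.
  move=> Gg hy; have [h|h] := ltP 2 (\tr g); first exact: pos h.
  have [||t e] := pos (- g).
  - by case: sG => _ G1 GM _; rewrite -mulN1r; exact: GM.
  - move: hy; rewrite /hyperbolic raddfN /= ltr_normr => /orP[|//].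
    by rewrite ltNge h.
  by exists (- t); rewrite rmorphN /= -e raddfN opprK.
move=> Gg tg; have hy : hyperbolic g' by rewrite /hyperbolic (lt_le_trans tg) // ler_norm.
have [l [lO HE]] := rational_Gamma_O gH (GH _ Gg) hy (rG _ Gg).
have := GH _ Gg; rewrite HE => -[zg _ dg].
have Ag : qcombs l g' by case: zg => c [_ e]; exists c.
have [rA nA _ _] := lO; have [_ _ _ _ /(_ _ Ag)[t te]] := rA.
have t2 : 2 < t by rewrite -(ltr_rat R) ratr_nat -te.
have [s [s0 sE]] := sqrt_disc t2.
have [T [b [dT b0 gE AE]]] := standardize sE s0 rA nA Ag dg te.
have uT := det1_unit dT; have oO := rational_order_qorder s0 b0 uT lO AE.
have Og : [set x | zcombs l (T^-1 * @qrep R rat (@ratr R) _ b s sE x * T)] (mkq (t ^+ 2 - 4) b (t / 2) (1 / 2) 0 0).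
  by rewrite /= -gE !mulrA mulVr // mul1r mulrVK.
have /intrP[z zE] := qorder_tr_int oO Og.
exists z; rewrite te (_ : t = z%:~R) ?ratr_int // -zE /qtr !qE.
by field.
Qed.

Lemma cheb_power (g : M2) (t : int) n : \det g = 1 -> \tr g = t%:~R ->
  g ^+ n.+1 = (chebU t n.+1)%:~R *: g - (chebU t n)%:~R *: 1.
Proof.
move=> dg tg; elim: n => [|n IH].
  by rewrite expr1 chebU0 chebU1 scale1r scale0r subr0.
rewrite exprS IH mulrBr -!scalerAr mulr1 cayley_hamilton2 dg tg chebUSS.
rewrite scalerBr scalerA rmorphB rmorphM /= [in RHS]scalerBl (mulrC t%:~R).
by rewrite addrAC.
Qed.

Lemma hyperbolic_power (g : M2) (t : int) k : \det g = 1 -> \tr g = t%:~R -> 2 < t -> (0 < k)%N ->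
  hyperbolic (g ^+ k).
Proof.
move=> dg tg t2 k0; have t2Q : (2 : rat) < t%:~R by rewrite -[2]/(2%:~R) ltr_int.
have [s [s0 sE]] := sqrt_disc t2Q.
have t2R : (2 : R) < t%:~R by rewrite -[2]/(2%:~R) ltr_int.
have sE' : s ^+ 2 = t%:~R ^+ 2 - 4 by rewrite sE rmorphB rmorphXn /= ratr_int ratr_nat.
have st : s < t%:~R by nra.
pose l := (t%:~R + s) / 2; pose m := (t%:~R - s) / 2.
have lm1 : l * m = 1.
  transitivity ((t%:~R ^+ 2 - s ^+ 2) / 4 : R); first by rewrite /l /m; field.
  by rewrite sE' opprB addrC subrK divff.
have [| |T [dT gE]] := @diagonalize R g t%:~R l m dg tg _ lm1.
- by rewrite /l /m; field.
- by rewrite /l /m; lra.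
have uT := det1_unit dT.
have pw n : T * g ^+ n * T^-1 = mx2 (l ^+ n) 0 0 (m ^+ n).
  rewrite -expr_conj // gE; elim: n => [|n IH]; first by rewrite !expr0 one_mx2.
  by rewrite exprS IH; apply: mx2P; rewrite mulmx2E !mx2E ?exprS; ring.
have trk : \tr (g ^+ k) = l ^+ k + m ^+ k.
  by rewrite -(tr_conj (T := T^-1) _ _) ?unitrV // invrK pw tr2 !mx2E.
have l1 : 1 < l by rewrite /l; lra.
have lk : 1 < l ^+ k by rewrite exprn_egt1 // -lt0n.
have mk : l ^+ k * m ^+ k = 1 by rewrite -exprMn lm1 expr1n.
rewrite /hyperbolic trk (lt_le_trans _ (ler_norm _)) //; nra.
Qed.

Section Standard.
Variables (t : int) (s : R).
Hypotheses (t2 : 2 < t) (sE : s ^+ 2 = ratr (t%:~R ^+ 2 - 4)) (s0 : 0 < s).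
Local Notation D := (t%:~R ^+ 2 - 4 : rat).
Local Notation rho b := (@qrep R rat (@ratr R) D b s sE).

(** Two groups Gamma_O are at hand: one commensurable with G, which provides the order O, and one
    containing G, which provides integral traces and norm 1. They span the same algebra because a
    finite index subgroup of the first lies in the second and generates. *)
Lemma derived_structure G g : derived_from_quaternion_algebra G -> rational_square_traces G ->
  G g -> \tr g = t%:~R -> exists T b (O : set (quaternion D b)),
  [/\ \det T = 1, b != 0, qorder O, commensurable_groups (conjset T G) (unit_group sE O) &
    T * g * T^-1 = rho b (mkq _ b (t%:~R / 2) (1 / 2) 0 0) /\
    forall x, conjset T G x -> exists y, [/\ x = rho b y, qtr y \is a Num.int & qnrd y = 1]].
Proof.
move=> dG rG Gg tg; have [[sG disG [H1 gH1 GH1]] [H2 gH2 GH2]] := dG.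
have dg : \det g = 1 by case: sG => h _ _ _; exact: h.
have t2Q : (2 : rat) < t%:~R by rewrite -[2]/(2%:~R) ltr_int.
have t2R : (2 : R) < t%:~R by rewrite -[2]/(2%:~R) ltr_int.
have hyg : hyperbolic g by rewrite /hyperbolic tg (lt_le_trans t2R) // ler_norm.
have [l2 [lO2 HE2]] := rational_Gamma_O gH2 (GH2 _ Gg) hyg (rG _ Gg).
have tg' : \tr g = ratr t%:~R by rewrite ratr_int.
  (* G and H1 meet in a subgroup of finite index, which contains a power of g. *)
have [k k0 Hk] : exists2 k, (0 < k)%N & H1 (g ^+ k).
  have [k k0 [_ Hk]] := finite_index_power sG (PSL2_setI sG (Gamma_O_PSL2 gH1)) GH1.1 Gg.
  by exists k.
have hyk : hyperbolic (g ^+ k) by exact: hyperbolic_power dg tg t2 k0.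
have [l1 [lO1 HE1]] := rational_Gamma_O gH1 Hk hyk (rG _ (PSL2_expr k sG Gg)).
have [rA1 nA1 _ _] := lO1; have [ Aone AB AM AZ At] := rA1.
have Ag : qcombs l1 g.
  have : qcombs l1 (g ^+ k) by move: Hk; rewrite HE1 => -[[c [_ e]] _ _]; exists c.
  case: k k0 {Hk hyk} => // k _; rewrite (cheb_power k dg tg) => Ak.
  have c0 : (chebU t k.+1)%:~R != 0 :> R by rewrite intr_eq0 gt_eqF // chebU_gt0.
  have -> : g = ratr ((chebU t k.+1)%:~R^-1) *: (((chebU t k.+1)%:~R *: g - (chebU t k)%:~R *: 1) -
      ratr (- (chebU t k)%:~R) *: 1).
    by rewrite rmorphN /= scaleNr opprK !ratr_int subrK fmorphV /= ratr_int scalerA mulVf // scale1r.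
  by apply: (AZ); apply: (AB) => //; exact: AZ.
have [T [b [dT b0 gE AE]]] := standardize sE s0 rA1 nA1 Ag dg tg'.
have uT := det1_unit dT; have oO := rational_order_qorder s0 b0 uT lO1 AE.
have uE := rational_order_units s0 b0 uT lO1 AE; rewrite -HE1 in uE.
set O := [set x | zcombs l1 _] in oO uE.
have com : commensurable_groups (conjset T G) (unit_group sE O).
  by rewrite -uE; exact: commensurable_conj.
exists T, b, O; split=> //; split=> //.
have sU := unit_group_PSL2 sE oO; have sTG := PSL2_conj uT sG.
have [rA2 nA2 _ _] := lO2; have rA2T := rational_algebra_conj uT rA2.
have GA2 : G `<=` qcombs l2 by move=> h /GH2; rewrite HE2 => -[[c [_ e]] _ _]; exists c.
have [A2i A2j] := finite_index_generates t2 s0 b0 oO (PSL2_setI sTG sU) com.2 rA2T (fun x h => GA2 _ h.1).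
have AE2 x : qcombs l2 x <-> exists y, T * x * T^-1 = rho b y.
  have xE : qcombs l2 x <-> conjset T (qcombs l2) (T * x * T^-1).
    by rewrite /conjset /= !mulrA mulVr // mul1r mulrVK.
  rewrite xE; split=> [h|[z ->]]; first exact: (rational_algebra_sub s0 b0 rA2T A2i A2j).
  exact: qrep_generated rA2T A2i A2j z.
have oO2 := rational_order_qorder s0 b0 uT lO2 AE2.
move=> x Gx; have : unit_group sE [set x | zcombs l2 (T^-1 * rho b x * T)] x.
  by rewrite -(rational_order_units s0 b0 uT lO2 AE2) -HE2; exact: GH2.
by case=> y [Oy ny] <-; exists y; split=> //; exact: qorder_tr_int oO2 Oy.
Qed.

End Standard.
End Structure.

(** * Finitely many classes of bounded volume *)

Section FinitelyManyClasses.
Variables (R : realType) (t : int) (s : R).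
Hypotheses (t2 : 2 < t) (sE : s ^+ 2 = ratr (t%:~R ^+ 2 - 4)) (s0 : 0 < s).
Local Notation M2 := 'M[R]_2.
Local Notation D := (t%:~R ^+ 2 - 4 : rat).
Local Notation rho b := (@qrep R rat (@ratr R) D b s sE).
Local Notation half_plane := (@half_plane R).
Hypothesis Dnsq : forall x y : rat, x ^+ 2 - D * y ^+ 2 = 0 -> x = 0 /\ y = 0.

(** The imaginary part of h z is y / |c z + d|^2, so imaginary parts between 1/K and 1 bound c x + d
    and c y, hence c and d. The inverse of h gives the bound on the other diagonal entry. *)
Lemma window_entries (h h' : M2) p K : \det h = 1 -> h' 1 0 = - h 1 0 -> h' 1 1 = h 0 0 ->
  mob h' (mob h p) = p -> 1 <= p.1 <= 2 -> 1 <= (mob h p).1 <= 2 ->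
  0 < p.2 -> K^-1 <= p.2 <= 1 -> 0 < (mob h p).2 -> K^-1 <= (mob h p).2 <= 1 -> 0 < K ->
  `|h 0 0| <= 3 * K ^+ 2 /\ `|h 1 1| <= 3 * K ^+ 2.
Proof.
move=> dh e10 e11; set q := mob h p => qp px qx y0 py z0 qy K0.
have bound (u v x y z : R) : 0 < y -> y <= 1 -> K^-1 <= y -> K^-1 <= z -> z = y / ((u * x + v) ^+ 2 + (u * y) ^+ 2) ->
    1 <= x <= 2 -> `|v| <= 3 * K ^+ 2.
  move=> yp y1 yK zK zE x12.
  have zp : 0 < z by apply: lt_le_trans zK; rewrite invr_gt0.
  have n0 : 0 < (u * x + v) ^+ 2 + (u * y) ^+ 2.
    rewrite lt_def addr_ge0 ?sqr_ge0 // andbT; apply/eqP => n0.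
    by move: zp; rewrite zE n0 invr0 mulr0 ltxx.
  have Ky : 1 <= K * y by rewrite -ler_pdivrMl // mulr1.
  have Kz : 1 <= K * z by rewrite -ler_pdivrMl // mulr1.
  have K1 : 1 <= K by nra.
  have nK : (u * x + v) ^+ 2 + (u * y) ^+ 2 <= K.
    have : z * ((u * x + v) ^+ 2 + (u * y) ^+ 2) = y by rewrite zE mulfVK // gt_eqF.
    by nra.
  have uxK : `|u * x + v| <= K.
    rewrite -(@ler_pXn2r _ 2) ?nnegrE ?normr_ge0 ?(le_trans ler01 K1) //.
    by rewrite -normrX ger0_norm ?sqr_ge0 //; nra.
  have uyK : `|u * y| <= K.
    rewrite -(@ler_pXn2r _ 2) ?nnegrE ?normr_ge0 ?(le_trans ler01 K1) //.
    rewrite -normrX ger0_norm ?sqr_ge0 //; move: nK (sqr_ge0 (u * x + v)).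
    by move: (u * y) (u * x + v) => A B; nra.
  have uK : `|u| <= K ^+ 2.
    rewrite normrM (gtr0_norm yp) in uyK.
    by have := normr_ge0 u; nra.
  have -> : v = (u * x + v) - u * x by ring.
  rewrite (le_trans (ler_normB _ _)) // normrM (ger0_norm (le_trans ler01 _ : 0 <= x)); last by case/andP: x12.
  by have := normr_ge0 u; case/andP: x12 => x1 x2; nra.
case/andP: py => py1 py2; case/andP: qy => qy1 qy2.
split; last exact: (bound (h 1 0) _ p.1 p.2 q.2).
rewrite -e11; apply: (bound (h' 1 0) _ q.1 q.2 p.2) => //.
by have := congr1 snd qp.
Qed.

(* A diagonal element moving the window into itself is trivial, because an integer
   trace u + 1/u with u^2 in [1/2, 2] is 2 or -2. *)
Lemma diagonal_trivial (u v x : R) (m : int) : u * v = 1 -> u + v = m%:~R ->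
  1 <= x <= 2 -> 1 <= u ^+ 2 * x <= 2 -> u ^+ 2 = 1.
Proof.
move=> uv uvm /andP[x1 x2] /andP[h1 h2].
have u2 : u ^+ 2 <= 2 by have := sqr_ge0 u; nra.
have u2' : 1 <= 2 * u ^+ 2 by have := sqr_ge0 u; nra.
have uv2 : u ^+ 2 * v ^+ 2 = 1 by rewrite -exprMn uv expr1n.
have v0 := sqr_ge0 v.
have mE : (m ^+ 2)%:~R = u ^+ 2 + v ^+ 2 + 2 :> R.
  by rewrite rmorphXn /= -uvm; transitivity (u ^+ 2 + v ^+ 2 + 2 * (u * v)); [ring|rewrite uv mulr1].
have m5 : m ^+ 2 < 5 by rewrite -(ltr_int R) mE; nra.
have m4 : 4 <= m ^+ 2 by rewrite -(ler_int R) mE; have := sqr_ge0 (u - v); nra.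
have /(congr1 (fun z : int => z%:~R : R)) : m ^+ 2 = 4 by lia.
rewrite mE => e; have : (u ^+ 2 - 1) ^+ 2 = 0.
  have vE : v ^+ 2 = 2 - u ^+ 2 by lra.
  by move: uv2; rewrite vE => e2; nra.
by move/eqP; rewrite sqrf_eq0 subr_eq0 => /eqP.
Qed.

Lemma disc_root_bound : 2 < t%:~R :> R /\ s < t%:~R.
Proof.
have h : (2%:~R : R) < t%:~R by rewrite ltr_int.
have sE' : s ^+ 2 = t%:~R ^+ 2 - 4 by rewrite sE rmorphB rmorphXn /= ratr_int ratr_nat.
split=> //; move: sE' s0 h; clear; move: (t%:~R) => x sE' s0 h; nra.
Qed.

Lemma trace_bounds (a d x y k : R) : `|a| <= 3 * k -> `|d| <= 3 * k -> 2 < x -> 0 < y < x ->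
  `|a + d| <= 6 * k * x /\ `|(x + y) / 2 * a + (x - y) / 2 * d| <= 6 * k * x.
Proof.
move=> ak dk x2 /andP[y0 yx]; have k0 : 0 <= k by have := normr_ge0 a; lra.
split; apply: le_trans (ler_normD _ _) _; first by nra.
have -> : `|(x + y) / 2 * a| = (x + y) / 2 * `|a| by rewrite normrM ger0_norm //; lra.
have -> : `|(x - y) / 2 * d| = (x - y) / 2 * `|d| by rewrite normrM ger0_norm //; lra.
have := normr_ge0 a; have := normr_ge0 d; move: ak dk; move: `|a| `|d| => A B; nra.
Qed.

Lemma finitely_many_classes (V : R) : exists bs : seq rat, forall G T b,
  PSL2_subgroup G -> (exists2 v, has_volume G v & (v < V%:E)%E) -> \det T = 1 -> b != 0 ->
  conjset T G (rho b (mkq _ b (t%:~R / 2) (1 / 2) 0 0)) ->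
  (forall x, conjset T G x -> exists y, [/\ x = rho b y, qtr y \is a Num.int & qnrd y = 1]) ->
  exists2 c, c \in bs & qnorm D (b * c).
Proof.
have [W [K [mW K0 Wb aW]]] := large_window V.
have [M hM] : exists M : nat, 6 * K ^+ 2 * t%:~R <= M%:R :> R.
  exists (Num.bound (6 * K ^+ 2 * t%:~R)); apply/ltW/archi_boundP.
  apply: mulr_ge0; last by rewrite ler0z; lia.
  by apply: mulr_ge0 => //; exact: sqr_ge0.
pose ints := [seq (i%:Z - M%:Z) | i <- iota 0 (2 * M).+1].
have intsP (m : int) : `|m%:~R : R| <= M%:R -> m \in ints.
  rewrite -intr_norm -[M%:R]/(M%:~R) ler_int => mM.
  apply/mapP; exists (absz (m + M%:Z)); last by rewrite gez0_abs; lia.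
  by rewrite mem_iota; lia.
pose cls (m k : int) : rat := (m%:~R / 2) ^+ 2 - D * ((k%:~R - t%:~R * (m%:~R / 2)) / D) ^+ 2 - 1.
exists [seq cls m k | m <- ints, k <- ints] => G T b sG [v [F [mF FH Ffund] <-] vV] dT b0 Gg Gint.
have uT := det1_unit dT; have [HT aT] := area_preserving_mob dT.
have WH : W `<=` half_plane by move=> p /Wb[].
have [mX aX] := aT _ mW WH; set X := _ `&` half_plane in mX aX.
have dG g : G g -> \det g = 1 by case: sG => h _ _ _; exact: h.
have GcT g : G g -> conjset T G (T * g * T^-1) by move=> Gg'; rewrite /conjset /= !mulrA mulVr // mul1r mulrVK.
have cG : countable G.
  have sub : G `<=` (fun y => T^-1 * rho b y * T) @` [set: quaternion D b].
    move=> g /GcT/Gint[y [e _ _]]; exists y => //.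
    by rewrite -e !mulrA mulVr // mul1r mulrVK.
  apply: sub_countable (subset_card_le sub) _.
  by apply: sub_countable (card_image_le _ _) _; exact: countableP.
(* Otherwise the window would inject into the quotient, and its area could not exceed that of the
   fundamental set. *)
have [p [g [Xp Gg' Xgp gpp]]] : exists p g, [/\ X p, G g, X (mob g p) & mob g p <> p].
  apply: contrapT => none.
  have : (hyperbolic_area X <= hyperbolic_area F)%E.
    apply: (hyperbolic_area_le_orbit sG cG mX _ mF FH) => [p [] //|p g Xp Gg' Xgp|p [_ Hp]].
      by apply: contrapT => n; apply: none; exists p, g.
    have [[q1 q2] [[Fq [g Gg' e]] _]] := Ffund (p.1 +i* p.2)%C Hp.
    exists g => //; move: e; rewrite mobiusE //; last exact: dG.
    case=> e1 e2; have -> : mob g p = (q1, q2); last by [].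
    by rewrite [LHS]surjective_pairing; congr (_, _); symmetry; [exact: e1|exact: e2].
  by rewrite aX => /le_lt_trans/(_ vV)/lt_trans/(_ aW); rewrite ltxx.
have dg := dG _ Gg'; have [Wq Hp] := Xp; have [Wq' Hgp] := Xgp.
have := GcT _ Gg'; set h := T * g * T^-1 => Gh.
have dh : \det h = 1 by have [z [e _ nz]] := Gint _ Gh; rewrite e qrep_det nz rmorph1.
have hq : mob h (mob T p) = mob T (mob g p).
  by rewrite -(mobM dh dT Hp) {1}/h mulrVK // mobM.
have hqq : mob h (mob T p) <> mob T p.
  rewrite hq => e; apply: gpp.
  by rewrite -(mobV dT Hgp (erefl _)) e (mobV dT Hp).
have [y [hE yint ny]] := Gint _ Gh; have [y0 [g0E y0int ny0]] := Gint _ Gg.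
have [qy0 qx qyK qy1] := Wb _ Wq.
have [qy0' qx' qyK' qy1'] := Wb _ Wq'; rewrite -hq in qy0' qx' qyK' qy1'.
have hV : h^-1 = rho b (qconj y) by rewrite hE qrep_inv.
have h00 : h 0 0 = ratr (q0 y) + ratr (q1 y) * s by rewrite hE /qrep mx2E.
have h11 : h 1 1 = ratr (q0 y) - ratr (q1 y) * s by rewrite hE /qrep mx2E.
have [b00 b11] : `|h 0 0| <= 3 * K ^+ 2 /\ `|h 1 1| <= 3 * K ^+ 2.
  apply: (@window_entries h h^-1 (mob T p) K) => //; try (by apply/andP).
  - by rewrite hV hE /qrep !mx2E !qE rmorphN /=; ring.
  - by rewrite hV hE /qrep !mx2E !qE rmorphN /=; ring.
  - exact: mobV.
have [m mE] := intrP yint.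
have g0y : conjset T G (rho b (mkq _ b (t%:~R / 2) (1 / 2) 0 0) * h).
  by rewrite /conjset /= conjgM //; case: sG => _ _ GM _; apply: GM.
have [y1 [y1E y1int _]] := Gint _ g0y; have [k kE] := intrP y1int.
have trm : h 0 0 + h 1 1 = m%:~R by rewrite -tr2 hE qrep_tr mE /= ratr_int.
have q0E : q0 y = m%:~R / 2 by rewrite -mE /qtr; field.
have y1E' : y1 = mkq _ b (t%:~R / 2) (1 / 2) 0 0 * y.
  by apply: (qrep_inj s0 b0 (sE := sE)); rewrite -y1E hE rmorphM.
have D0 : D != 0.
  by apply/eqP => D0; have [|/eqP] := @Dnsq 0 1; rewrite ?D0 ?mul0r ?subr0 ?expr0n ?oner_eq0.
have kE' : t%:~R * q0 y + D * q1 y = k%:~R.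
  by rewrite -kE y1E' /qtr !qE; field.
have q1E : q1 y = (k%:~R - t%:~R * (m%:~R / 2)) / D by rewrite -kE' q0E addrAC subrr add0r mulrC mulKf.
have [t2R st] := disc_root_bound.
have [trm_le trk_le] := @trace_bounds _ _ t%:~R s (K ^+ 2) b00 b11 t2R (introT andP (conj s0 st)).
have mM : m \in ints by apply: intsP; rewrite -trm; exact: le_trans trm_le hM.
have kM : k \in ints.
  apply: intsP; have -> : k%:~R = (t%:~R + s) / 2 * h 0 0 + (t%:~R - s) / 2 * h 1 1 :> R.
    have -> : k%:~R = ratr (t%:~R * q0 y + D * q1 y) :> R by rewrite kE' ratr_int.
    by rewrite rmorphD !rmorphM /= ratr_int -sE h00 h11; field.
  exact: le_trans trk_le hM.
exists (cls m k); first by apply/allpairsP; exists (m, k).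
have nE : b * (q2 y ^+ 2 - D * q3 y ^+ 2) = cls m k.
  rewrite /cls -q1E -q0E; transitivity (q0 y ^+ 2 - D * q1 y ^+ 2 - qnrd y); last by rewrite ny.
  by rewrite /qnrd; ring.
split; last first.
  by exists (b * q2 y), (b * q3 y); rewrite -nE; ring.
(* If the value is 0 then h is diagonal and fixes every point by [diagonal_trivial], against the
   choice of p and g. *)
rewrite mulf_neq0 //; apply/eqP => c0; move: nE; rewrite c0 => /eqP.
rewrite mulf_eq0 (negPf b0) /= => /eqP /Dnsq[q20 q30].
apply: hqq; have h10 : h 1 0 = 0 by rewrite hE /qrep mx2E q20 q30 rmorph0 mul0r subr0.
have h01 : h 0 1 = 0 by rewrite hE /qrep mx2E q20 q30 rmorph0 mul0r addr0 mulr0.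
have ad : h 0 0 * h 1 1 = 1 by rewrite -dh det2 h01 mul0r subr0.
have d0 : h 1 1 != 0 by apply: contra_eq_neq ad => ->; rewrite mulr0 eq_sym oner_eq0.
have a2E : h 0 0 ^+ 2 * h 1 1 ^+ 2 = 1 by rewrite -exprMn ad expr1n.
have mobE x : mob h x = (h 0 0 ^+ 2 * x.1, h 0 0 ^+ 2 * x.2).
  have aE : h 0 0 = (h 1 1)^-1 by rewrite -[LHS](mulfK d0) ad mul1r.
  by rewrite /mob h10 h01 !mul0r !add0r !mulr0 !mul0r expr0n /= !addr0 aE; congr (_, _); field.
rewrite mobE /= in qx'; have a1 := diagonal_trivial ad trm qx qx'.
by rewrite mobE a1 !mul1r -surjective_pairing.
Qed.

End FinitelyManyClasses.

(** * Realising classes by groups of finite area *)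

Section Realization.
Variable R : realType.
Local Notation M2 := 'M[R]_2.
Local Notation half_plane := (@half_plane R).
Implicit Types (G H : set M2).

(** The Dirichlet domain meets each orbit once, so [hyperbolic_area_le_orbit] bounds its area by
    that of any Y whose translates cover it. *)
Lemma finite_volume G (Y : set (R * R)) : PSL2_subgroup G -> locally_finite G ->
  measurable (Y : set (measurableTypeR R * measurableTypeR R)%type) -> Y `<=` half_plane ->
  (hyperbolic_area Y < +oo)%E ->
  (forall p, dirichlet G p -> exists2 g, G g & Y (mob g p)) ->
  exists2 v, has_volume G v & (v < +oo)%E.
Proof.
move=> sG lG mY YH Yfin cov; have cG := locally_finite_countable lG.
have fund := dirichlet_fundamental sG cG lG; have [mD DH Dfund] := fund.
exists (hyperbolic_area (dirichlet G)); first by exists (dirichlet G).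
apply: le_lt_trans Yfin; apply: (hyperbolic_area_le_orbit sG cG mD DH mY YH) => // p g Dp Gg Dgp.
have dG h : G h -> \det h = 1 by case: sG => k _ _ _; exact: k.
have Hp := DH _ Dp; have [q [_ uq]] := Dfund _ Hp.
rewrite -(uq (mob g p)); last by split=> //; exists g; rewrite // mobiusE //; exact: dG.
by apply: uq; split=> //; exists 1; [exact: PSL2_one|rewrite mobiusE ?det1 // mob1].
Qed.

Section UnitGroup.
Variables (D b : rat) (s : R).
Hypotheses (sE : s ^+ 2 = ratr D) (s0 : 0 < s) (D0 : D != 0) (b0 : b != 0).
Local Notation B := (quaternion D b).

(** Every embedding of Q in R or C is the canonical one; this settles total reality and the
    condition at the other real places. *)
Lemma unit_group_Gamma_O (O : set B) : qmaximal O -> is_Gamma_O (unit_group sE O).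
Proof.
move=> maxO; have oO := maxO.1.
pose nu : {rmorphism (rat^o : fieldExtType rat) -> R} := (@ratr R : {rmorphism rat -> R}).
have sE' : s ^+ 2 = nu (D : rat^o) by [].
exists (rat^o : fieldExtType rat), (@quaternion rat^o D b), nu, (@qrep_lrmorphism R rat^o nu D b s sE'), O; split.
- move=> f x; have -> : f x = (ratr x : R)%:C%C.
    by rewrite (fmorph_rat (real_complex R)); exact: (fmorph_eq_rat (f : {rmorphism rat -> R[i]})).
  by [].
- by apply: quaternion_algebra_quat => //; rewrite pnatr_eq0.
- by apply: qrep_base_change => //; rewrite gt_eqF.
- move=> w wnu; exfalso; apply: wnu => x.
  by rewrite (fmorph_eq_rat (w : {rmorphism rat -> R})).
- split; first exact: qmaximal_maximal_order.
  apply/seteqP; split=> [_ [x [Ox nx] <-]|_ [x [Ox _ nx] <-]]; exists x => //; last first.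
    split=> //; apply: (fmorph_inj (@ratr R)); rewrite /= -(qrep_det sE) rmorph1.
    exact: etrans nx (rmorph1 nu).
  split=> //; last by rewrite /reduced_norm -[LHS]/(\det (qrep sE x)) qrep_det nx.
  exists (qconj x); first exact: (qorder_conj oO).
  by split; [have := mul_qconj x|have := qconj_mul x]; rewrite nx scale1r.
Qed.

Lemma unit_group_derived (O : set B) : qmaximal O -> derived_from_quaternion_algebra (unit_group sE O).
Proof.
move=> maxO; have oO := maxO.1; have sG := unit_group_PSL2 sE oO; have gO := unit_group_Gamma_O maxO.
split; last by exists (unit_group sE O).
split=> //; first exact: locally_finite_discrete (unit_group_locally_finite sE s0 b0 oO).
by exists (unit_group sE O) => //; split; rewrite setIid; exact: finite_index_refl.
Qed.

Lemma unit_group_volume (O : set B) : (forall x : B, x != 0 -> qnrd x != 0) -> qorder O ->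
  exists2 v, has_volume (unit_group sE O) v & (v < +oo)%E.
Proof.
move=> div oO; have [C C1 cov] := unit_group_cocompact sE s0 div oO.
have [mE EH Efin] := box_area C1.
apply: (finite_volume (unit_group_PSL2 sE oO) (unit_group_locally_finite sE s0 b0 oO) mE EH Efin) => p [Hp _].
by have [g Gg [h1 h2]] := cov p Hp; exists g.
Qed.

End UnitGroup.

(** The class condition represents t'^2 - 4 by the squares of pure quaternions; halving it gives an
    element of norm 1 and trace t', which [conj_into_maximal] moves into O. *)
Lemma unit_group_trace (t t' : int) (s : R) (sE : s ^+ 2 = ratr (t%:~R ^+ 2 - 4)) b
  (O : set (quaternion (t%:~R ^+ 2 - 4) b)) : 2 < t -> 2 < t' -> b != 0 ->
  (forall x : quaternion (t%:~R ^+ 2 - 4) b, x != 0 -> qnrd x != 0) -> qmaximal O ->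
  (forall x y : rat, x ^+ 2 - (t%:~R ^+ 2 - 4) * y ^+ 2 = 0 -> x = 0 /\ y = 0) ->
  trace_class (t%:~R ^+ 2 - 4) (t'%:~R ^+ 2 - 4) b ->
  exists2 g, unit_group sE O g & \tr g = t'%:~R.
Proof.
move=> t2 t2' b0 div maxO Dnsq tc; set D := t%:~R ^+ 2 - 4 in sE O div maxO Dnsq tc *.
have pos (u : int) : 2 < u -> (u%:~R ^+ 2 - 4 : rat) != 0.
  move=> u2; have u2' : (2%:~R : rat) < u%:~R by rewrite ltr_int.
  by rewrite gt_eqF //; nra.
have [y [z [w e]]] := (trace_class_realized (pos _ t2) (pos _ t2') b0).1 tc.
pose x := mkq D b (t'%:~R / 2) (y / 2) (z / 2) (w / 2).
have nx : qnrd x = 1.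
  have -> : qnrd x = (t'%:~R ^+ 2 - (D * y ^+ 2 + b * (z ^+ 2 - D * w ^+ 2))) / 4 by rewrite /qnrd /x !qE; field.
  by rewrite -e opprB addrC subrK divff.
have tx : qtr x = t'%:~R by rewrite /qtr /x !qE; field.
have tint : qtr x \is a Num.int by rewrite tx; exact: intr_int.
have [d [nd Od]] := conj_into_maximal t2 div maxO nx tint.
exists (qrep sE (d * x * d^-1)); last by rewrite qrep_tr qtr_conjg // tx /= ratr_int.
by exists (d * x * d^-1) => //; split=> //; rewrite qnrd_conjg.
Qed.

(** * The modular group *)

Section ModularGroup.
Let sE1 : (1 : R) ^+ 2 = ratr (1 : rat).
Proof. by rewrite expr1n rmorph1. Qed.

Local Notation B1 := (quaternion (1 : rat) 1).

(** The order M_2(Z) in the coordinates of (1, 1): the four expressions are the entries of the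
    matrix [qrep] with s = 1. *)
Definition integral_matrices : set B1 := [set x | [/\ q0 x + q1 x \is a Num.int, q2 x + q3 x \is a Num.int,
  q2 x - q3 x \is a Num.int & q0 x - q1 x \is a Num.int]].

Lemma integral_matrices_qorder : qorder integral_matrices.
Proof.
split.
- by rewrite /integral_matrices /= !qE !(addr0, subr0, rpred0, rpred1).
- move=> x y [x1 x2 x3 x4] [y1 y2 y3 y4]; split; rewrite !qE.
  + by rewrite [_ + _](_ : _ = (q0 x + q1 x) - (q0 y + q1 y)); [exact: rpredB|ring].
  + by rewrite [_ + _](_ : _ = (q2 x + q3 x) - (q2 y + q3 y)); [exact: rpredB|ring].
  + by rewrite [_ - _](_ : _ = (q2 x - q3 x) - (q2 y - q3 y)); [exact: rpredB|ring].
  + by rewrite [_ - _](_ : _ = (q0 x - q1 x) - (q0 y - q1 y)); [exact: rpredB|ring].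
- move=> x y [x1 x2 x3 x4] [y1 y2 y3 y4]; split; rewrite !qE.
  + rewrite [X in X \is a _](_ : _ = (q0 x + q1 x) * (q0 y + q1 y) + (q2 x + q3 x) * (q2 y - q3 y)); last by ring.
    by apply: rpredD; exact: rpredM.
  + rewrite [X in X \is a _](_ : _ = (q0 x + q1 x) * (q2 y + q3 y) + (q2 x + q3 x) * (q0 y - q1 y)); last by ring.
    by apply: rpredD; exact: rpredM.
  + rewrite [X in X \is a _](_ : _ = (q2 x - q3 x) * (q0 y + q1 y) + (q0 x - q1 x) * (q2 y - q3 y)); last by ring.
    by apply: rpredD; exact: rpredM.
  + rewrite [X in X \is a _](_ : _ = (q2 x - q3 x) * (q2 y + q3 y) + (q0 x - q1 x) * (q0 y - q1 y)); last by ring.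
    by apply: rpredD; exact: rpredM.
- exists 2%N; split=> // x [x1 x2 x3 x4].
    split; rewrite !qE.
    + by rewrite (_ : _ * _ = (q0 x + q1 x) + (q0 x - q1 x)); [exact: rpredD|ring].
    + by rewrite (_ : _ * _ = (q0 x + q1 x) - (q0 x - q1 x)); [exact: rpredB|ring].
    + by rewrite (_ : _ * _ = (q2 x + q3 x) + (q2 x - q3 x)); [exact: rpredD|ring].
    + by rewrite (_ : _ * _ = (q2 x + q3 x) - (q2 x - q3 x)); [exact: rpredB|ring].
  by split; rewrite !qE -?mulrDr -?mulrBr; apply: rpredM; rewrite ?natr_int //; by [apply: rpredD|apply: rpredB].
Qed.

(* An order containing M_2(Z) pairs integrally with it under the trace, and the
   pairings with the matrix units are the matrix entries. *)
Lemma integral_matrices_qmaximal : qmaximal integral_matrices.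
Proof.
split=> [|O' oO' sub x Ox]; first exact: integral_matrices_qorder.
have [_ _ oM _] := oO'.
have pair y : integral_matrices y -> qtr (x * y) \is a Num.int.
  by move=> /sub Oy; apply: qorder_tr_int oO' _; exact: oM.
have h : (2^-1 + 2^-1 : rat) = 1 by field.
have int01 : (0 : rat) \is a Num.int /\ (1 : rat) \is a Num.int by rewrite rpred0 rpred1.
have e1 := pair (mkq 1 1 2^-1 2^-1 0 0); have e2 := pair (mkq 1 1 0 0 2^-1 2^-1).
have e3 := pair (mkq 1 1 0 0 2^-1 (- 2^-1)); have e4 := pair (mkq 1 1 2^-1 (- 2^-1) 0 0).
split.
- rewrite [X in X \is a _](_ : _ = qtr (x * mkq 1 1 2^-1 2^-1 0 0)); last by rewrite /qtr !qE; field.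
  by apply: e1; split; rewrite !qE ?h ?subrr ?addr0 ?subr0 //; case: int01.
- rewrite [X in X \is a _](_ : _ = qtr (x * mkq 1 1 0 0 2^-1 (- 2^-1))); last by rewrite /qtr !qE; field.
  by apply: e3; split; rewrite !qE ?opprK ?h ?subrr ?addr0 ?subr0 //; case: int01.
- rewrite [X in X \is a _](_ : _ = qtr (x * mkq 1 1 0 0 2^-1 2^-1)); last by rewrite /qtr !qE; field.
  by apply: e2; split; rewrite !qE ?h ?subrr ?addr0 ?subr0 //; case: int01.
- rewrite [X in X \is a _](_ : _ = qtr (x * mkq 1 1 2^-1 (- 2^-1) 0 0)); last by rewrite /qtr !qE; field.
  by apply: e4; split; rewrite !qE ?opprK ?h ?subrr ?addr0 ?subr0 //; case: int01.
Qed.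

Definition modular_group : set M2 := unit_group sE1 integral_matrices.

Lemma mx2_modular (a b c d : int) : a * d - b * c = 1 -> modular_group (mx2 a%:~R b%:~R c%:~R d%:~R).
Proof.
move=> dt; have dtQ : a%:~R * d%:~R - b%:~R * c%:~R = 1 :> rat by rewrite -!rmorphM -rmorphB dt.
exists (mkq 1 1 ((a%:~R + d%:~R) / 2) ((a%:~R - d%:~R) / 2) ((b%:~R + c%:~R) / 2) ((b%:~R - c%:~R) / 2)).
  split; last by rewrite /qnrd !qE -[RHS]dtQ; field.
  split; rewrite !qE; [rewrite [X in X \is a _](_ : _ = a%:~R)|rewrite [X in X \is a _](_ : _ = b%:~R)|
    rewrite [X in X \is a _](_ : _ = c%:~R)|rewrite [X in X \is a _](_ : _ = d%:~R)]; try exact: intr_int; by field.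
by apply: mx2P; rewrite /qrep !mx2E !qE !(fmorph_div, rmorphD, rmorphB) /= ?rmorph1 !ratr_int ?ratr_nat; field.
Qed.

(** Comparing heights along four group elements gives |x| <= 1/2 and (1 - |x|)^2 + y^2 >= 1 on the
    Dirichlet domain. Points with y >= 1/2 lie in the Siegel set, and for the others these
    inequalities place -1/z in it. *)
Lemma modular_volume : exists2 v, has_volume modular_group v & (v < +oo)%E.
Proof.
have oO := integral_matrices_qorder.
have [mE EH Efin] := siegel_area R.
have sG := unit_group_PSL2 sE1 oO.
apply: (finite_volume sG _ mE EH Efin) => [|p [Hp hmin]].
  by apply: unit_group_locally_finite.
have leh (a b c d : int) : a * d - b * c = 1 -> height p <= height (mob (mx2 a%:~R b%:~R c%:~R d%:~R) p).
  by move=> /mx2_modular/hmin[|[-> _]] //; exact: ltW.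
have d1 (a b c d : int) : a * d - b * c = 1 -> \det (mx2 a%:~R b%:~R c%:~R d%:~R : M2) = 1.
  by move=> dt; rewrite det2 !mx2E -!rmorphM -rmorphB dt.
have y0 : 0 < p.2 := Hp.
have hE (a b c d : int) : a * d - b * c = 1 -> p.1 ^+ 2 + p.2 ^+ 2 + 1 <=
    (a%:~R * p.1 + b%:~R) ^+ 2 + (a%:~R * p.2) ^+ 2 + (c%:~R * p.1 + d%:~R) ^+ 2 + (c%:~R * p.2) ^+ 2.
  move=> dt; have := leh _ _ _ _ dt; rewrite height_mob ?d1 // !mx2E /height.
  by rewrite ler_pM2r ?invr_gt0.
have t1 := hE 1 1 0 1 erefl; have t2 := hE 1 (-1) 0 1 erefl.
have t3 := hE 1 0 1 1 erefl; have t4 := hE 1 0 (-1) 1 erefl.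
rewrite !(mul1r, mul0r, add0r, addr0, expr0n, expr1n, rmorphN1, mulN1r, sqrrN, rmorph1, rmorph0) /= in t1 t2 t3 t4.
have [y12|y12] := leP 2^-1 p.2.
  by exists 1; [exact: PSL2_one|rewrite mob1; split=> //; rewrite ler_norml; apply/andP; split; nra].
exists (mx2 0 (-1) 1 0).
  by have := @mx2_modular 0 (-1) 1 0 erefl; rewrite rmorphN1 rmorph1 rmorph0.
have r0 : 0 < p.1 ^+ 2 + p.2 ^+ 2 by nra.
have -> : mob (mx2 0 (-1) 1 0) p = (- p.1 / (p.1 ^+ 2 + p.2 ^+ 2), p.2 / (p.1 ^+ 2 + p.2 ^+ 2)).
  rewrite /mob !mx2E (_ : (1 * p.1 + 0) ^+ 2 + (1 * p.2) ^+ 2 = p.1 ^+ 2 + p.2 ^+ 2); last by ring.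
  by congr (_ / _, _); ring.
split; rewrite /=.
  rewrite mulNr normrN normrM normfV (gtr0_norm r0) ler_pdivrMr // mul1r ler_norml.
  by apply/andP; split; nra.
rewrite ler_pdivlMr //; nra.
Qed.

Lemma modular_derived : derived_from_quaternion_algebra modular_group.
Proof. exact: unit_group_derived integral_matrices_qmaximal. Qed.

Lemma modular_trace (t : int) : exists2 g, modular_group g & \tr g = t%:~R.
Proof.
exists (mx2 t%:~R (-1)%:~R 1%:~R 0%:~R); first by apply: mx2_modular; rewrite mulr0 sub0r mulN1r opprK.
by rewrite tr2 !mx2E addr0.
Qed.

(* The modular group contains unipotent elements, division algebras do not. *)
Lemma modular_not_commensurable D b s (sE : s ^+ 2 = ratr D) (O : set (quaternion D b)) :
  0 < s -> b != 0 -> qorder O -> (forall x : quaternion D b, x != 0 -> qnrd x != 0) ->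
  forall G H, G = unit_group sE O -> H = modular_group ->
  ~ commensurable_surfaces G H /\ ~ commensurable_surfaces H G.
Proof.
move=> s0 b0 oO div G H GE HE.
suff no L g1 g2 : PSL2_subgroup L -> g1 \in unitmx -> g2 \in unitmx ->
    finite_index [set g1 * h * g1^-1 | h in L] G -> finite_index [set g2 * h * g2^-1 | h in L] H -> False.
  by split; move=> [L [sL _ [g1 u1 f1] [g2 u2 f2]]]; [apply: (no L g1 g2)|apply: (no L g2 g1)].
move=> sL u1 u2; have {}u1 : g1 \is a GRing.unit by []; have {}u2 : g2 \is a GRing.unit by [].
rewrite !conjset_image // GE HE => f1 f2.
have := @mx2_modular 1 1 0 1 erefl; set u := mx2 _ _ _ _ => Gu.
have [k k0 Lu] := finite_index_power (unit_group_PSL2 sE1 integral_matrices_qorder) (PSL2_conj u2 sL) f2 Gu.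
have uk : u ^+ k = mx2 1 k%:R 0 1.
  elim: k {k0 Lu} => [|k IH]; first by rewrite expr0 one_mx2.
  by rewrite exprS IH; apply: mx2P; rewrite mulmx2E !mx2E -?natr1 ?rmorph1 ?rmorph0; ring.
have : conjset g1 L (g1 * (g2^-1 * u ^+ k * g2) * g1^-1).
  by rewrite /conjset /= !mulrA mulVr // mul1r mulrVK.
move=> /f1.1[y [_ ny] ye].
have ty : qtr y = 2.
  apply: (fmorph_inj (@ratr R)); rewrite -(qrep_tr sE) ye.
  rewrite -(@tr_conj R g1 _ u1) !mulrA mulVr // mul1r mulrVK // tr_conj // uk tr2 !mx2E /= ratr_nat; ring.
have y1 : y - 1 != 0.
  rewrite subr_eq0; apply/eqP => y1; move: ye; rewrite y1 rmorph1 => e.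
  have : u ^+ k = 1.
    have := congr1 (fun z => g2 * (g1^-1 * z * g1) * g2^-1) e.
    by rewrite /= mulr1 mulVr // mulr1 divrr // !mulrA !mulrVK // divrr // mul1r mulrK // => <-.
  by rewrite uk one_mx2 => /matrixP/(_ 0 1)/eqP; rewrite !mx2E pnatr_eq0 gt_eqF.
have : qnrd (y - 1) = qnrd y - qtr y + 1 by rewrite /qnrd /qtr !qE; ring.
by rewrite ny ty => e; have := div _ y1; rewrite e (_ : 1 - 2 + 1 = 0) ?eqxx //; ring.
Qed.

End ModularGroup.
End Realization.

(** * An arithmetic group over Q(sqrt 3) *)

Lemma rat_sqr_int (r : rat) : r ^+ 2 \is a Num.int -> r \is a Num.int.
Proof.
move=> r2; apply: (@rat_pow_bounded r (denq r)%:~R); first by rewrite intr_eq0 denq_eq0.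
move=> n; rewrite -(odd_double_half n) exprD -mul2n exprM -mulrA mulrC -mulrA.
have dn : (denq r)%:~R * r ^+ odd n \is a Num.int.
  case: (odd n); last by rewrite expr0 mulr1 intr_int.
  by rewrite expr1 mulrC -[X in X * _]divq_num_den divfK ?intr_int // intr_eq0 denq_eq0.
by apply: rpredM => //; exact: rpredX.
Qed.

Lemma int_parity (m : int) : exists u, m = 2 * u \/ m = 2 * u + 1.
Proof.
exists (m %/ 2)%Z; have := divz_eq m 2; have := modz_ge0 m (isT : 2 != 0 :> int).
by have := ltz_pmod m (isT : 0 < 2 :> int); lia.
Qed.

Lemma integral_rmorphism (K L : fieldType) (f : {rmorphism K -> L}) x :
  integralOver (intr : int -> K) x -> integralOver (intr : int -> L) (f x).
Proof.
move=> [p mp rp]; exists p => //; rewrite -(fmorph_root f) in rp.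
rewrite -map_poly_comp in rp; rewrite (_ : map_poly _ p = map_poly (f \o intr) p) //.
by apply: eq_map_poly => n /=; rewrite rmorph_int.
Qed.

Lemma integral_in_alg (F : fieldType) (f : {rmorphism rat -> F}) (q : rat) :
  integralOver (intr : int -> F) (f q) <-> q \is a Num.int.
Proof.
split=> [[p mp rp]|/intrP[n ->]]; last by rewrite rmorph_int; exact: integral_intr.
apply: rat_integral_int; exists p => //; rewrite -(fmorph_root f) -map_poly_comp.
by rewrite (_ : map_poly _ p = map_poly intr p) //; apply: eq_map_poly => n /=; exact: (rmorph_int f).
Qed.

Lemma rat_sqr_neq3 (q : rat) : q ^+ 2 != 3.
Proof.
apply/eqP => e; have /intrP[n nE] : q \is a Num.int.
  by apply: rat_sqr_int; rewrite e; exact: (intr_int _ 3).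
have : n ^+ 2 = 3 by apply: (@intr_inj rat); rewrite rmorphXn /= -nE e.
by move=> n3; have [u [] nu] := int_parity n; [|have [v [] uv] := int_parity u]; rewrite ?uv in nu; nia.
Qed.

(** These are the integers of Q(sqrt 3): integral trace 2 a and norm a^2 - 3 b^2 make 2 b integral
    by divisibility by 3, and a congruence modulo 4 then makes both numerators even. *)
Lemma quad_coords_int (a b : rat) : 2 * a \is a Num.int -> a ^+ 2 - 3 * b ^+ 2 \is a Num.int ->
  a \is a Num.int /\ b \is a Num.int.
Proof.
move=> m2 nn; have [m mE] := intrP m2; have [n nE] := intrP nn.
have k3 : 3 * (2 * b) ^+ 2 = (m ^+ 2 - 4 * n)%:~R.
  by rewrite rmorphB rmorphXn /= rmorphM /= -mE -nE; ring.
have l3 : 3 * (2 * b) \is a Num.int.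
  apply: rat_sqr_int; rewrite (_ : _ ^+ 2 = 3 * (3 * (2 * b) ^+ 2)); last by ring.
  rewrite k3; apply: rpredM; last exact: intr_int.
  exact: (intr_int _ 3).
have [l lE] := intrP l3.
have l2 : l ^+ 2 = 3 * (m ^+ 2 - 4 * n).
  by apply: (@intr_inj rat); rewrite rmorphXn rmorphM /= -k3 -lE -[3%:~R]/(3 : rat); ring.
have /dvdzP[k lk] : (3 %| l)%Z.
  have : (3 %| l ^+ 2)%Z by rewrite l2; apply: dvdz_mulr.
  by rewrite !dvdzE abszX Euclid_dvdX // => /andP[].
have kE : 2 * b = k%:~R.
  apply: (@mulfI _ (3 : rat)) => //; rewrite lE lk rmorphM /= mulrC //.
have mk : m ^+ 2 - 3 * k ^+ 2 = 4 * n by move: l2; rewrite lk => h; nia.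
have [u [] mu] := int_parity m; have [v [] kv] := int_parity k; rewrite ?mu ?kv in mk; try (exfalso; nia).
split; apply/intrP.
  by exists u; apply: (@mulfI _ (2 : rat)) => //; rewrite mE mu rmorphM.
by exists v; apply: (@mulfI _ (2 : rat)) => //; rewrite kE kv rmorphM.
Qed.

Section QuadraticField.
Variables (F : fieldExtType rat) (z : F).
Hypotheses (z2 : z ^+ 2 = 3).
Variables c0 c1 : F -> rat.
Hypothesis cE : forall x, x = (c0 x)%:A + c1 x *: z.

Lemma natr_neq0 n : (0 < n)%N -> (n%:R : F) != 0.
Proof. by move=> n0; rewrite -(rmorph_nat (in_alg F)) fmorph_eq0 pnatr_eq0 -lt0n. Qed.

Lemma coord_uniq (a b : rat) x : x = a%:A + b *: z -> c0 x = a /\ c1 x = b.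
Proof.
rewrite {1}[x]cE => e; have d : (c0 x - a)%:A = (b - c1 x) *: z.
  by rewrite !scalerBl (canRL (addrK _) e) -(addrA a%:A) [LHS]addrC addKr.
have cb : b - c1 x = 0.
  apply/eqP/negPn/negP => n0; have := rat_sqr_neq3 ((c0 x - a) / (b - c1 x)); rewrite -(inj_eq (fmorph_inj (in_alg F))) rmorphXn /=.
  have -> : ((c0 x - a) / (b - c1 x))%:A = z.
    by rewrite mulrC -scalerA d scalerA mulVf // scale1r.
  by rewrite z2 -[3%:A]/(in_alg F 3) rmorph_nat eqxx.
move: d; rewrite cb scale0r => /eqP; rewrite scaler_eq0 oner_eq0 orbF subr_eq0 => /eqP ->.
by split=> //; apply/eqP; rewrite eq_sym -subr_eq0 cb.
Qed.

Let zz : z * z = 3%:A.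
Proof. by rewrite -expr2 z2 -(rmorph_nat (in_alg F)). Qed.

Lemma coordB x y : c0 (x - y) = c0 x - c0 y /\ c1 (x - y) = c1 x - c1 y.
Proof. by apply: coord_uniq; rewrite {1}[x]cE {1}[y]cE !scalerBl opprD addrACA. Qed.

Lemma coordM x y : c0 (x * y) = c0 x * c0 y + 3 * c1 x * c1 y /\ c1 (x * y) = c0 x * c1 y + c1 x * c0 y.
Proof.
apply: coord_uniq; rewrite {1}[x]cE {1}[y]cE mulrDl !mulrDr -!scalerAl -!scalerAr !mul1r mulr1 zz.
rewrite !scalerA [in RHS]scalerDl [in RHS]scalerDl -!addrA; congr (_ + _).
by rewrite addrC -addrA addrC -!addrA; congr (_ *: _ + _); ring.
Qed.

Lemma coord1 : c0 1 = 1 /\ c1 1 = 0.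
Proof. by apply: coord_uniq; rewrite scale1r scale0r addr0. Qed.

Lemma coordz : c0 z = 0 /\ c1 z = 1.
Proof. by apply: coord_uniq; rewrite scale1r scale0r add0r. Qed.

Section Embedding.
Variables (K : numFieldType) (r : K).

Definition quad_emb (_ : r ^+ 2 = 3) (x : F) : K := ratr (c0 x) + ratr (c1 x) * r.
Hypothesis r2 : r ^+ 2 = 3.

Let eB : zmod_morphism (quad_emb r2).
Proof. by move=> x y; rewrite /quad_emb; have [-> ->] := coordB x y; rewrite !rmorphB; ring. Qed.

Let eM : monoid_morphism (quad_emb r2).
Proof.
split=> [|x y]; rewrite /quad_emb.
  by have [-> ->] := coord1; rewrite rmorph1 rmorph0 mul0r addr0.
have [-> ->] := coordM x y; rewrite !rmorphD !rmorphM /= ratr_nat -[X in X * _ * _]r2; ring.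
Qed.

HB.instance Definition _ := GRing.isZmodMorphism.Build F K (quad_emb r2) eB.
HB.instance Definition _ := GRing.isMonoidMorphism.Build F K (quad_emb r2) eM.

Definition quad_rmorphism : {rmorphism F -> K} := quad_emb r2.

End Embedding.

Lemma rmorphism_quad (K : numFieldType) (f : {rmorphism F -> K}) x :
  f x = ratr (c0 x) + ratr (c1 x) * f z.
Proof.
have alg q : f q%:A = ratr q by have := fmorph_eq_rat (f \o in_alg F) q => /= ->.
by rewrite {1}[x]cE rmorphD /= alg -[c1 x *: z]mulr_algl rmorphM /= alg.
Qed.

Lemma rmorphism_z (K : numFieldType) (f : {rmorphism F -> K}) : f z ^+ 2 = 3.
Proof. by rewrite -rmorphXn z2 rmorph_nat. Qed.

Variables (R : realType) (r : R).
Hypotheses (r2 : r ^+ 2 = 3).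
Let r2N : (- r) ^+ 2 = 3. Proof. by rewrite sqrrN. Qed.

Lemma quad_integers x : ring_of_integers x <-> c0 x \is a Num.int /\ c1 x \is a Num.int.
Proof.
split=> [ix|[/intrP[m mE] /intrP[k kE]]]; last first.
  rewrite [x]cE mE kE; apply: integral_add.
    by rewrite -[_%:A]/(in_alg F _); apply/integral_in_alg; exact: intr_int.
  rewrite -mulr_algl; apply: integral_mul.
    by rewrite -[_%:A]/(in_alg F _); apply/integral_in_alg; exact: intr_int.
  exists ('X^2 - 3%:P); first by apply: monicXnsubC.
  rewrite rootE rmorphB /= map_polyXn map_polyC hornerD hornerN hornerXn hornerC z2; apply/eqP; exact: subrr.
have i1 := integral_rmorphism (quad_rmorphism r2) ix.
have i2 := integral_rmorphism (quad_rmorphism r2N) ix.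
have m2 : 2 * c0 x \is a Num.int.
  apply/(integral_in_alg (@ratr R)); rewrite /=.
  have -> : ratr (2 * c0 x) = quad_rmorphism r2 x + quad_rmorphism r2N x.
    by rewrite /quad_rmorphism /= /quad_emb rmorphM /= ratr_nat; ring.
  exact: integral_add.
have nn : c0 x ^+ 2 - 3 * c1 x ^+ 2 \is a Num.int.
  apply/(integral_in_alg (@ratr R)); rewrite /=.
  have -> : ratr (c0 x ^+ 2 - 3 * c1 x ^+ 2) = quad_rmorphism r2 x * quad_rmorphism r2N x.
    by rewrite /quad_rmorphism /= /quad_emb rmorphB /= !(rmorphXn, rmorphM) /= ratr_nat -[X in _ - X * _]r2; ring.
  exact: integral_mul.
exact: quad_coords_int.
Qed.

Lemma quad_integers_ring : [/\ ring_of_integers (1 : F), ring_of_integers z,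
  forall x y : F, ring_of_integers x -> ring_of_integers y -> ring_of_integers (x - y),
  forall x y : F, ring_of_integers x -> ring_of_integers y -> ring_of_integers (x + y) &
  forall x y : F, ring_of_integers x -> ring_of_integers y -> ring_of_integers (x * y)].
Proof.
split.
- by apply/quad_integers; have [-> ->] := coord1; rewrite rpred0 rpred1.
- by apply/quad_integers; have [-> ->] := coordz; rewrite rpred0 rpred1.
- exact: integral_sub.
- exact: integral_add.
- exact: integral_mul.
Qed.

Definition quad_norm (x : F) : rat := c0 x ^+ 2 - 3 * c1 x ^+ 2.

Lemma quad_normM x y : quad_norm (x * y) = quad_norm x * quad_norm y.
Proof. by rewrite /quad_norm; have [-> ->] := coordM x y; ring. Qed.

Lemma quad_norm_int x : ring_of_integers x -> quad_norm x \is a Num.int.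
Proof.
by move=> /quad_integers[i0 i1]; apply: rpredB; [exact: rpredX|apply: rpredM; [exact: (intr_int _ 3)|exact: rpredX]].
Qed.

Lemma coordD x y : c0 (x + y) = c0 x + c0 y /\ c1 (x + y) = c1 x + c1 y.
Proof. by apply: coord_uniq; rewrite {1}[x]cE {1}[y]cE !scalerDl addrACA. Qed.

(* The powers of 1 + x have bounded denominators as well, so the norms of x and 1 + x are integers. *)
Lemma quad_integral_of_powers (m x : F) : m != 0 -> (forall n, ring_of_integers (m * x ^+ n)) ->
  ring_of_integers x.
Proof.
move=> m0 hx; have [Z1 _ ZB ZD ZM] := quad_integers_ring.
have Z0 : ring_of_integers (0 : F) by rewrite -(subrr 1); exact: ZB.
have h1x n : ring_of_integers (m * (1 + x) ^+ n).
  rewrite exprDn mulr_sumr; apply: (big_ind (@ring_of_integers F)) => // i _.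
  rewrite expr1n mul1r mulrnAr; elim: 'C(n, i) => [|k IH]; first by rewrite mulr0n.
  by rewrite mulrS; exact: ZD.
have nm y : (forall n, ring_of_integers (m * y ^+ n)) -> quad_norm y \is a Num.int.
  move=> hy; have nX n : quad_norm (y ^+ n) = quad_norm y ^+ n.
    elim: n => [|n IH]; last by rewrite !exprS quad_normM IH.
    by rewrite !expr0 /quad_norm; have [-> ->] := coord1; rewrite expr1n expr0n mulr0 subr0.
  apply: (@rat_pow_bounded _ (quad_norm m)) => [|n]; last first.
    by rewrite mulrC -nX -quad_normM; exact: quad_norm_int.
  rewrite subr_eq0; apply/eqP => e; have [c10|c10] := eqVneq (c1 m) 0.
    move/eqP: m0; apply; rewrite [m]cE c10 scale0r addr0.
    by move: e; rewrite c10 expr0n mulr0 => /eqP; rewrite sqrf_eq0 => /eqP ->; rewrite scale0r.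
  have /eqP := rat_sqr_neq3 (c0 m / c1 m); apply.
  by rewrite expr_div_n e mulfK // expf_neq0.
have n0 := nm _ hx; have n1 := nm _ h1x.
apply/quad_integers; apply: quad_coords_int => //.
have -> : 2 * c0 x = quad_norm (1 + x) - quad_norm x - 1.
  by rewrite /quad_norm; have [-> ->] := coordD 1 x; have [-> ->] := coord1; ring.
by apply: rpredB; [exact: rpredB|exact: rpred1].
Qed.

Lemma quad_multiple (x : F) : exists2 n : nat, (0 < n)%N & ring_of_integers (n%:R * x).
Proof.
have [n [n0 nE]] := rat_multiple (c0 x); have [k [k0 kE]] := rat_multiple (c1 x).
exists (n * k)%N; first by rewrite muln_gt0 n0.
have [e0 e1] : c0 ((n * k)%:R * x) = (n * k)%:R * c0 x /\ c1 ((n * k)%:R * x) = (n * k)%:R * c1 x.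
  apply: coord_uniq; rewrite {1}[x]cE mulrDr -[in LHS](rmorph_nat (in_alg F)) /= !mulr_algl !scalerA.
  by congr (_ *: _ + _ *: _).
apply/quad_integers; rewrite e0 e1 natrM; split.
  by rewrite mulrAC mulrC; apply: rpredM => //; exact: natr_int.
by rewrite -mulrA; apply: rpredM => //; exact: natr_int.
Qed.

(* The prime 1 + sqrt 3 above 2 has residue field F_2, over which X^2 + X Y + Y^2 is anisotropic. *)
Lemma quad_prime_divides (u v w : F) : ring_of_integers u -> ring_of_integers v -> ring_of_integers w ->
  u ^+ 2 - z * u * v + v ^+ 2 = (1 + z) * w ->
  ring_of_integers (u / (1 + z)) /\ ring_of_integers (v / (1 + z)).
Proof.
move=> /quad_integers[/intrP[u0 eu0] /intrP[u1 eu1]] /quad_integers[/intrP[v0 ev0] /intrP[v1 ev1]].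
move=> /quad_integers[/intrP[w0 ew0] /intrP[w1 ew1]] e.
have par : exists k l, u0 + u1 = 2 * k /\ v0 + v1 = 2 * l.
  have ez : u0 ^+ 2 + 3 * u1 ^+ 2 + 2 * u0 * u1 - 3 * (u0 * v1 + u1 * v0) - (u0 * v0 + 3 * u1 * v1) +
      v0 ^+ 2 + 3 * v1 ^+ 2 + 2 * v0 * v1 = 2 * w0 + 4 * w1.
    have := congr1 (fun x => c0 x + c1 x) e; rewrite !expr2 -mulrA.
    have [-> ->] := coordD (u * u - z * (u * v)) (v * v); have [-> ->] := coordB (u * u) (z * (u * v)).
    have [-> ->] := coordM z (u * v); have [-> ->] := coordM u v; have [-> ->] := coordM u u.
    have [-> ->] := coordM v v; have [-> ->] := coordM (1 + z) w; have [-> ->] := coordD 1 z.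
    have [-> ->] := coord1; have [-> ->] := coordz; rewrite eu0 eu1 ev0 ev1 ew0 ew1 => h.
    by apply: (@intr_inj rat); move: h; lra.
  have [k ku] := int_parity (u0 + u1); have [l lv] := int_parity (v0 + v1); exists k, l.
  have e1 : u1 = (u0 + u1) - u0 by ring.
  have e2 : v1 = (v0 + v1) - v0 by ring.
  by move: ez; rewrite e1 e2; case: ku => ->; case: lv => -> ez; split; lia.
have z1 : 1 + z != 0.
  apply/eqP => h; have := congr1 c1 h; have [_ ->] := coordD 1 z; have [_ ->] := coord1; have [_ ->] := coordz.
  have := coordB 1 1; rewrite subrr => -[_ ->]; have [_ ->] := coord1; lra.
have div (x : F) (a b k : int) : c0 x = a%:~R -> c1 x = b%:~R -> a + b = 2 * k -> ring_of_integers (x / (1 + z)).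
  move=> xa xb abk; pose y : F := ((2 * b - k)%:~R : rat)%:A + ((k - b)%:~R : rat) *: z.
  have [y0 y1] : c0 y = (2 * b - k)%:~R /\ c1 y = (k - b)%:~R by exact: coord_uniq.
  have -> : x = y * (1 + z).
    have aE : a = 2 * k - b by rewrite -abk addrK.
    rewrite [LHS]cE [RHS]cE; have [-> ->] := coordM y (1 + z); have [-> ->] := coordD 1 z.
    have [-> ->] := coord1; have [-> ->] := coordz; rewrite y0 y1 xa xb aE.
    by congr (_%:A + _ *: z); rewrite !(rmorphB, rmorphM) /=; ring.
  by rewrite mulfK //; apply/quad_integers; rewrite y0 y1; split; exact: intr_int.
have [k [l [ku lv]]] := par.
by split; [exact: div eu0 eu1 ku|exact: div ev0 ev1 lv].
Qed.

End QuadraticField.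

Section QuaternionMap.
Variables (F E : fieldType) (w : {rmorphism F -> E}) (a b : F).

Definition qmap (x : quaternion a b) : quaternion (w a) (w b) :=
  mkq (w a) (w b) (w (q0 x)) (w (q1 x)) (w (q2 x)) (w (q3 x)).

Let mB : zmod_morphism qmap.
Proof. by move=> x y; apply: quatP; rewrite /qmap !qE ?rmorphB. Qed.

Let mM : monoid_morphism qmap.
Proof.
split=> [|x y]; apply: quatP; rewrite /qmap !qE ?rmorph1 ?rmorph0 //;
  by rewrite ?(rmorphB, rmorphD, rmorphM, rmorphN).
Qed.

Let mZ : scalable_for (w \; *:%R) qmap.
Proof. by move=> c x; apply: quatP; rewrite /qmap !qE /= rmorphM. Qed.

HB.instance Definition _ := GRing.isZmodMorphism.Build _ _ qmap mB.
HB.instance Definition _ := GRing.isMonoidMorphism.Build _ _ qmap mM.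
HB.instance Definition _ := GRing.isScalable.Build F _ _ (w \; *:%R) qmap mZ.

Definition qmap_lrmorphism : {lrmorphism quaternion a b -> quaternion (w a) (w b) | w \; *:%R} := qmap.
End QuaternionMap.

Lemma quat_decomp (F : fieldType) (a b : F) (x : quaternion a b) : x = q0 x *: 1 +
  (q1 x *: mkq a b 0 1 0 0 + (q2 x *: mkq a b 0 0 1 0 + q3 x *: mkq a b 0 0 0 1)).
Proof. by apply: quatP; rewrite !qE; ring. Qed.

(** Two negative constants make the norm form positive definite. *)
Lemma quaternion_division_at (R : realType) (F : fieldExtType rat) (a b : F) (w : {rmorphism F -> R}) :
  w a < 0 -> w b < 0 -> division_at (quaternion a b) w.
Proof.
move=> a0 b0; exists (quaternion (w a) (w b)), (qmap_lrmorphism w a b); split; last first.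
  move=> x x0; apply: qunitP; apply: contra_neq x0 => nx.
  have : q0 x ^+ 2 - w a * q1 x ^+ 2 - w b * q2 x ^+ 2 + w a * w b * q3 x ^+ 2 = 0 := nx.
  have ab : 0 < w a * w b by rewrite nmulr_rgt0.
  have h0 := sqr_ge0 (q0 x); have h1 : 0 <= - w a * q1 x ^+ 2 by rewrite mulr_ge0 ?sqr_ge0 // oppr_ge0 ltW.
  have h2 : 0 <= - w b * q2 x ^+ 2 by rewrite mulr_ge0 ?sqr_ge0 // oppr_ge0 ltW.
  have h3 : 0 <= w a * w b * q3 x ^+ 2 by rewrite mulr_ge0 ?sqr_ge0 // ltW.
  move=> e; have e0 : q0 x ^+ 2 = 0 by lra.
  have e1 : w a * q1 x ^+ 2 = 0 by lra.
  have e2 : w b * q2 x ^+ 2 = 0 by lra.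
  have e3 : w a * w b * q3 x ^+ 2 = 0 by lra.
  have sq (c u : R) : c != 0 -> c * u ^+ 2 = 0 -> u = 0.
    by move=> c0 /eqP; rewrite mulf_eq0 (negPf c0) sqrf_eq0 => /eqP.
  apply: quatP; rewrite !qE.
  - by apply: (sq 1); rewrite ?oner_eq0 ?mul1r.
  - by apply: (sq (w a)); rewrite ?lt_eqF.
  - by apply: (sq (w b)); rewrite ?lt_eqF.
  - by apply: (sq (w a * w b)); rewrite ?gt_eqF.
apply: (@base_change_spanning _ _ _ _ _ _ [:: 1; mkq a b 0 1 0 0; mkq a b 0 0 1 0; mkq a b 0 0 0 1]).
  by rewrite !dim_quaternion.
apply/eqP; rewrite eqEsubv subvf; apply/subvP => x _; rewrite [x]quat_decomp.
have m i : (i < 4)%N -> (map (qmap_lrmorphism w a b)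
    [:: 1; mkq a b 0 1 0 0; mkq a b 0 0 1 0; mkq a b 0 0 0 1])`_i \in span (map (qmap_lrmorphism w a b)
    [:: 1; mkq a b 0 1 0 0; mkq a b 0 0 1 0; mkq a b 0 0 0 1]) by move=> i4; apply/memv_span/mem_nth.
have e1 : 1 = qmap w (1 : quaternion a b) by rewrite rmorph1.
have eq i j k l : mkq (w a) (w b) (w i) (w j) (w k) (w l) = qmap w (mkq a b i j k l).
  by apply: quatP; rewrite /qmap !qE.
have i1 := eq 0 1 0 0; have j1 := eq 0 0 1 0; have k1 := eq 0 0 0 1.
rewrite rmorph0 rmorph1 in i1 j1 k1; rewrite e1 i1 j1 k1.
by do 3! (apply: rpredD; first by apply: rpredZ; first [exact: (m 0%N)|exact: (m 1%N)|exact: (m 2%N)]);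
  apply: rpredZ; exact: (m 3%N).
Qed.

(** * A maximal order over Q(sqrt 3) *)

Section Example.
Variables (R : realType) (F : fieldExtType rat) (z : F) (c0 c1 : F -> rat) (r : R).
Hypotheses (z2 : z ^+ 2 = 3) (cE : forall x, x = (c0 x)%:A + c1 x *: z) (r2 : r ^+ 2 = 3) (r0 : 0 < r).
Local Notation a := (1 + z).
Local Notation B := (@quaternion F (1 + z) (-1)).
Local Notation mk := (@mkq F (1 + z) (-1)).
Local Notation ZF := (@ring_of_integers F).

Let Zring := quad_integers_ring z2 cE r2.
Let Z1 : ZF 1. Proof. by case: Zring. Qed.
Let Zz : ZF z. Proof. by case: Zring. Qed.
Let ZB (x y : F) : ZF x -> ZF y -> ZF (x - y). Proof. by case: Zring => _ _ h _ _; exact: h. Qed.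
Let ZD (x y : F) : ZF x -> ZF y -> ZF (x + y). Proof. by case: Zring => _ _ _ h _; exact: h. Qed.
Let ZM (x y : F) : ZF x -> ZF y -> ZF (x * y). Proof. by case: Zring => _ _ _ _; exact. Qed.
Let Z0 : ZF 0. Proof. by rewrite -(subrr 1); exact: ZB. Qed.
Let ZN (x : F) : ZF x -> ZF (- x). Proof. by rewrite -sub0r; exact: ZB. Qed.
Let Za : ZF a. Proof. exact: ZD. Qed.
Let Zn n : ZF n%:R. Proof. by elim: n => [|n IH]; rewrite ?mulrS; [exact: Z0|exact: ZD]. Qed.

Let two0 : (2 : F) != 0. Proof. exact: natr_neq0. Qed.
Let four0 : (4 : F) != 0. Proof. exact: natr_neq0. Qed.

(** This quantity is the norm of zeta; the product formulas below leave it unevaluated, so that they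
    are identities in z. *)
Let n1 : (z ^+ 2 + 1) / 4 = 1.
Proof. by rewrite z2 -[X in 3 + X]/(1%:R) -natrD divff. Qed.

Let a0 : a != 0.
Proof.
apply/eqP => h; have : (1 + z) * (1 - z) = - 2 by transitivity (1 - z ^+ 2); [ring|rewrite z2; ring].
by rewrite h mul0r => /esym/eqP; rewrite oppr_eq0 (negPf two0).
Qed.

(* With zeta = (z + j)/2 a generator of the integers of F(j) over those of F, an
   element is P + Q zeta + (U - V zeta) i. *)
Let P (x : B) := q0 x - z * q2 x.
Let Q (x : B) := 2 * q2 x.
Let U (x : B) := q1 x + z * q3 x.
Let V (x : B) := 2 * q3 x.

Definition example_order : set B := [set x | [/\ ZF (P x), ZF (Q x), ZF (U x) & ZF (V x)]].
Local Notation O := example_order.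

Let PM x y : P (x * y) = P x * P y - (z ^+ 2 + 1) / 4 * (Q x * Q y) +
  a * (U x * (U y - z * V y) + (z ^+ 2 + 1) / 4 * (V x * V y)).
Proof. by rewrite /P /Q /U /V !qE; field; rewrite ?four0 ?two0. Qed.

Let QM x y : Q (x * y) = P x * Q y + Q x * P y + z * Q x * Q y + a * (U x * V y - V x * U y).
Proof. by rewrite /P /Q /U /V !qE; ring. Qed.

Let UM x y : U (x * y) = P x * U y + (z ^+ 2 + 1) / 4 * (Q x * V y) + U x * (P y + z * Q y) -
  (z ^+ 2 + 1) / 4 * (V x * Q y).
Proof. by rewrite /P /Q /U /V !qE; field; rewrite ?four0 ?two0. Qed.

Let VM x y : V (x * y) = P x * V y - Q x * U y + z * Q x * V y + U x * Q y + V x * P y.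
Proof. by rewrite /P /Q /U /V !qE; ring. Qed.

Let zeta : B := mk (z / 2) 0 (1 / 2) 0.
Let kappa : B := mk 0 (z / 2) 0 (- (1 / 2)).

Let decomp x : x = P x *: 1 + (Q x *: zeta + (U x *: mk 0 1 0 0 + (- V x *: kappa + 0))).
Proof. by apply: quatP; rewrite /zeta /kappa /P /Q /U /V !qE; field; rewrite two0. Qed.

Lemma example_is_order : is_order O.
Proof.
split.
- by split; rewrite /P /Q /U /V !qE ?mulr0 ?subr0 ?addr0.
- move=> x y [x1 x2 x3 x4] [y1 y2 y3 y4]; split; rewrite /P /Q /U /V !qE.
  + by rewrite (_ : _ - _ = P x - P y); [exact: ZB|rewrite /P; ring].
  + by rewrite (_ : _ * _ = Q x - Q y); [exact: ZB|rewrite /Q; ring].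
  + by rewrite (_ : _ + _ = U x - U y); [exact: ZB|rewrite /U; ring].
  + by rewrite (_ : _ * _ = V x - V y); [exact: ZB|rewrite /V; ring].
- by move=> x y [x1 x2 x3 x4] [y1 y2 y3 y4]; split; rewrite ?PM ?QM ?UM ?VM ?n1 ?mul1r;
    repeat first [assumption | exact: Za | exact: Zz | apply: ZB | apply: ZD | apply: ZM].
- exists [:: 1; zeta; mk 0 1 0 0; kappa].
    apply/eqP; rewrite eqEsubv subvf; apply/subvP => x _; rewrite [x]decomp.
    do 4! (apply: rpredD; first by apply: rpredZ; apply: memv_span; rewrite !inE eqxx ?orbT).
    exact: mem0v.
  apply/seteqP; split=> [x [x1 x2 x3 x4]|_ [c ci <-]].
    exists (fun i : 'I_4 => [:: P x; Q x; U x; - V x]`_i).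
      by case=> [[|[|[|[|i]]]] hi] //=; exact: ZN.
    by rewrite [RHS]decomp !big_ord_recl big_ord0.
  rewrite !big_ord_recl big_ord0 /=.
  have := ci (lift ord0 (lift ord0 (lift ord0 ord0))); have := ci (lift ord0 (lift ord0 ord0)).
  have := ci (lift ord0 ord0); have := ci ord0.
  move: (c _) (c _) (c _) (c _) => v u q p hp hq hu hv; split; rewrite /P /Q /U /V /zeta /kappa !qE.
  + by rewrite [X in ZF X](_ : _ = p) //; field; rewrite two0.
  + by rewrite [X in ZF X](_ : _ = q) //; field; rewrite two0.
  + by rewrite [X in ZF X](_ : _ = u) //; field; rewrite two0.
  + by rewrite [X in ZF X](_ : _ = - v); [exact: ZN|field; rewrite two0].
Qed.

Let Zq (n : nat) (x : B) := [/\ ZF (n%:R * q0 x), ZF (n%:R * q1 x), ZF (n%:R * q2 x) & ZF (n%:R * q3 x)].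

Let ZqM n k x : Zq n x -> Zq (n * k) x.
Proof.
by move=> [? ? ? ?]; split; rewrite mulnC natrM -mulrA; apply: ZM => //; exact: Zn.
Qed.

Let Zq_exists x : exists2 n : nat, (0 < n)%N & Zq n x.
Proof.
have [n0 p0 h0] := quad_multiple z2 cE r2 (q0 x); have [n1' p1 h1] := quad_multiple z2 cE r2 (q1 x).
have [n2 p2 h2] := quad_multiple z2 cE r2 (q2 x); have [n3 p3 h3] := quad_multiple z2 cE r2 (q3 x).
exists (n0 * n1' * n2 * n3)%N; first by rewrite !muln_gt0 p0 p1 p2.
split.
- by rewrite -!mulnA mulnC natrM -mulrA; apply: ZM => //; exact: Zn.
- by rewrite -mulnA mulnAC natrM -mulrA; apply: ZM => //; exact: Zn.
- by rewrite mulnAC natrM -mulrA; apply: ZM => //; exact: Zn.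
- by rewrite natrM -mulrA; apply: ZM => //; exact: Zn.
Qed.

(** The elements of an order have coordinates with a common denominator n, so n^2 times every power
    of the norm is integral. *)
Lemma order_nrd_integral (O' : set B) x : is_order O' -> O' x -> ZF (qnrd x).
Proof.
move=> [h1 hB hM [s _ hs]].
have [n n0 hn] : exists2 n : nat, (0 < n)%N & {in s, forall y, Zq n y}.
  elim: (s) => [|y l [n n0 hn]]; first by exists 1%N.
  have [k k0 hk] := Zq_exists y; exists (n * k)%N; first by rewrite muln_gt0 n0.
  by move=> u; rewrite inE => /predU1P[->|/hn]; [rewrite mulnC|]; exact: ZqM.
have Zn' y : O' y -> Zq n y.
  rewrite hs => -[c ci <-]; apply: (big_ind (Zq n)).
  - by split; rewrite !qE mulr0.
  - by move=> u v [? ? ? ?] [? ? ? ?]; split; rewrite !qE mulrDr; exact: ZD.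
  - move=> i _; have [? ? ? ?] := hn _ (mem_nth 0 (ltn_ord i)).
    by split; rewrite !qE mulrCA; apply: ZM => //; exact: ci.
move=> Ox; have OX k : O' (x ^+ k) by elim: k => [|k IH]; rewrite ?expr0 ?exprS //; exact: hM.
have nn : (n%:R ^+ 2 : F) != 0 by rewrite expf_neq0 // natr_neq0.
apply: (quad_integral_of_powers z2 cE r2 nn) => k; rewrite -qnrdX.
have [x0 x1 x2 x3] := Zn' _ (OX k).
rewrite [X in ZF X](_ : _ = (n%:R * q0 (x ^+ k)) ^+ 2 - a * (n%:R * q1 (x ^+ k)) ^+ 2 +
  (n%:R * q2 (x ^+ k)) ^+ 2 - a * (n%:R * q3 (x ^+ k)) ^+ 2); last by rewrite /qnrd; ring.
by rewrite !expr2; apply: ZB; [apply: ZD; [apply: ZB|]|]; try exact: ZM; apply: ZM => //; exact: ZM.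
Qed.

(** Traces against the generators confine a larger order to the dual lattice: P, Q, a U and a V are
    integral. Integrality of the norm makes a binary form in a U and a V divisible by the prime a =
    1 + sqrt 3, and [quad_prime_divides] turns this into divisibility of both by a. *)
Lemma example_maximal : maximal_order O.
Proof.
split=> [|O' oO' sub]; first exact: example_is_order.
apply/seteqP; split=> [x O'x|]; last exact: sub.
have [h1 hB hM _] := oO'.
have tr y : O' y -> ZF (qtr y).
  move=> O'y; have -> : qtr y = qnrd (1 + y) - 1 - qnrd y by rewrite /qtr /qnrd !qE; ring.
  have O'1y : O' (1 + y).
    by rewrite -[y]opprK; apply: (hB) => //; rewrite -sub0r; apply: (hB) => //; rewrite -(subrr 1); exact: hB.
  by apply: ZB; [apply: ZB => //|]; exact: order_nrd_integral oO' _.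
have pair y : O y -> ZF (qtr (x * y)) by move=> /sub O'y; apply: tr; exact: hM.
have T1 := tr _ O'x.
have T2 : ZF (qtr (x * zeta)).
  apply: pair; split; rewrite /P /Q /U /V /zeta !qE.
  + by rewrite [X in ZF X](_ : _ = 0) //; field; rewrite two0.
  + by rewrite [X in ZF X](_ : _ = 1) //; field; rewrite two0.
  + by rewrite mulr0 addr0.
  + by rewrite mulr0.
have T3 : ZF (qtr (x * mk 0 1 0 0)).
  by apply: pair; split; rewrite /P /Q /U /V !qE ?mulr0 ?subr0 ?addr0.
have T4 : ZF (qtr (x * kappa)).
  apply: pair; split; rewrite /P /Q /U /V /kappa !qE ?mulr0 ?subr0 //.
    by rewrite [X in ZF X](_ : _ = 0) //; field; rewrite two0.
  by rewrite [X in ZF X](_ : _ = - 1); [exact: ZN|field; rewrite two0].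
have three1 : z ^+ 2 - 2 = 1 by rewrite z2; ring.
have PE : P x = z * qtr (x * zeta) - qtr x.
  have -> : z * qtr (x * zeta) - qtr x = (z ^+ 2 - 2) * q0 x - z * q2 x.
    by rewrite /qtr /zeta !qE; field; rewrite two0.
  by rewrite three1 mul1r.
have QE : Q x = z * qtr x - 2 * qtr (x * zeta).
  by rewrite /Q /qtr /zeta !qE; field; rewrite two0.
have aUE : a * U x = 2 * qtr (x * mk 0 1 0 0) - z * qtr (x * kappa).
  have -> : 2 * qtr (x * mk 0 1 0 0) - z * qtr (x * kappa) =
      (1 - (z ^+ 2 - 2) + 1) * (a * q1 x) + z * (a * q3 x).
    by rewrite /qtr /kappa !qE; field; rewrite two0.
  by rewrite three1 /U; ring.
have aVE : a * V x = z * qtr (x * mk 0 1 0 0) - 2 * qtr (x * kappa).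
  by rewrite /V /qtr /kappa !qE; field; rewrite two0.
have ZPx : ZF (P x) by rewrite PE; apply: ZB => //; exact: ZM.
have ZQx : ZF (Q x) by rewrite QE; apply: ZB; apply: ZM => //; exact: (Zn 2).
have ZUx : ZF (a * U x) by rewrite aUE; apply: ZB; apply: ZM => //; exact: (Zn 2).
have ZVx : ZF (a * V x) by rewrite aVE; apply: ZB; apply: ZM => //; exact: (Zn 2).
pose W := a * (q1 x ^+ 2 + q3 x ^+ 2).
have ZW : ZF W.
  have -> : W = P x ^+ 2 + z * P x * Q x + (z ^+ 2 - 2) * Q x ^+ 2 - qnrd x + 3 * (3 - z ^+ 2) * q2 x ^+ 2.
    by rewrite /W /P /Q /qnrd; ring.
  rewrite three1 mul1r z2 subrr mulr0 mul0r addr0 !expr2; apply: ZB; last exact: order_nrd_integral oO' _.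
  by apply: ZD; [apply: ZD|]; repeat first [assumption|apply: ZM].
have key : (a * U x) ^+ 2 - z * (a * U x) * (a * V x) + (a * V x) ^+ 2 = a * W.
  have -> : a * W = (a * U x) ^+ 2 - z * (a * U x) * (a * V x) + (a * V x) ^+ 2 + (z ^+ 2 - 3) * a ^+ 2 * q3 x ^+ 2.
    by rewrite /W /U /V; ring.
  by rewrite z2 subrr !mul0r addr0.
have [ZU ZV] := quad_prime_divides z2 cE r2 ZUx ZVx ZW key.
by split=> //; [move: ZU|move: ZV]; rewrite mulrC mulKf.
Qed.

End Example.

Lemma qnrd_morph (F K : fieldType) (w : {rmorphism F -> K}) (a b : F) (x : quaternion a b) :
  w (qnrd x) = w (q0 x) ^+ 2 - w a * w (q1 x) ^+ 2 - w b * w (q2 x) ^+ 2 + w a * w b * w (q3 x) ^+ 2.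
Proof. by rewrite /qnrd !(rmorphD, rmorphN, rmorphM, rmorphXn). Qed.

Lemma quadratic_field_sqrt3 : exists (F : fieldExtType rat) (z : F) (c0 c1 : F -> rat),
  z ^+ 2 = 3 /\ forall x, x = (c0 x)%:A + c1 x *: z.
Proof.
pose p : {poly rat} := 'X^2 - 3%:P.
have sp : size p = 3%N by rewrite size_XnsubC.
have irr : irreducible_poly p.
  apply: cubic_irreducible => [|q]; first by rewrite sp.
  by rewrite rootE hornerD hornerN hornerXn hornerC subr_eq0 rat_sqr_neq3.
have [F dF [z rz _]] := irredp_FAdjoin irr.
have z2 : z ^+ 2 = 3.
  move: rz; rewrite rootE rmorphB /= map_polyXn map_polyC hornerD hornerN hornerXn hornerC subr_eq0 => /eqP ->.
  exact: (rmorph_nat (in_alg F)).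
have fz : free [:: z; 1].
  apply: scalar_free => c zc; have := rat_sqr_neq3 c; rewrite -(inj_eq (fmorph_inj (in_alg F))) rmorphXn /=.
  by rewrite -zc z2 -[3%:A]/(in_alg F 3) rmorph_nat eqxx.
have bz : basis_of {:F}%VS [:: z; 1] by rewrite basisEfree fz subvf dF sp.
have ex x : exists c : rat * rat, x = c.1%:A + c.2 *: z.
  have := memvf x; rewrite -(span_basis bz) span_cons span_seq1.
  by move=> /memv_addP[_ /vlineP[d ->] [_ /vlineP[c ->] ->]]; exists (c, d); rewrite addrC.
have [c cE] := choice ex.
by exists F, z, (fun x => (c x).1), (fun x => (c x).2).
Qed.

(** * The arithmetic group of that order *)

Section ExampleGroup.
Variables (R : realType) (F : fieldExtType rat) (z : F) (c0 c1 : F -> rat) (r : R).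
Hypotheses (z2 : z ^+ 2 = 3) (cE : forall x, x = (c0 x)%:A + c1 x *: z) (r2 : r ^+ 2 = 3) (r0 : 0 < r).
Local Notation a := (1 + z).
Local Notation B := (@quaternion F (1 + z) (-1)).
Local Notation ZF := (@ring_of_integers F).
Local Notation O := (@example_order F z).

Let nu : {rmorphism F -> R} := quad_rmorphism z2 cE r2.

Let nuz : nu z = r.
Proof. by rewrite /nu /= /quad_emb; have [-> ->] := coordz z2 cE; rewrite rmorph0 rmorph1 add0r mul1r. Qed.

Let nua : nu a = 1 + r. Proof. by rewrite rmorphD rmorph1 nuz. Qed.

Let s := Num.sqrt (1 + r).
Let sE : s ^+ 2 = nu a. Proof. by rewrite nua sqr_sqrtr // addr_ge0 // ltW. Qed.
Let s1 : 1 <= s. Proof. by rewrite -[1](sqrtr1) ler_wsqrtr // lerDl ltW. Qed.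
Let s0 : s != 0. Proof. by rewrite gt_eqF // (lt_le_trans ltr01). Qed.
Let rho : {lrmorphism B -> 'M[R]_2 | nu \; *:%R} := qrep_lrmorphism (-1) sE.

Let r32 : 3 / 2 <= r.
Proof. by rewrite -(@ler_pXn2r _ 2) ?nnegrE ?(ltW r0) ?divr_ge0 // r2; lra. Qed.

Let rmorph_pm (K : numFieldType) (f : {rmorphism F -> K}) (q : K) : q ^+ 2 = 3 -> f z = q \/ f z = - q.
Proof.
move=> q2; have : (f z - q) * (f z + q) = 0.
  by transitivity (f z ^+ 2 - q ^+ 2); [ring|rewrite rmorphism_z // q2 subrr].
by move/eqP; rewrite mulf_eq0 subr_eq0 addr_eq0 => /orP[] /eqP; [left|right].
Qed.

Definition example_group : set 'M[R]_2 := rho @` norm_one_units rho O.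

(** The algebra (1 + sqrt 3, -1) is split where sqrt 3 is positive. At the other place both
    constants are negative, so it is a division algebra there. *)
Lemma example_Gamma_O : is_Gamma_O example_group.
Proof.
have two0 : (2 : F) != 0 by exact: natr_neq0.
exists F, B, nu, rho, O; split.
- move=> f x; rewrite (rmorphism_quad cE f x).
  have re q : (ratr q : R[i]) = (ratr q)%:C%C by rewrite (fmorph_rat (real_complex R)).
  have q2 : ((r%:C)%C : R[i]) ^+ 2 = 3 by rewrite -[_ ^+ 2](rmorphXn (real_complex R)) r2 rmorph_nat.
  by rewrite !re; case: (rmorph_pm f q2) => ->; rewrite /= ?mulr0 ?mul0r ?oppr0 ?addr0 ?mulr0 ?addr0.
- apply: quaternion_algebra_quat => //; last by rewrite oppr_eq0 oner_eq0.
  by rewrite -(fmorph_eq0 nu) nua gt_eqF // addr_gt0.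
- by apply: qrep_base_change; rewrite ?oppr_eq0 ?oner_eq0.
- move=> w wnu; have [wz|wz] := rmorph_pm w r2.
    by exfalso; apply: wnu => x; rewrite (rmorphism_quad cE w) (rmorphism_quad cE nu) wz nuz.
  apply: quaternion_division_at; last by rewrite rmorphN rmorph1 oppr_lt0.
  by rewrite rmorphD rmorph1 wz; have := r32; lra.
- by split=> //; exact: example_maximal z2 cE r2.
Qed.

Let r2N : (- r) ^+ 2 = 3. Proof. by rewrite sqrrN. Qed.
Let om : {rmorphism F -> R} := quad_rmorphism z2 cE r2N.
Let omz : om z = - r.
Proof. by rewrite /om /= /quad_emb; have [-> ->] := coordz z2 cE; rewrite rmorph0 rmorph1 add0r mul1r. Qed.

(* An integer bounded at both real places has bounded coordinates. *)
Lemma bounded_integers_finite (C : R) :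
  finite_set [set u : F | [/\ ZF (2 * u), `|nu u| <= C & `|om u| <= C]].
Proof.
pose M := (Num.truncn `|2 * C|).+1.
have bnd (x : rat) : x \is a Num.int -> `|ratr x : R| <= 2 * C -> exists i : 'I_(M + M).+1, x = i%:R - M%:R.
  move=> /intrP[m ->]; rewrite ratr_int => h.
  have mM : `|m%:~R : R| < M%:R.
    have /andP[_] := truncn_itv (normr_ge0 (2 * C)); apply: le_lt_trans.
    by apply: le_trans h _; exact: ler_norm.
  have {mM} mM : `|m| < M%:Z by rewrite -(ltr_int R) intr_norm.
  have iM : (absz (m + M%:Z)%R < (M + M).+1)%N by lia.
  exists (Ordinal iM) => /=; have : (absz (m + M%:Z))%:Z = m + M%:Z by rewrite gez0_abs //; lia.
  by move/(congr1 (fun k : int => k%:~R : rat)); rewrite rmorphD /= -!pmulrn => ->; rewrite addrK.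
pose f (i : 'I_(M + M).+1 * 'I_(M + M).+1) : F :=
  ((i.1%:R - M%:R) / 2)%:A + ((i.2%:R - M%:R) / 2) *: z.
apply: (@sub_finite_set _ _ (f @` [set: _])); last by apply: finite_image; exact: finite_finset.
move=> u [/(quad_integers z2 cE r2)[i0 i1] hn ho].
have [d0 d1] : c0 (2 * u) = 2 * c0 u /\ c1 (2 * u) = 2 * c1 u.
  by rewrite mulr2n mulrDl !mul1r; have [-> ->] := coordD z2 cE u u; split; ring.
rewrite d0 in i0; rewrite d1 in i1.
have nuE : nu u = ratr (c0 u) + ratr (c1 u) * r by rewrite (rmorphism_quad cE nu) nuz.
have omE : om u = ratr (c0 u) - ratr (c1 u) * r by rewrite (rmorphism_quad cE om) omz mulrN.
have [i e0] : exists i : 'I_(M + M).+1, 2 * c0 u = i%:R - M%:R.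
  apply: bnd => //; have -> : ratr (2 * c0 u) = nu u + om u by rewrite nuE omE rmorphM /= ratr_nat; ring.
  by apply: le_trans (ler_normD _ _) _; lra.
have [j e1] : exists i : 'I_(M + M).+1, 2 * c1 u = i%:R - M%:R.
  apply: bnd => //; have e : ratr (2 * c1 u) * r = nu u - om u by rewrite nuE omE rmorphM /= ratr_nat; ring.
  have : `|ratr (2 * c1 u) : R| * r <= 2 * C.
    rewrite -{1}(gtr0_norm r0) -normrM e; apply: le_trans (ler_normB _ _) _; lra.
  by have := normr_ge0 (ratr (2 * c1 u) : R); have := r32; nra.
exists (i, j) => //; rewrite /f /= -e0 -e1 [RHS]cE.
by congr (_%:A + _ *: z); field.
Qed.

(** At the other real place the norm form is positive definite, so norm 1 bounds all coordinates
    there; the matrix entries bound them at nu, and integers bounded at both places are finite in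
    number. *)
Lemma example_locally_finite : locally_finite example_group.
Proof.
move=> C; pose Fin := [set u : F | [/\ ZF (2 * u), `|nu u| <= `|C| + 2 & `|om u| <= `|C| + 2]].
have fin : finite_set Fin by exact: bounded_integers_finite.
pose f (q : F * F * F * F) := rho (mkq (1 + z) (-1) q.1.1.1 q.1.1.2 q.1.2 q.2).
apply: (@sub_finite_set _ _ (f @` (Fin `*` Fin `*` Fin `*` Fin))); last first.
  by apply: finite_image; do 3! (apply: finite_setX => //).
move=> _ [[x [[ZP ZQ ZU ZV] _ nx] <-] hC].
have [Z1 Zz ZB ZD ZM] := quad_integers_ring z2 cE r2.
have hC' i j : `|rho x i j| <= `|C| by apply: le_trans (hC i j) (ler_norm C).
have H := (hC' 0 0, hC' 0 1, hC' 1 0, hC' 1 1).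
rewrite /rho /= /qrep !mx2E rmorphN1 mulN1r normrN in H; case: H => [[[h00 h01] h10] h11].
have half (u v : R) : `|u + v * s| <= `|C| -> `|u - v * s| <= `|C| -> `|u| <= `|C| + 2 /\ `|v| <= `|C| + 2.
  move=> h1 h2; have hu : `|2 * u| <= 2 * `|C|.
    have -> : 2 * u = (u + v * s) + (u - v * s) by ring.
    by apply: le_trans (ler_normD _ _) _; lra.
  have hv : `|2 * v * s| <= 2 * `|C|.
    have -> : 2 * v * s = (u + v * s) - (u - v * s) by ring.
    by apply: le_trans (ler_normB _ _) _; lra.
  rewrite !normrM normr_nat (ger0_norm (le_trans ler01 s1)) in hu hv.
  by split; [lra|have := normr_ge0 v; have := s1; nra].
have [b0 b1] := half _ _ h00 h11; have [b2 b3] := half _ _ h01 h10.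
have omn : om (q0 x) ^+ 2 + (r - 1) * om (q1 x) ^+ 2 + om (q2 x) ^+ 2 + (r - 1) * om (q3 x) ^+ 2 = 1.
  have nx1 : qnrd x = 1.
    by apply: (fmorph_inj nu); rewrite rmorph1 -(qrep_det sE); move: nx; rewrite /reduced_norm rmorph1.
  have e : om (qnrd x) = 1 by rewrite nx1 rmorph1.
  have omz' : om (1 + z) = 1 - r by rewrite rmorphD rmorph1; congr (_ + _); exact: omz.
  have om1 : om (-1) = -1 by rewrite rmorphN rmorph1.
  by rewrite -[RHS]e qnrd_morph omz' om1; ring.
have sq (u : R) : u ^+ 2 <= 2 -> `|u| <= `|C| + 2.
  move=> u2; have := normr_ge0 C; have : `|u| ^+ 2 <= 2 by rewrite -normrX ger0_norm ?sqr_ge0.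
  by move: (normr_ge0 u); move: `|u| `|C| => A A'; nra.
have o0 := sqr_ge0 (om (q0 x)); have o1 := sqr_ge0 (om (q1 x)).
have o2 := sqr_ge0 (om (q2 x)); have o3 := sqr_ge0 (om (q3 x)).
have [k0 k1 k2 k3] : [/\ om (q0 x) ^+ 2 <= 2, om (q1 x) ^+ 2 <= 2, om (q2 x) ^+ 2 <= 2 & om (q3 x) ^+ 2 <= 2].
  by have := r32; move: omn o0 o1 o2 o3; move: (om (q0 x) ^+ 2) (om (q1 x) ^+ 2) (om (q2 x) ^+ 2) (om (q3 x) ^+ 2)
    => A0 A1 A2 A3 e *; split; nra.
have Z2 u : ZF u -> ZF (2 * u) by move=> hu; rewrite mulr2n mulrDl !mul1r; exact: ZD.
have Zq0 : ZF (2 * q0 x).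
  rewrite (_ : 2 * q0 x = 2 * (q0 x - z * q2 x) + z * (2 * q2 x)); last by ring.
  by apply: ZD; [exact: Z2|exact: ZM].
have Zq1 : ZF (2 * q1 x).
  rewrite (_ : 2 * q1 x = 2 * (q1 x + z * q3 x) - z * (2 * q3 x)); last by ring.
  by apply: ZB; [exact: Z2|exact: ZM].
have xE : mkq (1 + z) (-1) (q0 x) (q1 x) (q2 x) (q3 x) = x by apply: quatP; rewrite !qE.
exists (q0 x, q1 x, q2 x, q3 x); last by rewrite -[in RHS]xE.
by split; [split; [split|]|]; split=> //=; exact: sq.
Qed.

Lemma example_arithmetic : arithmetic_Fuchsian example_group.
Proof.
have sG := Gamma_O_PSL2 example_Gamma_O.
split=> //; first exact: locally_finite_discrete example_locally_finite.
exists example_group; first exact: example_Gamma_O.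
by split; rewrite setIid; exact: finite_index_refl.
Qed.

Lemma example_trace : exists2 g, example_group g & ~ range (ratr : rat -> R) (\tr (g ^+ 2)).
Proof.
have two0 : (2 : F) != 0 by exact: natr_neq0.
have four0 : (4 : F) != 0 by exact: natr_neq0.
have [Z1 Zz ZB ZD ZM] := quad_integers_ring z2 cE r2.
have Z0 : ZF 0 by rewrite -(subrr 1); exact: ZB.
have ZN1 : ZF (- 1) by rewrite -sub0r; exact: ZB.
(* x = 1 + zeta + i has norm 1 and trace 2 + sqrt 3, so its square has trace 5 + 4 sqrt 3. *)
pose x := mkq (1 + z) (-1) (1 + z / 2) 1 (1 / 2) 0.
have nx : qnrd x = 1.
  transitivity ((z ^+ 2 + 1) / 4); first by rewrite /qnrd /x !qE; field; rewrite ?two0 ?four0.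
  by rewrite z2 -[X in 3 + X]/(1%:R) -natrD divff.
have Ox : O x.
  split; rewrite /x !qE.
  - by rewrite [X in ZF X](_ : _ = 1) //; field; rewrite two0.
  - by rewrite [X in ZF X](_ : _ = 1) //; field; rewrite two0.
  - by rewrite mulr0 addr0.
  - by rewrite mulr0.
have Oy : O (qconj x).
  split; rewrite /x /qconj !qE.
  - by rewrite [X in ZF X](_ : _ = 1 + z); [exact: ZD|field; rewrite two0].
  - by rewrite [X in ZF X](_ : _ = - 1) //; field; rewrite two0.
  - by rewrite oppr0 mulr0 addr0.
  - by rewrite oppr0 mulr0.
exists (rho x).
  exists x => //; split=> //; last by rewrite /reduced_norm /rho /= qrep_det nx.
  by exists (qconj x) => //; rewrite mul_qconj qconj_mul nx scale1r.
move=> [q _ qE'].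
have tx : \tr (rho x) = 2 + r.
  rewrite /rho /= qrep_tr (_ : qtr x = 2 + z); last by rewrite /qtr /x !qE; field; rewrite two0.
  by rewrite rmorphD rmorph_nat nuz.
have dx : \det (rho x) = 1 by rewrite /rho /= qrep_det nx rmorph1.
have tx2 : \tr (rho x ^+ 2) = 5 + 4 * r.
  rewrite expr2 cayley_hamilton2 tx dx raddfB /= mxtraceZ tx mxtrace_scalar.
  by transitivity (r ^+ 2 + 4 * r + 2); [ring|rewrite r2; ring].
have /eqP := rat_sqr_neq3 ((q - 5) / 4); apply; apply: (fmorph_inj (@ratr R)).
rewrite rmorphXn fmorph_div rmorphB /= qE' tx2 !ratr_nat -r2; by field.
Qed.

End ExampleGroup.

Lemma arithmetic_irrational_trace (R : realType) : exists2 G : set 'M[R]_2, arithmetic_Fuchsian G &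
  exists2 g, G g & ~ range (ratr : rat -> R) (\tr (g ^+ 2)).
Proof.
have [F [z [c0 [c1 [z2 cE]]]]] := quadratic_field_sqrt3.
have r2 : (Num.sqrt 3 : R) ^+ 2 = 3 by rewrite sqr_sqrtr.
have r0 : 0 < Num.sqrt 3 :> R by rewrite sqrtr_gt0.
exists (example_group z2 cE r2 r0); first exact: example_arithmetic.
exact: example_trace.
Qed.

(** * Counting classes *)

(** t^2 - 4 lies strictly between (t - 1)^2 and t^2. *)
Lemma disc_nonsquare (t : int) : 2 < t -> forall x y : rat,
  x ^+ 2 - (t%:~R ^+ 2 - 4) * y ^+ 2 = 0 -> x = 0 /\ y = 0.
Proof.
move=> t2 x y e; have [y0|y0] := eqVneq y 0.
  by split=> //; move: e; rewrite y0 expr0n mulr0 subr0 => /eqP; rewrite sqrf_eq0 => /eqP.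
exfalso; pose r := x / y.
have r2 : r ^+ 2 = (t ^+ 2 - 4)%:~R.
  rewrite rmorphB rmorphXn /= /r expr_div_n; apply: (mulIf (expf_neq0 2 y0)).
  by rewrite divfK ?expf_neq0 //; apply/eqP; rewrite -subr_eq0; apply/eqP.
have /intrP[z rz] : r \is a Num.int.
  apply: (@rat_pow_bounded r (denq r)%:~R); first by rewrite intr_eq0 denq_eq0.
  move=> n; rewrite -(odd_double_half n) exprD -mul2n exprM r2 -mulrA mulrC -mulrA.
  have dn : (denq r)%:~R * r ^+ odd n \is a Num.int.
    case: (odd n); last by rewrite expr0 mulr1 intr_int.
    by rewrite expr1 mulrC -[X in X * _]divq_num_den divfK ?intr_int // intr_eq0 denq_eq0.
  by rewrite -rmorphXn; apply: rpredM => //; exact: intr_int.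
have : z ^+ 2 = t ^+ 2 - 4 by apply: (@intr_inj rat); rewrite rmorphXn /= -rz r2.
move=> ze; have zz : `|z| ^+ 2 = t ^+ 2 - 4 by rewrite -normrX ger0_norm ?sqr_ge0.
have := normr_ge0 z; move: zz; move: `|z| => u uu u0.
by have [ut|ut] := leP u (t - 1); nia.
Qed.

Section Counting.
Variables (R : realType) (t : int) (s : R).
Hypotheses (t2 : 2 < t) (sE : s ^+ 2 = ratr (t%:~R ^+ 2 - 4)) (s0 : 0 < s).
Local Notation M2 := 'M[R]_2.
Local Notation D := (t%:~R ^+ 2 - 4 : rat).
Local Notation N := (qnorm D).
Variable S : set R.
Hypothesis tS : forall l, S l -> 0 < l /\ exists t' : int, 2 < t' /\ 2 * cosh (l / 2) = t'%:~R.
Variable l0 : R.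
Hypothesis (Sl0 : S l0) (tl0 : 2 * cosh (l0 / 2) = t%:~R).

Let Dnsq := disc_nonsquare t2.

Let disc_neq0 (u : int) : 2 < u -> (u%:~R ^+ 2 - 4 : rat) != 0.
Proof.
move=> u2; have u2' : (2%:~R : rat) < u%:~R by rewrite ltr_int.
by rewrite gt_eqF //; move: u2'; move: (u%:~R) => x; nra.
Qed.

Let D0 : D != 0 := disc_neq0 t2.

Definition length_classes : set rat := [set b | b != 0 /\ forall l (t' : int), S l -> 2 < t' ->
  2 * cosh (l / 2) = t'%:~R -> trace_class D (t'%:~R ^+ 2 - 4) b].
Local Notation E := length_classes.

(** The last clause records a conjugation putting an element of trace t in standard position with
    integral traces, the form that [finitely_many_classes] takes as input. *)
Definition represents (G : set M2) (b : rat) : Prop :=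
  [/\ E b, std_form sE G b & exists T,
    [/\ \det T = 1, conjset T G (@qrep R rat (@ratr R) _ b s sE (mkq _ b (t%:~R / 2) (1 / 2) 0 0)) &
    forall x, conjset T G x -> exists y : quaternion D b,
      [/\ x = @qrep R rat (@ratr R) _ b s sE y, qtr y \is a Num.int & qnrd y = 1]]].

Lemma represents_exists G : derived_from_quaternion_algebra G -> rational_square_traces G ->
  S `<=` length_spectrum G -> exists b, represents G b.
Proof.
move=> dG rG SG; have [[sG _ _] _] := dG.
have tr l (t' : int) : S l -> 2 * cosh (l / 2) = t'%:~R -> exists2 g, G g & \tr g = t'%:~R.
  move=> Sl tl; have [_ [g [Gg hy ch]]] := SG _ Sl.
  have : `|\tr g| = t'%:~R by rewrite -tl ch mulrC divfK ?pnatr_eq0.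
  have [h|h] := ger0P (\tr g) => e; first by exists g.
  exists (- g); last by rewrite raddfN.
  by case: sG => _ G1 GM _; rewrite -mulN1r; exact: GM.
have [g Gg tg] := tr _ _ Sl0 tl0.
have [T [b [ O [dT b0 oO com [gE Gint]]]]] := derived_structure t2 sE s0 dG rG Gg tg.
have uT := det1_unit dT.
have GT h : G h -> conjset T G (T * h * T^-1) by move=> Gh; rewrite /conjset /= !mulrA mulVr // mul1r mulrVK.
exists b; split; last first.
- by exists T; split=> //; rewrite -gE; exact: GT.
- by exists T, O.
- split=> // l t' Sl t2' tl; have [h Gh th] := tr _ _ Sl tl.
  have [y [ye _ ny]] := Gint _ (GT _ Gh).
  have ty : qtr y = t'%:~R.
    apply: (fmorph_inj (@ratr R)); rewrite /= ratr_int -th -(qrep_tr sE) -ye.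
    by rewrite -(@tr_conj R T _ uT) !mulrA mulVr // mul1r mulrVK.
  apply/(trace_class_realized D0 (disc_neq0 t2') b0); exists (2 * q1 y), (2 * q2 y), (2 * q3 y).
  transitivity (t'%:~R ^+ 2 - 4 * qnrd y); first by rewrite ny mulr1.
  by rewrite -ty /qtr /qnrd; ring.
Qed.

Lemma represents_commensurable G G' b b' : derived_from_quaternion_algebra G ->
  derived_from_quaternion_algebra G' -> represents G b -> represents G' b' -> N (b * b') ->
  commensurable_surfaces G G'.
Proof.
move=> [[sG dG _] _] [[sG' _ _] _] [_ fG _] [_ fG' _] nbb.
exact: (std_form_commensurable sG sG' dG (std_form_twist sG nbb fG) fG').
Qed.

(** The trivial class gets the modular group: finite area of a unit group is proved through
    cocompactness, which holds for division algebras. *)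
Definition realizes (G : set M2) (b : rat) : Prop :=
  ((forall x : quaternion D b, x != 0 -> qnrd x != 0) /\
    exists2 O, qmaximal O & G = @unit_group R D b s sE O) \/ (N b /\ G = @modular_group R).

Lemma realizes_exists b : E b -> exists G, [/\ realizes G b, derived_from_quaternion_algebra G,
  exists2 v, has_volume G v & (v < +oo)%E & S `<=` length_spectrum G].
Proof.
move=> [b0 Eb].
have spec (G : set M2) : (forall t' : int, 2 < t' -> (exists2 l, S l & 2 * cosh (l / 2) = t'%:~R) ->
    exists2 g, G g & \tr g = t'%:~R) -> S `<=` length_spectrum G.
  move=> h l Sl; have [lp [t' [t2' tl]]] := tS Sl.
  have [|g Gg tg] := h _ t2'; first by exists l.
  have t2R : (2%:~R : R) < t'%:~R by rewrite ltr_int.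
  have tn : `|\tr g| = t'%:~R by rewrite tg ger0_norm // ltW // (lt_trans _ t2R).
  split=> //; exists g; split=> //; first by rewrite /hyperbolic tn.
  by rewrite tn -tl mulrAC divff ?mul1r // pnatr_eq0.
have [div|ndiv] := pselect (forall x : quaternion D b, x != 0 -> qnrd x != 0).
  have [ O maxO] := qmaximal_exists D0 b0.
  exists (unit_group sE O); split.
  - by left; split=> //; exists O.
  - exact: unit_group_derived.
  - exact: (unit_group_volume sE s0 b0 div maxO.1).
  - apply: spec => t' t2' [l Sl tl]; apply: (unit_group_trace sE t2 t2' b0 div maxO Dnsq).
    exact: Eb tl.
exists (@modular_group R); split.
- right; split=> //; have [x x0 nx] : exists2 x : quaternion D b, x != 0 & qnrd x = 0.
    apply: contrapT => h; apply: ndiv => x x0; apply/eqP => nx; apply: h; by exists x.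
  pose n := q2 x ^+ 2 - D * q3 x ^+ 2; pose m := q0 x ^+ 2 - D * q1 x ^+ 2.
  have mn : m = b * n by apply/eqP; rewrite -subr_eq0 -nx /m /n /qnrd; apply/eqP; ring.
  have n0 : n != 0.
    apply: contra_neq x0 => n0; have [e2 e3] := Dnsq n0.
    have [e0 e1] : q0 x = 0 /\ q1 x = 0 by apply: Dnsq; rewrite -/m mn n0 mulr0.
    by apply: quatP; rewrite ?e0 ?e1 ?e2 ?e3 !qE.
  have m0 : m != 0 by rewrite mn mulf_neq0.
  apply: (@qnorm_sqV D n) => //; rewrite (_ : n ^+ 2 * b = m * n); last by rewrite mn; ring.
  apply: qnormM; split=> //; first by exists (q0 x), (q1 x).
  by exists (q2 x), (q3 x).
- exact: modular_derived.
- exact: modular_volume.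
- by apply: spec => t' _ _; exact: modular_trace.
Qed.

Lemma realizes_not_commensurable G G' b b' : E b -> E b' -> realizes G b -> realizes G' b' ->
  ~ N (b * b') -> ~ commensurable_surfaces G G'.
Proof.
move=> [b0 _] [b0' _] [[div [ O maxO GE]]|[Nb GE]] [[div' [ O' maxO' GE']]|[Nb' GE']] nbb.
- by rewrite GE GE' => /(commensurable_unit_groups t2 s0 b0 b0' maxO.1 maxO'.1 div').
- by have [] := @modular_not_commensurable R D b s sE O s0 b0 maxO.1 div G G' GE GE'.
- by have [] := @modular_not_commensurable R D b' s sE O' s0 b0' maxO'.1 div' G' G GE' GE.
- by case: nbb; exact: qnormM.
Qed.

(** Two members sharing a representative c have b b' c^2 in [N], so they are commensurable. *)
Lemma family_bound (cs : seq rat) (V : R) n (G : 'I_n -> set M2) (b : 'I_n -> rat) :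
  noncommensurable_family V S G -> (forall i, represents (G i) (b i)) ->
  (forall i, exists2 c, c \in cs & N (b i * c)) -> (n <= size cs)%N.
Proof.
move=> [dG nc] rep hc; have ex i : exists c, c \in cs /\ N (b i * c).
  by have [c ? ?] := hc i; exists c.
have [c cP] := choice ex.
have inj : injective (fun i => c i).
  move=> i j /= cij; apply/eqP/negPn/negP => /nc; apply.
  have [di _ _] := dG i; have [dj _ _] := dG j.
  apply: (represents_commensurable di dj (rep i) (rep j)).
  have [_ ni] := cP i; have [_ nj] := cP j; rewrite -cij in nj.
  have c0 : c i != 0 by case: ni => + _; rewrite mulf_eq0 negb_or => /andP[].
  apply: (qnorm_sqV c0); rewrite (_ : _ * _ = (b i * c i) * (b j * c i)); last by ring.
  exact: qnormM.
have -> : n = size (map c (enum 'I_n)) by rewrite size_map size_enum_ord.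
by apply: uniq_leq_size; [rewrite map_inj_uniq ?enum_uniq|move=> _ /mapP[i _ ->]; have [] := cP i].
Qed.

Lemma realized_family (cs : seq rat) (V0 : R) : {in cs, forall x, E x} -> inequivalent N cs ->
  exists2 V1, V0 <= V1 & forall V, V1 <= V ->
    exists G : 'I_(size cs) -> set M2, noncommensurable_family V S G.
Proof.
move=> csE ineq.
have Ei (i : 'I_(size cs)) : E cs`_i by apply: csE; exact: mem_nth.
have [G GP] := choice (fun i => realizes_exists (Ei i)).
have rex i : exists r : R, exists2 v, has_volume (G i) v & (v <= r%:E)%E.
  have [_ _ [v hv vfin] _] := GP i; case: v hv vfin => [r| |] // hv _.
    by exists r; exists r%:E.
  by exists 0; exists -oo%E => //; rewrite leNye.
have [r rP] := choice rex.
exists (Num.max V0 (\sum_i `|r i| + 1)); first by rewrite le_max lexx.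
move=> V; rewrite ge_max => /andP[_ V1V]; exists G; split=> [i|i j ij].
  have [_ di _ Si] := GP i; split=> //; have [v hv vr] := rP i; exists v => //.
  apply: le_lt_trans vr _; rewrite lte_fin; apply: lt_le_trans V1V; rewrite (bigD1 i) //=.
  have := ler_norm (r i); have : 0 <= \sum_(j < size cs | j != i) `|r j| by exact: sumr_ge0.
  by lra.
have [ri _ _ _] := GP i; have [rj _ _ _] := GP j.
by apply: (realizes_not_commensurable (Ei i) (Ei j) ri rj); apply: ineq.
Qed.

(** An inequivalent family of classes is realised below some V1 >= V0 and so counts in pi(V1) =
    pi(V0), which is finite; this bounds the transversals. A full transversal is realised for large
    V and meets every represented class, which gives the two inequalities. *)
Lemma piVS_limit : eventually_constant (fun V : R => piVS V S) ->
  (forall G, derived_from_quaternion_algebra G -> S `<=` length_spectrum G -> rational_square_traces G) ->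
  exists n : nat, piVS V S @[V --> +oo] --> ((2 ^+ n)%:E : \bar R).
Proof.
move=> [V0 const] rat_tr.
have rep V n (G : 'I_n -> set M2) : noncommensurable_family V S G ->
    exists b : 'I_n -> rat, forall i, represents (G i) (b i).
  move=> [dG _]; have ex i : exists b, represents (G i) b.
    by have [di _ Si] := dG i; apply: represents_exists => //; exact: rat_tr.
  by have [b hb] := choice ex; exists b.
have upper (cs : seq rat) V : (forall G b, (exists2 v, has_volume G v & (v < V%:E)%E) ->
    derived_from_quaternion_algebra G -> represents G b -> exists2 c, c \in cs & N (b * c)) ->
    (piVS V S <= (size cs)%:R%:E)%E.
  move=> h; apply: ge_ereal_sup => _ [n [G fam] <-].
  have [b hb] := rep _ _ _ fam; rewrite lee_fin ler_nat.
  apply: (family_bound fam hb) => i; have [di vi _] := fam.1 i; exact: h (hb i).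
have lower V n (G : 'I_n -> set M2) : noncommensurable_family V S G -> (n%:R%:E <= piVS V S)%E.
  by move=> fam; apply: ereal_sup_ubound; exists n => //; exists G.
have [bs hbs] := finitely_many_classes t2 sE s0 Dnsq V0.
have le0 : (piVS V0 S <= (size bs)%:R%:E)%E.
  apply: upper => G b vG dG [[b0 _] _ [T [dT Gg Gint]]].
  by have [[sG _ _] _] := dG; exact: hbs sG vG dT b0 Gg Gint.
have N1 : N 1 by split; rewrite ?oner_eq0 //; exists 1, 0; rewrite expr1n expr0n mulr0 subr0.
have [n [cs [scs csE ineq cover]]] : exists n (cs : seq rat), [/\ size cs = (2 ^ n)%N,
    {in cs, forall x, E x}, inequivalent N cs & forall x, E x -> exists2 y, y \in cs & N (x * y)].
  apply: (@transversal_pow2 N E _ _ _ _ _ _ (size bs)).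
  - exact: qnorm_sq.
  - exact: qnormM.
  - exact: qnorm_sqV.
  - by split; [exact: oner_neq0|move=> *; exact: qnorm_trace_class].
  - by move=> x [].
  - move=> x y [x0 Ex] [y0 Ey]; split; first exact: mulf_neq0.
    by move=> l t' Sl t2' tl; apply: trace_classM; [exact: Ex tl|exact: Ey tl].
  - move=> cs csE ineq; have [V1 V01 fam] := realized_family V0 csE ineq.
    have [G /lower] := fam _ (lexx V1); rewrite const // => /le_trans/(_ le0).
    by rewrite lee_fin ler_nat.
exists n; have [V1 V01 fam] := realized_family V0 csE ineq.
apply: cvg_near_cst; exists V1; split; first exact: num_real.
move=> V /ltW V1V; apply/eqP; rewrite eq_le; apply/andP; split.
  rewrite -natrX -scs; apply: upper => G b _ _ [Eb _ _]; exact: cover.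
by have [G] := fam _ V1V; rewrite -natrX -scs => /lower.
Qed.

End Counting.

(** * Consequences of the trace field being Q *)

Section InvariantTraceField.
Variables (R : realType) (S : set R).
Hypothesis trace_field_Q : associated_invariant_trace_field S (range (ratr : rat -> R)).

Lemma invariant_trace_field_squares G : invariant_trace_field G = range (ratr : rat -> R) ->
  rational_square_traces G.
Proof.
move=> e g Gg; have : invariant_trace_field G (\tr (g ^+ 2)) by move=> K [_ hK]; exact: hK.
by rewrite e => -[q _ <-]; exists q.
Qed.

Lemma spectrum_neq0 : exists l, S l.
Proof.
apply: contrapT => none; have [G aG [g Gg ng]] := arithmetic_irrational_trace R.
have SG : S `<=` length_spectrum G by move=> l Sl; case: none; exists l.
by have [q qE] := invariant_trace_field_squares (trace_field_Q.2 G aG SG) Gg; apply: ng; exists q.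
Qed.

Lemma derived_square_traces G : derived_from_quaternion_algebra G -> S `<=` length_spectrum G ->
  rational_square_traces G.
Proof. by move=> [aG _] SG; apply: invariant_trace_field_squares; exact: trace_field_Q.2. Qed.

(** Positivity of pi supplies a derived group with S in its spectrum, and the integrality of 2
    cosh(l / 2) is read off from it. *)
Lemma spectrum_traces l : S l -> 0 < l /\ exists t : int, 2 < t /\ 2 * cosh (l / 2) = t%:~R.
Proof.
move=> Sl; have [[V0 hV] _] := trace_field_Q.
have /ereal_sup_gt[_ [n [G fam] <-]] := hV _ (lexx V0).
rewrite lte_fin ltr0n => n0; have [dG _ SG] := fam.1 (Ordinal n0).
have [lp [g [Gg hy ch]]] := SG _ Sl; split=> //.
have [t tg] := hyperbolic_trace_int dG (derived_square_traces dG SG) Gg hy.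
have e : 2 * cosh (l / 2) = `|t|%:~R by rewrite ch tg mulrC divfK ?pnatr_eq0 // intr_norm.
exists `|t|; split=> //; move: hy; rewrite /hyperbolic tg -intr_norm.
by rewrite -[2]/(2%:~R) ltr_int.
Qed.

End InvariantTraceField.

Theorem corollary1p3 (R : realType) (S : set R)
    (finS : finite_set S) (S_ge0 : forall l, S l -> 0 <= l)
    (pi_const : eventually_constant (fun V : R => piVS V S))
    (trace_field_Q :
       associated_invariant_trace_field S (range (ratr : rat -> R))) :
  exists n : nat, piVS V S @[V --> +oo] --> ((2 ^+ n)%:E : \bar R).
Proof.
have [l Sl] := spectrum_neq0 trace_field_Q.
have [_ [t [t2 tl]]] := spectrum_traces trace_field_Q Sl.
have t2Q : (2 : rat) < t%:~R by rewrite -[2]/(2%:~R) ltr_int.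
have [s [s0 sE]] := sqrt_disc R t2Q.
apply: (piVS_limit t2 sE s0 (spectrum_traces trace_field_Q) Sl tl pi_const).
by move=> G dG SG; exact: derived_square_traces trace_field_Q _ dG SG.
Qed.
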